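(* Let $d\ge 1$, $H\in(\tfrac12,1)$, $0<\alpha<d$, $d<4H+\alpha$, and assume $\mu(d\xi)\asymp|\xi|^{-\alpha}d\xi$. Let $\gamma=H-\frac{d-\alpha}{4}$ and let $u=\{u(t,x)\}$ be the mild solution of the stochastic heat equation with fractional-colored noise. Let $x\in\mathbb{R}^d$ be fixed. Then for any $0<a<b<\infty$ there is a (non-random) constant $0<c_3<\infty$, which may depend on $a,b,\gamma$ and $x$, such that $$\lim_{\varepsilon\to0}\ \sup_{s,t\in[a,b],\,0<|s-t|\le\varepsilon}\frac{|u(t,x)-u(s,x)|}{|s-t|^{\gamma}\sqrt{\log(1/|t-s|)}}=c_3\quad\text{a.s.},$$ and, with the same constant, $$\limsup_{\varepsilon\to0}\ \sup_{s,t\in[a,b],\,|s-t|\le\varepsilon}\frac{|u(t,x)-u(s,x)|}{\varepsilon^{\gamma}\sqrt{\log(1/\varepsilon)}}=c_3\quad\text{a.s.}$$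
   Context: Let $\alpha_H=H(2H-1)$ and $\mathcal{F}g(\xi)=\int_{\mathbb{R}^d}e^{-i\langle\xi,x\rangle}g(x)\,dx$. The measure $\mu$ is a non-negative, symmetric tempered measure on $\mathbb{R}^d$ (tempered: $\int(1+|\xi|^2)^{-l}\mu(d\xi)<\infty$ for some $l>0$). The notation $\mu(d\xi)\asymp|\xi|^{-\alpha}d\xi$ means: for every non-negative (measurable) function $h$ there are positive finite constants $C,C'$, which may depend on $h$, with $C'\int h(\xi)|\xi|^{-\alpha}d\xi\le\int h(\xi)\mu(d\xi)\le C\int h(\xi)|\xi|^{-\alpha}d\xi$. The fractional-colored noise $W^H$ is a centered Gaussian noise, fractional with Hurst index $H$ in time and with spatial spectral measure $\mu$: the Wiener integrals $\iint\varphi\,dW^H$ of deterministic functions $\varphi(u,y)$ (those for which the expression below converges absolutely) are centered, jointly Gaussian, linear in $\varphi$, with $$\mathbb{E}\Big[\iint\varphi\,dW^H\iint\psi\,dW^H\Big]=\alpha_H(2\pi)^{-d}\int\!\!\int\frac{du\,dv}{|u-v|^{2-2H}}\int_{\mathbb{R}^d}\mathcal{F}\varphi(u,\cdot)(\xi)\,\overline{\mathcal{F}\psi(v,\cdot)(\xi)}\,\mu(d\xi).$$ Let $G(t,x)=(2\pi t)^{-d/2}e^{-|x|^2/(2t)}$ for $t>0$ and $G(t,x)=0$ for $t\le0$. The mild solution of $\partial_tu=\frac12\Delta u+\dot W^H$, $u(0,\cdot)=0$, is $u(t,x)=\int_0^t\int_{\mathbb{R}^d}G(t-u,x-y)\,W^H(du,dy)$;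 a modification with continuous sample paths in $t$ (for fixed $x$) is used. *)

(* Defs.v *)
From HB Require Import structures.
From mathcomp Require Import all_boot all_order all_algebra.
From mathcomp Require Import complex.
From mathcomp Require Import all_classical all_reals all_analysis.

Set Implicit Arguments.
Unset Strict Implicit.
Unset Printing Implicit Defensive.

Import Order.TTheory GRing.Theory Num.Theory.
Import numFieldNormedType.Exports.

Local Open Scope classical_set_scope.
Local Open Scope ring_scope.

Section euclidean_tuples.
Context {R : realType} {n : nat}.
Implicit Types x y : n.-tuple R.

Definition tuple_opp x : n.-tuple R := [tuple - tnth x i | i < n].
Definition tuple_sub x y : n.-tuple R := [tuple tnth x i - tnth y i | i < n].
Definition dotp x y : R := \sum_(i < n) tnth x i * tnth y i.
Definition enorm x : R := Num.sqrt (dotp x x).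

End euclidean_tuples.

Section lebesgue_tuple_step.
Context {R : realType} {n : nat}.
Variable m : {sigma_finite_measure set (n.-tuple R) -> \bar R}.

Definition cons_pair (p : R * n.-tuple R) : n.+1.-tuple R :=
  [tuple of p.1 :: p.2].

Lemma measurable_cons_pair : measurable_fun setT cons_pair.
Proof. exact: measurable_cons. Qed.

Definition lebesgue_step : set (n.+1.-tuple R) -> \bar R :=
  pushforward (@lebesgue_measure R \x m)%E cons_pair.

Let lebesgue_step0 : lebesgue_step set0 = 0%E.
Proof. by rewrite /lebesgue_step /pushforward preimage_set0 measure0. Qed.

Let lebesgue_step_ge0 A : (0 <= lebesgue_step A)%E.
Proof. by rewrite /lebesgue_step /pushforward; exact: measure_ge0. Qed.

Let lebesgue_step_sigma_additive : semi_sigma_additive lebesgue_step.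
Proof.
move=> F mF tF mUF; rewrite /lebesgue_step /pushforward preimage_bigcup.
apply: measure_semi_sigma_additive.
- by move=> i; rewrite -[X in measurable X]setTI; exact: measurable_cons_pair.
- apply/trivIsetP => /= i j _ _ ij; rewrite -preimage_setI.
  by move/trivIsetP : tF => -> //; rewrite preimage_set0.
- by rewrite -preimage_bigcup -[X in measurable X]setTI;
    exact: measurable_cons_pair.
Qed.

HB.instance Definition _ := isMeasure.Build _ _ _ lebesgue_step
  lebesgue_step0 lebesgue_step_ge0 lebesgue_step_sigma_additive.

Let lebesgue_step_sigma_finite : sigma_finite setT lebesgue_step.
Proof.
have /sigma_finiteP[F [FT Fnd Ffin]] := sigma_finiteT (@lebesgue_measure R).
have /sigma_finiteP[G [GT Gnd Gfin]] := sigma_finiteT m.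
pose B k := [set z : n.+1.-tuple R |
  F k (thead z) /\ G k [tuple of behead z]].
exists B.
  apply/esym; rewrite -subTset => z _.
  have [i _ Fi] : (\bigcup_i F i) (thead z) by rewrite -FT.
  have [j _ Gj] : (\bigcup_i G i) [tuple of behead z] by rewrite -GT.
  exists (maxn i j) => //; split.
  - by have /subsetPset := Fnd _ _ (leq_maxl i j); exact.
  - by have /subsetPset := Gnd _ _ (leq_maxr i j); exact.
move=> k; have [mF Foo] := Ffin k; have [mG Goo] := Gfin k; split.
  have -> : B k = (fun z : n.+1.-tuple R => tnth z ord0) @^-1` F k `&`
      (fun z : n.+1.-tuple R => [tuple of behead z]) @^-1` G k by [].
  apply: measurableI; rewrite -[X in measurable X]setTI.
  - exact: measurable_tnth.
  - exact: measurable_behead.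
rewrite /lebesgue_step /pushforward.
have -> : cons_pair @^-1` B k = F k `*` G k.
  apply/funext => -[x y]; rewrite /B /preimage /=.
  have e : [tuple of behead (cons_pair (x, y))] = y :> n.-tuple R.
    exact: val_inj.
  by apply/propext; split; rewrite e; case.
by rewrite product_measure1E// lte_mul_pinfty// ge0_fin_numE.
Qed.

HB.instance Definition _ := @Measure_isSigmaFinite.Build _ _ _ lebesgue_step
  lebesgue_step_sigma_finite.

End lebesgue_tuple_step.

(* Lebesgue measure on R^n, as an iterated product of [lebesgue_measure];
   R^0 is a single point of mass 1. *)
Fixpoint lebesgue_tuple {R : realType} (n : nat) :
    {sigma_finite_measure set (n.-tuple R) -> \bar R} :=
  if n is n'.+1 return {sigma_finite_measure set (n.-tuple R) -> \bar R}
  then lebesgue_step (lebesgue_tuple n') else \d_[tuple].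

Section fourier.
Context {R : realType}.
Local Open Scope complex_scope.

(* For complex-valued [f]; meaningful when [Re f] and [Im f] are integrable. *)
Definition cintegral d (T : measurableType d) (m : {measure set T -> \bar R})
    (f : T -> R[i]) : R[i] :=
  (\int[m]_x complex.Re (f x)) +i* (\int[m]_x complex.Im (f x)).

Definition cexpi (a : R) : R[i] := cos a +i* sin a.

Definition fourier n (g : n.-tuple R -> R) (xi : n.-tuple R) : R[i] :=
  cintegral (lebesgue_tuple n) (fun x => cexpi (- dotp xi x) * (g x)%:C).

End fourier.

Section spectral_measure.
Context {R : realType} {n : nat}.
Variable mu : {measure set (n.-tuple R) -> \bar R}.

Definition symmetric_measure :=
  forall A, measurable A -> mu (@tuple_opp R n @^-1` A) = mu A.

Definition tempered_measure :=
  exists2 l : R, 0 < l &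
    (\int[mu]_xi ((1 + enorm xi ^+ 2) `^ (- l))%:E < +oo)%E.

(* The two constants are allowed to depend on [h]. *)
Definition asymp_power (alpha : R) :=
  forall h : n.-tuple R -> R,
    measurable_fun setT h -> (forall xi, 0 <= h xi) ->
    exists C' C : R, [/\ 0 < C', 0 < C,
      (C'%:E * \int[lebesgue_tuple n]_xi (h xi * enorm xi `^ (- alpha))%:E
         <= \int[mu]_xi (h xi)%:E)%E &
      (\int[mu]_xi (h xi)%:E
         <= C%:E * \int[lebesgue_tuple n]_xi
                     (h xi * enorm xi `^ (- alpha))%:E)%E].

End spectral_measure.

Section fractional_colored_noise.
Context {R : realType} {n : nat}.
Variables (H : R) (mu : {measure set (n.-tuple R) -> \bar R}).
Implicit Types phi psi : R -> n.-tuple R -> R.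
Notation leb := (@lebesgue_measure R).

(* The deterministic integrands: [fourier (phi u)] is defined for almost every
   [u], and the variance integral converges absolutely.  By Cauchy-Schwarz the
   covariance integral of two such integrands converges absolutely too. *)
Definition wiener_integrable phi :=
  [/\ measurable_fun setT (fun p : R * n.-tuple R => phi p.1 p.2),
      {ae leb, forall u,
         (lebesgue_tuple n).-integrable setT (EFin \o phi u)} &
      (\int[leb]_u \int[leb]_v ((`|u - v| `^ (2 - 2 * H))^-1%:E *
         \int[mu]_xi (Normc.normc (fourier (phi u) xi) *
                      Normc.normc (fourier (phi v) xi))%:E) < +oo)%E].

Definition alphaH : R := H * (2 * H - 1).

Definition noise_covariance phi psi : R[i] :=
  (alphaH * (2 * pi) `^ (- n%:R))%:C%C *
  cintegral leb (fun u => cintegral leb (fun v =>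
    ((`|u - v| `^ (2 - 2 * H))^-1)%:C%C *
    cintegral mu (fun xi =>
      fourier (phi u) xi * ((fourier (psi v) xi)^*)%C))).

Variables (d : measure_display) (T : measurableType d) (P : probability T R).

(* The degenerate law is separate because [normal_prob 0 0] is not a Dirac
   mass. *)
Definition centered_gaussian (X : T -> R) :=
  {ae P, forall w, X w = 0} \/
  exists2 s : R, 0 < s &
    forall A : set R, measurable A -> P (X @^-1` A) = normal_prob 0 s A.

(* [W phi] is the Wiener integral of [phi]; its values on integrands that are
   not [wiener_integrable] are unconstrained. *)
Record fractional_colored_noise
    (W : (R -> n.-tuple R -> R) -> {RV P >-> R}) : Prop := {
    noise_linear : forall (c : R) phi psi,
      wiener_integrable phi -> wiener_integrable psi ->
      {ae P, forall w,
         W (fun u y => c * phi u y + psi u y) w = c * W phi w + W psi w} ;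
    noise_gaussian : forall (k : nat) (c : 'I_k -> R)
        (phi : 'I_k -> R -> n.-tuple R -> R),
      (forall i, wiener_integrable (phi i)) ->
      centered_gaussian (fun w => \sum_(i < k) c i * W (phi i) w) ;
    noise_covarianceE : forall phi psi,
      wiener_integrable phi -> wiener_integrable psi ->
      (fine ('E_P[fun w => (W phi w * W psi w)%R]%E))%:C%C =
        noise_covariance phi psi }.

End fractional_colored_noise.

Section mild_solution.
Context {R : realType} {n : nat}.

Definition heat_kernel (t : R) (x : n.-tuple R) : R :=
  if 0 < t
  then (2 * pi * t) `^ (- (n%:R / 2)) * expR (- (enorm x ^+ 2 / (2 * t)))
  else 0.

Definition mild_integrand (t : R) (x : n.-tuple R)
    (s : R) (y : n.-tuple R) : R :=
  \1_`[0, t] s * heat_kernel (t - s) (tuple_sub x y).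

Context (d : measure_display) (T : measurableType d) (P : probability T R).

(* Each [u t x] is only determined up to a null set, so that any modification
   is again a mild solution. *)
Definition mild_solution (W : (R -> n.-tuple R -> R) -> {RV P >-> R})
    (u : R -> n.-tuple R -> {RV P >-> R}) :=
  forall t x, 0 <= t -> {ae P, forall w, u t x w = W (mild_integrand t x) w}.

End mild_solution.

(* Main.v *)
(** With respect to time the mild solution is a centered Gaussian process whose covariance is a mixture, over the
    frequencies [xi], of the covariances of Ornstein-Uhlenbeck processes of rate [|xi|^2 / 2] driven by fractional
    noise.  Scaling in [xi] gives increments of length [h] a variance of order [h^(2 gamma)] (above, and below away
    from time 0), and two such increments at distance [D] a covariance of order [D^(2H-2) h^(2 gamma + 2 - 2H)].
    Chaining over dyadic points and the variance bound show that the normalized supremum is finite with positive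
    probability; the lower variance bound and the decorrelation show that it is bounded below, by a second moment
    estimate on sums of [exp (beta Y_j)] over disjoint increments.  A supremum of Gaussian variables of variance at most
    [s^2] is within [pi s], in mean, of an independent copy of itself (rotate one copy into the other), and the
    increments over pairs at distance less than [eps], normalized by the modulus, have variance [O(1 / log (1/eps))].
    Hence the limit is almost surely constant. *)

From HB Require Import structures.
Require Import Defs.
From mathcomp Require Import all_boot all_order all_algebra.
From mathcomp Require Import complex ring lra.
From mathcomp Require Import all_classical all_reals all_analysis measurable_realfun.

Set Implicit Arguments.
Unset Strict Implicit.
Unset Printing Implicit Defensive.

Import Order.TTheory GRing.Theory Num.Theory.
Import numFieldNormedType.Exports.

Local Open Scope classical_set_scope.
Local Open Scope ring_scope.

(** * Gamma integrals and the Gaussian Fourier transform *)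

(** Scaling applies the hypothesis on the spectral measure to whole families of test functions,
    while its constants may depend on each test function; they are therefore made uniform first.
    Powers of the frequency are treated as Gamma mixtures of exponentials, so that every spectral
    integral reduces to a Gaussian one. The random quantities are maxima over finitely many dyadic
    pairs, truncated at a level [K]. Truncation keeps all integrals bounded and costs nothing: the
    mean of the truncated maximum is bounded by a number strictly below [K], so the almost sure
    constant lies below [K] as well. Two monotone limits are taken, in the dyadic level and then in
    the distance cutoff. The concentration bound does not depend on the number of pairs, so it
    passes through the first limit, and it tends to 0 in the second. Once the limit is known to be
    constant, it equals its mean, and bounds on means become almost sure bounds. *)

Section affine_change_of_variable.
Context {R : realType}.
Local Notation leb := (@lebesgue_measure R).

Lemma measurable_affine (c d : R) : measurable_fun setT (fun x : R => c * x + d).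
Proof. by apply: measurable_funD => //; exact: measurable_funM. Qed.

(** The pushforward under the affine map, multiplied by [c], gives half-open intervals their length,
    so it is Lebesgue measure by uniqueness. *)
Lemma lebesgue_measure_affine (c d : R) (A : set R) : 0 < c -> measurable A ->
  (c%:E * leb [set x : R | A (c * x + d)%R])%E = leb A.
Proof.
move=> c0 mA.
have mphi : measurable_fun setT ((fun x => (c * x + d)%R) : measurableTypeR R -> measurableTypeR R).
  by apply: measurable_funD => //; exact: measurable_funM.
pose nu := mscale (NngNum (ltW c0)) (measure_function_pushforward__canonical__measure_function_Measure leb mphi).
apply/esym.
apply: (@lebesgue_measure_unique _ nu) => //= _ [[a b]] _ <-.
rewrite /nu /mscale /= /pushforward.
have -> : (fun x => c * x + d) @^-1` `]a, b] = `](a - d) / c, (b - d) / c]%classic.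
  apply/seteqP; split => x /=; rewrite !in_itv/= ltr_pdivrMr// ler_pdivlMr//.
    by move=> /andP[h1 h2]; apply/andP; split; lra.
  by move=> /andP[h1 h2]; apply/andP; split; lra.
rewrite /nu !lebesgue_measure_itv/= !lte_fin ltr_pM2r ?invr_gt0// ltrD2r.
case: ifPn => _; last by rewrite mule0.
rewrite -!EFinD -EFinM; congr (_%:E); field. exact: lt0r_neq0.
Qed.

Lemma ge0_integral_affine (f : R -> \bar R) (c d : R) : 0 < c ->
  measurable_fun setT f -> (forall x, 0 <= f x)%E ->
  (\int[leb]_x f (c * x + d)%R = c^-1%:E * \int[leb]_x f x)%E.
Proof.
move=> c0 mf f0.
have mphi : measurable_fun setT ((fun x => (c * x + d)%R) : measurableTypeR R -> measurableTypeR R).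
  by apply: measurable_funD => //; exact: measurable_funM.
pose nu := measure_function_pushforward__canonical__measure_function_Measure leb mphi.
have -> : (\int[leb]_x f x = c%:E * \int[nu]_x f x)%E.
  have -> : c%:E = ((NngNum (ltW c0))%:num)%:E by [].
  rewrite -(@ge0_integral_mscale _ _ _ nu setT measurableT (NngNum (ltW c0)))//.
  apply: eq_measure_integral => A mA _.
  exact: (esym (lebesgue_measure_affine d c0 mA)).
rewrite ge0_integral_pushforward//=.
by rewrite muleA -EFinM mulVf ?mul1e// lt0r_neq0.
Qed.

Lemma ge0_integral_shift (f : R -> \bar R) (d : R) :
  measurable_fun setT f -> (forall x, 0 <= f x)%E ->
  (\int[leb]_x f (x + d)%R = \int[leb]_x f x)%E.
Proof.
move=> mf f0; have := ge0_integral_affine d (@ltr01 R) mf f0.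
by rewrite invr1 mul1e => <-; apply: eq_integral => x _; rewrite mul1r.
Qed.

Lemma ge0_integral_oppr (f : R -> \bar R) :
  measurable_fun setT f -> (forall x, 0 <= f x)%E ->
  (\int[leb]_x f (- x)%R = \int[leb]_x f x)%E.
Proof.
move=> mf f0.
transitivity (\int[pushforward leb (-%R : _ -> measurableTypeR R)]_x f x)%E.
  by rewrite ge0_integral_pushforward//=.
by apply: eq_measure_integral => //= A mA AS; exact/lebesgue_measureN.
Qed.

Lemma ge0_integral_reflect (f : R -> \bar R) (d : R) :
  measurable_fun setT f -> (forall x, 0 <= f x)%E ->
  (\int[leb]_x f (d - x)%R = \int[leb]_x f x)%E.
Proof.
move=> mf f0; rewrite -[RHS](ge0_integral_shift d)// -[RHS]ge0_integral_oppr//.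
- by apply: eq_integral => x _; rewrite addrC.
- apply: (measurableT_comp mf); exact: measurable_funD.
Qed.

End affine_change_of_variable.

(** Measurability by recursion on the shape of the function; what it cannot close is left as a
    goal. *)
Ltac mbl := cbv beta;
  first [exact: measurable_cst | exact: measurable_id |
  lazymatch goal with
  | |- measurable_fun _ (fun x => (@?f x)%:E) => apply/measurable_EFinP; mbl
  | |- measurable_fun _ (fun x => (@?f x * @?g x)%R) => apply: (@measurable_funM _ _ _ _ f g); mbl
  | |- measurable_fun _ (fun x => (@?f x - @?g x)%R) => apply: (@measurable_funB _ _ _ _ f g); mbl
  | |- measurable_fun _ (fun x => (@?f x + @?g x)%R) => apply: (@measurable_funD _ _ _ _ f g); mbl
  | |- measurable_fun _ (fun x => (- @?f x)%R) => apply: (@measurable_funN _ _ _ _ f); mbl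
  | |- measurable_fun _ (fun x => (@?f x ^+ _)%R) => apply: (@measurable_funX _ _ _ _ f); mbl
  | |- measurable_fun _ (fun x => expR (@?f x)) =>
      apply: (measurableT_comp (@measurable_expR _) (g := f)); mbl
  | |- measurable_fun _ (fun x => powR (@?f x) ?a) =>
      apply: (measurableT_comp (@measurable_powR _ a) (g := f)); mbl
  | |- measurable_fun _ (fun x => indic ?A x) => try (apply: measurable_indic; try exact: measurable_itv)
  | |- measurable_fun _ (fun x => (@?f x * @?g x)%E) => apply: (@emeasurable_funM _ _ _ _ f g); mbl
  | |- measurable_fun _ (fun x => (@?f x + @?g x)%E) => apply: (@emeasurable_funD _ _ _ _ f g); mbl
  | |- measurable_fun _ _ => first [assumption | idtac]
  | |- _ => idtac
  end].

Section gamma.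
Context {R : realType}.
Local Notation leb := (@lebesgue_measure R).

(** The rate [l] stays a parameter because the integral is mostly read backwards: it represents
    [l^(-q)] as a mixture of the exponentials [exp (- l w)]. *)
Definition gamma_integrand (q l w : R) : R :=
  \1_`]0, +oo[ w * (w `^ (q - 1) * expR (- (l * w))).

Definition Gamma (q : R) : R := fine (\int[leb]_w (gamma_integrand q 1 w)%:E)%E.

Lemma gamma_integrand_ge0 q l w : 0 <= gamma_integrand q l w.
Proof. by rewrite /gamma_integrand !mulr_ge0// ?powR_ge0 ?expR_ge0. Qed.

Lemma gamma_integrand_le0 q l w : w <= 0 -> gamma_integrand q l w = 0.
Proof.
move=> w0; rewrite /gamma_integrand indicE memNset ?mul0r//=.
by rewrite in_itv/= andbT; apply/negP; rewrite -leNgt.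
Qed.

Lemma gamma_integrandE q l w : 0 < w ->
  gamma_integrand q l w = w `^ (q - 1) * expR (- (l * w)).
Proof.
move=> w0; rewrite /gamma_integrand indicE mem_set ?mul1r//=.
by rewrite in_itv/= andbT.
Qed.

Lemma measurable_gamma_integrand q l : measurable_fun setT (gamma_integrand q l).
Proof.
apply: measurable_funM; first exact: measurable_indic.
apply: measurable_funM; first exact: measurable_powR.
by apply: measurableT_comp => //; apply: measurableT_comp => //; exact: measurable_funM.
Qed.

(** The power may be singular at 0, so the fundamental theorem of calculus is applied on
    [[1 / (k + 2), 1]] and the interval is exhausted monotonically. *)
Lemma integral_powR_01 (q : R) : 0 < q ->
  (\int[leb]_(w in `]0%R, 1%R]) (w `^ (q - 1))%:E <= (q^-1)%:E)%E.
Proof.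
move=> q0.
have -> : `]0%R, 1%R]%classic = \bigcup_k `[(k.+2%:R^-1 : R), 1%R]%classic.
  apply/seteqP; split => x /=; rewrite in_itv/=.
    move=> /andP[x0 x1]; exists (Num.trunc x^-1) => //=.
    rewrite in_itv/= x1 andbT invf_ple ?posrE// .
    apply: le_trans (ltW (truncnS_gt _)) _; rewrite ler_nat; exact: leqnSn.
  move=> [k _] /=; rewrite in_itv/= => /andP[kx x1]; rewrite x1 andbT.
  by apply: lt_le_trans kx; rewrite invr_gt0.
have mf A : measurable_fun A (fun w : R => (w `^ (q - 1))%:E).
  apply: measurable_funTS; apply/measurable_EFinP; exact: measurable_powR.
pose F k := `[(k.+2%:R^-1 : R), 1%R]%classic.
have mF k : measurable (F k) by exact: measurable_itv.
have subF m k : (m <= k)%N -> F m `<=` F k.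
  move=> mk x /=; rewrite /F/= !in_itv/= => /andP[h ->].
  by rewrite andbT; apply: le_trans h; rewrite lef_pV2 ?posrE// ler_nat !ltnS.
have f0 x : (0 <= (x `^ (q - 1))%:E)%E by rewrite lee_fin powR_ge0.
rewrite -/F; have : (\int[leb]_(w in F k) (w `^ (q - 1))%:E)%E @[k --> \oo] -->
    (\int[leb]_(w in \bigcup_k F k) (w `^ (q - 1))%:E)%E.
  apply: ge0_nondecreasing_set_cvg_integral => //.
    by move=> m k mk; apply/subsetPset; exact: subF.
  by move=> i; exact: mf.
move=> /(cvg_lim (@ereal_hausdorff R)) <-; apply: lime_le.
  apply: ereal_nondecreasing_is_cvgn => m k mk; apply: (@ge0_subset_integral _ _ _ leb _ _ (mF m) (mF k)) => //.
    by apply: mf.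
  exact: subF.
apply: nearW => k.
have k1 : (k.+2%:R^-1 : R) < 1 by rewrite invf_lt1// ltr1n.
have k0 : 0 < (k.+2%:R^-1 : R) by rewrite invr_gt0.
have dF : forall x : R, 0 < x -> is_derive x 1 (fun w => q^-1 * w `^ q) (x `^ (q - 1)).
  move=> x x0; have dp : derivable (@powR R ^~ q) x 1.
    by apply: derivable_powR; rewrite in_itv/= x0.
  have -> : x `^ (q - 1) = q^-1 *: (@powR R ^~ q)^`()%classic x.
    rewrite powR_derive1 ?in_itv/= ?x0// /GRing.scale/= mulrA mulVf ?mul1r//.
    exact: lt0r_neq0.
  rewrite derive1E; apply: is_deriveZ; exact: derivableP.
have cF : forall x : R, 0 < x -> {for x, continuous (fun w => q^-1 * w `^ q)}.
  move=> x x0; apply: differentiable_continuous; apply/derivable1_diffP.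
  by case: (dF x x0).
rewrite (@continuous_FTC2 _ _ (fun w => q^-1 * w `^ q))//.
- rewrite powR1 mulr1 -EFinB lee_fin gerBl// mulr_ge0// ?powR_ge0// invr_ge0.
  exact: ltW.
- apply: continuous_in_subspaceT => x; rewrite inE/= in_itv/= => /andP[h _].
  have x0 : 0 < x by apply: lt_le_trans h.
  apply: differentiable_continuous; apply/derivable1_diffP.
  by apply: derivable_powR; rewrite in_itv/= x0.
- split.
  + move=> x; rewrite in_itv/= => /andP[h _]; have x0 : 0 < x by apply: lt_trans h.
    by case: (dF x x0).
  + apply: cvg_at_right_filter; exact: cF.
  + apply: cvg_at_left_filter; exact: cF.
- move=> x; rewrite in_itv/= => /andP[h _]; have x0 : 0 < x by apply: lt_trans h.
  by rewrite derive1E; case: (dF x x0).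
Qed.

(** Raise [w / (2 q) <= exp (w / (2 q))] to the power [q]; the missing factor [1 / w] is at most
    1. *)
Lemma powR_le_expR (q w : R) : 0 < q -> 1 <= w ->
  w `^ (q - 1) <= (2 * q) `^ q * expR (w / 2).
Proof.
move=> q0 w1; have w0 : 0 < w by apply: lt_le_trans w1.
apply: (@le_trans _ _ (w `^ q)).
  by apply: ler_powR => //; rewrite gerBl.
have -> : w / 2 = w / (2 * q) * q by field; exact: lt0r_neq0.
rewrite expRM -powRM ?expR_ge0//; last by rewrite mulr_ge0// ltW.
apply: ge0_ler_powR; rewrite ?nnegrE ?mulr_ge0 ?expR_ge0//; try exact: ltW.
rewrite -ler_pdivrMl ?mulr_gt0// mulrC.
by apply: le_trans (expR_ge1Dx _); rewrite lerDr.
Qed.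

Lemma integral_expRN_le (c : R) : 0 < c ->
  (\int[leb]_w (\1_`]0, +oo[ w * expR (- (c * w)))%:E <= (c^-1)%:E)%E.
Proof.
move=> c0.
have <- : ((c^-1)%:E * \int[leb]_w (exponential_pdf c w)%:E = c^-1%:E)%E.
  by rewrite integral_exponential_pdf// mule1.
rewrite -ge0_integralZl//; first last.
- by rewrite lee_fin invr_ge0 ltW.
- by move=> x _; rewrite lee_fin exponential_pdf_ge0// ltW.
- by apply/measurable_EFinP; exact: measurable_exponential_pdf.
apply: ge0_le_integral => //.
- by mbl.
- apply: measurable_funeM; apply/measurable_EFinP; exact: measurable_exponential_pdf.
- move=> w _; rewrite -EFinM lee_fin indicE.
  have [w0|w0] := leP w 0.
    rewrite memNset/= ?in_itv/= ?andbT -?leNgt ?mul0r ?mulr_ge0 ?invr_ge0 ?exponential_pdf_ge0 ?ltW//.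
    by apply/negP; rewrite -leNgt.
  rewrite exponential_pdfE; last exact: ltW.
  rewrite mem_set/= ?in_itv/= ?w0// mul1r mulNr.
  by rewrite mulrA mulVf ?mul1r// lt0r_neq0.
Qed.

(** Up to 1 the power alone dominates; beyond 1, half of the exponential decay absorbs the power. *)
Lemma Gamma_fin_num q : 0 < q ->
  (\int[leb]_w (gamma_integrand q 1 w)%:E < +oo)%E.
Proof.
move=> q0.
apply: (@le_lt_trans _ _ (\int[leb]_w ((\1_`]0%R, 1%R] w * w `^ (q - 1))%:E +
   ((2 * q) `^ q * (\1_`]0, +oo[ w * expR (- (2^-1 * w))))%:E))%E).
  apply: ge0_le_integral => //.
  - by move=> w _; rewrite lee_fin gamma_integrand_ge0.
  - by apply/measurable_EFinP; exact: measurable_gamma_integrand.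
  - apply: emeasurable_funD; apply/measurable_EFinP.
      by apply: measurable_funM; [exact: measurable_indic|exact: measurable_powR].
    apply: measurable_funM => //; apply: measurable_funM; first exact: measurable_indic.
    by apply: measurableT_comp => //; apply: measurableT_comp => //; exact: measurable_funM.
  - move=> w _; rewrite -EFinD lee_fin.
    have [w0|w0] := leP w 0.
      by rewrite gamma_integrand_le0// addr_ge0// !mulr_ge0// ?powR_ge0 ?expR_ge0.
    rewrite gamma_integrandE//.
    have [w1|w1] := leP w 1.
      rewrite [in X in _ <= X]indicE mem_set/= ?in_itv/= ?w0// mul1r.
      apply: (@le_trans _ _ (w `^ (q - 1))).
        by rewrite ler_piMr ?powR_ge0// -expR0 ler_expR oppr_le0 ltW.
      by rewrite mul1r lerDl !mulr_ge0// ?powR_ge0 ?expR_ge0.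
    apply: (@le_trans _ _ ((2 * q) `^ q * (1 * expR (- (2^-1 * w))))); last first.
      by rewrite [\1_`]0, +oo[ w]indicE mem_set/= ?in_itv/= ?w0// lerDr mulr_ge0 ?powR_ge0.
    have -> : expR (- (1 * w)) = expR (- (w / 2)) * expR (- (2^-1 * w)) :> R.
      by rewrite -expRD; congr expR; lra.
    rewrite !mul1r mulrA ler_pM2r ?expR_gt0// expRN ler_pdivrMr ?expR_gt0//.
    by apply: powR_le_expR => //; exact: ltW.
rewrite ge0_integralD//; first last.
- apply/measurable_EFinP.
  apply: measurable_funM => //; apply: measurable_funM; first exact: measurable_indic.
  by apply: measurableT_comp => //; apply: measurableT_comp => //; exact: measurable_funM.
- by move=> w _; rewrite lee_fin !mulr_ge0 ?powR_ge0 ?expR_ge0.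
- apply/measurable_EFinP.
  by apply: measurable_funM; [exact: measurable_indic|exact: measurable_powR].
- by move=> w _; rewrite lee_fin !mulr_ge0 ?powR_ge0.
apply: lte_add_pinfty.
  apply: (@le_lt_trans _ _ (q^-1)%:E); last exact: ltry.
  apply: le_trans (integral_powR_01 q0).
  rewrite [leRHS]integral_mkcond.
  rewrite le_eqVlt; apply/orP; left; apply/eqP; apply: eq_integral => w _.
  by rewrite patchE indicE; case: ifPn => _; rewrite ?mul1r ?mul0r.
under eq_integral do rewrite EFinM.
rewrite ge0_integralZl//; first last.
- by rewrite lee_fin powR_ge0.
- by mbl.
apply: lte_mul_pinfty => //; first by rewrite lee_fin powR_ge0.
apply: (le_lt_trans (integral_expRN_le _)); last exact: ltry.
by rewrite invr_gt0.
Qed.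

(** On [[1, 2]] the integrand is at least [exp (-2) / 2], because [w^q >= 1] and [1 / w >= 1 / 2]
    there. *)
Lemma Gamma_gt0 q : 0 < q -> 0 < Gamma q.
Proof.
move=> q0; rewrite /Gamma fine_gt0//; rewrite Gamma_fin_num// andbT.
apply: (@lt_le_trans _ _ (\int[leb]_w ((2^-1 * expR (- 2)) * \1_`[1%R, 2%R] w)%:E)%E).
  under eq_integral do rewrite EFinM.
  rewrite ge0_integralZl//; last by mbl.
  have m12 : leb [set` `[1%R, 2%R]] = 1%E.
    by rewrite lebesgue_measure_itv/= lte_fin ltr1n -EFinB; congr EFin; lra.
  rewrite [X in (_ * X)%E](_ : _ = 1%E); last by rewrite integral_indic// setIT; exact: m12.
  by rewrite mule1 lte_fin mulr_gt0 ?expR_gt0.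
apply: ge0_le_integral => //.
- by mbl.
- by apply/measurable_EFinP; exact: measurable_gamma_integrand.
move=> w _; rewrite lee_fin indicE.
have [/[!inE]/=|_] := boolP (w \in _); last by rewrite mulr0 gamma_integrand_ge0.
rewrite in_itv/= => /andP[w1 w2].
have w0 : 0 < w by apply: lt_le_trans w1.
rewrite mulr1 gamma_integrandE// ler_pM ?expR_ge0//; last by rewrite ler_expR mul1r lerN2.
rewrite powRB; last by rewrite lt0r_neq0 ?implybT.
rewrite powRr1; last exact: ltW.
rewrite -[leLHS]mul1r; apply: ler_pM => //.
  by rewrite -(powRr0 w); apply: ler_powR => //; exact: ltW.
by rewrite lef_pV2 ?posrE.
Qed.

Lemma integral_gamma q l : 0 < q -> 0 < l ->
  (\int[leb]_w (gamma_integrand q l w)%:E = (Gamma q * l `^ (- q))%:E)%E.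
Proof.
move=> q0 l0.
have GE : (Gamma q)%:E = (\int[leb]_w (gamma_integrand q 1 w)%:E)%E.
  rewrite /Gamma fineK// ge0_fin_numE ?Gamma_fin_num//.
  by apply: integral_ge0 => w _; rewrite lee_fin gamma_integrand_ge0.
rewrite EFinM {}GE muleC.
have -> : l `^ (- q) = l^-1 * l `^ (1 - q) .
  by rewrite mulrC -[X in _ * X](powR_inv1 (ltW l0)) -powRD ?lt0r_neq0//; last exact/implyP;
   congr powR; lra.
rewrite EFinM -muleA muleCA.
rewrite -[in RHS](@ge0_integral_affine _ (fun w => (gamma_integrand q 1 w)%:E) l 0)//; first last.
- by move=> w; rewrite lee_fin gamma_integrand_ge0.
- by apply/measurable_EFinP; exact: measurable_gamma_integrand.
rewrite -ge0_integralZl//; first last.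
- by rewrite lee_fin powR_ge0.
- by move=> w _; rewrite lee_fin gamma_integrand_ge0.
- apply/measurable_EFinP.
  by apply: (measurableT_comp (measurable_gamma_integrand q 1)); exact: measurable_affine.
apply: eq_integral => w _; rewrite -EFinM addr0; congr (_%:E).
have [w0|w0] := leP w 0.
  by rewrite !gamma_integrand_le0 ?mulr0// pmulr_rle0.
rewrite !gamma_integrandE ?mulr_gt0// mul1r powRM ?ltW// !mulrA -powRD ?lt0r_neq0//; last exact/implyP.
by rewrite (_ : 1 - q + (q - 1) = 0) ?powRr0 ?mul1r//; ring.
Qed.

End gamma.

Section gauss_fourier.
Context {R : realType}.
Local Notation leb := (@lebesgue_measure R).

Lemma integral_gauss (c m : R) : 0 < c ->
  (\int[leb]_y (expR (- (c * (y - m) ^+ 2)))%:E = (Num.sqrt (pi / c))%:E)%E.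
Proof.
move=> c0.
have s0 : 0 < Num.sqrt c by rewrite sqrtr_gt0.
transitivity (\int[leb]_y (gauss_fun (Num.sqrt c * y + (- (Num.sqrt c * m)))%R)%:E)%E.
  apply: eq_integral => y _; rewrite /gauss_fun; congr (expR (- _))%:E.
  by rewrite -mulrBr exprMn sqr_sqrtr// ltW.
rewrite (@ge0_integral_affine _ (fun y => (gauss_fun y)%:E) (Num.sqrt c))//; last 2 first.
- by apply/measurable_EFinP; exact: measurable_gauss_fun.
- by move=> x; rewrite lee_fin gauss_fun_ge0.
rewrite integralT_gauss -EFinM sqrtrM ?pi_ge0// mulrC; congr ((_ * _)%:E).
by rewrite sqrtrV// ltW.
Qed.

Lemma integrable_gauss (c m : R) : 0 < c ->
  leb.-integrable setT (fun y => (expR (- (c * (y - m) ^+ 2)))%:E).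
Proof.
move=> c0; apply/integrableP; split; first by mbl.
under eq_integral do rewrite abse_EFin ger0_norm ?expR_ge0//.
by rewrite integral_gauss// ltry.
Qed.

(** Half of the exponent absorbs the factor: [exp (y^2 / 4) >= 1 + y^2 / 4 >= |y|], the last
    inequality being a square. This is the dominating function for differentiation under the
    integral sign. *)
Lemma normr_mul_gauss_le (y : R) :
  `|y| * expR (- (y ^+ 2 / 2)) <= expR (- (4^-1 * (y - 0) ^+ 2)).
Proof.
have -> : expR (- (4^-1 * (y - 0) ^+ 2)) =
    expR (4^-1 * y ^+ 2) * expR (- (y ^+ 2 / 2)) :> R.
  by rewrite -expRD subr0; congr expR; lra.
rewrite ler_pM2r ?expR_gt0//; apply: le_trans (expR_ge1Dx _).
rewrite -[in leRHS](real_normK (num_real y)); set z := `|y|.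
have := sqr_ge0 (z / 2 - 1); nra.
Qed.

(** The integrand is the derivative of [sin (z y) exp (- y^2 / 2)], which vanishes at both ends of
    the line. *)
Lemma gauss_by_parts (z : R) :
  (\int[leb]_y ((z * cos (z * y) - y * sin (z * y)) * expR (- (y ^+ 2 / 2))))%R = 0.
Proof.
pose F y := sin (z * y) * expR (- (y ^+ 2 / 2)).
pose f y := (z * cos (z * y) - y * sin (z * y)) * expR (- (y ^+ 2 / 2)).
have dF (y : R) : is_derive y 1 F (f y).
  by rewrite /F; apply: is_derive_eq; rewrite /GRing.scale/= /f; field.
have intf : leb.-integrable setT (EFin \o f).
  apply: (@le_integrable _ _ _ leb setT measurableT _ (fun y =>
      (`|z|%:E * (expR (- (2^-1 * (y - 0) ^+ 2)))%:E + (expR (- (4^-1 * (y - 0) ^+ 2)))%:E)%E)).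
  - apply/measurable_EFinP; apply: continuous_measurable_fun => y.
    rewrite /f; apply: differentiable_continuous; apply/derivable1_diffP.
    exact: ex_derive.
  - move=> y _; rewrite -EFinM -EFinD /= lee_fin [leRHS]ger0_norm; last first.
      by rewrite addr_ge0 ?mulr_ge0 ?expR_ge0.
    rewrite /f mulrBl; apply: le_trans (ler_normB _ _) _; rewrite lerD//.
      rewrite !normrM (ger0_norm (expR_ge0 _)) (_ : y ^+ 2 / 2 = 2^-1 * (y - 0) ^+ 2); last by field.
      by rewrite ler_wpM2r ?expR_ge0// ler_piMr// cos_max.
    apply: le_trans (normr_mul_gauss_le y).
    by rewrite !normrM (ger0_norm (expR_ge0 _)) ler_wpM2r ?expR_ge0// ler_piMr// sin_max.
  - apply: integrableD => //; last exact: integrable_gauss.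
    by apply: integrableZl => //; exact: integrable_gauss.
have intn (n : nat) : (\int[leb]_(y in `[(- n.+1%:R)%R, (n.+1%:R)%R]) (f y)%:E = (F n.+1%:R)%:E - (F (- n.+1%:R))%:E)%E.
  apply: continuous_FTC2 => //.
  - by rewrite (@lt_trans _ _ 0)// ltrNl oppr0.
  - apply: continuous_subspaceT => y.
    rewrite /f; apply: differentiable_continuous; apply/derivable1_diffP.
    exact: ex_derive.
  - split; first by move=> y _; case: (dF y).
    + apply: cvg_at_right_filter; apply: differentiable_continuous; apply/derivable1_diffP.
      by case: (dF (- n.+1%:R)).
    + apply: cvg_at_left_filter; apply: differentiable_continuous; apply/derivable1_diffP.
      by case: (dF (n.+1%:R)).
  - by move=> y _; rewrite derive1E; case: (dF y).
pose In (n : nat) : set R := `[(- n.+1%:R)%R, (n.+1%:R)%R]%classic.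
have fn_cvg (y : R) : (((f \_ (In n)) y)%:E @[n --> \oo] --> (f y)%:E)%E.
  apply: cvg_near_cst; exists (Num.trunc `|y|) => //= n /= yn.
  rewrite patchE mem_set// /In/= in_itv/= -ler_norml.
  by apply: le_trans (ltW (truncnS_gt _)) _; rewrite ler_nat.
have mfn n : measurable_fun setT (fun y => ((f \_ (In n)) y)%:E).
  apply/measurable_EFinP/measurable_restrict => //; first exact: measurable_itv.
  by apply: measurable_funTS; case/integrableP : intf => /measurable_EFinP.
have mf : measurable_fun setT (fun y => (f y)%:E) by case/integrableP : intf.
pose nf (y : R) : R := `|f y|.
have dom : {ae leb, forall y n, setT y -> (`|((f \_ (In n)) y)%:E| <= (EFin \o nf) y)%E}.
  apply: aeW => y n _; rewrite /= lee_fin patchE; case: ifPn => // _.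
  by rewrite normr0 /nf.
have intfn : leb.-integrable setT (EFin \o nf).
  exact: (integrable_norm intf).
have aecvg : {ae leb, forall y, setT y -> ((f \_ (In n)) y)%:E @[n --> \oo] --> (f y)%:E}.
  by apply: aeW => y _; exact: fn_cvg.
have [_ _ /=] := @dominated_convergence _ _ _ leb setT measurableT
  (fun n y => ((f \_ (In n)) y)%:E) (EFin \o f) _ mfn mf aecvg intfn dom.
have -> : (fun n => \int[leb]_x ((f \_ (In n)) x)%:E)%E =
    (fun n => (F n.+1%:R - F (- n.+1%:R))%:E).
  apply/funext => n; rewrite EFinB -intn [RHS]integral_mkcond.
  by apply: eq_integral => y _; rewrite !patchE; case: ifPn.
have F0 : (fun n : nat => (F n.+1%:R - F (- n.+1%:R))%:E) @ \oo --> 0%E.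
  apply: cvg_EFin; first exact: nearW.
  have Fle (y : R) : 1 <= y -> `|F y| <= 2 * y^-1 /\ `|F (- y)| <= 2 * y^-1.
    move=> y1; have y0 : 0 < y by apply: lt_le_trans y1.
    have ey : expR (- (y ^+ 2 / 2)) <= 2 * y^-1.
      rewrite expRN -[2 * y^-1]invrK invfM invrK lef_pV2 ?posrE ?expR_gt0 ?mulr_gt0 ?invr_gt0//.
      apply: le_trans (expR_ge1Dx _); nra.
    split; rewrite /F normrM (ger0_norm (expR_ge0 _)) ?sqrrN;
      by apply: le_trans ey; rewrite ler_piMl ?expR_ge0// sin_max.
  apply: norm_cvg0; apply: (@squeeze_cvgr _ _ _ _ (cst 0) (fun n : nat => 4 * n.+1%:R^-1)).
  - apply: nearW => n /=; rewrite normr_ge0/=.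
    have [|h1 h2] := Fle n.+1%:R; first by rewrite ler1n.
    apply: le_trans (ler_normB _ _) (le_trans (lerD h1 h2) _).
    by rewrite -mulrDl; have -> : (2 + 2 = 4 :> R) by ring.
  - exact: cvg_cst.
  - rewrite -(mulr0 4); apply: cvgM; first exact: cvg_cst.
    exact: cvg_harmonic.
move=> /(cvg_unique _ F0) => E.
by rewrite /Rintegral -/f -E.
Qed.

Lemma integrable_cos_gauss t : leb.-integrable setT (EFin \o (fun y => cos (t * y) * expR (- (y ^+ 2 / 2)))).
Proof.
apply: (@le_integrable _ _ _ leb setT measurableT _ (fun y => (expR (- (2^-1 * (y - 0) ^+ 2)))%:E)).
- apply/measurable_EFinP; apply: continuous_measurable_fun => y.
  apply: differentiable_continuous; apply/derivable1_diffP.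
  exact: ex_derive.
- move=> y _; rewrite /= lee_fin [leRHS]ger0_norm ?expR_ge0//.
  by rewrite normrM (ger0_norm (expR_ge0 _)) subr0 [2^-1 * _]mulrC ler_piMl ?expR_ge0// cos_max.
- exact: integrable_gauss.
Qed.

Lemma integrable_sin_gauss t : leb.-integrable setT (EFin \o (fun y => sin (t * y) * expR (- (y ^+ 2 / 2)))).
Proof.
apply: (@le_integrable _ _ _ leb setT measurableT _ (fun y => (expR (- (2^-1 * (y - 0) ^+ 2)))%:E)).
- apply/measurable_EFinP; apply: continuous_measurable_fun => y.
  apply: differentiable_continuous; apply/derivable1_diffP.
  exact: ex_derive.
- move=> y _; rewrite /= lee_fin [leRHS]ger0_norm ?expR_ge0//.
  by rewrite normrM (ger0_norm (expR_ge0 _)) subr0 [2^-1 * _]mulrC ler_piMl ?expR_ge0// sin_max.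
- exact: integrable_gauss.
Qed.

Lemma integrable_mulsin_gauss t : leb.-integrable setT (EFin \o (fun y => y * sin (t * y) * expR (- (y ^+ 2 / 2)))).
Proof.
apply: (@le_integrable _ _ _ leb setT measurableT _ (fun y => (expR (- (4^-1 * (y - 0) ^+ 2)))%:E)).
- apply/measurable_EFinP; apply: continuous_measurable_fun => y.
  apply: differentiable_continuous; apply/derivable1_diffP.
  exact: ex_derive.
- move=> y _; rewrite /= lee_fin [leRHS]ger0_norm ?expR_ge0//; apply: le_trans (normr_mul_gauss_le y).
  by rewrite !normrM (ger0_norm (expR_ge0 _)) ler_wpM2r ?expR_ge0// ler_piMr// sin_max.
- exact: integrable_gauss.
Qed.

(** As a function of [z] the integral solves [phi' = - z phi], by differentiation under the integral
    sign and [gauss_by_parts]. Hence [phi z * exp (z^2 / 2)] is constant, and its value at 0 is the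
    Gaussian integral. *)
Lemma cos_gauss (z : R) :
  (\int[leb]_y (cos (z * y) * expR (- (y ^+ 2 / 2))))%R =
  Num.sqrt (2 * pi) * expR (- (z ^+ 2 / 2)).
Proof.
pose phi z := (\int[leb]_y (cos (z * y) * expR (- (y ^+ 2 / 2))))%R.
have dphi (t : R) : is_derive t 1 phi (- t * phi t).
  have [dd dE] : derivable phi t 1 /\ phi^`()%classic t = (\int[leb]_y (- (y * sin (t * y)) * expR (- (y ^+ 2 / 2)))).
    pose f (t y : R) := cos (t * y) * expR (- (y ^+ 2 / 2)).
    have df (t' y : R) : is_derive t' 1 (f ^~ y) (- (y * sin (t' * y)) * expR (- (y ^+ 2 / 2))).
      by rewrite /f; apply: is_derive_eq; rewrite /GRing.scale/=; ring.
    have Ia : `]t - 1, t + 1[%classic t by rewrite /= in_itv/=; apply/andP; split; lra.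
    have derf1 (x y : R) : `]t - 1, t + 1[%classic x -> setT y -> derivable (f ^~ y) x 1.
      by move=> _ _; case: (df x y).
    have intG : leb.-integrable setT (EFin \o (fun y => expR (- (4^-1 * (y - 0) ^+ 2)))).
      exact: integrable_gauss.
    have G0 (y : R) : 0 <= expR (- (4^-1 * (y - 0) ^+ 2)) :> R by exact: expR_ge0.
    have Gub (x y : R) : `]t - 1, t + 1[%classic x -> setT y -> `|partial1of2 f x y| <= expR (- (4^-1 * (y - 0) ^+ 2)).
      move=> _ _; rewrite partial1of2E; case: (df x y) => _ ->.
      apply: le_trans (normr_mul_gauss_le y).
      by rewrite mulNr normrN !normrM (ger0_norm (expR_ge0 _)) ler_wpM2r ?expR_ge0// ler_piMr// sin_max.
    have intf (x : R) : `]t - 1, t + 1[%classic x -> leb.-integrable setT (EFin \o f x).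
      by move=> _; exact: integrable_cos_gauss.
    split; first exact: (derivable_under_integral measurableT Ia intf derf1 G0 intG Gub).
    rewrite (differentiation_under_integral measurableT Ia intf derf1 G0 intG Gub).
    by apply: eq_Rintegral => y _; rewrite partial1of2E; case: (df t y) => _ ->.
  apply: DeriveDef => //; rewrite -derive1E dE.
  have := gauss_by_parts t.
  under eq_Rintegral do rewrite mulrBl -mulrA.
  rewrite RintegralB//; last 2 first.
  - have := @integrableZl _ _ _ leb setT measurableT t _ (integrable_cos_gauss t).
    by under eq_fun do rewrite /= -EFinM.
  - exact: integrable_mulsin_gauss.
  rewrite RintegralZl//; last exact: integrable_cos_gauss.
  rewrite -/(phi t) => /eqP; rewrite subr_eq0 => /eqP h.
  rewrite mulNr h -mulN1r -RintegralZl//; last exact: integrable_mulsin_gauss.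
  by apply: eq_Rintegral => y _; rewrite mulN1r mulNr.
have dpsi (t : R) : is_derive t 1 (fun t => phi t * expR (t ^+ 2 / 2)) 0.
  by apply: is_derive_eq; rewrite /GRing.scale/=; field.
have := @is_derive_0_is_cst _ _ z 0 dpsi.
rewrite /= expr0n/= mul0r expR0 mulr1.
have -> : phi 0 = Num.sqrt (2 * pi).
  rewrite /phi /Rintegral.
  under eq_integral do rewrite mul0r cos0 mul1r.
  transitivity (fine (\int[leb]_y (expR (- (2^-1 * (y - 0) ^+ 2)))%:E)%E).
    by congr fine; apply: eq_integral => y _; rewrite subr0 mulrC.
  by rewrite integral_gauss//= invrK mulrC.
move=> /(congr1 (fun u => u * expR (- (z ^+ 2 / 2)))).
by rewrite -mulrA -expRD subrr expR0 mulr1.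
Qed.

(** For an odd function the positive part is the reflection of the negative part. *)
Lemma sin_gauss (z : R) :
  (\int[leb]_y (sin (z * y) * expR (- (y ^+ 2 / 2))))%R = 0.
Proof.
rewrite /Rintegral integralE.
rewrite [X in (_ - X)%E](_ : _ = \int[leb]_y ((fun y => (sin (z * y) * expR (- (y ^+ 2 / 2)))%:E)^\+ y))%E.
  by rewrite fineB ?subrr//; apply: integrable_pos_fin_num => //; exact: integrable_sin_gauss.
rewrite -[RHS]ge0_integral_oppr//; last first.
  by apply: measurable_funepos; case/integrableP: (integrable_sin_gauss z).
apply: eq_integral => y _; rewrite funeposE funenegE.
by rewrite mulrN sinN mulNr sqrrN EFinN.
Qed.

End gauss_fourier.

Section affine_signed.
Context {R : realType}.
Local Notation leb := (@lebesgue_measure R).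

Lemma integrable_affine (f : R -> R) (c d : R) : 0 < c ->
  leb.-integrable setT (EFin \o f) ->
  leb.-integrable setT (EFin \o (fun x => f (c * x + d))).
Proof.
move=> c0 /integrableP[mf fi]; apply/integrableP; split.
  apply/measurable_EFinP; apply: (measurableT_comp (f := f)).
    exact/measurable_EFinP.
  exact: measurable_affine.
rewrite (@ge0_integral_affine _ (fun x => `|(f x)%:E|)%E)//.
  by apply: lte_mul_pinfty => //; rewrite lee_fin invr_ge0 ltW.
exact: (measurableT_comp _ mf).
Qed.

Lemma Rintegral_affine (f : R -> R) (c d : R) : 0 < c ->
  leb.-integrable setT (EFin \o f) ->
  (\int[leb]_x f (c * x + d)%R = c^-1 * \int[leb]_x f x)%R.
Proof.
move=> c0 fi; have mf : measurable_fun setT (EFin \o f) by case/integrableP : fi.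
have fci := integrable_affine d c0 fi.
have E1 : (\int[leb]_x (f (c * x + d))%:E = c^-1%:E * \int[leb]_x (EFin \o f)^\+ x - c^-1%:E * \int[leb]_x (EFin \o f)^\- x)%E.
  rewrite -!(@ge0_integral_affine _ _ c d)//; last 2 first.
  - exact: measurable_funeneg.
  - exact: measurable_funepos.
  by rewrite [LHS]integralE; congr (_ - _)%E; apply: eq_integral => x _; rewrite ?funeposE ?funenegE.
have E2 : (\int[leb]_x (f x)%:E = \int[leb]_x (EFin \o f)^\+ x - \int[leb]_x (EFin \o f)^\- x)%E.
  by rewrite [LHS]integralE.
have := integrable_pos_fin_num measurableT fi.
have := integrable_neg_fin_num measurableT fi.
rewrite /Rintegral E1 E2.
case: (\int[leb]_x (EFin \o f)^\- x)%E => // u _; case: (\int[leb]_x (EFin \o f)^\+ x)%E => // v _.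
by rewrite /= mulrBr.
Qed.

(** Substitution of the standardized variable. The shift by [m] mixes cosine and sine, so the two
    integrals are treated together; this avoids complex-valued integrands until the very end. *)
Lemma gauss_fourier (tau m z : R) : 0 < tau ->
  [/\ leb.-integrable setT (EFin \o (fun y => cos (z * y) * expR (- ((m - y) ^+ 2 / (2 * tau))))),
      leb.-integrable setT (EFin \o (fun y => sin (z * y) * expR (- ((m - y) ^+ 2 / (2 * tau))))),
   (\int[leb]_y (cos (z * y) * expR (- ((m - y) ^+ 2 / (2 * tau)))) =
     Num.sqrt (2 * pi * tau) * expR (- (tau * z ^+ 2 / 2)) * cos (z * m))%R &
   (\int[leb]_y (sin (z * y) * expR (- ((m - y) ^+ 2 / (2 * tau)))) =
     Num.sqrt (2 * pi * tau) * expR (- (tau * z ^+ 2 / 2)) * sin (z * m))%R].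
Proof.
move=> t0; set s := Num.sqrt tau.
have s0 : 0 < s by rewrite sqrtr_gt0.
have s2 : s ^+ 2 = tau by rewrite sqr_sqrtr// ltW.
pose C y := cos ((z * s) * y) * expR (- (y ^+ 2 / 2)).
pose S y := sin ((z * s) * y) * expR (- (y ^+ 2 / 2)).
have iC : leb.-integrable setT (EFin \o C) by exact: integrable_cos_gauss.
have iS : leb.-integrable setT (EFin \o S) by exact: integrable_sin_gauss.
have si0 : 0 < s^-1 by rewrite invr_gt0.
have E (y : R) : expR (- ((m - y) ^+ 2 / (2 * tau))) = expR (- ((s^-1 * y + (- (m / s))) ^+ 2 / 2)).
  congr (expR (- _)); rewrite -s2; field; exact: lt0r_neq0.
have Z (y : R) : z * y = (z * s) * (s^-1 * y + (- (m / s))) + z * m.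
  by field; exact: lt0r_neq0.
have EC (y : R) : cos (z * y) * expR (- ((m - y) ^+ 2 / (2 * tau))) =
   cos (z * m) * C (s^-1 * y + (- (m / s))) - sin (z * m) * S (s^-1 * y + (- (m / s))).
  by rewrite Z E cosD /C /S; ring.
have ES (y : R) : sin (z * y) * expR (- ((m - y) ^+ 2 / (2 * tau))) =
   cos (z * m) * S (s^-1 * y + (- (m / s))) + sin (z * m) * C (s^-1 * y + (- (m / s))).
  by rewrite Z E sinD /C /S; ring.
have iC' : forall k, leb.-integrable setT (EFin \o (fun y => k * C (s^-1 * y + (- (m / s))))).
  move=> k; have := @integrableZl _ _ _ leb setT measurableT k _ (integrable_affine (- (m / s)) si0 iC).
  by under eq_fun do rewrite /= -EFinM.
have iS' : forall k, leb.-integrable setT (EFin \o (fun y => k * S (s^-1 * y + (- (m / s))))).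
  move=> k; have := @integrableZl _ _ _ leb setT measurableT k _ (integrable_affine (- (m / s)) si0 iS).
  by under eq_fun do rewrite /= -EFinM.
have s2pi : s * Num.sqrt (2 * pi) = Num.sqrt (2 * pi * tau).
  by rewrite [in RHS]sqrtrM ?mulr_ge0 ?pi_ge0// mulrC.
have sz : (z * s) ^+ 2 / 2 = tau * z ^+ 2 / 2 by rewrite exprMn s2; field.
split.
- rewrite /comp; under eq_fun do rewrite EC EFinB.
  exact: (integrableB measurableT (iC' _) (iS' _)).
- rewrite /comp; under eq_fun do rewrite ES EFinD.
  exact: (integrableD measurableT (iS' _) (iC' _)).
- under eq_Rintegral do rewrite EC.
  rewrite RintegralB// !RintegralZl//; [|exact: integrable_affine..].
  rewrite (Rintegral_affine _ si0 iC) (Rintegral_affine _ si0 iS) cos_gauss sin_gauss.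
  by rewrite !mulr0 subr0 invrK sz -s2pi; ring.
- under eq_Rintegral do rewrite ES.
  rewrite RintegralD// !RintegralZl//; [|exact: integrable_affine..].
  rewrite (Rintegral_affine _ si0 iC) (Rintegral_affine _ si0 iS) cos_gauss sin_gauss.
  by rewrite !mulr0 add0r invrK sz -s2pi; ring.
Qed.

End affine_signed.

Section product.
Context {R : realType} d1 d2 (T1 : measurableType d1) (T2 : measurableType d2).
Variables (m1 : {sigma_finite_measure set T1 -> \bar R})
  (m2 : {sigma_finite_measure set T2 -> \bar R}).

Lemma integrable_prodM (g : T1 -> R) (h : T2 -> R) :
  m1.-integrable setT (EFin \o g) -> m2.-integrable setT (EFin \o h) ->
  (m1 \x m2)%E.-integrable setT (EFin \o (fun p => g p.1 * h p.2)).
Proof.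
move=> gi hi; have /integrableP[/measurable_EFinP mg gf] := gi.
have /integrableP[/measurable_EFinP mh hf] := hi.
have mgh : measurable_fun setT (fun p : T1 * T2 => g p.1 * h p.2).
  apply: measurable_funM; first exact: (measurableT_comp mg).
  exact: (measurableT_comp mh).
apply/integrableP; split; first exact/measurable_EFinP.
rewrite fubini_tonelli1//=; last first.
  by apply/measurable_EFinP; exact: (measurableT_comp (@normr_measurable R setT) mgh).
rewrite /fubini_F/=.
under eq_integral do under eq_integral do rewrite normrM EFinM.
have mah : measurable_fun setT (fun y => (`|h y|)%:E).
  by apply/measurable_EFinP; exact: measurableT_comp.
under eq_integral do rewrite ge0_integralZl//.
rewrite ge0_integralZr//; last by apply: integral_ge0.
  by rewrite lte_mul_pinfty// ?integral_ge0// ge0_fin_numE// integral_ge0.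
by apply/measurable_EFinP; exact: measurableT_comp.
Qed.

Lemma Rintegral_prodM (g : T1 -> R) (h : T2 -> R) :
  m1.-integrable setT (EFin \o g) -> m2.-integrable setT (EFin \o h) ->
  (\int[(m1 \x m2)%E]_p (g p.1 * h p.2) =
   (\int[m1]_x g x) * (\int[m2]_y h y))%R.
Proof.
move=> gi hi; have ghi := integrable_prodM gi hi.
rewrite {1}/Rintegral -(integral12_prod_meas1 ghi) /=.
have E x : (\int[m2]_y (g x * h y)%:E = (g x)%:E * (\int[m2]_y h y)%:E)%E.
  by rewrite /Rintegral fineK ?integrable_fin_num// -integralZl.
rewrite /fubini_F/=; under eq_integral do rewrite E.
by rewrite integralZr// fineM//; exact: integrable_fin_num.
Qed.

End product.

(** * Fourier transform of the heat kernel *)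

Section tuple_integral.
Context {R : realType}.
Local Notation leb := (@lebesgue_measure R).

Lemma thead_cons_pair n (p : R * n.-tuple R) : thead (cons_pair p) = p.1.
Proof. by []. Qed.

Lemma behead_cons_pair n (p : R * n.-tuple R) :
  [tuple of behead (cons_pair p)] = p.2.
Proof. exact: val_inj. Qed.

Lemma integral_lebesgue_tupleS n (f : n.+1.-tuple R -> R) :
  measurable_fun setT f ->
  (leb \x lebesgue_tuple n)%E.-integrable setT (EFin \o (f \o cons_pair)) ->
  (lebesgue_tuple n.+1).-integrable setT (EFin \o f) /\
  (\int[lebesgue_tuple n.+1]_z f z =
   \int[(leb \x lebesgue_tuple n)%E]_p f (cons_pair p))%R.
Proof.
move=> mf fi.
have mf' : measurable_fun setT (EFin \o f) by exact/measurable_EFinP.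
have mc : measurable_fun (setT : set (measurableTypeR R * n.-tuple R))
    (@cons_pair R n : measurableTypeR R * n.-tuple R -> _) by exact: measurable_cons_pair.
pose nu0 : {measure set (measurableTypeR R * n.-tuple R) -> \bar R} := (leb \x lebesgue_tuple n)%E.
have fi' : nu0.-integrable setT (EFin \o (f \o @cons_pair R n)) by exact: fi.
split; first exact: (integrable_pushforward mc mf' fi' measurableT).
rewrite /Rintegral; congr fine.
exact: (integral_pushforward mc mf' fi' measurableT).
Qed.

Lemma tnth_behead_lift n (x : n.+1.-tuple R) (i : 'I_n) :
  tnth [tuple of behead x] i = tnth x (lift ord0 i).
Proof.
by rewrite tnth_behead; congr tnth; apply: val_inj; rewrite /= inordK// ltnS.
Qed.

(** The heat kernel without its power factor: in this form the weight is a product over the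
    coordinates. *)
Definition gauss_weight n (tau : R) (m y : n.-tuple R) : R :=
  expR (- (enorm (tuple_sub m y) ^+ 2 / (2 * tau))).

Lemma dotp_ge0 n (x : n.-tuple R) : 0 <= dotp x x.
Proof. by apply: sumr_ge0 => i _; rewrite -expr2 sqr_ge0. Qed.

Lemma enorm_sqr n (x : n.-tuple R) : enorm x ^+ 2 = dotp x x.
Proof. by rewrite sqr_sqrtr// dotp_ge0. Qed.

Lemma dotpS n (x y : n.+1.-tuple R) :
  dotp x y = thead x * thead y + dotp [tuple of behead x] [tuple of behead y].
Proof.
rewrite /dotp big_ord_recl; congr (_ + _); apply: eq_bigr => i _.
by rewrite -!tnth_behead_lift.
Qed.

Lemma gauss_weightS n tau (m y : n.+1.-tuple R) :
  gauss_weight tau m y = expR (- ((thead m - thead y) ^+ 2 / (2 * tau))) *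
    gauss_weight tau [tuple of behead m] [tuple of behead y].
Proof.
rewrite /gauss_weight !enorm_sqr dotpS -expRD; congr expR.
rewrite mulrDl opprD; congr (- (_ / _) + - (_ / _)).
  by rewrite /thead !tnth_mktuple expr2.
by congr dotp; apply: eq_from_tnth => i; rewrite tnth_behead_lift !tnth_mktuple !tnth_behead_lift.
Qed.

Lemma measurable_dotp n (x : n.-tuple R) : measurable_fun setT (dotp x).
Proof.
apply: measurable_sum => i; apply: measurable_funM => //.
exact: measurable_tnth.
Qed.

Lemma measurable_gauss_weight n tau (m : n.-tuple R) :
  measurable_fun setT (gauss_weight tau m).
Proof.
rewrite /gauss_weight; under eq_fun do rewrite enorm_sqr.
apply: (measurableT_comp (@measurable_expR R)).
apply: measurable_funN; apply: measurable_funM => //.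
apply: measurable_sum => i.
have h : measurable_fun setT (fun y : n.-tuple R => tnth m i - tnth y i).
  by apply: measurable_funB => //; exact: measurable_tnth.
under eq_fun do rewrite !tnth_mktuple.
exact: measurable_funM.
Qed.

(** Induction on the dimension: the weight splits off its first coordinate, and the addition
    formulas turn the cosine and sine of the inner product into sums of products, to which Fubini
    applies. *)
Lemma gauss_fourier_tuple n (tau : R) (m z : n.-tuple R) : 0 < tau ->
  [/\ (lebesgue_tuple n).-integrable setT (EFin \o (fun y => cos (dotp z y) * gauss_weight tau m y)),
      (lebesgue_tuple n).-integrable setT (EFin \o (fun y => sin (dotp z y) * gauss_weight tau m y)),
   (\int[lebesgue_tuple n]_y (cos (dotp z y) * gauss_weight tau m y) =
     Num.sqrt (2 * pi * tau) ^+ n * expR (- (tau * enorm z ^+ 2 / 2)) * cos (dotp z m))%R &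
   (\int[lebesgue_tuple n]_y (sin (dotp z y) * gauss_weight tau m y) =
     Num.sqrt (2 * pi * tau) ^+ n * expR (- (tau * enorm z ^+ 2 / 2)) * sin (dotp z m))%R].
Proof.
move=> t0; elim: n m z => [m z|n IH m z].
  have d0 (y : 0.-tuple R) : dotp z y = 0 by rewrite /dotp big_ord0.
  have w1 (y : 0.-tuple R) : gauss_weight tau m y = 1.
    by rewrite /gauss_weight enorm_sqr /dotp big_ord0 mul0r oppr0 expR0.
  have e0 : enorm z ^+ 2 = 0 by rewrite enorm_sqr d0.
  have l0 : @lebesgue_tuple R 0 setT = 1%E by exact: diracT.
  have ic (c : R) : (@lebesgue_tuple R 0).-integrable setT (EFin \o (fun y : 0.-tuple R => c)).
    apply/integrableP; split; first exact: measurable_cst.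
    by rewrite integral_cst//= l0 mule1 ltry.
  have cc (c : R) : (\int[@lebesgue_tuple R 0]_y c)%R = c.
    transitivity (c * fine (@lebesgue_tuple R 0 setT)); first exact: Rintegral_cst.
    by rewrite l0/= mulr1.
  split.
  - by rewrite /comp; under eq_fun do rewrite d0 w1; exact: ic.
  - by rewrite /comp; under eq_fun do rewrite d0 w1; exact: ic.
  - by under eq_Rintegral do rewrite d0 w1; rewrite cc d0 e0 cos0 expr0 mulr0 mul0r oppr0 expR0 !mulr1.
  - by under eq_Rintegral do rewrite d0 w1; rewrite cc d0 sin0 mulr0 mul0r.
have [iC iS eC eS] := IH [tuple of behead m] [tuple of behead z].
have [jC jS fC fS] := gauss_fourier (thead m) (thead z) t0.
set C1 := (X in leb.-integrable setT (EFin \o X)) in jC.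
set S1 := (X in leb.-integrable setT (EFin \o X)) in jS.
set C2 := (X in (lebesgue_tuple n).-integrable setT (EFin \o X)) in iC.
set S2 := (X in (lebesgue_tuple n).-integrable setT (EFin \o X)) in iS.
have EC (p : R * n.-tuple R) : cos (dotp z (cons_pair p)) * gauss_weight tau m (cons_pair p) =
   C1 p.1 * C2 p.2 - S1 p.1 * S2 p.2.
  rewrite dotpS gauss_weightS thead_cons_pair behead_cons_pair cosD /C1 /C2 /S1 /S2; ring.
have ES (p : R * n.-tuple R) : sin (dotp z (cons_pair p)) * gauss_weight tau m (cons_pair p) =
   S1 p.1 * C2 p.2 + C1 p.1 * S2 p.2.
  rewrite dotpS gauss_weightS thead_cons_pair behead_cons_pair sinD /C1 /C2 /S1 /S2; ring.
have mC : measurable_fun setT (fun y => cos (dotp z y) * gauss_weight tau m y).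
  apply: measurable_funM; last exact: measurable_gauss_weight.
  apply: (measurableT_comp _ (measurable_dotp z)); exact: continuous_measurable_fun (@continuous_cos R).
have mS : measurable_fun setT (fun y => sin (dotp z y) * gauss_weight tau m y).
  apply: measurable_funM; last exact: measurable_gauss_weight.
  apply: (measurableT_comp _ (measurable_dotp z)); exact: continuous_measurable_fun (@continuous_sin R).
have kC : (leb \x lebesgue_tuple n)%E.-integrable setT (EFin \o ((fun y => cos (dotp z y) * gauss_weight tau m y) \o cons_pair)).
  rewrite /comp; under eq_fun do rewrite EC EFinB.
  by apply: integrableB => //; exact: integrable_prodM.
have kS : (leb \x lebesgue_tuple n)%E.-integrable setT (EFin \o ((fun y => sin (dotp z y) * gauss_weight tau m y) \o cons_pair)).
  rewrite /comp; under eq_fun do rewrite ES EFinD.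
  by apply: integrableD => //; exact: integrable_prodM.
have [lC ->] := integral_lebesgue_tupleS mC kC.
have [lS ->] := integral_lebesgue_tupleS mS kS.
have eN : expR (- (tau * enorm z ^+ 2 / 2)) = expR (- (tau * thead z ^+ 2 / 2)) *
   expR (- (tau * enorm [tuple of behead z] ^+ 2 / 2)).
  by rewrite -expRD; congr expR; rewrite !enorm_sqr dotpS; field.
split => //.
- under eq_Rintegral do rewrite EC.
  rewrite RintegralB//; [|exact: integrable_prodM..].
  rewrite !Rintegral_prodM// eC eS fC fS eN (dotpS z m) cosD [_ ^+ n.+1]exprS; ring.
- under eq_Rintegral do rewrite ES.
  rewrite RintegralD//; [|exact: integrable_prodM..].
  rewrite !Rintegral_prodM// eC eS fC fS eN (dotpS z m) sinD [_ ^+ n.+1]exprS; ring.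
Qed.

End tuple_integral.

Section heat_fourier.
Context {R : realType}.
Local Notation leb := (@lebesgue_measure R).
Local Open Scope complex_scope.

(** The normalization of the heat kernel cancels the constant of the Gaussian integral. *)
Lemma powR_half_natr (c : R) (n : nat) : 0 < c ->
  c `^ (- (n%:R / 2)) * Num.sqrt c ^+ n = 1.
Proof.
move=> c0; rewrite -powR12_sqrt ?ltW// -powR_mulrn ?powR_ge0// -powRrM -powRD.
  by rewrite (_ : - (n%:R / 2) + 2^-1 * n%:R = 0) ?powRr0//; ring.
by rewrite lt0r_neq0 ?implybT.
Qed.

Lemma heat_kernelE n (tau : R) (x y : n.-tuple R) : 0 < tau ->
  heat_kernel tau (tuple_sub x y) = (2 * pi * tau) `^ (- (n%:R / 2)) * gauss_weight tau x y.
Proof. by move=> t0; rewrite /heat_kernel t0. Qed.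

Lemma integrable_gauss_weight n (tau : R) (x : n.-tuple R) : 0 < tau ->
  (lebesgue_tuple n).-integrable setT (EFin \o gauss_weight tau x).
Proof.
move=> t0; have [+ _ _ _] := gauss_fourier_tuple x [tuple (0 : R) | i < n] t0.
apply: eq_integrable => // y _ /=.
rewrite (_ : dotp _ _ = 0) ?cos0 ?mul1r//.
by rewrite /dotp big1// => i _; rewrite tnth_mktuple mul0r.
Qed.

Lemma integrable_heat_kernel n (tau : R) (x : n.-tuple R) :
  (lebesgue_tuple n).-integrable setT (EFin \o (fun y => heat_kernel tau (tuple_sub x y))).
Proof.
have [t0|t0] := ltP 0 tau; last first.
  rewrite /comp/=; under eq_fun do rewrite /heat_kernel ltNge t0/=.
  exact: integrable0.
have := @integrableZl _ _ _ _ setT measurableT ((2 * pi * tau) `^ (- (n%:R / 2))) _ (integrable_gauss_weight x t0).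
apply: eq_integrable => // y _ /=.
by rewrite heat_kernelE.
Qed.

Lemma fourier_heat_kernel n (tau : R) (x xi : n.-tuple R) : 0 < tau ->
  fourier (fun y => heat_kernel tau (tuple_sub x y)) xi =
  cexpi (- dotp xi x) * (expR (- (tau * enorm xi ^+ 2 / 2)))%:C.
Proof.
move=> t0; rewrite /fourier /cintegral.
set k := (2 * pi * tau) `^ (- (n%:R / 2)).
have [iC iS eC eS] := gauss_fourier_tuple x xi t0.
have ks : k * Num.sqrt (2 * pi * tau) ^+ n = 1.
  by rewrite powR_half_natr// !mulr_gt0// pi_gt0.
congr (_ +i* _).
  under eq_Rintegral do rewrite heat_kernelE//= -/k cosN mulr0 subr0 mulrCA.
  by rewrite RintegralZl// eC mulr0 subr0 !mulrA ks mul1r cosN mulrC.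
have E y : sin (- dotp xi y) * heat_kernel tau (tuple_sub x y) =
    (- k) * (sin (dotp xi y) * gauss_weight tau x y).
  by rewrite heat_kernelE//= -/k sinN; ring.
under eq_Rintegral do rewrite /= mulr0 add0r E.
rewrite RintegralZl// eS mulr0 add0r sinN mulNr !mulrA ks mul1r mulrC mulNr.
by [].
Qed.

(** Time kernel of the Ornstein-Uhlenbeck process of rate [lam] started from 0. The interval is open
    at [t] because [heat_kernel] is 0 at time 0. *)
Definition ou_kernel (lam t s : R) : R := \1_`[0, t[ s * expR (- (lam * (t - s))).

Definition freq n (xi : n.-tuple R) : R := enorm xi ^+ 2 / 2.

Lemma fourier_mild n (t : R) (x xi : n.-tuple R) (s : R) :
  fourier (mild_integrand t x s) xi =
  cexpi (- dotp xi x) * (ou_kernel (freq xi) t s)%:C.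
Proof.
rewrite /mild_integrand /ou_kernel.
have [s1|s1] := boolP (s \in `[0, t[%classic); last first.
  rewrite [\1_`[0, t[ s]indicE (negbTE s1) mul0r mulr0.
  (* The one point of [[0, t]] outside [[0, t[] is [s = t], where the heat kernel itself is 0. *)
  have f0 y : \1_`[0, t] s * heat_kernel (t - s) (tuple_sub x y) = 0.
    rewrite indicE; have [s2|] := boolP (s \in `[0, t]%classic); last by rewrite mul0r.
    rewrite mul1r /heat_kernel ifF//; apply/negbTE.
    move: s1 s2; rewrite !inE/= !in_itv/= => /negP h /andP[h0 _].
    by apply/negP; rewrite subr_gt0 => st; apply: h; rewrite inE/= in_itv/= h0.
  rewrite /fourier /cintegral; under eq_Rintegral do rewrite f0 /= !mulr0 subr0.
  rewrite [X in _ +i* X](_ : _ = 0); last first.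
    under eq_Rintegral do rewrite f0 /= !mulr0 addr0.
    by rewrite /Rintegral integral0.
  by rewrite /Rintegral integral0.
have /andP[s0 st] : 0 <= s < t by move: s1; rewrite inE/= in_itv.
have -> : (fun y => \1_`[0, t] s * heat_kernel (t - s) (tuple_sub x y)) =
    (fun y => heat_kernel (t - s) (tuple_sub x y)).
  apply/funext => y; rewrite indicE mem_set ?mul1r//=.
  by rewrite in_itv/= s0 ltW.
rewrite fourier_heat_kernel ?subr_gt0// indicE s1 mul1r; congr (_ * (expR (- _))%:C).
by rewrite /freq; ring.
Qed.

Lemma ou_kernel_ge0 lam t s : 0 <= ou_kernel lam t s.
Proof. by rewrite /ou_kernel mulr_ge0// expR_ge0. Qed.

Lemma normc_fourier_mild n (t : R) (x xi : n.-tuple R) (s : R) :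
  Normc.normc (fourier (mild_integrand t x s) xi) = ou_kernel (freq xi) t s.
Proof.
rewrite fourier_mild /Normc.normc /cexpi /=.
set k := ou_kernel _ _ _; set d := - _.
transitivity (Num.sqrt ((cos d ^+ 2 + sin d ^+ 2) * k ^+ 2)).
  by congr Num.sqrt; ring.
rewrite cos2Dsin2 mul1r sqrtr_sqr ger0_norm//.
exact: ou_kernel_ge0.
Qed.

(** The phase [exp (- i <xi, x>)] cancels against its conjugate: this is why the covariance is real
    and does not depend on [x]. *)
Lemma fourier_mild_conj n (t t' : R) (x xi : n.-tuple R) (s s' : R) :
  fourier (mild_integrand t x s) xi * ((fourier (mild_integrand t' x s') xi)^*)%C =
  (ou_kernel (freq xi) t s * ou_kernel (freq xi) t' s')%:C.
Proof.
rewrite !fourier_mild /cexpi; set k := ou_kernel _ _ _; set k' := ou_kernel _ _ _; set d := - _.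
have := cos2Dsin2 d; set c := cos d; set r := sin d => cr.
apply/eqP; rewrite eq_complex /=; apply/andP; split; apply/eqP; last by ring.
transitivity (k * k' * (c ^+ 2 + r ^+ 2)); last by rewrite cr mulr1.
by ring.
Qed.

(** The Fourier formula at frequency 0, with [tau = 1 / (2 c)]. *)
Lemma integral_expR_enorm n (c : R) : 0 < c ->
  (\int[lebesgue_tuple n]_xi (expR (- (c * enorm xi ^+ 2)))%:E =
   ((pi / c) `^ (n%:R / 2))%:E)%E.
Proof.
move=> c0.
have t0 : 0 < (2 * c)^-1 by rewrite invr_gt0 mulr_gt0.
pose z := [tuple (0 : R) | i < n].
have [iC _ eC _] := gauss_fourier_tuple z z t0.
have d0 y : dotp z y = 0 by rewrite /dotp big1// => i _; rewrite tnth_mktuple mul0r.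
have E y : cos (dotp z y) * gauss_weight (2 * c)^-1 z y = expR (- (c * enorm y ^+ 2)).
  rewrite d0 cos0 mul1r /gauss_weight.
  rewrite !enorm_sqr (_ : dotp (tuple_sub z y) _ = dotp y y); last first.
    by apply: eq_bigr => i _; rewrite !tnth_mktuple sub0r mulrNN.
  by congr (expR (- _)); field; exact: lt0r_neq0.
have : (\int[lebesgue_tuple n]_xi (expR (- (c * enorm xi ^+ 2)))%:E)%E \is a fin_num.
  have := integrable_fin_num measurableT iC; rewrite /comp.
  by under eq_integral do rewrite /= E.
move=> /fineK <-; congr EFin.
move: eC; under eq_Rintegral do rewrite E.
rewrite /Rintegral => ->.
rewrite d0 cos0 mulr1 enorm_sqr d0 mulr0 mul0r oppr0 expR0 mulr1.
rewrite -powR12_sqrt; last by rewrite !mulr_ge0 ?pi_ge0 ?invr_ge0 ?ltW// mulr_gt0.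
rewrite -powR_mulrn ?powR_ge0// -powRrM; congr powR; last by ring.
by field; exact: lt0r_neq0.
Qed.

Lemma measurable_enorm n : measurable_fun setT (@enorm R n).
Proof.
apply: (measurableT_comp (continuous_measurable_fun (@sqrt_continuous R))).
apply: measurable_sum => i; apply: measurable_funM; exact: measurable_tnth.
Qed.

Lemma freq_ge0 n (xi : n.-tuple R) : 0 <= freq xi.
Proof. by rewrite /freq mulr_ge0// sqr_ge0. Qed.

Lemma measurable_freq n : measurable_fun setT (@freq n).
Proof.
apply: measurable_funM => //; apply: measurable_funX; exact: measurable_enorm.
Qed.

End heat_fourier.

(** * Bounds for the spectral measure *)

Lemma tonelli {R : realType} d1 d2 (T1 : measurableType d1) (T2 : measurableType d2)
  (m1 : {sigma_finite_measure set T1 -> \bar R})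
  (m2 : {sigma_finite_measure set T2 -> \bar R}) (f : T1 -> T2 -> R) :
  measurable_fun setT (fun p : T1 * T2 => f p.1 p.2) -> (forall x y, 0 <= f x y) ->
  (\int[m1]_x \int[m2]_y (f x y)%:E = \int[m2]_y \int[m1]_x (f x y)%:E)%E.
Proof.
move=> mf f0.
have := @fubini_tonelli _ _ _ _ R m1 m2 (fun p : T1 * T2 => (f p.1 p.2)%:E).
rewrite /fubini_F /fubini_G /=; apply; first exact/measurable_EFinP.
by move=> p; rewrite lee_fin.
Qed.

Section uniform_domination.
Context {R : realType} d (T : measurableType d).
Variables (m1 m2 : {measure set T -> \bar R}) (w1 w2 : T -> R).
Hypotheses (mw1 : measurable_fun setT w1) (mw2 : measurable_fun setT w2).
Hypotheses (w10 : forall x, 0 <= w1 x) (w20 : forall x, 0 <= w2 x).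

Let I1 (h : T -> R) := (\int[m1]_x (h x * w1 x)%:E)%E.
Let I2 (h : T -> R) := (\int[m2]_x (h x * w2 x)%:E)%E.

Hypothesis dom : forall h : T -> R, measurable_fun setT h -> (forall x, 0 <= h x) ->
  exists2 C : R, 0 < C & (I1 h <= C%:E * I2 h)%E.

(* If no constant worked for all [h], the sum of suitably normalized counterexamples would violate the hypothesis. *)
Lemma uniform_domination : exists2 C : R, 0 < C &
  forall h : T -> R, measurable_fun setT h -> (forall x, 0 <= h x) ->
    (I1 h <= C%:E * I2 h)%E.
Proof.
apply: contrapT => noC.
have bad (k : nat) : exists h : T -> R, [/\ measurable_fun setT h, forall x, 0 <= h x &
    I2 h = (2 ^- k)%:E /\ ((2 ^+ k)%:E <= I1 h)%E].
  have [h [mh h0 hk]] : exists h : T -> R, [/\ measurable_fun setT h, forall x, 0 <= h x &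
      ((4 ^+ k)%:E * I2 h < I1 h)%E].
    apply: contrapT => noh; apply: noC; exists (4 ^+ k); first by rewrite exprn_gt0.
    move=> h mh h0; rewrite leNgt; apply/negP => hk; apply: noh; exists h; split => //.
  have I2ge0 : (0 <= I2 h)%E by apply: integral_ge0 => x _; rewrite lee_fin mulr_ge0.
  have I2fin : I2 h \is a fin_num.
    rewrite ge0_fin_numE// ltey; apply/eqP => I2oo.
    by move: hk; rewrite I2oo gt0_muley ?lte_fin ?exprn_gt0// ltNge leey.
  have I2gt0 : 0 < fine (I2 h).
    rewrite lt0r fine_ge0// andbT; apply/eqP => I20.
    have I2z : I2 h = 0%E by rewrite -(fineK I2fin) I20.
    have [C C0] := dom mh h0; rewrite I2z mule0 => h1.
    by move: hk; rewrite I2z mule0 ltNge h1.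
  set b := fine (I2 h) in I2gt0.
  have cb : 0 <= (2 ^+ k * b)^-1 by rewrite invr_ge0 mulr_ge0 ?exprn_ge0 ?ltW.
  (* Normalized so that the [m2] integral is [2^(-k)], which is summable, while the gap [4^k] leaves
     at least [2^k] on the [m1] side. *)
  exists (fun x => (2 ^+ k * b)^-1 * h x); split.
  - exact: measurable_funM.
  - by move=> x; rewrite mulr_ge0.
  - have E (w : T -> R) (m : {measure set T -> \bar R}) : measurable_fun setT w -> (forall x, 0 <= w x) ->
       (\int[m]_x ((2 ^+ k * b)^-1 * h x * w x)%:E = ((2 ^+ k * b)^-1)%:E * \int[m]_x (h x * w x)%:E)%E.
      move=> mw w0; under eq_integral do rewrite -mulrA EFinM.
      rewrite ge0_integralZl//.
      + by apply/measurable_EFinP; exact: measurable_funM.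
      + by move=> x _; rewrite lee_fin mulr_ge0.
    split.
      rewrite /I2 E// -/(I2 h) -(fineK I2fin) -EFinM -/b; congr EFin.
      by rewrite invfM -mulrA mulVf ?mulr1// lt0r_neq0.
    rewrite /I1 E// -/(I1 h).
    have -> : (2 ^+ k : R)%:E = (((2 ^+ k * b)^-1)%:E * ((4 ^+ k)%:E * I2 h))%E.
      rewrite -(fineK I2fin) -!EFinM -/b; congr EFin.
      have -> : (4 : R) = 2 * 2 by ring.
      by rewrite exprMn; field; rewrite lt0r_neq0//= expf_neq0.
    by apply: lee_wpmul2l; [rewrite lee_fin|exact: ltW].
pose g k := projT1 (cid (bad k)).
have mg k : measurable_fun setT (g k) by rewrite /g; case: cid => h [].
have g0 k x : 0 <= g k x by rewrite /g; case: cid => h [] /=.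
have g2 k : I2 (g k) = (2 ^- k)%:E by rewrite /g; case: cid => h [_ _ []] /=.
have g1 k : ((2 ^+ k)%:E <= I1 (g k))%E by rewrite /g; case: cid => h [_ _ []] /=.
pose S x := (\sum_(k <oo) (g k x)%:E)%E.
have S0 x : (0 <= S x)%E by apply: nneseries_ge0 => k _ _; rewrite lee_fin.
have mS : measurable_fun setT S.
  by apply: ge0_emeasurable_sum => [k x _ _|k _]; [rewrite lee_fin|exact/measurable_EFinP].
have intS : (\int[m2]_x ((w2 x)%:E * S x) < +oo)%E.
  have -> : (\int[m2]_x ((w2 x)%:E * S x) = \sum_(k <oo) (2 ^- k)%:E)%E.
    rewrite (eq_integral (fun x => \sum_(k <oo) (g k x * w2 x)%:E)%E); last first.
      move=> x _; rewrite /S -nneseriesZl; last by move=> k _; rewrite lee_fin.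
      by apply: eq_eseriesr => k _; rewrite mulrC EFinM.
    rewrite integral_nneseries//.
    - by apply: eq_eseriesr => k _; exact: g2.
    - by move=> k; apply/measurable_EFinP; exact: measurable_funM.
    - by move=> k x _; rewrite lee_fin mulr_ge0.
  have /cvg_lim := @cvg_geometric_eseries_half R 2 0.
  have E2 : eseries (fun k : nat => (2 / (2 ^ (k + 1))%:R)%:E) = eseries (fun k => (2 ^- k : R)%:E).
    congr eseries; apply/funext => k; congr EFin.
    by rewrite addn1 natrX exprS invfM mulrA divff ?mul1r// pnatr_eq0.
  by rewrite E2 => -> //; exact: ltry.
(* The series has a finite [m2] integral, so [N] carries no mass for the weighted [m2]; the
   hypothesis transfers this to the weighted [m1]. *)
pose N := [set x | S x = +oo%E].
have mN : measurable N by rewrite /N -[X in measurable X]setTI; exact: (mS measurableT _ (emeasurable_set1 +oo%E)).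
have N2 (h : T -> R) : measurable_fun setT h -> (forall x, 0 <= h x) ->
    I2 (fun x => h x * \1_N x) = 0%E.
  move=> mh h0; rewrite /I2.
  have mw2S : measurable_fun setT (fun x => (w2 x)%:E * S x)%E.
    by apply: emeasurable_funM => //; exact/measurable_EFinP.
  have w2S0 x : (0 <= (w2 x)%:E * S x)%E by rewrite mule_ge0// lee_fin.
  have /integrable_ae : m2.-integrable setT (fun x => (w2 x)%:E * S x)%E.
    by apply/integrableP; split=> //; under eq_integral do rewrite gee0_abs//.
  move=> /(_ measurableT) aeS.
  rewrite (ge0_ae_eq_integral (g := cst 0%E))//.
  - exact: integral0.
  - by apply/measurable_EFinP; do 2 apply: measurable_funM => //; exact: measurable_indic.
  - by move=> x _; rewrite lee_fin !mulr_ge0.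
  - apply: filterS aeS => x /(_ I) Sx _ /=; rewrite indicE.
    have [/[!inE] Nx|_] := boolP (x \in N); last by rewrite mulr0 mul0r.
    have := w20 x; rewrite le_eqVlt => /predU1P[<-|w2x]; first by rewrite mulr0.
    by move: Sx; rewrite Nx gt0_muley ?lte_fin.
pose G x := fine (S x).
have mG : measurable_fun setT G by apply: measurableT_comp mS.
have G0 x : 0 <= G x by exact: fine_ge0.
have I2G : (I2 G < +oo)%E.
  apply: le_lt_trans intS; apply: ge0_le_integral => //.
  - by move=> x _; rewrite lee_fin mulr_ge0.
  - by apply/measurable_EFinP; exact: measurable_funM.
  - by apply: emeasurable_funM => //; exact/measurable_EFinP.
  - move=> x _; rewrite EFinM muleC lee_wpmul2l ?lee_fin// /G.
    by case: (S x) (S0 x) => [r| |] _ //=; rewrite ?lexx ?leey.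
have I1G k : ((2 ^+ k)%:E <= I1 G)%E.
  apply: le_trans (g1 k) _.
  (* On [N] the function [G] is 0, because [fine] sends infinity to 0. There [h] takes over: it
     integrates to 0, so adding it is free and makes [g k <= G + h] hold everywhere. *)
  pose h x : R := g k x * \1_N x.
  have mgN : measurable_fun setT h.
    by apply: measurable_funM => //; exact: measurable_indic.
  have gN0 x : 0 <= h x by rewrite mulr_ge0.
  have gN : I1 h = 0%E.
    have [C C0] := dom mgN gN0.
    rewrite N2// mule0 => h1; apply/eqP; rewrite eq_le h1/=.
    by apply: integral_ge0 => x _; rewrite lee_fin mulr_ge0.
  have -> : I1 G = (I1 G + I1 h)%E by rewrite gN adde0.
  rewrite -ge0_integralD//; first last.
  - by apply/measurable_EFinP; exact: measurable_funM.
  - by move=> x _; rewrite lee_fin mulr_ge0.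
  - by apply/measurable_EFinP; exact: measurable_funM.
  - by move=> x _; rewrite lee_fin mulr_ge0.
  apply: ge0_le_integral => //.
  - by move=> x _; rewrite lee_fin mulr_ge0.
  - by apply/measurable_EFinP; exact: measurable_funM.
  - by apply: emeasurable_funD; apply/measurable_EFinP; exact: measurable_funM.
  move=> x _; rewrite -EFinD lee_fin -mulrDl ler_wpM2r// /h indicE.
  have [|Nx] := boolP (x \in N); first by rewrite mulr1 lerDr.
  rewrite mulr0 addr0 /G.
  have Sk : ((g k x)%:E <= S x)%E.
    apply: le_trans (nneseries_lim_ge k.+1 _); last by move=> i _ _; rewrite lee_fin.
    by rewrite big_nat_recr//= leeDr// sume_ge0// => i _; rewrite lee_fin.
  case E : (S x) (S0 x) Sk => [r| |]//= _.
  by move: Nx; rewrite notin_setE /N/= E.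
have [C C0] := dom mG G0.
apply/negP; rewrite -ltNge.
have I2Gf : I2 G \is a fin_num.
  by rewrite ge0_fin_numE//; apply: integral_ge0 => x _; rewrite lee_fin mulr_ge0.
rewrite -(fineK I2Gf) -EFinM.
pose k := Num.trunc (C * fine (I2 G)).
apply: lt_le_trans (I1G k.+1); rewrite lte_fin.
apply: lt_le_trans (truncnS_gt _) _.
by rewrite -natrX ler_nat -/k ltnW// ltn_expl.
Qed.
End uniform_domination.

Lemma ge0_integralZl_real {R : realType} d (T : measurableType d)
    (m : {measure set T -> \bar R}) (c : R) (f : T -> R) :
  0 <= c -> measurable_fun setT f -> (forall x, 0 <= f x) ->
  (\int[m]_x (c * f x)%:E = c%:E * \int[m]_x (f x)%:E)%E.
Proof.
move=> c0 mf f0; under eq_integral do rewrite EFinM.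
rewrite ge0_integralZl//; first exact/measurable_EFinP.
by move=> x _; rewrite lee_fin.
Qed.

Lemma measurable_int2 {R : realType} d1 d2 (T1 : measurableType d1) (T2 : measurableType d2)
  (m2 : {sigma_finite_measure set T2 -> \bar R}) (f : T1 -> T2 -> R) :
  measurable_fun setT (fun p : T1 * T2 => f p.1 p.2) -> (forall x y, 0 <= f x y) ->
  measurable_fun setT (fun x => \int[m2]_y (f x y)%:E)%E.
Proof.
move=> mf f0.
have := @measurable_fun_fubini_tonelli_F _ _ T1 T2 R m2 (fun p => (f p.1 p.2)%:E).
rewrite /fubini_F /=; apply; first exact/measurable_EFinP.
by move=> p; rewrite lee_fin.
Qed.

Lemma mule_eq_fin {R : realType} (c r : R) (A : \bar R) : 0 < c ->
  (c%:E * A = r%:E)%E -> A = (r / c)%:E.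
Proof.
move=> c0 h; have : (c^-1%:E * (c%:E * A) = (r / c)%:E)%E by rewrite h -EFinM mulrC.
by rewrite muleA -EFinM mulVf ?mul1e// lt0r_neq0.
Qed.

Lemma measurable_gamma_comp {R : realType} d (T : measurableType d) (q : R) (f g : T -> R) :
  measurable_fun setT f -> measurable_fun setT g ->
  measurable_fun setT (fun x => gamma_integrand q (f x) (g x)).
Proof.
move=> mf mg; apply: measurable_funM.
  apply: (measurableT_comp _ mg); apply: measurable_indic; exact: measurable_itv.
apply: measurable_funM.
  exact: (measurableT_comp (@measurable_powR _ _)).
apply: (measurableT_comp (@measurable_expR _)); apply: measurable_funN; exact: measurable_funM.
Qed.

Section power_weight.
Context {R : realType} (n : nat) (alpha : R).
Hypotheses (n1 : (1 <= n)%N) (alpha0 : 0 < alpha) (alphan : alpha < n%:R).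
Local Notation leb := (@lebesgue_measure R).
Local Notation lebn := (@lebesgue_tuple R n).

Let beta : R := (n%:R - alpha) / 2.

Lemma measurable_enorm0 : measurable [set xi : n.-tuple R | enorm xi = 0].
Proof.
rewrite -[X in measurable X]setTI.
exact: (@measurable_enorm R n measurableT _ (measurable_set1 0)).
Qed.

(** The indicator of the origin lies below [exp (- c |xi|^2)], and [c] is chosen so that this
    Gaussian integrates to [e]. *)
Lemma lebesgue_tuple_enorm0 : lebn [set xi : n.-tuple R | enorm xi = 0] = 0%E.
Proof.
apply/eqP; rewrite eq_le measure_ge0 andbT; apply/lee_addgt0Pr => e e0; rewrite add0e.
have n0 : 0 < (n%:R / 2 : R) by rewrite divr_gt0// ltr0n.
pose c := pi / e `^ (n%:R / 2)^-1 : R.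
have ep : 0 < e `^ (n%:R / 2)^-1 by rewrite powR_gt0.
have c0 : 0 < c by rewrite divr_gt0// pi_gt0.
have <- : (\int[lebn]_xi (expR (- (c * enorm xi ^+ 2)))%:E = e%:E)%E.
  rewrite integral_expR_enorm// /c invf_div mulrCA divff ?mulr1 ?lt0r_neq0 ?pi_gt0//.
  by rewrite -powRrM mulVf ?powRr1 ?lt0r_neq0 ?ltW.
rewrite -[X in (lebn X <= _)%E]setIT -integral_indic//; last exact: measurable_enorm0.
apply: ge0_le_integral => //.
- by apply/measurable_EFinP; apply: measurable_indic; exact: measurable_enorm0.
- apply/measurable_EFinP; apply: (measurableT_comp (@measurable_expR _)).
  apply: measurable_funN; apply: measurable_funM => //; apply: measurable_funX.
  exact: measurable_enorm.
- move=> xi _; rewrite lee_fin indicE; have [/[!inE]/= ->|_] := boolP (_ \in _).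
    by rewrite expr0n/= mulr0 oppr0 expR0.
  exact: expR_ge0.
Qed.

(** The integral of [exp (- freq xi) |xi|^(-alpha)], by [integral_expR_pow] at [w = 1]. *)
Definition pow_const : R :=
  pi `^ (n%:R / 2) * Gamma beta / Gamma (n%:R / 2) * 2 `^ beta.

Lemma pow_const_gt0 : 0 < pow_const.
Proof.
have n0 : 0 < (n%:R / 2 : R) by rewrite divr_gt0// ltr0n.
by rewrite /pow_const !mulr_gt0// ?invr_gt0 ?powR_gt0 ?pi_gt0// Gamma_gt0// /beta divr_gt0// subr_gt0.
Qed.

Lemma measurable_pow_weight : measurable_fun setT (fun xi : n.-tuple R => enorm xi `^ (- alpha)).
Proof. apply: (measurableT_comp (@measurable_powR _ _)); exact: measurable_enorm. Qed.

Lemma measurable_expR_freq (w : R) : measurable_fun setT (fun xi : n.-tuple R => expR (- (w * freq xi))).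
Proof.
apply: (measurableT_comp (@measurable_expR _)); apply: measurable_funN.
apply: measurable_funM => //; exact: measurable_freq.
Qed.

(** Polar coordinates are replaced by subordination. Writing [|xi|^(-alpha)] as a Gamma mixture of
    [exp (- v |xi|^2)] makes the integral over [xi] Gaussian. What remains is a Beta integral in
    [v], computed by writing [(v + w / 2)^(-n / 2)] as a Gamma mixture too and exchanging the
    integrals once more. *)
Lemma integral_expR_pow (w : R) : 0 < w ->
  (\int[lebn]_xi (expR (- (w * freq xi)) * enorm xi `^ (- alpha))%:E =
   (pow_const * w `^ (- beta))%:E)%E.
Proof.
move=> w0.
have n0 : 0 < (n%:R / 2 : R) by rewrite divr_gt0// ltr0n.
have a0 : 0 < alpha / 2 by rewrite divr_gt0.
have b0 : 0 < beta by rewrite divr_gt0// subr_gt0.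
have Ga := Gamma_gt0 a0; have Gn := Gamma_gt0 n0.
pose vv (v : R) : R := \1_`]0, +oo[ v * v `^ (alpha / 2 - 1).
have vv0 v : 0 <= vv v by rewrite /vv mulr_ge0// powR_ge0.
have mvv : measurable_fun setT vv.
  by apply: measurable_funM; [exact: measurable_indic|exact: measurable_powR].
have step1 : ((Gamma (alpha / 2))%:E * \int[lebn]_xi (expR (- (w * freq xi)) * enorm xi `^ (- alpha))%:E =
    \int[lebn]_xi \int[leb]_v (expR (- (w * freq xi)) * gamma_integrand (alpha / 2) (enorm xi ^+ 2) v)%:E)%E.
  rewrite -ge0_integralZl_real//; first last.
  - by move=> x; rewrite mulr_ge0 ?expR_ge0 ?powR_ge0.
  - apply: measurable_funM; [exact: measurable_expR_freq|exact: measurable_pow_weight].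
  - exact: ltW.
  have E (xi : n.-tuple R) : (\int[leb]_v (expR (- (w * freq xi)) * gamma_integrand (alpha / 2) (enorm xi ^+ 2) v)%:E =
     (expR (- (w * freq xi)))%:E * \int[leb]_v (gamma_integrand (alpha / 2) (enorm xi ^+ 2) v)%:E)%E.
    rewrite ge0_integralZl_real ?expR_ge0//; first exact: measurable_gamma_integrand.
    by move=> x; exact: gamma_integrand_ge0.
  apply: ge0_ae_eq_integral => //.
  - apply/measurable_EFinP; apply: measurable_funM => //; apply: measurable_funM; [exact: measurable_expR_freq|exact: measurable_pow_weight].
  - apply: measurable_int2 => //.
      apply: measurable_funM; first exact: (measurableT_comp (measurable_expR_freq w)).
      apply: measurable_gamma_comp => //; apply: measurable_funX.
      exact: (measurableT_comp (@measurable_enorm R n)).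
    by move=> x v; rewrite mulr_ge0 ?expR_ge0//; exact: gamma_integrand_ge0.
  - move=> x _; rewrite lee_fin; apply: mulr_ge0; first exact: ltW.
    by apply: mulr_ge0; [exact: expR_ge0|exact: powR_ge0].
  - move=> x _; apply: integral_ge0 => v _; rewrite lee_fin mulr_ge0 ?expR_ge0//; exact: gamma_integrand_ge0.
  (* At the origin the mixture diverges while [powR] returns 0, so the identity only holds off a
     null set. *)
  have : lebn.-negligible [set xi : n.-tuple R | enorm xi = 0].
    by exists [set xi : n.-tuple R | enorm xi = 0]; split => //; [exact: measurable_enorm0|exact: lebesgue_tuple_enorm0].
  apply: negligibleS => xi /= ; apply: contra_notP => /eqP xi0 _.
  have x0 : 0 < enorm xi by rewrite lt0r xi0 sqrtr_ge0.
  rewrite E integral_gamma ?exprn_gt0// -EFinM; congr EFin.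
  rewrite -powR_mulrn; last exact: ltW.
  by rewrite -powRrM mulrCA; congr (_ * (_ * _ `^ _)); field.
have step2 : (\int[lebn]_xi \int[leb]_v (expR (- (w * freq xi)) * gamma_integrand (alpha / 2) (enorm xi ^+ 2) v)%:E =
   \int[leb]_v (pi `^ (n%:R / 2) * (vv v * (v + w / 2) `^ (- (n%:R / 2))))%:E)%E.
  rewrite (@tonelli _ _ _ _ _ lebn leb (fun xi v => expR (- (w * freq xi)) * gamma_integrand (alpha / 2) (enorm xi ^+ 2) v)).
  - apply: eq_integral => v _.
    have [v0|v0] := leP v 0.
      rewrite /vv indicE memNset; last by rewrite /= in_itv/= andbT; apply/negP; rewrite -leNgt.
      by rewrite !mul0r mulr0 integral0_eq// => xi _; rewrite gamma_integrand_le0 ?mulr0.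
    transitivity (\int[lebn]_xi (vv v * expR (- ((v + w / 2) * enorm xi ^+ 2)))%:E)%E.
      apply: eq_integral => xi _; congr EFin; rewrite gamma_integrandE// /vv indicE mem_set/= ?in_itv/= ?v0// mul1r.
      by rewrite mulrCA -expRD; congr (_ * expR _); rewrite /freq; field.
    rewrite ge0_integralZl_real//; last first.
      apply: (measurableT_comp (@measurable_expR _)); apply: measurable_funN; apply: measurable_funM => //.
      by apply: measurable_funX; exact: measurable_enorm.
    rewrite integral_expR_enorm ?addr_gt0// ?divr_gt0// -EFinM; congr EFin.
    rewrite powRM ?pi_ge0 ?invr_ge0 ?addr_ge0 ?ltW ?divr_gt0//.
    have z0 : 0 <= v + w / 2 by rewrite addr_ge0 ?ltW ?divr_gt0.
    by rewrite -[(v + w / 2)^-1]powR_inv1// -powRrM mulN1r; ring.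
  - apply: measurable_funM.
      exact: (measurableT_comp (measurable_expR_freq w)).
    apply: measurable_gamma_comp => //; apply: measurable_funX.
    exact: (measurableT_comp (@measurable_enorm R n)).
  - by move=> xi v; rewrite mulr_ge0 ?expR_ge0//; exact: gamma_integrand_ge0.
have mvw : measurable_fun setT (fun v : R => vv v * (v + w / 2) `^ (- (n%:R / 2))).
  apply: measurable_funM => //; apply: (measurableT_comp (@measurable_powR _ _)).
  exact: measurable_funD.
have step3 : ((Gamma (n%:R / 2))%:E * \int[leb]_v (vv v * (v + w / 2) `^ (- (n%:R / 2)))%:E =
    \int[leb]_v \int[leb]_y (vv v * gamma_integrand (n%:R / 2) (v + w / 2) y)%:E)%E.
  rewrite -ge0_integralZl_real//; [|exact: ltW|by move=> v; rewrite mulr_ge0 ?powR_ge0].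
  apply: eq_integral => v _.
  rewrite ge0_integralZl_real//; [|exact: measurable_gamma_integrand|by move=> x; exact: gamma_integrand_ge0].
  have [v0|v0] := leP v 0.
    rewrite /vv indicE memNset; last by rewrite /= in_itv/= andbT; apply/negP; rewrite -leNgt.
    by rewrite !mul0r mulr0 mul0e.
  have vw0 : 0 < v + w / 2 by rewrite addr_gt0// divr_gt0.
  by rewrite (integral_gamma n0 vw0) -EFinM; congr EFin; ring.
have step4 : (\int[leb]_v \int[leb]_y (vv v * gamma_integrand (n%:R / 2) (v + w / 2) y)%:E =
    \int[leb]_y (Gamma (alpha / 2) * gamma_integrand beta (w / 2) y)%:E)%E.
  rewrite (@tonelli _ _ _ _ _ leb leb (fun v y => vv v * gamma_integrand (n%:R / 2) (v + w / 2) y)).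
  - apply: eq_integral => y _.
    have [y0|y0] := leP y 0.
      rewrite gamma_integrand_le0// mulr0.
      by rewrite integral0_eq// => v _; rewrite gamma_integrand_le0 ?mulr0.
    transitivity (\int[leb]_v ((y `^ (n%:R / 2 - 1) * expR (- (w / 2 * y))) * gamma_integrand (alpha / 2) y v)%:E)%E.
      apply: eq_integral => v _; congr EFin; rewrite gamma_integrandE// /vv /gamma_integrand.
      rewrite (_ : expR (- ((v + w / 2) * y)) = expR (- (w / 2 * y)) * expR (- (y * v))); last by rewrite -expRD; congr expR; ring.
      ring.
    rewrite ge0_integralZl_real//; last 3 first.
    + by rewrite mulr_ge0 ?powR_ge0 ?expR_ge0.
    + exact: measurable_gamma_integrand.
    + by move=> x; exact: gamma_integrand_ge0.
    rewrite integral_gamma// -EFinM; congr EFin; rewrite gamma_integrandE//.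
    rewrite (_ : y `^ (beta - 1) = y `^ (n%:R / 2 - 1) * y `^ (- (alpha / 2))); last first.
      by rewrite -powRD ?lt0r_neq0 ?implybT//; congr powR; rewrite /beta; field.
    ring.
  - apply: measurable_funM; first exact: (measurableT_comp mvv).
    apply: measurable_gamma_comp => //; exact: measurable_funD.
  - by move=> v y; rewrite mulr_ge0//; exact: gamma_integrand_ge0.
have w20 : 0 < w / 2 by rewrite divr_gt0.
have step5 : (\int[leb]_y (Gamma (alpha / 2) * gamma_integrand beta (w / 2) y)%:E =
    (Gamma (alpha / 2) * (Gamma beta * (w / 2) `^ (- beta)))%:E)%E.
  rewrite (ge0_integralZl_real leb (ltW Ga) (measurable_gamma_integrand _ _) (gamma_integrand_ge0 _ _)).
  by rewrite integral_gamma.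
move: step3; rewrite step4 step5 => /(mule_eq_fin Gn) step6.
move: step1; rewrite step2 ge0_integralZl_real ?powR_ge0//; last first.
  by move=> v; rewrite mulr_ge0 ?powR_ge0.
rewrite step6 -EFinM => /(mule_eq_fin Ga) ->; congr EFin; rewrite /pow_const.
have -> : (w / 2) `^ (- beta) = w `^ (- beta) * 2 `^ beta.
  by rewrite powRM ?invr_ge0 ?ltW// -[2^-1]powR_inv1// -powRrM mulN1r opprK.
move: Ga Gn; move: (Gamma (alpha / 2)) (Gamma (n%:R / 2)) (Gamma beta) => A B C A0 B0.
by field; rewrite !lt0r_neq0.
Qed.

(** A power of the resolvent is a Gamma mixture of [exp (- y freq)], so the previous formula applies
    under the mixture; [beta < q] makes the remaining Gamma integral converge at 0. *)
Lemma integral_resolvent_pow (q h : R) : beta < q -> 0 < h ->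
  (\int[lebn]_xi ((freq xi + h^-1) `^ (- q) * enorm xi `^ (- alpha))%:E =
   (pow_const * Gamma (q - beta) / Gamma q * h `^ (q - beta))%:E)%E.
Proof.
move=> bq h0.
have b0 : 0 < beta by rewrite divr_gt0// subr_gt0.
have q0 : 0 < q by apply: lt_trans bq.
have hi : 0 < h^-1 by rewrite invr_gt0.
have Gq := Gamma_gt0 q0.
have mres : measurable_fun setT (fun xi : n.-tuple R => (freq xi + h^-1) `^ (- q)).
  apply: (measurableT_comp (@measurable_powR _ _)); apply: measurable_funD => //; exact: measurable_freq.
have fh (xi : n.-tuple R) : 0 < freq xi + h^-1 by rewrite ltr_wpDl// freq_ge0.
have step1 : ((Gamma q)%:E * \int[lebn]_xi ((freq xi + h^-1) `^ (- q) * enorm xi `^ (- alpha))%:E =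
   \int[lebn]_xi \int[leb]_y (enorm xi `^ (- alpha) * gamma_integrand q (freq xi + h^-1) y)%:E)%E.
  rewrite -ge0_integralZl_real//; first last.
  - by move=> x; rewrite mulr_ge0 ?powR_ge0.
  - by apply: measurable_funM => //; exact: measurable_pow_weight.
  - exact: ltW.
  apply: eq_integral => xi _.
  rewrite ge0_integralZl_real ?powR_ge0//; last 2 first.
  - exact: measurable_gamma_integrand.
  - by move=> x; exact: gamma_integrand_ge0.
  by rewrite (integral_gamma q0 (fh xi)) -EFinM; congr EFin; ring.
have step2 : (\int[lebn]_xi \int[leb]_y (enorm xi `^ (- alpha) * gamma_integrand q (freq xi + h^-1) y)%:E =
   \int[leb]_y (pow_const * gamma_integrand (q - beta) h^-1 y)%:E)%E.
  rewrite (@tonelli _ _ _ _ _ lebn leb (fun xi y => enorm xi `^ (- alpha) * gamma_integrand q (freq xi + h^-1) y)).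
  - apply: eq_integral => y _.
    have [y0|y0] := leP y 0.
      rewrite gamma_integrand_le0// mulr0.
      by rewrite integral0_eq// => v _; rewrite gamma_integrand_le0 ?mulr0.
    transitivity (\int[lebn]_xi ((y `^ (q - 1) * expR (- (h^-1 * y))) * (expR (- (y * freq xi)) * enorm xi `^ (- alpha)))%:E)%E.
      apply: eq_integral => v _; congr EFin; rewrite gamma_integrandE//.
      rewrite (_ : expR (- ((freq v + h^-1) * y)) = expR (- (h^-1 * y)) * expR (- (y * freq v))); last first.
        by rewrite -expRD; congr expR; ring.
      ring.
    rewrite ge0_integralZl_real//; last 3 first.
    + by rewrite mulr_ge0 ?powR_ge0 ?expR_ge0.
    + by apply: measurable_funM; [exact: measurable_expR_freq|exact: measurable_pow_weight].
    + by move=> x; rewrite mulr_ge0 ?expR_ge0 ?powR_ge0.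
    rewrite integral_expR_pow// -EFinM; congr EFin; rewrite gamma_integrandE//.
    rewrite (_ : y `^ (q - beta - 1) = y `^ (q - 1) * y `^ (- beta)); last first.
      by rewrite -powRD ?lt0r_neq0 ?implybT//; congr powR; ring.
    ring.
  - apply: measurable_funM; first exact: (measurableT_comp measurable_pow_weight).
    apply: measurable_gamma_comp => //; apply: measurable_funD => //.
    exact: (measurableT_comp (@measurable_freq R n)).
  - by move=> v y; rewrite mulr_ge0 ?powR_ge0//; exact: gamma_integrand_ge0.
move: step1; rewrite step2 ge0_integralZl_real//; last 3 first.
- by apply: ltW; exact: pow_const_gt0.
- exact: measurable_gamma_integrand.
- by move=> x; exact: gamma_integrand_ge0.
rewrite integral_gamma ?subr_gt0// -EFinM => /(mule_eq_fin Gq) ->; congr EFin.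
rewrite -[h^-1]powR_inv1 ?ltW// -powRrM mulN1r opprK.
by field; rewrite lt0r_neq0.
Qed.

Section spectral.
Variable mu : {measure set (n.-tuple R) -> \bar R}.
Hypotheses (tmu : tempered_measure mu) (amu : asymp_power mu alpha).

(** Scaling needs one pair of constants for all [w] and all [h], whereas [asymp_power] may change
    them with the test function. [uniform_domination], used in both directions, removes this
    dependence. *)
Lemma asymp_power_uniform : exists c C : R, [/\ 0 < c, 0 < C &
  forall h : n.-tuple R -> R, measurable_fun setT h -> (forall xi, 0 <= h xi) ->
  ((c%:E * \int[lebn]_xi (h xi * enorm xi `^ (- alpha))%:E <= \int[mu]_xi (h xi)%:E)%E /\
   (\int[mu]_xi (h xi)%:E <= C%:E * \int[lebn]_xi (h xi * enorm xi `^ (- alpha))%:E)%E)].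
Proof.
have w10 (x : n.-tuple R) : 0 <= cst (1 : R) x by [].
have w20 (x : n.-tuple R) : 0 <= enorm x `^ (- alpha) by exact: powR_ge0.
have [C C0 hC] : exists2 C : R, 0 < C & forall h : n.-tuple R -> R,
   measurable_fun setT h -> (forall xi, 0 <= h xi) ->
   (\int[mu]_xi (h xi * cst 1 xi)%:E <= C%:E * \int[lebn]_xi (h xi * enorm xi `^ (- alpha))%:E)%E.
  apply: (@uniform_domination _ _ _ mu lebn (cst 1)) => //; first exact: measurable_pow_weight.
  move=> h mh h0; have [C' [C [_ C0 _ hC]]] := amu mh h0.
  by exists C => //; under eq_integral do rewrite /= mulr1.
have [D D0 hD] : exists2 C : R, 0 < C & forall h : n.-tuple R -> R,
   measurable_fun setT h -> (forall xi, 0 <= h xi) ->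
   (\int[lebn]_xi (h xi * enorm xi `^ (- alpha))%:E <= C%:E * \int[mu]_xi (h xi * cst 1 xi)%:E)%E.
  apply: (@uniform_domination _ _ _ lebn mu _ (cst 1)) => //; first exact: measurable_pow_weight.
  move=> h mh h0; have [C' [C1 [C'0 _ hC' _]]] := amu mh h0.
  exists C'^-1; first by rewrite invr_gt0.
  under [X in (_ <= _ * X)%E]eq_integral do rewrite /= mulr1.
  have := lee_wpmul2l _ hC'; move=> /(_ (C'^-1)%:E).
  by rewrite lee_fin invr_ge0 (ltW C'0) muleA -EFinM mulVf ?lt0r_neq0// mul1e; apply.
exists D^-1, C; split => //; first by rewrite invr_gt0.
move=> h mh h0; split; last first.
  by have := hC h mh h0; under eq_integral do rewrite /= mulr1.
have := hD h mh h0; under [X in (_ <= _ * X)%E]eq_integral do rewrite /= mulr1.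
move=> /(lee_wpmul2l _) => /(_ (D^-1)%:E).
rewrite [X in (_ -> (_ <= X)%E) -> _]muleA -EFinM mulVf ?lt0r_neq0// mul1e; apply.
by rewrite lee_fin invr_ge0 ltW.
Qed.

(** On each ball the tempered weight is bounded below, so balls have finite mass. This is what the
    exchanges of integrals over frequency and time require. *)
Lemma tempered_sigma_finite : sigma_finite setT mu.
Proof.
have [l l0 fl] := tmu.
exists (fun k => [set xi : n.-tuple R | enorm xi <= k%:R]).
  apply/esym; rewrite -subTset => xi _; exists (Num.trunc (enorm xi)).+1 => //=.
  exact: ltW (truncnS_gt _).
move=> k.
have mk : measurable [set xi : n.-tuple R | enorm xi <= k%:R].
  rewrite -[X in measurable X]setTI.
  have := @measurable_enorm R n measurableT _ (measurable_itv `]-oo, k%:R]).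
  by congr measurable; apply/seteqP; split => xi /=; rewrite in_itv.
split => //.
pose c : R := (1 + k%:R ^+ 2) `^ l.
have c0 : 0 < c by rewrite powR_gt0// ltr_pwDl// sqr_ge0.
rewrite -[X in mu X]setIT -integral_indic//.
apply: (@le_lt_trans _ _ (\int[mu]_xi (c * (1 + enorm xi ^+ 2) `^ (- l))%:E)%E).
  apply: ge0_le_integral => //.
  - by apply/measurable_EFinP; exact: measurable_indic.
  - apply/measurable_EFinP; apply: measurable_funM => //.
    apply: (measurableT_comp (@measurable_powR _ _)); apply: measurable_funD => //.
    by apply: measurable_funX; exact: measurable_enorm.
  - move=> xi _; rewrite lee_fin indicE; have [/[!inE]/= xk|_] := boolP (_ \in _); last first.
      by rewrite mulr_ge0 ?powR_ge0.
    have p0 : 0 < 1 + enorm xi ^+ 2 by rewrite ltr_pwDl// sqr_ge0.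
    rewrite powRN /c ler_pdivlMr ?powR_gt0// mul1r; apply: ge0_ler_powR.
    + exact: ltW.
    + by rewrite nnegrE ltW.
    + by rewrite nnegrE addr_ge0// sqr_ge0.
    + by rewrite lerD2l lerXn2r// nnegrE// sqrtr_ge0.
rewrite ge0_integralZl_real//.
- by apply: lte_mul_pinfty => //; rewrite lee_fin ltW.
- exact: ltW.
- apply: (measurableT_comp (@measurable_powR _ _)); apply: measurable_funD => //.
  by apply: measurable_funX; exact: measurable_enorm.
- by move=> xi; exact: powR_ge0.
Qed.

(** Test the upper bound with the indicator of the origin: [powR] gives [0^(-alpha) = 0], so the
    right-hand integral vanishes. *)
Lemma spectral_enorm0 : mu [set xi : n.-tuple R | enorm xi = 0] = 0%E.
Proof.
have mN := measurable_enorm0.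
have [C' [C [_ _ _]]] := amu (@measurable_indic _ _ R setT _ mN) (fun xi => ler0n _ _).
rewrite integral_indic// setIT.
rewrite [X in (_ <= _ * X)%E](_ : _ = 0)%E; last first.
  apply: integral0_eq => xi _; congr EFin; rewrite indicE.
  have [/[!inE]/= ->|_] := boolP (_ \in _); last by rewrite mul0r.
  by rewrite powR0 ?mulr0// oppr_eq0 lt0r_neq0.
by rewrite mule0 => h; apply/eqP; rewrite eq_le h measure_ge0.
Qed.

Lemma spectral_expR_bounds : exists c C : R, [/\ 0 < c, 0 < C & forall w : R, 0 < w ->
   ((c * w `^ (- beta))%:E <= \int[mu]_xi (expR (- (w * freq xi)))%:E)%E /\
   (\int[mu]_xi (expR (- (w * freq xi)))%:E <= (C * w `^ (- beta))%:E)%E].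
Proof.
have [c [C [c0 C0 h]]] := asymp_power_uniform.
exists (c * pow_const), (C * pow_const); split; [exact: mulr_gt0 pow_const_gt0|exact: mulr_gt0 pow_const_gt0|].
move=> w w0; have := h _ (measurable_expR_freq w) (fun xi => expR_ge0 _).
by rewrite integral_expR_pow// -!EFinM !mulrA.
Qed.

Lemma spectral_resolvent_le (q : R) : beta < q -> exists2 C : R, 0 < C & forall h : R, 0 < h ->
   (\int[mu]_xi ((freq xi + h^-1) `^ (- q))%:E <= (C * h `^ (q - beta))%:E)%E.
Proof.
move=> bq.
have b0 : 0 < beta by rewrite divr_gt0// subr_gt0.
have q0 : 0 < q by apply: lt_trans bq.
have [c [C [c0 C0 hC]]] := asymp_power_uniform.
exists (C * (pow_const * Gamma (q - beta) / Gamma q)).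
  apply: mulr_gt0 => //; apply: mulr_gt0; last by rewrite invr_gt0 Gamma_gt0.
  by apply: mulr_gt0; [exact: pow_const_gt0|rewrite Gamma_gt0// subr_gt0].
move=> h h0.
have mres : measurable_fun setT (fun xi : n.-tuple R => (freq xi + h^-1) `^ (- q)).
  apply: (measurableT_comp (@measurable_powR _ _)); apply: measurable_funD => //; exact: measurable_freq.
have [_] := hC _ mres (fun xi => powR_ge0 _ _).
by rewrite integral_resolvent_pow// -EFinM !mulrA.
Qed.

End spectral.

End power_weight.

(** * Fractional covariances of Ornstein-Uhlenbeck kernels *)

Section kernel.
Context {R : realType}.
Variable kappa : R.
Hypotheses (k0 : 0 < kappa) (k1 : kappa < 1).
Local Notation leb := (@lebesgue_measure R).
Implicit Types phi psi : R -> R.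

(** The fractional kernel [|x|^(-kappa)], used with [kappa = 2 - 2 H] and written exactly as in
    [wiener_integrable]; its value at 0 is 0 for [kappa > 0]. *)
Definition hker (x : R) : R := (`|x| `^ kappa)^-1.

Lemma hker_ge0 x : 0 <= hker x.
Proof. by rewrite /hker invr_ge0 powR_ge0. Qed.

Lemma hkerN x : hker (- x) = hker x.
Proof. by rewrite /hker normrN. Qed.

Lemma hker_le (x y : R) : x != 0 -> `|x| <= `|y| -> hker y <= hker x.
Proof.
move=> x0 xy; rewrite /hker lef_pV2 ?posrE ?powR_gt0 ?normr_gt0//.
  by apply: ge0_ler_powR; rewrite ?nnegrE// ltW.
by apply/eqP => y0; move: xy; rewrite y0 normr0 normr_le0 (negbTE x0).
Qed.

Lemma hker_le_pow (x d : R) : 0 < d -> d <= `|x| -> hker x <= d `^ (- kappa).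
Proof.
move=> d0 dx; rewrite powRN -[X in (X `^ _)^-1](gtr0_norm d0); apply: hker_le.
  exact: lt0r_neq0.
by rewrite gtr0_norm.
Qed.

Lemma measurable_hker d (T : measurableType d) (f : T -> R) :
  measurable_fun setT f -> measurable_fun setT (fun x => hker (f x)).
Proof.
move=> mf.
have -> : (fun x => hker (f x)) = (fun x => (`|f x| `^ (- kappa))).
  by apply/funext => x; rewrite /hker powRN.
apply: (measurableT_comp (@measurable_powR _ _)).
exact: (measurableT_comp (@normr_measurable R setT) mf).
Qed.

(** The Gamma term counts the two one-sided neighbourhoods of the singularity, the 1 the far
    region. *)
Definition kconst : R := 2 * expR 1 * Gamma (1 - kappa) + 1.

Lemma kconst_gt0 : 0 < kconst.
Proof. by rewrite /kconst addr_gt0// !mulr_gt0 ?expR_gt0// Gamma_gt0// subr_gt0. Qed.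

(* Splitting at distance [m] from [r]: near [r] the kernel is integrable, away
   from [r] it is at most [m^-kappa]. *)
Lemma hker_convolution_le psi (m r : R) : 0 < m ->
  measurable_fun setT psi -> (forall v, 0 <= psi v <= 1) ->
  (\int[leb]_v (psi v)%:E <= m%:E)%E ->
  (\int[leb]_v (hker (r - v) * psi v)%:E <= (kconst * m `^ (1 - kappa))%:E)%E.
Proof.
move=> m0 mpsi psi01 intpsi.
have psi0 v : 0 <= psi v by have /andP[] := psi01 v.
have psi1 v : psi v <= 1 by have /andP[] := psi01 v.
(* The factor [exp (1 - w / m)] is at least 1 on []0, m]], so [g] dominates the kernel there and its
   integral over the whole line is explicit. *)
pose g (w : R) := expR 1 * gamma_integrand (1 - kappa) m^-1 w.
have g0 w : 0 <= g w by rewrite mulr_ge0 ?expR_ge0 ?gamma_integrand_ge0.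
have mg : measurable_fun setT g by apply: measurable_funM => //; exact: measurable_gamma_integrand.
have near (w : R) : 0 < w -> w <= m -> hker w <= g w.
  move=> w0 wm; rewrite /hker gtr0_norm// /g gamma_integrandE// -powRN.
  rewrite (_ : 1 - kappa - 1 = - kappa); last by ring.
  rewrite mulrCA ler_peMr ?powR_ge0// -expRD -[leLHS]expR0 ler_expR subr_ge0.
  by rewrite mulrC ler_pdivrMr// mul1r.
apply: (@le_trans _ _ (\int[leb]_v ((g (r - v))%:E + (g (v - r))%:E + (m `^ (- kappa) * psi v)%:E))%E).
  apply: ge0_le_integral => //.
  - by move=> v _; rewrite lee_fin mulr_ge0 ?hker_ge0.
  - apply/measurable_EFinP; apply: measurable_funM => //; apply: measurable_hker.
    exact: measurable_funB.
  - apply: emeasurable_funD; last by apply/measurable_EFinP; exact: measurable_funM.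
    apply: emeasurable_funD; apply/measurable_EFinP; apply: (measurableT_comp mg);
      exact: measurable_funB.
  - move=> v _; rewrite -!EFinD lee_fin.
    have p0 : 0 <= m `^ (- kappa) * psi v by rewrite mulr_ge0 ?powR_ge0.
    have [rv|rv] := leP `|r - v| m.
      have h1 : hker (r - v) * psi v <= hker (r - v) by rewrite ler_piMr ?hker_ge0.
      have h2 : hker (r - v) <= g (r - v) + g (v - r).
        have [vr|vr|->] := ltgtP v r.
        + have w0 : 0 < r - v by rewrite subr_gt0.
          by move: rv; rewrite gtr0_norm// => /(near _ w0) h; apply: le_trans h _; rewrite lerDl.
        + have w0 : 0 < v - r by rewrite subr_gt0.
          move: rv; rewrite distrC gtr0_norm// => /(near _ w0) h.
          by rewrite -hkerN opprB; apply: le_trans h _; rewrite lerDr.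
        + by rewrite subrr /hker normr0 powR0 ?lt0r_neq0// invr0 addr_ge0.
      by apply: le_trans h1 (le_trans h2 _); rewrite lerDl.
    have h : hker (r - v) * psi v <= m `^ (- kappa) * psi v.
      by rewrite ler_wpM2r//; apply: hker_le_pow => //; exact: ltW.
    by apply: le_trans h _; rewrite lerDr addr_ge0.
have mi : 0 < m^-1 by rewrite invr_gt0.
have ig : (\int[leb]_w (g w)%:E = (expR 1 * Gamma (1 - kappa) * m `^ (1 - kappa))%:E)%E.
  rewrite ge0_integralZl_real ?expR_ge0//; last 2 first.
  - exact: measurable_gamma_integrand.
  - by move=> w; exact: gamma_integrand_ge0.
  rewrite integral_gamma ?subr_gt0// -EFinM -mulrA; congr (_ * (_ * _))%:E.
  by rewrite -[m^-1]powR_inv1 ?ltW// -powRrM mulN1r opprK.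
rewrite ge0_integralD//; first last.
- by apply/measurable_EFinP; exact: measurable_funM.
- by move=> v _; rewrite lee_fin mulr_ge0 ?powR_ge0.
- by apply: emeasurable_funD; apply/measurable_EFinP; apply: (measurableT_comp mg); exact: measurable_funB.
- by move=> v _; rewrite -EFinD lee_fin addr_ge0.
rewrite ge0_integralD//; first last.
- by apply/measurable_EFinP; apply: (measurableT_comp mg); exact: measurable_funB.
- by move=> v _; rewrite lee_fin.
- by apply/measurable_EFinP; apply: (measurableT_comp mg); exact: measurable_funB.
- by move=> v _; rewrite lee_fin.
have mgE : measurable_fun setT (fun w => (g w)%:E) by exact/measurable_EFinP.
have gE0 w : (0 <= (g w)%:E)%E by rewrite lee_fin.
have -> : (\int[leb]_v (g (r - v))%:E = \int[leb]_v (g v)%:E)%E.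
  exact: (ge0_integral_reflect r mgE gE0).
have -> : (\int[leb]_v (g (v - r))%:E = \int[leb]_v (g v)%:E)%E.
  exact: (ge0_integral_shift (- r) mgE gE0).
rewrite ig ge0_integralZl_real ?powR_ge0//.
apply: (@le_trans _ _ ((expR 1 * Gamma (1 - kappa) * m `^ (1 - kappa))%:E +
   (expR 1 * Gamma (1 - kappa) * m `^ (1 - kappa))%:E + ((m `^ (- kappa))%:E * m%:E))%E).
  by rewrite leeD2l// lee_wpmul2l// lee_fin powR_ge0.
rewrite -EFinM -!EFinD lee_fin /kconst.
have -> : m `^ (- kappa) * m = m `^ (1 - kappa).
  rewrite -{2}(powRr1 (ltW m0)) -powRD ?lt0r_neq0 ?implybT//; congr powR; ring.
lra.
Qed.

Definition kform phi psi : \bar R :=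
  (\int[leb]_r \int[leb]_v (hker (r - v) * (phi r * psi v))%:E)%E.

Lemma measurable_kform phi psi : measurable_fun setT phi -> measurable_fun setT psi ->
  measurable_fun setT (fun p : R * R => hker (p.1 - p.2) * (phi p.1 * psi p.2)).
Proof.
move=> mphi mpsi; apply: measurable_funM.
  by apply: measurable_hker; apply: measurable_funB.
by apply: measurable_funM; exact: (measurableT_comp (f := _)).
Qed.

Lemma measurable_kform_inner phi psi :
  measurable_fun setT phi -> measurable_fun setT psi ->
  (forall x, 0 <= phi x) -> (forall x, 0 <= psi x) ->
  measurable_fun setT (fun r : measurableTypeR R =>
    (\int[leb]_v (hker (r - v) * (phi r * psi v))%:E)%E).
Proof.
move=> mp mq p0 q0.
apply: (@measurable_int2 R _ _ (measurableTypeR R) _ leb (fun r v => hker (r - v) * (phi r * psi v))).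
  exact: measurable_kform.
by move=> r v; rewrite !mulr_ge0 ?hker_ge0.
Qed.

Lemma kform_ge0 phi psi : (forall x, 0 <= phi x) -> (forall x, 0 <= psi x) -> (0 <= kform phi psi)%E.
Proof.
move=> p0 q0; apply: integral_ge0 => r _; apply: integral_ge0 => v _.
by rewrite lee_fin !mulr_ge0 ?hker_ge0.
Qed.

Lemma kformC phi psi : measurable_fun setT phi -> measurable_fun setT psi ->
  (forall x, 0 <= phi x) -> (forall x, 0 <= psi x) -> kform phi psi = kform psi phi.
Proof.
move=> mp mq p0 q0; rewrite /kform.
rewrite (@tonelli _ _ _ _ _ leb leb (fun r v => hker (r - v) * (phi r * psi v))).
- apply: eq_integral => v _; apply: eq_integral => r _.
  by rewrite -hkerN opprB [phi r * _]mulrC.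
- exact: measurable_kform.
- by move=> r v; rewrite !mulr_ge0 ?hker_ge0.
Qed.

Lemma kformDl phi phi' psi : measurable_fun setT phi -> measurable_fun setT phi' ->
  measurable_fun setT psi ->
  (forall x, 0 <= phi x) -> (forall x, 0 <= phi' x) -> (forall x, 0 <= psi x) ->
  kform (fun x => phi x + phi' x) psi = (kform phi psi + kform phi' psi)%E.
Proof.
move=> mp mp' mq p0 p'0 q0; rewrite /kform.
have mf (f : R -> R) : measurable_fun setT f -> forall r : R, measurable_fun setT (fun v : R => hker (r - v) * (f r * psi v)).
  move=> m r; apply: measurable_funM; last exact: measurable_funM.
  by apply: measurable_hker; exact: measurable_funB.
rewrite -ge0_integralD//; first last.
- exact: measurable_kform_inner.
- by move=> r _; apply: integral_ge0 => v _; rewrite lee_fin !mulr_ge0 ?hker_ge0.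
- exact: measurable_kform_inner.
- by move=> r _; apply: integral_ge0 => v _; rewrite lee_fin !mulr_ge0 ?hker_ge0.
apply: eq_integral => r _; rewrite -ge0_integralD//; first last.
- apply/measurable_EFinP; exact: mf.
- by move=> v _; rewrite lee_fin !mulr_ge0 ?hker_ge0.
- apply/measurable_EFinP; exact: mf.
- by move=> v _; rewrite lee_fin !mulr_ge0 ?hker_ge0.
by apply: eq_integral => v _; rewrite -EFinD; congr EFin; ring.
Qed.

Lemma kformZl c phi psi : 0 <= c -> measurable_fun setT phi ->
  measurable_fun setT psi -> (forall x, 0 <= phi x) -> (forall x, 0 <= psi x) ->
  kform (fun x => c * phi x) psi = (c%:E * kform phi psi)%E.
Proof.
move=> c0 mp mq p0 q0; rewrite /kform -ge0_integralZl//; first last.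
- by move=> r _; apply: integral_ge0 => v _; rewrite lee_fin !mulr_ge0 ?hker_ge0.
- exact: measurable_kform_inner.
apply: eq_integral => r _; rewrite -ge0_integralZl_real//.
- by apply: eq_integral => v _; congr EFin; ring.
- apply: measurable_funM; last exact: measurable_funM.
  by apply: measurable_hker; exact: measurable_funB.
- by move=> v; rewrite !mulr_ge0 ?hker_ge0.
Qed.

Lemma le_kform phi psi phi' psi' :
  measurable_fun setT phi -> measurable_fun setT psi ->
  measurable_fun setT phi' -> measurable_fun setT psi' ->
  (forall x, 0 <= phi x <= phi' x) -> (forall x, 0 <= psi x <= psi' x) ->
  (kform phi psi <= kform phi' psi')%E.
Proof.
move=> mp mq mp' mq' pp qq.
have p0 x : 0 <= phi x by have /andP[] := pp x.
have q0 x : 0 <= psi x by have /andP[] := qq x.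
have p1 x : phi x <= phi' x by have /andP[] := pp x.
have q1 x : psi x <= psi' x by have /andP[] := qq x.
have p'0 x : 0 <= phi' x by apply: le_trans (p1 x).
have q'0 x : 0 <= psi' x by apply: le_trans (q1 x).
apply: ge0_le_integral => //.
- by move=> r _; apply: integral_ge0 => v _; rewrite lee_fin !mulr_ge0 ?hker_ge0.
- exact: measurable_kform_inner.
- exact: measurable_kform_inner.
- move=> r _; apply: ge0_le_integral => //.
  + by move=> v _; rewrite lee_fin !mulr_ge0 ?hker_ge0.
  + apply/measurable_EFinP; apply: measurable_funM; last exact: measurable_funM.
    by apply: measurable_hker; exact: measurable_funB.
  + apply/measurable_EFinP; apply: measurable_funM; last exact: measurable_funM.
    by apply: measurable_hker; exact: measurable_funB.
  + by move=> v _; rewrite lee_fin ler_wpM2l ?hker_ge0// ler_pM.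
Qed.

Lemma kform_le phi psi (m : R) : 0 < m ->
  measurable_fun setT phi -> measurable_fun setT psi ->
  (forall v, 0 <= phi v) -> (forall v, 0 <= psi v <= 1) ->
  (\int[leb]_v (phi v)%:E <= m%:E)%E -> (\int[leb]_v (psi v)%:E <= m%:E)%E ->
  (kform phi psi <= (kconst * m `^ (2 - kappa))%:E)%E.
Proof.
move=> m0 mp mq p0 q01 ip iq.
have q0 x : 0 <= psi x by have /andP[] := q01 x.
have kc := kconst_gt0.
apply: (@le_trans _ _ (\int[leb]_r ((kconst * m `^ (1 - kappa)) * phi r)%:E)%E).
  apply: ge0_le_integral => //.
  - by move=> r _; apply: integral_ge0 => v _; rewrite lee_fin !mulr_ge0 ?hker_ge0.
  - exact: measurable_kform_inner.
  - by apply/measurable_EFinP; exact: measurable_funM.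
  move=> r _; under eq_integral do rewrite mulrCA.
  rewrite ge0_integralZl_real//; last 2 first.
  - by apply: measurable_funM => //; apply: measurable_hker; exact: measurable_funB.
  - by move=> v; rewrite mulr_ge0 ?hker_ge0.
  rewrite EFinM muleC lee_wpmul2r ?lee_fin//.
  exact: hker_convolution_le.
rewrite ge0_integralZl_real//; last by rewrite mulr_ge0 ?powR_ge0 ?ltW.
apply: (@le_trans _ _ ((kconst * m `^ (1 - kappa))%:E * m%:E)%E).
  by rewrite lee_wpmul2l// lee_fin mulr_ge0 ?powR_ge0 ?ltW.
rewrite -EFinM lee_fin -mulrA; apply: ler_wpM2l; first exact: ltW.
rewrite -{2}(powRr1 (ltW m0)) -powRD ?lt0r_neq0 ?implybT//.
by rewrite (_ : 1 - kappa + 1 = 2 - kappa)//; ring.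
Qed.

End kernel.

Section ou.
Context {R : realType}.
Variables kappa lam : R.
Hypotheses (k0 : 0 < kappa) (k1 : kappa < 1) (l0 : 0 < lam).
Local Notation leb := (@lebesgue_measure R).
Local Notation kf := (kform kappa).
Local Notation kconst := (kconst kappa).
Implicit Types phi psi : R -> R.

(** The height bound and the mass bound that together give an energy of order [M^(2 - kappa)] for
    the singular form. *)
Definition bounded_profile (M : R) phi :=
  [/\ measurable_fun setT phi, forall v, 0 <= phi v <= 1 & (\int[leb]_v (phi v)%:E <= M%:E)%E].

Lemma bounded_profile_ge0 M phi : bounded_profile M phi -> forall v, 0 <= phi v.
Proof. by move=> [_ + _] v => /(_ v)/andP[]. Qed.

Lemma kform_profile_le M phi psi : 0 < M -> bounded_profile M phi -> bounded_profile M psi ->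
  (kf phi psi <= (kconst * M `^ (2 - kappa))%:E)%E.
Proof.
move=> M0 pp qq; have p0 := bounded_profile_ge0 pp.
by case: pp => mp _ ip; case: qq => mq q01 iq; exact: kform_le.
Qed.

Lemma kform_fin_num M phi psi : 0 < M -> bounded_profile M phi -> bounded_profile M psi ->
  kf phi psi \is a fin_num.
Proof.
move=> M0 pp qq; rewrite ge0_fin_numE; last first.
  by apply: kform_ge0; [exact: bounded_profile_ge0 pp|exact: bounded_profile_ge0 qq].
exact: le_lt_trans (kform_profile_le M0 pp qq) (ltry _).
Qed.

Lemma fine_kformDZ M c phi phi' psi : 0 < M -> 0 <= c ->
  bounded_profile M phi -> bounded_profile M phi' -> bounded_profile M psi ->
  fine (kf (fun x => phi x + c * phi' x) psi) = fine (kf phi psi) + c * fine (kf phi' psi).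
Proof.
move=> M0 c0 pp pp' qq.
have p0 := bounded_profile_ge0 pp; have p'0 := bounded_profile_ge0 pp'.
have q0 := bounded_profile_ge0 qq.
have f1 := kform_fin_num M0 pp qq; have f2 := kform_fin_num M0 pp' qq.
case: pp pp' qq => mp _ _ [mp' _ _] [mq _ _].
rewrite kformDl//; last 2 first.
- exact: measurable_funM.
- by move=> x; rewrite mulr_ge0.
rewrite (kformZl _ c0 mp' mq p'0 q0) fineD//; first by rewrite fineM.
by rewrite fin_numM.
Qed.

Lemma fine_kformC phi psi M : bounded_profile M phi -> bounded_profile M psi ->
  fine (kf phi psi) = fine (kf psi phi).
Proof.
move=> pp qq; have p0 := bounded_profile_ge0 pp; have q0 := bounded_profile_ge0 qq.
by case: pp qq => mp _ _ [mq _ _]; rewrite kformC.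
Qed.

Lemma fine_kform_ge0 M phi psi : bounded_profile M phi -> bounded_profile M psi ->
  0 <= fine (kf phi psi).
Proof.
by move=> pp qq; rewrite fine_ge0// kform_ge0//; [exact: bounded_profile_ge0 pp|exact: bounded_profile_ge0 qq].
Qed.

Lemma kform_far D phi psi M : 0 < D -> 0 < M -> bounded_profile M phi -> bounded_profile M psi ->
  (forall r v, phi r * psi v != 0 -> D <= `|r - v|) ->
  (kf phi psi <= (D `^ (- kappa) * (M * M))%:E)%E.
Proof.
move=> D0 M0 pp qq far.
have p0 := bounded_profile_ge0 pp; have q0 := bounded_profile_ge0 qq.
case: pp qq => mp _ ip [mq _ iq].
have mD : 0 <= D `^ (- kappa) by exact: powR_ge0.
apply: (@le_trans _ _ (\int[leb]_r ((D `^ (- kappa) * M) * phi r)%:E)%E).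
  apply: ge0_le_integral => //.
  - by move=> r _; apply: integral_ge0 => v _; rewrite lee_fin !mulr_ge0 ?hker_ge0.
  - exact: measurable_kform_inner.
  - by apply/measurable_EFinP; exact: measurable_funM.
  move=> r _; apply: (@le_trans _ _ (\int[leb]_v (D `^ (- kappa) * phi r * psi v)%:E)%E).
    apply: ge0_le_integral => //.
    + by move=> v _; rewrite lee_fin !mulr_ge0 ?hker_ge0.
    + apply/measurable_EFinP; apply: measurable_funM; last exact: measurable_funM.
      by apply: measurable_hker; exact: measurable_funB.
    + by apply/measurable_EFinP; exact: measurable_funM.
    + move=> v _; rewrite lee_fin -mulrA.
      have [->|nz] := eqVneq (phi r * psi v) 0; first by rewrite !mulr0.
      rewrite ler_wpM2r ?mulr_ge0//; apply: hker_le_pow => //; exact: far.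
  rewrite ge0_integralZl_real ?mulr_ge0// mulrAC [in leRHS]EFinM.
  by rewrite lee_wpmul2l// ?lee_fin// mulr_ge0.
rewrite ge0_integralZl_real//; last by rewrite mulr_ge0// ltW.
rewrite mulrA [in leRHS]EFinM.
by rewrite lee_wpmul2l// lee_fin mulr_ge0// ltW.
Qed.

Local Notation ou := (ou_kernel lam).

Lemma ou_kernelE t s : ou t s = if (0 <= s) && (s < t) then expR (- (lam * (t - s))) else 0.
Proof.
rewrite /ou_kernel indicE; have [/[!inE]/=|/negP] := boolP (s \in `[0, t[%classic).
  by rewrite in_itv/= => ->; rewrite mul1r.
by rewrite inE/= in_itv/= => /negP/negbTE ->; rewrite mul0r.
Qed.

Lemma measurable_ou t : measurable_fun setT (ou t).
Proof.
apply: measurable_funM; first by apply: measurable_indic; exact: measurable_itv.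
apply: (measurableT_comp (@measurable_expR _)); apply: measurable_funN.
by apply: measurable_funM => //; exact: measurable_funB.
Qed.

Lemma ou_itv t s : 0 <= ou t s <= 1.
Proof.
rewrite ou_kernelE; case: ifPn => [/andP[s0 st]|_]; last by rewrite lexx ler01.
rewrite expR_ge0 -expR0 ler_expR oppr_le0 mulr_ge0 ?ltW//.
by rewrite subr_gt0.
Qed.

Definition ou_slice (a t s : R) : R := \1_`[a, +oo[ s * ou t s.

Lemma ou_sliceE a t s : 0 <= a -> ou_slice a t s = if (a <= s) && (s < t) then expR (- (lam * (t - s))) else 0.
Proof.
move=> a0; rewrite /ou_slice indicE ou_kernelE.
have [/[!inE]/=|/negP] := boolP (s \in `[a, +oo[%classic).
  by rewrite in_itv/= andbT => as_; rewrite as_ (le_trans a0 as_) mul1r.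
by rewrite inE/= in_itv/= andbT => /negP/negbTE ->; rewrite mul0r.
Qed.

Lemma ou_slice0 t : ou_slice 0 t = ou t.
Proof. by apply/funext => s; rewrite ou_sliceE// ou_kernelE. Qed.

Lemma measurable_ou_slice a t : measurable_fun setT (ou_slice a t).
Proof.
apply: measurable_funM; last exact: measurable_ou.
by apply: measurable_indic; exact: measurable_itv.
Qed.

Lemma ou_slice_itv a t s : 0 <= ou_slice a t s <= 1.
Proof.
have /andP[h0 h1] := ou_itv t s; rewrite /ou_slice indicE.
by case: (_ \in _); rewrite ?mul1r ?mul0r ?h0 ?h1 ?lexx ?ler01.
Qed.

Lemma integral_ou_slice_le a t : 0 <= a ->
  (\int[leb]_s (ou_slice a t s)%:E <= (lam^-1)%:E)%E.
Proof.
move=> a0.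
pose g w := \1_`]0, +oo[ w * expR (- (lam * w)) : R.
have mg : measurable_fun setT (fun w => (g w)%:E).
  apply/measurable_EFinP; apply: measurable_funM.
    by apply: measurable_indic; exact: measurable_itv.
  apply: (measurableT_comp (@measurable_expR _)); apply: measurable_funN.
  by apply: measurable_funM.
have g0 w : (0 <= (g w)%:E)%E by rewrite lee_fin mulr_ge0 ?expR_ge0.
apply: le_trans (integral_expRN_le l0).
rewrite -/(g _) -[leRHS](ge0_integral_reflect t mg g0).
apply: ge0_le_integral => //.
- by move=> s _; rewrite lee_fin; have /andP[] := ou_slice_itv a t s.
- by apply/measurable_EFinP; exact: measurable_ou_slice.
- by apply: (measurableT_comp mg); exact: measurable_funB.
- move=> s _; rewrite lee_fin ou_sliceE// /g indicE.
  case: ifPn => [/andP[_ st]|_]; last by rewrite mulr_ge0 ?expR_ge0.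
  by rewrite mem_set ?mul1r//= in_itv/= subr_gt0 st.
Qed.

Lemma integral_ou_slice_le_len a t : 0 <= a -> a <= t ->
  (\int[leb]_s (ou_slice a t s)%:E <= (t - a)%:E)%E.
Proof.
move=> a0 at_.
apply: (@le_trans _ _ (\int[leb]_s (\1_`[a, t] s)%:E)%E).
  apply: ge0_le_integral => //.
  - by move=> s _; rewrite lee_fin; have /andP[] := ou_slice_itv a t s.
  - by apply/measurable_EFinP; exact: measurable_ou_slice.
  - by apply/measurable_EFinP; apply: measurable_indic; exact: measurable_itv.
  - move=> s _; rewrite lee_fin indicE.
    have [|/negP] := boolP (s \in `[a, t]%classic).
      by move=> _; have /andP[] := ou_slice_itv a t s.
    rewrite inE/= in_itv/= ou_sliceE// => /negP; case: ifPn => // /andP[as_ st].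
    by rewrite as_ ltW.
rewrite integral_indic// setIT.
rewrite [X in (X <= _)%E](_ : _ = lebesgue_measure `[a, t])// lebesgue_measure_itv/= lte_fin.
by case: ifPn => // _; rewrite lee_fin subr_ge0.
Qed.

Lemma ou_slice_profile a t : 0 <= a -> bounded_profile lam^-1 (ou_slice a t).
Proof.
move=> a0; split; [exact: measurable_ou_slice|exact: ou_slice_itv|].
exact: integral_ou_slice_le.
Qed.

Lemma ou_profile t : bounded_profile lam^-1 (ou t).
Proof. by rewrite -ou_slice0; exact: ou_slice_profile. Qed.

Lemma ou_slice_profile_min t h : 0 <= t -> 0 < h ->
  bounded_profile (Num.min h lam^-1) (ou_slice t (t + h)).
Proof.
move=> t0 h0; split; [exact: measurable_ou_slice|exact: ou_slice_itv|].
rewrite /Num.min; case: ifPn => _; last exact: integral_ou_slice_le.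
have := @integral_ou_slice_le_len t (t + h) t0; rewrite addrAC subrr add0r; apply.
by rewrite lerDl ltW.
Qed.

(** The flow property: at time [t + h] the process keeps [exp (- lam h)] times its value at [t] and
    adds the fresh noise of [[t, t + h[]. All upper bounds on increments start here. *)
Lemma ou_split t h : 0 <= t -> 0 < h ->
  ou (t + h) = (fun s => ou_slice t (t + h) s + expR (- (lam * h)) * ou t s).
Proof.
move=> t0 h0; apply/funext => s; rewrite ou_sliceE// !ou_kernelE.
have [st|st] := ltP s t.
  have -> : s < t + h by rewrite (lt_trans st)// ltrDl.
  rewrite !andbT /= add0r; case: ifPn => _; last by rewrite mulr0.
  by rewrite -expRD; congr expR; ring.
by rewrite (le_trans t0 st) /= mulr0 addr0.
Qed.

Definition ou_cov t s : R := fine (kf (ou t) (ou s)).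

Lemma inv_rate_gt0 : 0 < lam^-1. Proof. by rewrite invr_gt0. Qed.

Lemma ou_cov_ge0 t s : 0 <= ou_cov t s.
Proof. exact: fine_kform_ge0 (ou_profile t) (ou_profile s). Qed.

Lemma one_minus_expR_le h : 0 < h -> 0 <= 1 - expR (- (lam * h)) <= lam * Num.min h lam^-1.
Proof.
move=> h0; have lh : 0 < lam * h by rewrite mulr_gt0.
rewrite subr_ge0 -{1}expR0 ler_expR oppr_le0 (ltW lh)/=.
rewrite /Num.min; case: ifPn => _.
  have := expR_ge1Dx (- (lam * h)); lra.
by rewrite divff ?lt0r_neq0// lerBlDr lerDl expR_ge0.
Qed.

(** With [y = lam * min (h, 1 / lam) <= 1] the claim becomes [(1 - exp (- lam h))^2 <= y^2 <= y^(2 -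
    kappa)]. *)
Lemma min_pow_le h : 0 < h ->
  (1 - expR (- (lam * h))) ^+ 2 * lam^-1 `^ (2 - kappa) <= Num.min h lam^-1 `^ (2 - kappa).
Proof.
move=> h0; have /andP[e0 e1] := one_minus_expR_le h0.
set m := Num.min h lam^-1 in e1 *.
have m0 : 0 < m by rewrite /m lt_min h0 inv_rate_gt0.
have y1 : lam * m <= 1 by rewrite mulrC -ler_pdivlMr// mul1r /m ge_min lexx orbT.
have y0 : 0 < lam * m by rewrite mulr_gt0.
have -> : m `^ (2 - kappa) = (lam * m) `^ (2 - kappa) * lam^-1 `^ (2 - kappa).
  rewrite -powRM ?(ltW y0) ?(ltW inv_rate_gt0)//; congr powR; field; exact: lt0r_neq0.
rewrite ler_wpM2r ?powR_ge0//; apply: (@le_trans _ _ ((lam * m) ^+ 2)).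
  by rewrite lerXn2r// nnegrE// ltW.
rewrite -powR_mulrn ?(ltW y0)//; apply: ger_powR; first by rewrite y0 y1.
by rewrite gerBl ltW.
Qed.

(** Here [P] is the fresh slice, [a] the old kernel and [a' = P + k a]. The increment is
    [P - (1 - k) a]; its cross term is nonnegative, enters with a minus sign and is dropped. *)
Lemma increment_algebra (k D PP Pa' a'P aP Pa aa aa' a'a a'a' : R) :
  a'a' = Pa' + k * aa' -> Pa' = a'P -> a'P = PP + k * aP -> aa' = a'a ->
  a'a = Pa + k * aa -> aP = Pa -> 0 <= 1 - k -> 0 <= Pa -> PP <= D ->
  (1 - k) ^+ 2 * aa <= D -> a'a' + aa - 2 * a'a <= 2 * D.
Proof.
move=> -> -> -> -> -> -> k' P0 PD aD.
have : 0 <= (1 - k) * Pa by rewrite mulr_ge0.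
nra.
Qed.

(** The increments are [P - (1 - k) a] and [P' - (1 - k) b]; both mixed terms enter with a minus
    sign and are dropped. *)
Lemma far_increment_algebra (k D1 D2 PP Pb aP ab Pb' ab' a'b a'b' : R) :
  a'b' = Pb' + k * ab' -> a'b = Pb + k * ab -> Pb' = PP + k * Pb ->
  ab' = aP + k * ab -> 0 <= 1 - k -> 0 <= Pb -> 0 <= aP -> PP <= D1 ->
  (1 - k) ^+ 2 * ab <= D2 -> a'b' - a'b - ab' + ab <= D1 + D2.
Proof.
move=> -> -> -> -> k' P0 a0 PD aD.
have : 0 <= (1 - k) * Pb by rewrite mulr_ge0.
have : 0 <= (1 - k) * aP by rewrite mulr_ge0.
nra.
Qed.

Lemma ou_cov_increment_le t h : 0 <= t -> 0 < h ->
  ou_cov (t + h) (t + h) + ou_cov t t - 2 * ou_cov (t + h) t <=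
    2 * kconst * Num.min h lam^-1 `^ (2 - kappa).
Proof.
move=> t0 h0; have /andP[e0 e1] := one_minus_expR_le h0.
have m0 : 0 < Num.min h lam^-1 by rewrite lt_min h0 inv_rate_gt0.
have kc := kconst_gt0 k1.
set k := expR (- (lam * h)) in e0 e1 *.
have k'0 : 0 <= k by exact: expR_ge0.
pose P := ou_slice t (t + h).
have pP := ou_slice_profile (t + h) t0; have pA := ou_profile t.
have pP' := ou_slice_profile_min t0 h0.
have pA' := ou_profile (t + h).
(* The form is hidden behind [B], so that the algebra treats its values as atoms. *)
have [B BE] : {B : (R -> R) -> (R -> R) -> R | forall p q, B p q = fine (kf p q)}.
  by exists (fun p q => fine (kf p q)).
have BC p q : bounded_profile lam^-1 p -> bounded_profile lam^-1 q -> B p q = B q p.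
  by rewrite !BE; exact: fine_kformC.
have E (psi : R -> R) : bounded_profile lam^-1 psi -> B (ou (t + h)) psi = B P psi + k * B (ou t) psi.
  by move=> pq; rewrite !BE (ou_split t0 h0); exact: (fine_kformDZ inv_rate_gt0).
have PA0 : 0 <= B P (ou t) by rewrite BE; exact: (fine_kform_ge0 pP pA).
have AA0 : 0 <= B (ou t) (ou t) by rewrite BE; exact: (fine_kform_ge0 pA pA).
have PP : B P P <= kconst * Num.min h lam^-1 `^ (2 - kappa).
  by rewrite BE -lee_fin fineK ?(kform_fin_num inv_rate_gt0 pP pP)//; exact: kform_profile_le.
have AA : B (ou t) (ou t) <= kconst * lam^-1 `^ (2 - kappa).
  by rewrite BE -lee_fin fineK ?(kform_fin_num inv_rate_gt0 pA pA)//; apply: kform_profile_le => //; exact: inv_rate_gt0.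
have AA2 : (1 - k) ^+ 2 * B (ou t) (ou t) <= kconst * Num.min h lam^-1 `^ (2 - kappa).
  apply: (@le_trans _ _ ((1 - k) ^+ 2 * (kconst * lam^-1 `^ (2 - kappa)))).
    by rewrite ler_wpM2l// sqr_ge0.
  by rewrite mulrCA ler_wpM2l ?(ltW kc)//; exact: min_pow_le.
have BO x y : B (ou x) (ou y) = ou_cov x y by rewrite BE.
have q1 := E _ pA'; have q2 := BC _ _ pP pA'; have q3 := E _ pP.
have q4 := BC _ _ pA pA'; have q5 := E _ pA; have q6 := BC _ _ pA pP.
have := increment_algebra q1 q2 q3 q4 q5 q6 e0 PA0 PP AA2.
by rewrite (BO (t + h) (t + h)) (BO t t) (BO (t + h) t) mulrA.
Qed.

(** Since [kappa] lies between 0 and 1, [x^kappa <= 1 + x <= 2 exp (x / 2)]. *)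
Lemma expR_half_le (x : R) : 0 < x -> expR (- (x / 2)) <= 2 * x `^ (- kappa).
Proof.
move=> x0; rewrite powRN expRN ler_pdivlMr ?powR_gt0// mulrC.
rewrite -ler_pdivlMr ?invr_gt0 ?expR_gt0// invrK.
apply: (@le_trans _ _ (1 + x)).
  have [x1|x1] := leP x 1.
    apply: (@le_trans _ _ 1); last by rewrite lerDl ltW.
    have <- : 1 `^ kappa = 1 :> R by rewrite powR1.
    by apply: ge0_ler_powR; rewrite ?nnegrE// ltW.
  apply: (@le_trans _ _ x); last by rewrite lerDr.
  by rewrite -[leRHS](powRr1 (ltW x0)); apply: ler_powR; exact: ltW.
have := expR_ge1Dx (x / 2); lra.
Qed.

(** Cut the later kernel halfway, at [c = s + T / 2]. After [c] it stays at distance [T / 2] from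
    the support of the earlier kernel; before [c] it is damped by [exp (- lam T / 2)], which
    [expR_half_le] trades for [(lam T)^(-kappa)]. *)
Lemma ou_cov_far_le t s T : 0 <= s -> 0 < T -> s + T <= t ->
  ou_cov t s <= (2 + 2 * kconst) * T `^ (- kappa) * (lam^-1 * lam^-1).
Proof.
move=> s0 T0 sTt; have kc := kconst_gt0 k1; have l1 := inv_rate_gt0.
pose M := lam^-1; have M0 : 0 < M by exact: inv_rate_gt0.
pose c := s + T / 2; have c0 : 0 <= c by rewrite addr_ge0// divr_ge0// ltW.
pose e := expR (- (lam * T / 2)).
pose near r := \1_`]-oo, c[ r * ou t r.
have mnear : measurable_fun setT near.
  apply: measurable_funM; last exact: measurable_ou.
  by apply: measurable_indic; exact: measurable_itv.
have near_le r : 0 <= near r <= e * ou c r.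
  rewrite /near indicE; have [/[!inE]/=|_] := boolP (r \in `]-oo, c[%classic); last first.
    by rewrite mul0r lexx mulr_ge0 ?expR_ge0//; have /andP[] := ou_itv c r.
  rewrite in_itv/= mul1r => rc; have /andP[-> _] /= := ou_itv t r.
  rewrite !ou_kernelE rc andbT; case: ifPn => [/andP[-> rt]|]; last first.
    rewrite negb_and => /orP[/negbTE ->|]; first by rewrite mulr0.
    by rewrite -leNgt => tr; rewrite mulr_ge0 ?expR_ge0//; case: ifP.
  rewrite -expRD ler_expR -opprD lerN2.
  rewrite -mulrA -mulrDr; apply: ler_wpM2l; first exact: ltW.
  rewrite /c in rc *; lra.
have split : ou t = fun r => ou_slice c t r + 1 * near r.
  apply/funext => r; rewrite mul1r /ou_slice /near !indicE.
  have [rc|rc] := ltP r c.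
    rewrite memNset ?mul0r ?add0r; last by rewrite /= in_itv/= andbT; apply/negP; rewrite -ltNge.
    by rewrite mem_set ?mul1r//= in_itv.
  rewrite mem_set; last by rewrite /= in_itv/= rc.
  by rewrite memNset ?mul1r ?mul0r ?addr0//= in_itv/=; apply/negP; rewrite -leNgt.
have pnear : bounded_profile M near.
  have le1 r : near r <= ou t r.
    rewrite /near indicE; case: (_ \in _); rewrite ?mul1r ?mul0r//.
    by have /andP[] := ou_itv t r.
  split => //.
    move=> r; have /andP[-> _] /= := near_le r; apply: le_trans (le1 r) _.
    by have /andP[] := ou_itv t r.
  have [_ _ /(le_trans _)] := ou_profile t; apply.
  apply: ge0_le_integral => //.
  - by move=> r _; rewrite lee_fin; have /andP[] := near_le r.
  - exact/measurable_EFinP.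
  - by apply/measurable_EFinP; exact: measurable_ou.
  - by move=> r _; rewrite lee_fin.
have pc := ou_slice_profile t c0.
have ps := ou_profile s.
have E : ou_cov t s = fine (kf (ou_slice c t) (ou s)) + fine (kf near (ou s)).
  by rewrite -[X in _ + X]mul1r -(fine_kformDZ M0 ler01 pc pnear ps) -split.
have h1 : fine (kf (ou_slice c t) (ou s)) <= (T / 2) `^ (- kappa) * (M * M).
  rewrite -lee_fin fineK ?(kform_fin_num M0 pc ps)//; apply: kform_far => //; first by rewrite divr_gt0.
  move=> r v; rewrite ou_sliceE// ou_kernelE.
  case: ifPn => [/andP[cr rt]|]; last by rewrite mul0r eqxx.
  case: ifPn => [/andP[v0 vs] _|]; last by rewrite mulr0 eqxx.
  have cr' : s + T / 2 <= r := cr.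
  have h : T / 2 <= r - v by move: cr' vs; clear; lra.
  by apply: le_trans h (ler_norm _).
have h2 : fine (kf near (ou s)) <= e * (kconst * M `^ (2 - kappa)).
  rewrite -lee_fin fineK ?(kform_fin_num M0 pnear ps)//.
  apply: (@le_trans _ _ (kf (fun r => e * ou c r) (ou s))).
    apply: le_kform => //.
    - exact: measurable_ou.
    - by apply: measurable_funM => //; exact: measurable_ou.
    - exact: measurable_ou.
    - by move=> x; have /andP[->] := ou_itv s x; rewrite lexx.
  rewrite kformZl ?expR_ge0//; last 4 first.
  - exact: measurable_ou.
  - exact: measurable_ou.
  - exact: bounded_profile_ge0 (ou_profile c).
  - exact: bounded_profile_ge0 (ou_profile s).
  rewrite [leRHS]EFinM lee_wpmul2l ?lee_fin ?expR_ge0//.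
  exact: kform_profile_le (ou_profile c) (ou_profile s).
have h3 : e * (kconst * M `^ (2 - kappa)) <= 2 * kconst * T `^ (- kappa) * (M * M).
  have -> : M `^ (2 - kappa) = lam `^ kappa * (M * M).
    rewrite powRD; last by rewrite lt0r_neq0 ?implybT.
    rewrite mulrC; congr (_ * _); last by rewrite -expr2 -powR_mulrn ?ltW.
    by rewrite /M -powR_inv1 ?ltW// -powRrM mulrNN mul1r.
  have := @expR_half_le (lam * T) (mulr_gt0 l0 T0); rewrite -/e => he.
  have : e * lam `^ kappa <= 2 * T `^ (- kappa).
    apply: (@le_trans _ _ (2 * (lam * T) `^ (- kappa) * lam `^ kappa)).
      by rewrite ler_wpM2r ?powR_ge0.
    have lk : lam `^ (- kappa) * lam `^ kappa = 1.
      by rewrite -powRD ?lt0r_neq0 ?implybT// addNr powRr0.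
    rewrite powRM; [|exact: ltW..].
    by rewrite [X in 2 * X]mulrC -!mulrA lk mulr1.
  move=> h4; have MM : 0 <= M * M by rewrite mulr_ge0// ltW.
  have : kconst * (M * M) * (e * lam `^ kappa) <= kconst * (M * M) * (2 * T `^ (- kappa)).
    by rewrite ler_wpM2l// mulr_ge0// ltW.
  have -> : e * (kconst * (lam `^ kappa * (M * M))) = kconst * (M * M) * (e * lam `^ kappa) by ring.
  have -> // : 2 * kconst * T `^ (- kappa) * (M * M) = kconst * (M * M) * (2 * T `^ (- kappa)) by ring.
have h4 : (T / 2) `^ (- kappa) <= 2 * T `^ (- kappa).
  rewrite powRM ?invr_ge0 ?(ltW T0)// mulrC ler_wpM2r ?powR_ge0//.
  rewrite -[2^-1]powR_inv1// -powRrM mulrNN mul1r.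
  by rewrite -[leRHS](powRr1 (ler0n R 2)); apply: ler_powR; [rewrite ler1n|exact: ltW].
have h5 : (T / 2) `^ (- kappa) * (M * M) <= 2 * T `^ (- kappa) * (M * M).
  by rewrite ler_wpM2r// mulr_ge0// ltW.
rewrite E -/M (_ : (2 + _) * _ * _ = 2 * T `^ (- kappa) * (M * M) + 2 * kconst * T `^ (- kappa) * (M * M)); last by ring.
exact: lerD (le_trans h1 h5) (le_trans h2 h3).
Qed.

(** Because [2 h <= T], the two fresh slices are still [T / 2] apart. The other surviving term is
    [(1 - k)^2] times the covariance at distance [T], and [1 - k <= lam min (h, 1 / lam)] turns its
    factor [lam^(-2)] into the square of the minimum. *)
Lemma ou_cov_increments_far_le t s h T : 0 <= s -> 0 < h -> 2 * h <= T -> s + T <= t ->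
  ou_cov (t + h) (s + h) - ou_cov (t + h) s - ou_cov t (s + h) + ou_cov t s <=
    (4 + 2 * kconst) * T `^ (- kappa) * Num.min h lam^-1 ^+ 2.
Proof.
move=> s0 h0 hT sTt; have /andP[e0 e1] := one_minus_expR_le h0.
have T0 : 0 < T by lra.
have t0 : 0 <= t by lra.
have M0 := inv_rate_gt0.
have m0 : 0 < Num.min h lam^-1 by rewrite lt_min h0 inv_rate_gt0.
have kc := kconst_gt0 k1.
set k := expR (- (lam * h)) in e0 e1 *; set m := Num.min h lam^-1 in e1 m0 *.
have k'0 : 0 <= k by exact: expR_ge0.
pose P := ou_slice t (t + h); pose P' := ou_slice s (s + h).
have pP := ou_slice_profile (t + h) t0; have pA := ou_profile t.
have qP := ou_slice_profile (s + h) s0; have qA := ou_profile s.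
have pPm := ou_slice_profile_min t0 h0.
have qPm := ou_slice_profile_min s0 h0.
have pAh := ou_profile (t + h); have qAh := ou_profile (s + h).
have [B BE] : {B : (R -> R) -> (R -> R) -> R | forall p q, B p q = fine (kf p q)}.
  by exists (fun p q => fine (kf p q)).
have BC p q : bounded_profile lam^-1 p -> bounded_profile lam^-1 q -> B p q = B q p.
  by rewrite !BE; exact: fine_kformC.
have E (psi : R -> R) : bounded_profile lam^-1 psi -> B (ou (t + h)) psi = B P psi + k * B (ou t) psi.
  by move=> pq; rewrite !BE (ou_split t0 h0); exact: (fine_kformDZ inv_rate_gt0).
have E2 (psi : R -> R) : bounded_profile lam^-1 psi -> B (ou (s + h)) psi = B P' psi + k * B (ou s) psi.
  by move=> pq; rewrite !BE (ou_split s0 h0); exact: (fine_kformDZ inv_rate_gt0).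
have E' (psi : R -> R) : bounded_profile lam^-1 psi -> B psi (ou (s + h)) = B psi P' + k * B psi (ou s).
  by move=> pq; rewrite (BC psi _ pq qAh) (E2 _ pq) (BC P' _ qP pq) (BC _ psi qA pq).
have PP : B P P' <= 2 * T `^ (- kappa) * m ^+ 2.
  apply: (@le_trans _ _ ((T / 2) `^ (- kappa) * (m * m))).
    rewrite BE -lee_fin fineK ?(kform_fin_num inv_rate_gt0 pP qP)//; apply: kform_far => //; first by rewrite divr_gt0.
    move=> r v; rewrite /P /P' !ou_sliceE//.
    case: ifPn => [/andP[tr rt]|]; last by rewrite mul0r eqxx.
    case: ifPn => [/andP[sv vs] _|]; last by rewrite mulr0 eqxx.
    have hh : T / 2 <= r - v by move: tr vs sTt hT; clear; lra.
    by apply: le_trans hh (ler_norm _).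
  rewrite -expr2 ler_wpM2r ?sqr_ge0//.
  rewrite powRM ?invr_ge0 ?(ltW T0)// mulrC ler_wpM2r ?powR_ge0//.
  rewrite -[2^-1]powR_inv1// -powRrM mulrNN mul1r.
  by rewrite -[leRHS](powRr1 (ler0n R 2)); apply: ler_powR; [rewrite ler1n|exact: ltW].
have AA := ou_cov_far_le s0 T0 sTt.
have AA0 := ou_cov_ge0 t s.
have AA2 : (1 - k) ^+ 2 * ou_cov t s <= (2 + 2 * kconst) * T `^ (- kappa) * m ^+ 2.
  apply: (@le_trans _ _ ((lam * m) ^+ 2 * ou_cov t s)).
    by rewrite ler_wpM2r// lerXn2r// nnegrE// mulr_ge0 ?ltW.
  apply: (@le_trans _ _ ((lam * m) ^+ 2 * ((2 + 2 * kconst) * T `^ (- kappa) * (lam^-1 * lam^-1)))).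
    by rewrite ler_wpM2l// sqr_ge0.
  rewrite le_eqVlt; apply/orP; left; apply/eqP; field; exact: lt0r_neq0.
have PA0 : 0 <= B P (ou s) by rewrite BE; exact: (fine_kform_ge0 pP qA).
have AP0 : 0 <= B (ou t) P' by rewrite BE; exact: (fine_kform_ge0 pA qP).
have BO x y : B (ou x) (ou y) = ou_cov x y by rewrite BE.
rewrite -BO in AA2.
have := far_increment_algebra (E _ qAh) (E _ qA) (E' _ pP) (E' _ pA) e0 PA0 AP0 PP AA2.
rewrite (BO (t + h) (s + h)) (BO (t + h) s) (BO t (s + h)) (BO t s).
by move/le_trans; apply; rewrite -!mulrDl ler_wpM2r ?sqr_ge0// ler_wpM2r ?powR_ge0//; lra.
Qed.

End ou.

(** * Lower bound for the variance of an Ornstein-Uhlenbeck increment *)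

Lemma swap_algebra {R : realDomainType} (x y u v k : R) :
  k <= (x - y) * (u - v) -> y * u + x * v + k <= x * u + y * v.
Proof. by rewrite mulrBl !mulrBr; lra. Qed.

Lemma swap_le {R : realDomainType} (x y u v k : R) : 0 <= k ->
  y * u + x * v + k <= x * u + y * v -> x * v + y * u <= y * v + x * u.
Proof. lra. Qed.

(** With [s = a' - b], the energy [ss >= 0] means [aa + bb >= 2 ab]. The variance [aa + v - 2 a0] is
    therefore at least the gain [2 (ab - a0)]. *)
Lemma increment_lower_algebra {R : realFieldType} (aa ab as_ ba bb bs sa sb ss a0 K v : R) :
  aa = ba + 1 * sa -> ab = bb + 1 * sb -> as_ = bs + 1 * ss -> ab = ba -> as_ = sa -> bs = sb ->
  0 <= ss -> bb = v -> a0 + a0 + K <= ab + ab -> K <= aa + v - 2 * a0.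
Proof. lra. Qed.

Lemma lower_bound_algebra {R : realFieldType} (A p e2 x y z w q h l v : R) :
  A * p * (e2 * (h ^+ 2 / 4)) * (x * y) <= A * p * (e2 * (h ^+ 2 / 4)) * ((z * w) * (l * q)) ->
  A * p * (w * e2 * q * (h / 4)) * (l * h * z) <= A * p * (w * e2 * q * (h / 4)) * v ->
  A * e2 / 4 * (h ^+ 2 * p) * (x * y) <= A * p * (v * (w * e2 * q)) * (h / 4).
Proof.
set L1 := (X in X <= _ -> _); set R1 := (X in _ <= X -> _).
set L2 := (X in _ -> X <= _ -> _); set R2 := (X in _ -> _ <= X -> _) => le1 le2.
have -> : A * e2 / 4 * (h ^+ 2 * p) * (x * y) = L1 by rewrite /L1; field.
have -> : A * p * (v * (w * e2 * q)) * (h / 4) = R2 by rewrite /R2; field.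
apply: le_trans le1 _; suff -> : R1 = L2 by [].
by rewrite /R1 /L2; field.
Qed.

(* The gain [J0 - Jh] is half the integral of [(k w - k (w + h)) * (M w - M (- h - w))]: reflect [w] to [- h - w]. *)
Lemma reflect_gain {R : realType} (k M : R -> R) (h K J0 Jh : R) : 0 < h -> 0 <= K ->
  measurable_fun setT k -> measurable_fun setT M ->
  (forall w, 0 <= k w) -> (forall w, k (- w) = k w) -> (forall w, 0 <= M w) ->
  (forall w, - (h / 2) <= w -> w != 0 ->
    k (w + h) * M w + k w * M (- h - w) + \1_`]0, (h / 4)] w * K
      <= k w * M w + k (w + h) * M (- h - w)) ->
  (\int[@lebesgue_measure R]_w (k w * M w)%:E)%E = J0%:E ->
  (\int[@lebesgue_measure R]_w (k (w + h) * M w)%:E)%E = Jh%:E ->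
  Jh + Jh + K * (h / 4) <= J0 + J0.
Proof.
move=> h0 K0 mk mM k_ge0 kN M0 pointwise eJ0 eJh.
have ms : measurable_fun setT (fun w : R => - h - w) by exact: measurable_funB.
have mk' : measurable_fun setT (fun w : R => k (w + h)).
  by apply: (measurableT_comp mk); exact: measurable_funD.
have mM' : measurable_fun setT (fun w : R => M (- h - w)) by exact: (measurableT_comp mM ms).
pose A w := k w * M w + k (w + h) * M (- h - w).
pose B w := k (w + h) * M w + k w * M (- h - w) + \1_`]0, (h / 4)] w * K.
(* The inequality is given on one side of the centre [- h / 2] only; the other side follows by
   reflection. The points 0 and [- h], where the singular kernel has a conventional value, are
   discarded as a null set. *)
have le_ae : {ae (@lebesgue_measure R), forall w, setT w -> ((B w)%:E <= (A w)%:E)%E}.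
  exists [set 0; - h]; split => [||w]; first by apply: measurableU; exact: measurable_set1.
    rewrite (@measureU0 _ _ _ (@lebesgue_measure R)); [|exact: measurable_set1..|exact: lebesgue_measure_set1].
    exact: lebesgue_measure_set1.
  move=> /= nle; apply: contrapT => wn; apply: nle => _; rewrite lee_fin.
  have [wn0 wnh] : w != 0 /\ w != - h by split; apply/eqP => wE; apply: wn; [left|right].
  have [wge|wlt] := leP (- (h / 2)) w; first exact: pointwise.
  have /pointwise : - (h / 2) <= - h - w by lra.
  have -> : - h - (- h - w) = w by ring.
  rewrite (_ : - h - w + h = - w) ?kN; last by ring.
  have -> : k (- h - w) = k (w + h) by rewrite -kN; congr k; ring.
  rewrite /A /B; have : 0 <= \1_`]0, (h / 4)] (- h - w) * K by rewrite mulr_ge0.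
  have -> : \1_`]0, (h / 4)] w = 0 :> R.
    by rewrite indicE memNset//= in_itv/=; apply/negP; rewrite negb_and -leNgt; apply/orP; left; lra.
  have wn' : - h - w != 0 by apply: contra wnh => /eqP e; apply/eqP; lra.
  move=> i0 /(_ wn'); rewrite mul0r addr0; exact: swap_le.
have mA : measurable_fun setT (fun w => (A w)%:E).
  by apply/measurable_EFinP; apply: measurable_funD; exact: measurable_funM.
have mI : measurable_fun setT (fun w : R => \1_`]0, (h / 4)] w : R).
  by apply: measurable_indic; exact: measurable_itv.
have mB : measurable_fun setT (fun w => (B w)%:E).
  apply/measurable_EFinP; apply: measurable_funD; last exact: measurable_funM.
  by apply: measurable_funD; exact: measurable_funM.
have A0 w : setT w -> (0 <= (A w)%:E)%E by move=> _; rewrite lee_fin /A addr_ge0 ?mulr_ge0.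
have B0 w : setT w -> (0 <= (B w)%:E)%E by move=> _; rewrite lee_fin /B !addr_ge0 ?mulr_ge0.
have := @ae_ge0_le_integral _ _ _ (@lebesgue_measure R) setT measurableT _ _ B0 mB A0 mA le_ae.
pose f0 w := (k w * M w)%:E; pose f1 w := (k (w + h) * M w)%:E.
have mf0 : measurable_fun setT f0 by apply/measurable_EFinP; exact: measurable_funM.
have mf1 : measurable_fun setT f1 by apply/measurable_EFinP; exact: measurable_funM.
have f00 w : (0 <= f0 w)%E by rewrite lee_fin mulr_ge0.
have f10 w : (0 <= f1 w)%E by rewrite lee_fin mulr_ge0.
have mf0s : measurable_fun setT (fun w : R => f0 (- h - w)) by exact: (measurableT_comp mf0 ms).
have mf1s : measurable_fun setT (fun w : R => f1 (- h - w)) by exact: (measurableT_comp mf1 ms).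
have eA : (\int[(@lebesgue_measure R)]_w (A w)%:E)%E = (J0 + J0)%:E.
  rewrite EFinD -{1}eJ0 -eJ0 -{2}(ge0_integral_reflect (- h) mf0 f00).
  rewrite -(ge0_integralD (@lebesgue_measure R) measurableT (fun w _ => f00 w) mf0 (fun w _ => f00 (- h - w)) mf0s).
  apply: eq_integral => w _; rewrite /A /f0 -EFinD; congr (_ + _ * _)%:E.
  by rewrite -kN; congr k; ring.
have eB : (\int[(@lebesgue_measure R)]_w (B w)%:E)%E = (Jh + Jh + K * (h / 4))%:E.
  have eI : (\int[(@lebesgue_measure R)]_w (\1_`]0, (h / 4)] w)%:E)%E = (h / 4)%:E.
    rewrite integral_indic; [|by []|exact: measurable_itv]; rewrite setIT.
    transitivity ((@lebesgue_measure R) `]0, h / 4]%classic) => //.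
    by rewrite lebesgue_measure_itv/= lte_fin divr_gt0// sube0.
  have eJJ : (\int[(@lebesgue_measure R)]_w (f1 w + f1 (- h - w)%R))%E = (Jh + Jh)%:E.
    rewrite (ge0_integralD (@lebesgue_measure R) measurableT (fun w _ => f10 w) mf1 (fun w _ => f10 (- h - w)) mf1s).
    by rewrite (ge0_integral_reflect (- h) mf1 f10) eJh.
  have mIK : measurable_fun setT (fun w : R => (K * \1_`]0, (h / 4)] w)%:E).
    by apply/measurable_EFinP; exact: measurable_funM.
  have mff : measurable_fun setT (fun w : R => (f1 w + f1 (- h - w)%R)%E) by exact: emeasurable_funD.
  rewrite EFinD EFinM -eI -(ge0_integralZl_real (@lebesgue_measure R) K0 mI)// -eJJ.
  have IK0 w : setT w -> (0 <= (K * \1_`]0, (h / 4)] w)%:E)%E by move=> _; rewrite lee_fin mulr_ge0.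
  rewrite -(ge0_integralD (@lebesgue_measure R) measurableT (fun w _ => adde_ge0 (f10 w) (f10 (- h - w))) mff IK0 mIK).
  apply: eq_integral => w _; rewrite /B /f1 -!EFinD [in RHS](mulrC K); congr (_ + _ * _ + _)%:E.
  by rewrite -kN; congr k; ring.
by rewrite eA eB lee_fin.
Qed.

Section ou_lower_bound.
Context {R : realType}.
Variables kappa lam t h : R.
Hypotheses (k0 : 0 < kappa) (k1 : kappa < 1) (l0 : 0 < lam) (h0 : 0 < h) (ht : h <= t).
Local Notation leb := (@lebesgue_measure R).
Local Notation kf := (kform kappa).
Local Notation ou := (ou_kernel lam).
Local Notation hk := (hker kappa).

Let t0 : 0 < t. Proof. exact: lt_le_trans ht. Qed.
Local Notation a' := (ou (t + h)).
Local Notation b := (ou_slice lam h (t + h)).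

(** Thus [b] is the kernel of time [t] delayed by [h]: comparing the forms of [a'] with [b] and with
    [ou t] amounts to moving the singular kernel by [h]. *)
Lemma ou_kernel_shift r : ou t r = b (r + h).
Proof.
rewrite ou_kernelE ou_sliceE ?(ltW h0)//.
have -> : (h <= r + h) = (0 <= r) by rewrite lerDr.
have -> : (r + h < t + h) = (r < t) by rewrite ltrD2r.
by case: ifP => // _; congr expR; ring.
Qed.

Lemma ouc_profile1 : bounded_profile lam^-1 a'. Proof. exact: ou_profile. Qed.

Lemma ouc_profile : bounded_profile lam^-1 (ou t). Proof. exact: ou_profile. Qed.

Lemma ouc_profile2 : bounded_profile lam^-1 b. Proof. by apply: ou_slice_profile => //; exact: ltW. Qed.

Lemma measurable_ouc1 : measurable_fun setT a'. Proof. exact: measurable_ou. Qed.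

Lemma measurable_ouc2 : measurable_fun setT b. Proof. exact: measurable_ou_slice. Qed.

Lemma ouc1_ge0 r : 0 <= a' r. Proof. exact: bounded_profile_ge0 ouc_profile1 r. Qed.

Lemma ouc2_ge0 r : 0 <= b r. Proof. exact: bounded_profile_ge0 ouc_profile2 r. Qed.
Local Hint Resolve measurable_ouc1 measurable_ouc2 ouc1_ge0 ouc2_ge0 : core.

(** Cross-correlation at lag [w]. Both forms become one-dimensional integrals of it, against the
    kernel at [w] or at [w + h]. *)
Definition ou_corr (w : R) : \bar R := \int[leb]_r (a' r * b (r - w))%:E.
Local Notation m := ou_corr.

Lemma measurable_ouc_pair : measurable_fun setT (fun p : R * R => a' p.2 * b (p.2 - p.1)).
Proof.
apply: measurable_funM; first exact: (measurableT_comp measurable_ouc1).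
by apply: (measurableT_comp measurable_ouc2); exact: measurable_funB.
Qed.

Lemma measurable_ou_corr : measurable_fun setT (m : measurableTypeR R -> _).
Proof.
have fp (w r : R) : 0 <= a' r * b (r - w) by rewrite mulr_ge0.
exact: (measurable_int2 leb (f := fun w r : measurableTypeR R => a' r * b (r - w)) measurable_ouc_pair fp).
Qed.

Lemma ou_corr_ge0 w : (0 <= m w)%E.
Proof. by apply: integral_ge0 => r _; rewrite lee_fin mulr_ge0. Qed.
Local Hint Resolve ou_corr_ge0 : core.

Lemma ou_corr_fin_num w : m w \is a fin_num.
Proof.
rewrite ge0_fin_numE//; case: ouc_profile1 => _ _ ia; apply: le_lt_trans (ltry lam^-1).
apply: le_trans ia; apply: ge0_le_integral => //.
- by move=> r _; rewrite lee_fin mulr_ge0.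
- apply/measurable_EFinP; apply: measurable_funM => //.
  by apply: (measurableT_comp measurable_ouc2); exact: measurable_funB.
- exact/measurable_EFinP.
- move=> r _; rewrite lee_fin -[leRHS]mulr1 ler_wpM2l//.
  by case: ouc_profile2 => _ /(_ (r - w))/andP[].
Qed.
Local Hint Resolve ou_corr_fin_num : core.

Lemma kform_ou_corr : kf a' b = (\int[leb]_w ((hk w)%:E * m w))%E.
Proof.
transitivity (\int[leb]_r \int[leb]_w (hk w * (a' r * b (r - w)))%:E)%E.
  apply: eq_integral => r _.
  pose f w := (hk w * (a' r * b (r - w)))%:E.
  rewrite -(@ge0_integral_reflect _ f r); last 2 first.
  - apply/measurable_EFinP; apply: measurable_funM.
      by apply: measurable_hker.
    apply: measurable_funM => //.
    by apply: (measurableT_comp measurable_ouc2); exact: measurable_funB.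
  - by move=> w; rewrite lee_fin !mulr_ge0 ?hker_ge0.
  by apply: eq_integral => v _; rewrite /f (_ : r - (r - v) = v)//; ring.
rewrite (tonelli leb leb (f := fun r w => hk w * (a' r * b (r - w)))); last 2 first.
- apply: measurable_funM; first by apply: measurable_hker.
  apply: measurable_funM; first exact: (measurableT_comp measurable_ouc1).
  by apply: (measurableT_comp measurable_ouc2); exact: measurable_funB.
- by move=> r w; rewrite !mulr_ge0 ?hker_ge0.
apply: eq_integral => w _; rewrite ge0_integralZl_real ?hker_ge0//.
- apply: measurable_funM => //.
  by apply: (measurableT_comp measurable_ouc2); exact: measurable_funB.
- by move=> r; rewrite mulr_ge0.
Qed.

Lemma kform_ou_corr_shift : kf a' (ou t) = (\int[leb]_w ((hk (w + h))%:E * m w))%E.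
Proof.
transitivity (\int[leb]_r \int[leb]_w (hk (w + h) * (a' r * b (r - w)))%:E)%E.
  apply: eq_integral => r _.
  pose f w := (hk (w + h) * (a' r * b (r - w)))%:E.
  rewrite -(@ge0_integral_reflect _ f (r - h)); last 2 first.
  - apply/measurable_EFinP; apply: measurable_funM.
      by apply: measurable_hker; exact: measurable_funD.
    apply: measurable_funM => //.
    by apply: (measurableT_comp measurable_ouc2); exact: measurable_funB.
  - by move=> w; rewrite lee_fin !mulr_ge0 ?hker_ge0.
  apply: eq_integral => v _; rewrite /f ou_kernel_shift (_ : r - h - v + h = r - v); last by ring.
  by rewrite (_ : r - (r - h - v) = v + h)//; ring.
rewrite (tonelli leb leb (f := fun r w => hk (w + h) * (a' r * b (r - w)))); last 2 first.
- apply: measurable_funM; first by apply: measurable_hker; exact: measurable_funD.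
  apply: measurable_funM; first exact: (measurableT_comp measurable_ouc1).
  by apply: (measurableT_comp measurable_ouc2); exact: measurable_funB.
- by move=> r w; rewrite !mulr_ge0 ?hker_ge0.
apply: eq_integral => w _; rewrite ge0_integralZl_real ?hker_ge0//.
- apply: measurable_funM => //.
  by apply: (measurableT_comp measurable_ouc2); exact: measurable_funB.
- by move=> r; rewrite mulr_ge0.
Qed.

Lemma kform_ou_shift : kf b b = kf (ou t) (ou t).
Proof.
pose f r := (\int[leb]_v (hk (r - v) * (b r * b v))%:E)%E.
rewrite /kform -(@ge0_integral_shift _ f h); last 2 first.
- exact: measurable_kform_inner.
- by move=> r; apply: integral_ge0 => v _; rewrite lee_fin !mulr_ge0 ?hker_ge0.
apply: eq_integral => r _; rewrite /f.
pose g v := (hk (r + h - v) * (b (r + h) * b v))%:E.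
rewrite -(@ge0_integral_shift _ g h); last 2 first.
- apply/measurable_EFinP; apply: measurable_funM; last exact: measurable_funM.
  by apply: measurable_hker; exact: measurable_funB.
- by move=> v; rewrite lee_fin !mulr_ge0 ?hker_ge0.
by apply: eq_integral => v _; rewrite /g !ou_kernel_shift (_ : r + h - (v + h) = r - v)//; ring.
Qed.

(** Translating the integration variable by [d] reduces the comparison of two correlations to that
    of their integrands; [d] is chosen by the user of the lemma. *)
Lemma ou_corr_reflect_le c w d : 0 <= c ->
  (forall r, a' (r - d) * b (r - d + h + w) <= c * (a' r * b (r - w))) ->
  (m (- h - w) <= c%:E * m w)%E.
Proof.
move=> c0 le.
pose f r := (a' r * b (r + h + w))%:E.
have mf : measurable_fun setT f.
  apply/measurable_EFinP; apply: measurable_funM => //.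
  by apply: (measurableT_comp measurable_ouc2); apply: measurable_funD => //; exact: measurable_funD.
have f0 r : (0 <= f r)%E by rewrite lee_fin mulr_ge0.
have -> : m (- h - w) = (\int[leb]_r f r)%E.
  by apply: eq_integral => r _; rewrite /f (_ : r - (- h - w) = r + h + w)//; ring.
have mg : measurable_fun setT (fun r => a' r * b (r - w)).
  apply: measurable_funM => //.
  by apply: (measurableT_comp measurable_ouc2); exact: measurable_funB.
rewrite -(ge0_integral_shift (- d) mf f0) -ge0_integralZl_real//; last first.
  by move=> r; rewrite mulr_ge0.
apply: ge0_le_integral => //.
- by apply: (measurableT_comp mf); exact: measurable_funD.
- by apply/measurable_EFinP; exact: measurable_funM.
- by move=> r _; rewrite lee_fin.
Qed.

Lemma ou_kernel_expR s r : 0 <= r -> r < s -> ou s r = expR (- (lam * (s - r))).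
Proof. by move=> r0 rs; rewrite ou_kernelE r0 rs. Qed.

Lemma ouc2_expR r : h <= r -> r < t + h -> b r = expR (- (lam * (t + h - r))).
Proof. by move=> r0 rs; rewrite ou_sliceE ?(ltW h0)// r0 rs. Qed.

Lemma ouc_support r s : a' r * b s != 0 -> [/\ 0 <= r, r < t + h, h <= s & s < t + h].
Proof.
rewrite ou_kernelE ou_sliceE ?(ltW h0)//.
case: ifPn => [/andP[-> ->]|_]; last by rewrite mul0r eqxx.
by case: ifPn => [/andP[-> ->]|_]; last by rewrite mulr0 eqxx.
Qed.

(** After translation by [h + w] both integrands are exponentials on the support of the left one, in
    the exact ratio [exp (- lam h)]. *)
Lemma ou_corr_reflect_pos w : 0 <= w -> (m (- h - w) <= (expR (- (lam * h)))%:E * m w)%E.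
Proof.
move=> w0; apply: (@ou_corr_reflect_le _ _ (h + w)); first exact: expR_ge0.
move=> r; have [->|/ouc_support[r1 r2 r3 r4]] := eqVneq (a' (r - (h + w)) * b (r - (h + w) + h + w)) 0.
  by rewrite !mulr_ge0 ?expR_ge0.
have hh := h0.
rewrite !ou_kernel_expR ?ouc2_expR//; try lra.
rewrite -!expRD ler_expR le_eqVlt; apply/orP; left; apply/eqP; ring.
Qed.

(** Translation by [h + 2 w >= 0] leaves the factor [b (r - w)] unchanged and evaluates [a'], which
    increases on its support, at an earlier time. *)
Lemma ou_corr_reflect_neg w : - (h / 2) <= w -> w <= 0 -> (m (- h - w) <= m w)%E.
Proof.
move=> w0 w1; rewrite -[leRHS]mul1e; apply: (@ou_corr_reflect_le _ _ (h + 2 * w)) => //.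
move=> r; have [->|/ouc_support[r1 r2 r3 r4]] := eqVneq (a' (r - (h + 2 * w)) * b (r - (h + 2 * w) + h + w)) 0.
  by rewrite !mulr_ge0.
have hh := h0; have [g1 g2] : 0 <= r /\ r < t + h by split; lra.
rewrite mul1r (_ : r - (h + 2 * w) + h + w = r - w); last by ring.
apply: ler_wpM2r => //.
rewrite (ou_kernel_expR r1 r2) (ou_kernel_expR g1 g2) ler_expR lerN2 ler_wpM2l ?(ltW l0)//.
lra.
Qed.

Local Notation q := (Num.min (t / 2) lam^-1).

(** Only the last stretch of length [q] before [t + h] is used: there [lam (t + h - r) <= 1], and
    the lag costs [lam w] more in one factor. The conditions [q <= t / 2] and [h <= t] keep [r - w]
    in the support of [b]. *)
Lemma ou_corr_lower w : 0 <= w -> w <= h / 4 ->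
  ((expR (- (lam * h / 4)) * expR (- 2) * q)%:E <= m w)%E.
Proof.
move=> w0 w1; have hh := h0; have th := ht.
have q0 : 0 < q by rewrite lt_min divr_gt0// invr_gt0.
have qt : q <= t / 2 by rewrite ge_min lexx.
have ql : lam * q <= 1 by rewrite mulrC -ler_pdivlMr// div1r ge_min lexx orbT.
have [I [mI leI Ir]] : exists I : set (measurableTypeR R),
    [/\ measurable I, leb I = q%:E & forall r, I r -> t + h - q <= r < t + h].
  exists `[t + h - q, t + h[%classic; split; first exact: measurable_itv.
    rewrite lebesgue_measure_itv/= lte_fin ltrBlDr ltrDl q0 -EFinB; congr EFin; ring.
  by move=> r; rewrite /= in_itv.
have eI : (\int[leb]_r (\1_I r)%:E)%E = q%:E by rewrite integral_indic// setIT.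
rewrite EFinM -eI -ge0_integralZl_real ?mulr_ge0 ?expR_ge0//.
apply: ge0_le_integral => //.
- by apply/measurable_EFinP; apply: measurable_funM.
- apply/measurable_EFinP; apply: measurable_funM => //.
  by apply: (measurableT_comp measurable_ouc2); exact: measurable_funB.
move=> r _; rewrite lee_fin indicE.
have [|_] := boolP (r \in I); last by rewrite mulr0 mulr_ge0.
rewrite inE mulr1 => /Ir/andP[r1 r2].
rewrite ou_kernel_expR ?ouc2_expR; try lra.
rewrite -!expRD ler_expR.
have : lam * (t + h - r) <= 1 by apply: le_trans ql; rewrite ler_wpM2l ?(ltW l0)//; lra.
have : lam * w <= lam * (h / 4) by rewrite ler_wpM2l ?(ltW l0).
lra.
Qed.

Local Notation c1 := ((4 `^ kappa - 1) * h `^ (- kappa)).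

Lemma hker_drop_ge0 : 0 <= c1.
Proof.
have : (4 : R) `^ 0 <= 4 `^ kappa by apply: ler_powR; [rewrite ler1n|exact: ltW].
by rewrite powRr0 => h1; rewrite mulr_ge0 ?powR_ge0// subr_ge0.
Qed.
Local Hint Resolve hker_drop_ge0 : core.

(** The kernel decreases away from 0, so the drop is at least the one from [h / 4] to [h]. *)
Lemma hker_drop w : 0 < w -> w <= h / 4 -> c1 <= hk w - hk (w + h).
Proof.
move=> w0 w1; have hh := h0.
have e : hk (h / 4) - hk h = c1.
  rewrite /hker !gtr0_norm ?divr_gt0// powRM ?invr_ge0 ?(ltW h0)//.
  rewrite -[4^-1]powR_inv1// -powRrM mulN1r invfM -!powRN opprK; ring.
rewrite -e lerB//; apply: hker_le => //; rewrite ?lt0r_neq0// !gtr0_norm ?divr_gt0 ?addr_gt0//.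
by rewrite lerDr ltW.
Qed.

(** The strict gain comes from the lags in []0, h / 4]]: there the kernel drops by [c1] and
    reflection shrinks the correlation by a factor [exp (- lam h)]. At all other lags the
    rearrangement only has to be nonnegative. *)
Lemma ou_cov_increment_ge_gain :
  c1 * ((1 - expR (- (lam * h))) * (expR (- (lam * h / 4)) * expR (- 2) * q)) * (h / 4) <=
  ou_cov kappa lam (t + h) (t + h) + ou_cov kappa lam t t - 2 * ou_cov kappa lam (t + h) t.
Proof.
have li : 0 < lam^-1 by rewrite invr_gt0.
pose K := c1 * ((1 - expR (- (lam * h))) * (expR (- (lam * h / 4)) * expR (- 2) * q)).
have e1 : 0 <= 1 - expR (- (lam * h)) by have /andP[] := one_minus_expR_le l0 h0.
have q0 : 0 < q by rewrite lt_min divr_gt0// invr_gt0.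
have K0 : 0 <= K by apply: mulr_ge0; [exact: hker_drop_ge0|rewrite !mulr_ge0 ?expR_ge0 ?(ltW q0)].
have pointwise w : - (h / 2) <= w -> w != 0 ->
  hk (w + h) * fine (m w) + hk w * fine (m (- h - w)) + \1_`]0, (h / 4)] w * K
  <= hk w * fine (m w) + hk (w + h) * fine (m (- h - w)).
  move=> w0 wn; rewrite indicE.
  have kk : hk (w + h) <= hk w.
    have hh := h0; apply: hker_le => //; rewrite [leRHS]ger0_norm; last lra.
    by rewrite ler_norml; apply/andP; split; lra.
  have [|] := boolP (w \in `]0, (h / 4)]%classic).
    rewrite inE/= in_itv/= mul1r => /andP[wp wq].
    have d1 := hker_drop wp wq.
    have := ou_corr_lower (ltW wp) wq.
    have := ou_corr_reflect_pos (ltW wp).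
    rewrite -{1}(fineK (ou_corr_fin_num w)) -{1}(fineK (ou_corr_fin_num (- h - w))) -EFinM lee_fin => d2.
    rewrite -{1}(fineK (ou_corr_fin_num w)) lee_fin => d3.
    have d4 : K <= (hk w - hk (w + h)) * (fine (m w) - fine (m (- h - w))).
      rewrite /K; apply: ler_pM => //; first by rewrite !mulr_ge0 ?expR_ge0 ?(ltW q0).
      apply: le_trans (_ : (1 - expR (- (lam * h))) * fine (m w) <= _).
        by rewrite ler_wpM2l.
      by rewrite mulrBl mul1r lerD2l lerN2.
    exact: swap_algebra.
  move=> _; rewrite mul0r addr0.
  have d2 : fine (m (- h - w)) <= fine (m w).
    rewrite -lee_fin !fineK//; have [wp|wn0] := leP 0 w.
      apply: le_trans (ou_corr_reflect_pos wp) _; rewrite -[leRHS]mul1e.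
      rewrite lee_wpmul2r// lee_fin -expR0 ler_expR oppr_le0 mulr_ge0// ltW//.
    by apply: ou_corr_reflect_neg => //; exact: ltW.
  have : 0 <= (hk w - hk (w + h)) * (fine (m w) - fine (m (- h - w))).
    by rewrite mulr_ge0// subr_ge0.
  by move/swap_algebra; rewrite addr0.

pose J0 := kf a' b; pose Jh := kf a' (ou t).
have fJ0 : J0 \is a fin_num by exact: (kform_fin_num k0 k1 li ouc_profile1 ouc_profile2).
have fJh : Jh \is a fin_num by exact: (kform_fin_num k0 k1 li ouc_profile1 ouc_profile).
have mfm : measurable_fun setT (fun w : R => fine (m w)).
  exact: (measurableT_comp (@fine_measurable R setT measurableT) measurable_ou_corr).
have mk : measurable_fun setT (fun w : R => hk w) by exact: measurable_hker.
have mf0 w : 0 <= fine (m w) by exact: fine_ge0.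
have eJ0 : (\int[leb]_w (hk w * fine (m w))%:E)%E = (fine J0)%:E.
  by rewrite (fineK fJ0) /J0 kform_ou_corr; apply: eq_integral => w _; rewrite EFinM fineK.
have eJh : (\int[leb]_w (hk (w + h) * fine (m w))%:E)%E = (fine Jh)%:E.
  by rewrite (fineK fJh) /Jh kform_ou_corr_shift; apply: eq_integral => w _; rewrite EFinM fineK.
have main := reflect_gain h0 K0 mk mfm (hker_ge0 kappa) (hkerN kappa) mf0 pointwise eJ0 eJh.
(* The difference [a' - b], that is, what [a'] sees of the noise before time [h]. *)
pose sg r : R := \1_`]-oo, h[ r * a' r.
have split : a' = fun r => b r + 1 * sg r.
  apply/funext => r; rewrite mul1r /sg /ou_slice !indicE.
  have [rh|rh] := ltP r h.
    rewrite memNset ?mul0r ?add0r; last by rewrite /= in_itv/= andbT; apply/negP; rewrite -ltNge.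
    by rewrite mem_set ?mul1r//= in_itv.
  rewrite mem_set; last by rewrite /= in_itv/= rh.
  by rewrite memNset ?mul1r ?mul0r ?addr0//= in_itv/=; apply/negP; rewrite -leNgt.
have psg : bounded_profile lam^-1 sg.
  have sl r : 0 <= sg r <= a' r.
    rewrite /sg indicE; case: (_ \in _); by rewrite ?mul1r ?mul0r ?lexx ?andbT /= ouc1_ge0.
  have msg : measurable_fun setT sg.
    by apply: measurable_funM => //; apply: measurable_indic; exact: measurable_itv.
  have [_ a1 ia] := ouc_profile1; split => //.
    by move=> r; have /andP[s0 s1] := sl r; have /andP[_ a2] := a1 r; rewrite s0 (le_trans s1 a2).
  apply: le_trans ia; apply: ge0_le_integral => //.
  - by move=> r _; rewrite lee_fin; have /andP[] := sl r.
  - exact/measurable_EFinP.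
  - exact/measurable_EFinP.
  - by move=> r _; rewrite lee_fin; have /andP[] := sl r.
have E psi : bounded_profile lam^-1 psi -> fine (kf a' psi) = fine (kf b psi) + 1 * fine (kf sg psi).
  by move=> pp; rewrite split; exact: (fine_kformDZ k0 k1 li ler01 ouc_profile2 psg pp).
have D1 := E _ ouc_profile1; have D2 := E _ ouc_profile2; have D3 := E _ psg.
have D4 := fine_kformC kappa ouc_profile1 ouc_profile2.
have D5 := fine_kformC kappa ouc_profile1 psg.
have D6 := fine_kformC kappa ouc_profile2 psg.
have D7 : 0 <= fine (kf sg sg) by exact: (fine_kform_ge0 kappa psg psg).
have D8 : fine (kf b b) = ou_cov kappa lam t t := f_equal fine kform_ou_shift.
rewrite /J0 /Jh in main.
exact: (increment_lower_algebra D1 D2 D3 D4 D5 D6 D7 D8 main).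
Qed.

(** The gain is weakened to a difference of two exponentials in [lam], a shape whose integral
    against the spectral measure is known up to constants. *)
Lemma ou_cov_increment_ge :
  (4 `^ kappa - 1) * expR (- 2) / 4 * h `^ (2 - kappa) *
    (expR (- (2 * h * lam)) - expR (- ((2 * h + t / 2) * lam))) <=
  ou_cov kappa lam (t + h) (t + h) + ou_cov kappa lam t t - 2 * ou_cov kappa lam (t + h) t.
Proof.
have q0 : 0 < q by rewrite lt_min divr_gt0// invr_gt0.
apply: le_trans ou_cov_increment_ge_gain.
have ql : 1 - expR (- (lam * (t / 2))) <= lam * q.
  by have /andP[] := one_minus_expR_le l0 (divr_gt0 t0 (ltr0Sn R 1)).
have el : lam * h * expR (- (lam * h)) <= 1 - expR (- (lam * h)).
  have := expR_ge1Dx (lam * h); rewrite expRN => g.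
  rewrite ler_pdivrMr ?expR_gt0// mulrBl mul1r mulVf ?lt0r_neq0 ?expR_gt0//.
  by rewrite lerBrDl.
have eh : h `^ (2 - kappa) = h ^+ 2 * h `^ (- kappa).
  by rewrite powRD ?lt0r_neq0 ?implybT// powR_mulrn// ltW.
rewrite eh (_ : expR (- (2 * h * lam)) - _ = expR (- (2 * h * lam)) * (1 - expR (- (lam * (t / 2))))); last first.
  by rewrite mulrBr mulr1 -expRD; congr (_ - expR _); ring.
have e3 : expR (- (2 * h * lam)) <= expR (- (lam * h)) * expR (- (lam * h / 4)).
  rewrite -expRD ler_expR; have := mulr_gt0 l0 h0; lra.
have C0 : 0 <= c1 * (expR (- (lam * h / 4)) * expR (- 2) * q * (h / 4)).
  by apply: mulr_ge0 => //; rewrite !mulr_ge0 ?expR_ge0 ?(ltW q0) ?(ltW h0).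
have := ler_wpM2l C0 el.
have C1 : 0 <= c1 * (expR (- 2) * (h ^+ 2 / 4)).
  by apply: mulr_ge0 => //; rewrite !mulr_ge0 ?expR_ge0 ?exprn_ge0 ?(ltW h0).
have e4 : 0 <= 1 - expR (- (lam * (t / 2))).
  by have /andP[] := one_minus_expR_le l0 (divr_gt0 t0 (ltr0Sn R 1)).
have e34 := ler_pM (expR_ge0 _) e4 e3 ql.
have := ler_wpM2l C1 e34.
exact: lower_bound_algebra.
Qed.

End ou_lower_bound.

(** * Covariance of the mild solution *)

Section sigma_finite_packaging.
Context {R : realType} d (T : measurableType d) (mu : {measure set T -> \bar R}).

(* [mu] with its sigma-finiteness made visible to Fubini's theorem *)
Definition sf_measure (sf : sigma_finite setT mu) : set T -> \bar R := mu.

HB.instance Definition _ (sf : sigma_finite setT mu) := Measure.copy (sf_measure sf) mu.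
HB.instance Definition _ (sf : sigma_finite setT mu) :=
  @Measure_isSigmaFinite.Build _ _ _ (sf_measure sf) sf.

Lemma integral_sf_measure (sf : sigma_finite setT mu) D f :
  (\int[sf_measure sf]_(x in D) f x = \int[mu]_(x in D) f x)%E.
Proof. by []. Qed.

End sigma_finite_packaging.

Lemma measurable_heat_kernel_comp {R : realType} n d (T : measurableType d)
  (f : T -> R) (g : T -> n.-tuple R) :
  measurable_fun setT f -> measurable_fun setT (fun z => enorm (g z)) ->
  measurable_fun setT (fun z => heat_kernel (f z) (g z)).
Proof.
move=> mf mg.
have -> : (fun z => heat_kernel (f z) (g z)) = (fun z => if 0 < f z then
    (2 * pi * f z) `^ (- (n%:R / 2)) * expR (- (enorm (g z) ^+ 2 * (2 * f z) `^ (- 1))) else 0).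
  apply/funext => z; rewrite /heat_kernel; case: ifPn => // fz.
  by rewrite powR_inv1// mulr_ge0// ltW.
apply: measurable_fun_ifT => //.
  by apply: measurable_fun_ltr.
apply: measurable_funM.
  by apply: (measurableT_comp (@measurable_powR _ _)); exact: measurable_funM.
apply: (measurableT_comp (@measurable_expR _)); apply: measurable_funN.
apply: measurable_funM; first exact: measurable_funX.
by apply: (measurableT_comp (@measurable_powR _ _)); exact: measurable_funM.
Qed.

Lemma measurable_mild_integrand {R : realType} n (t : R) (x : n.-tuple R) :
  measurable_fun setT (fun p : R * n.-tuple R => mild_integrand t x p.1 p.2).
Proof.
rewrite /mild_integrand; apply: measurable_funM.
  have mi : measurable_fun setT (fun s : R => \1_`[0, t] s : R).
    by apply: measurable_indic; exact: measurable_itv.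
  exact: (measurableT_comp mi).
apply: measurable_heat_kernel_comp; first exact: measurable_funB.
apply: (measurableT_comp (continuous_measurable_fun (@sqrt_continuous R))).
apply: measurable_sum => i.
have h : measurable_fun setT (fun p : R * n.-tuple R => tnth (tuple_sub x p.2) i).
  have -> : (fun p : R * n.-tuple R => tnth (tuple_sub x p.2) i) = (fun p => tnth x i - tnth p.2 i).
    by apply/funext => p; rewrite tnth_mktuple.
  apply: measurable_funB => //.
  exact: (measurableT_comp (@measurable_tnth _ R n i) measurable_snd).
exact: measurable_funM.
Qed.

Lemma measurable_ou_comp {R : realType} d (T : measurableType d) (t : R) (f g : T -> R) :
  measurable_fun setT f -> measurable_fun setT g ->
  measurable_fun setT (fun z => ou_kernel (f z) t (g z)).
Proof.
move=> mf mg; apply: measurable_funM.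
  have mi : measurable_fun setT (fun s : R => \1_`[0, t[ s : R).
    by apply: measurable_indic; exact: measurable_itv.
  exact: (measurableT_comp mi).
apply: (measurableT_comp (@measurable_expR _)); apply: measurable_funN.
by apply: measurable_funM => //; exact: measurable_funB.
Qed.

Lemma tonelli_ereal {R : realType} d1 d2 (T1 : measurableType d1) (T2 : measurableType d2)
  (m1 : {sigma_finite_measure set T1 -> \bar R}) (m2 : {sigma_finite_measure set T2 -> \bar R})
  (f : T1 * T2 -> \bar R) :
  measurable_fun setT f -> (forall p, (0 <= f p)%E) ->
  (\int[m1]_x \int[m2]_y f (x, y) = \int[m2]_y \int[m1]_x f (x, y))%E.
Proof.
move=> mf f0; transitivity (\int[(m1 \x m2)%E]_z f z)%E.
  by rewrite fubini_tonelli1.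
by rewrite fubini_tonelli2.
Qed.

Section kform_mixture.
Context {R : realType} {n : nat}.
Variables (mu : {measure set (n.-tuple R) -> \bar R}) (kappa t s : R).
Hypothesis sf : sigma_finite setT mu.
Local Notation leb := (@lebesgue_measure R).

Local Notation g := (fun (xi : n.-tuple R) (u v : R) =>
  hker kappa (u - v) * (ou_kernel (freq xi) t u * ou_kernel (freq xi) s v)).

Lemma measurable_ou_mixture d (T : measurableType d) (a : T -> n.-tuple R) (b c : T -> R) :
  measurable_fun setT a -> measurable_fun setT b -> measurable_fun setT c ->
  measurable_fun setT (fun q => g (a q) (b q) (c q)).
Proof.
move=> ma mb mc.
have mf : measurable_fun setT (fun q => freq (a q)).
  exact: (measurableT_comp (@measurable_freq R n)).
apply: measurable_funM; first by apply: measurable_hker; exact: measurable_funB.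
by apply: measurable_funM; apply: measurable_ou_comp.
Qed.

Lemma ou_mixture_ge0 xi u v : 0 <= g xi u v.
Proof. by rewrite !mulr_ge0 ?hker_ge0 ?ou_kernel_ge0. Qed.

Lemma measurable_ou_mixture_inner : measurable_fun setT
  (fun p : n.-tuple R * R => (\int[leb]_v (g p.1 p.2 v)%:E)%E).
Proof.
apply: (measurable_int2 leb (f := fun (p : n.-tuple R * R) v => g p.1 p.2 v)).
  apply: measurable_ou_mixture; [|exact: measurableT_comp..|exact: measurable_snd].
  exact: (measurableT_comp measurable_fst measurable_fst).
by move=> p v; exact: ou_mixture_ge0.
Qed.

Lemma measurable_kform_freq : measurable_fun setT (fun xi : n.-tuple R =>
  kform kappa (ou_kernel (freq xi) t) (ou_kernel (freq xi) s)).
Proof.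
pose f (p : n.-tuple R * R) := (\int[leb]_v (g p.1 p.2 v)%:E)%E.
have f0 p : (0 <= f p)%E by apply: integral_ge0 => v _; rewrite lee_fin ou_mixture_ge0.
exact: (measurable_fun_fubini_tonelli_F (m2 := leb) f measurable_ou_mixture_inner f0).
Qed.

(** Everything is nonnegative, so two Tonelli exchanges bring the frequency outside both time
    integrals. *)
Lemma kform_mixture :
  (\int[leb]_u \int[leb]_v ((hker kappa (u - v))%:E *
     \int[mu]_xi (ou_kernel (freq xi) t u * ou_kernel (freq xi) s v)%:E) =
   \int[mu]_xi kform kappa (ou_kernel (freq xi) t) (ou_kernel (freq xi) s))%E.
Proof.
have mf := @measurable_freq R n.
transitivity (\int[leb]_u \int[leb]_v \int[sf_measure sf]_xi (g xi u v)%:E)%E.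
  apply: eq_integral => u _; apply: eq_integral => v _.
  rewrite integral_sf_measure ge0_integralZl_real ?hker_ge0//.
    by apply: measurable_funM; apply: measurable_ou_comp.
  by move=> xi; rewrite mulr_ge0 ?ou_kernel_ge0.
transitivity (\int[leb]_u \int[sf_measure sf]_xi \int[leb]_v (g xi u v)%:E)%E.
  apply: eq_integral => u _.
  apply: (tonelli leb (sf_measure sf) (f := fun v xi => g xi u v)).
    by apply: measurable_ou_mixture; [exact: measurable_snd|exact: measurable_cst|exact: measurable_fst].
  by move=> *; exact: ou_mixture_ge0.
pose f (p : R * n.-tuple R) := (\int[leb]_v (g p.2 p.1 v)%:E)%E.
have mf' : measurable_fun setT f.
  apply: (measurable_int2 leb (f := fun (p : R * n.-tuple R) v => g p.2 p.1 v)).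
    apply: measurable_ou_mixture; last exact: measurable_snd.
      exact: (measurableT_comp measurable_snd measurable_fst).
    exact: (measurableT_comp measurable_fst measurable_fst).
  by move=> p v; exact: ou_mixture_ge0.
have f0 p : (0 <= f p)%E by apply: integral_ge0 => v _; rewrite lee_fin ou_mixture_ge0.
exact: (tonelli_ereal leb (sf_measure sf) mf' f0).
Qed.

End kform_mixture.

Lemma ou_kernel_gt {R : realType} (lam t u : R) : t <= u -> ou_kernel lam t u = 0.
Proof.
move=> tu; rewrite /ou_kernel indicE memNset ?mul0r//= in_itv/=.
by apply/negP; rewrite negb_and -!leNgt tu orbT.
Qed.

Section Rintegral_combinations.
Context {R : realType} d (T : measurableType d) (m : {measure set T -> \bar R}) (D : set T).
Hypothesis mD : measurable D.

Lemma Rintegral_increment (f1 f2 f3 : T -> R) :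
  m.-integrable D (EFin \o f1) -> m.-integrable D (EFin \o f2) -> m.-integrable D (EFin \o f3) ->
  \int[m]_(x in D) (f1 x + f2 x - 2 * f3 x) =
  \int[m]_(x in D) f1 x + \int[m]_(x in D) f2 x - 2 * \int[m]_(x in D) f3 x.
Proof.
move=> i1 i2 i3.
rewrite (RintegralB (f1 := fun x => f1 x + f2 x) (f2 := fun x => 2 * f3 x) mD); last 2 first.
- exact: (integrableD mD i1 i2).
- exact: (integrableZl mD 2 i3).
by rewrite RintegralD// RintegralZl.
Qed.

Lemma Rintegral_increments (f1 f2 f3 f4 : T -> R) :
  m.-integrable D (EFin \o f1) -> m.-integrable D (EFin \o f2) -> m.-integrable D (EFin \o f3) ->
  m.-integrable D (EFin \o f4) ->
  \int[m]_(x in D) (f1 x - f2 x - f3 x + f4 x) =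
  \int[m]_(x in D) f1 x - \int[m]_(x in D) f2 x - \int[m]_(x in D) f3 x + \int[m]_(x in D) f4 x.
Proof.
move=> i1 i2 i3 i4.
rewrite (RintegralD (f1 := fun x => f1 x - f2 x - f3 x) (f2 := f4) mD)//; last first.
  exact: (integrableB mD (integrableB mD i1 i2) i3).
rewrite (RintegralB (f1 := fun x => f1 x - f2 x) (f2 := f3) mD)//; last exact: (integrableB mD i1 i2).
by rewrite RintegralB.
Qed.

End Rintegral_combinations.

Section spectral_covariance.
Context {R : realType} {n : nat}.
Variables (H alpha : R) (mu : {measure set (n.-tuple R) -> \bar R}).
Hypotheses (n1 : (1 <= n)%N) (H12 : 1 / 2 < H) (H1 : H < 1) (alpha0 : 0 < alpha)
  (alphan : alpha < n%:R) (nH : n%:R < 4 * H + alpha).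
Hypotheses (tmu : tempered_measure mu) (amu : asymp_power mu alpha).
Local Notation leb := (@lebesgue_measure R).
Local Notation kappa := (2 - 2 * H).
Local Notation beta := ((n%:R - alpha) / 2).
Local Notation ou xi := (ou_kernel (freq xi)).
Local Notation pos := [set xi : n.-tuple R | 0 < freq xi].

Lemma hurst_kappa_gt0 : 0 < kappa. Proof. by move: H1; lra. Qed.

Lemma hurst_kappa_lt1 : kappa < 1. Proof. by move: H12; lra. Qed.

Lemma spectral_exponent_lt : beta < 2 * H. Proof. by move: nH; lra. Qed.

Lemma measurable_pos_freq : measurable pos.
Proof.
rewrite -[X in measurable X]setTI.
have -> : pos = @freq R n @^-1` `]0, +oo[%classic by apply/seteqP; split => xi; rewrite /= in_itv/= andbT.
exact: (measurable_freq measurableT (measurable_itv _)).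
Qed.

(** The Ornstein-Uhlenbeck bounds need a positive rate; only the origin has none, and [mu] does not
    charge it. *)
Lemma integral_pos_freq (f : n.-tuple R -> \bar R) : measurable_fun setT f ->
  (forall xi, (0 <= f xi)%E) -> (\int[mu]_xi f xi = \int[mu]_(xi in pos) f xi)%E.
Proof.
move=> mf f0.
have mN : measurable [set xi : n.-tuple R | enorm xi = 0] by exact: measurable_enorm0.
rewrite (ge0_negligible_integral mN measurableT mf (fun x _ => f0 x) (spectral_enorm0 alpha0 amu)).
congr (integral _ _ _); apply/seteqP; split => xi /=.
  move=> [_ xn]; rewrite /freq divr_gt0// exprn_even_gt0//=; exact/eqP.
move=> xp; split=> // x0; move: xp; rewrite /freq x0 expr0n/= mul0r ltxx//.
Qed.

Definition spectral_cov_ereal (t s : R) : \bar R :=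
  (\int[mu]_xi kform kappa (ou xi t) (ou xi s))%E.

Lemma ou_profile_min (lam t T : R) : 0 < lam -> 0 < T -> t <= T ->
  bounded_profile (Num.min T lam^-1) (ou_kernel lam t).
Proof.
move=> l0 T0 tT; have [ml le1 il] := ou_profile l0 t; split => //.
rewrite /Num.min; case: ifPn => // _; have [t0|t0] := leP 0 t.
  have := @integral_ou_slice_le_len R lam l0 0 t (lexx 0) t0.
  by rewrite ou_slice0 subr0 => /le_trans; apply; rewrite lee_fin.
rewrite (_ : (\int[leb]_v _)%E = 0%E) ?lee_fin ?ltW//.
apply: integral0_eq => v _; rewrite ou_kernelE; case: ifPn => // /andP[v0 vt].
by have := lt_trans (le_lt_trans v0 vt) t0; rewrite ltxx.
Qed.

(** In [min (h, 1 / lam) * (lam + 1 / h)] each of the two products is at most 1. The resolvent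
    replaces the minimum because its spectral integral is explicit. *)
Lemma min_le_resolvent (lam h q : R) : 0 < lam -> 0 < h -> 0 < q ->
  Num.min h lam^-1 `^ q <= 2 `^ q * (lam + h^-1) `^ (- q).
Proof.
move=> l0 h0 q0; have lh : 0 < lam + h^-1 by rewrite addr_gt0// invr_gt0.
have m0 : 0 < Num.min h lam^-1 by rewrite lt_min h0 invr_gt0.
rewrite powRN ler_pdivlMr ?powR_gt0// -powRM; [|exact: ltW..].
apply: ge0_ler_powR; rewrite ?nnegrE ?(ltW q0) ?(ltW (mulr_gt0 m0 lh))//.
rewrite mulrDr (_ : 2 = 1 + 1 :> R)// lerD// /Num.min; case: ifPn.
- by rewrite -[X in X < _]invrK => h1; rewrite -ler_pdivlMr// div1r ltW// -[X in X < _]invrK.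
- by move=> _; rewrite mulVf// gt_eqF.
- by move=> _; rewrite divff// gt_eqF.
- by rewrite -leNgt => h1; rewrite ler_pdivrMr// mul1r.
Qed.

(** The hypothesis [n < 4 H + alpha] says [beta < 2 H], which is exactly what makes the resolvent to
    the power [2 H] integrable against [mu]. *)
Lemma spectral_cov_fin t s : spectral_cov_ereal t s \is a fin_num.
Proof.
rewrite /spectral_cov_ereal ge0_fin_numE; last first.
  apply: integral_ge0 => xi _; apply: kform_ge0 => v; exact: ou_kernel_ge0.
have k0 := hurst_kappa_gt0; have k1 := hurst_kappa_lt1; have b2 := spectral_exponent_lt.
have mk := @measurable_kform_freq R n kappa t s.
rewrite integral_pos_freq//; last by move=> xi; apply: kform_ge0 => v; exact: ou_kernel_ge0.
pose T := `|t| + `|s| + 1; have T0 : 0 < T by rewrite ltr_wpDl// addr_ge0.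
have tT : t <= T by rewrite (le_trans (ler_norm t))// /T -addrA lerDl addr_ge0.
have sT : s <= T by rewrite (le_trans (ler_norm s))// /T addrAC lerDr addr_ge0.
have [C C0 hC] := @spectral_resolvent_le R n alpha n1 alpha0 alphan mu amu (2 * H) b2.
have kc := kconst_gt0 k1.
have H20 : 0 < 2 * H by move: H12; lra.
apply: (@le_lt_trans _ _ ((kconst kappa * 2 `^ (2 * H))%:E * \int[mu]_xi ((freq xi + T^-1) `^ (- (2 * H)))%:E)%E).
  rewrite -ge0_integralZl_real; last 3 first.
  - by rewrite mulr_ge0 ?powR_ge0// ltW.
  - apply: (measurableT_comp (@measurable_powR _ _)); apply: measurable_funD => //; exact: measurable_freq.
  - by move=> xi; exact: powR_ge0.
  rewrite [leRHS]integral_pos_freq; last 2 first.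
  - apply/measurable_EFinP; apply: measurable_funM => //.
    apply: (measurableT_comp (@measurable_powR _ _)); apply: measurable_funD => //; exact: measurable_freq.
  - by move=> xi; rewrite lee_fin !mulr_ge0 ?powR_ge0// ltW.
  apply: ge0_le_integral => //.
  - exact: measurable_pos_freq.
  - by move=> xi _; apply: kform_ge0 => v; exact: ou_kernel_ge0.
  - exact: measurable_funTS.
  - apply: measurable_funTS; apply/measurable_EFinP; apply: measurable_funM => //.
    apply: (measurableT_comp (@measurable_powR _ _)); apply: measurable_funD => //; exact: measurable_freq.
  - move=> xi /= xp; have m0 : 0 < Num.min T (freq xi)^-1 by rewrite lt_min T0 invr_gt0.
    apply: le_trans (kform_profile_le k0 k1 m0 (ou_profile_min xp T0 tT) (ou_profile_min xp T0 sT)) _.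
    rewrite lee_fin -mulrA ler_wpM2l ?(ltW kc)//.
    by rewrite (_ : 2 - kappa = 2 * H); [exact: min_le_resolvent|ring].
apply: (@le_lt_trans _ _ ((kconst kappa * 2 `^ (2 * H))%:E * (C * T `^ (2 * H - beta))%:E)%E); last by rewrite -EFinM ltry.
by apply: lee_wpmul2l; [rewrite lee_fin mulr_ge0 ?powR_ge0// ltW|exact: hC].
Qed.

Definition spectral_cov (t s : R) : R := \int[mu]_(xi in pos) ou_cov kappa (freq xi) t s.

Lemma kform_ou_cov (xi : n.-tuple R) (t s : R) : 0 < freq xi -> kform kappa (ou xi t) (ou xi s) = (ou_cov kappa (freq xi) t s)%:E.
Proof.
move=> x0; rewrite /ou_cov fineK//.
have li : 0 < (freq xi)^-1 by rewrite invr_gt0.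
exact: (kform_fin_num hurst_kappa_gt0 hurst_kappa_lt1 li (ou_profile x0 t) (ou_profile x0 s)).
Qed.

Lemma spectral_cov_pos t s :
  (\int[mu]_(xi in pos) (ou_cov kappa (freq xi) t s)%:E = spectral_cov_ereal t s)%E.
Proof.
rewrite /spectral_cov_ereal integral_pos_freq; last 2 first.
- exact: measurable_kform_freq.
- by move=> xi; apply: kform_ge0 => v; exact: ou_kernel_ge0.
by apply: eq_integral => xi; rewrite inE => xp; rewrite kform_ou_cov.
Qed.

Lemma spectral_covE t s : (spectral_cov t s)%:E = spectral_cov_ereal t s.
Proof. by rewrite /spectral_cov /Rintegral spectral_cov_pos fineK// spectral_cov_fin. Qed.

Lemma measurable_ou_cov t s : measurable_fun pos (fun xi : n.-tuple R => ou_cov kappa (freq xi) t s).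
Proof.
apply: measurable_funTS.
exact: (measurableT_comp (@fine_measurable R setT measurableT) (measurable_kform_freq kappa t s)).
Qed.

Lemma integrable_ou_cov t s :
  mu.-integrable pos (EFin \o (fun xi : n.-tuple R => ou_cov kappa (freq xi) t s)).
Proof.
apply/integrableP; split; first by apply/measurable_EFinP; exact: measurable_ou_cov.
have c0 (xi : n.-tuple R) : 0 <= ou_cov kappa (freq xi) t s.
  by rewrite fine_ge0// kform_ge0// => v; exact: ou_kernel_ge0.
under eq_integral => xi do rewrite /= (ger0_norm (c0 xi)).
have := spectral_cov_fin t s; rewrite -spectral_cov_pos ge0_fin_numE//.
by apply: integral_ge0 => xi _; rewrite lee_fin.
Qed.

Lemma Rintegral_pos_le (f g : n.-tuple R -> R) (K : R) :
  mu.-integrable pos (EFin \o f) -> measurable_fun setT g -> (forall xi, 0 <= g xi) ->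
  (forall xi, 0 < freq xi -> f xi <= g xi) -> (\int[mu]_xi (g xi)%:E <= K%:E)%E ->
  \int[mu]_(xi in pos) f xi <= K.
Proof.
move=> fi mg g0 fg gK.
have mp := measurable_pos_freq.
have gK' : (\int[mu]_(xi in pos) (g xi)%:E <= K%:E)%E.
  apply: le_trans gK; apply: ge0_subset_integral => //.
    exact/measurable_EFinP.
  by move=> xi _; rewrite lee_fin.
have gi : mu.-integrable pos (EFin \o g).
  apply/integrableP; split; first by apply/measurable_EFinP; exact: measurable_funTS.
  under eq_integral do rewrite /= ger0_norm//.
  exact: le_lt_trans gK' (ltry _).
apply: (le_trans (le_Rintegral mp fi gi fg)).
by rewrite -lee_fin /Rintegral fineK//; exact: (integrable_fin_num mp gi).
Qed.

Lemma spectral_cov_increment_eq t s : spectral_cov t t + spectral_cov s s - 2 * spectral_cov t s =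
  \int[mu]_(xi in pos) (ou_cov kappa (freq xi) t t + ou_cov kappa (freq xi) s s - 2 * ou_cov kappa (freq xi) t s).
Proof.
by rewrite (Rintegral_increment measurable_pos_freq (integrable_ou_cov t t) (integrable_ou_cov s s) (integrable_ou_cov t s)).
Qed.

Lemma spectral_cov_increments_eq t t' s s' :
  spectral_cov t' s' - spectral_cov t' s - spectral_cov t s' + spectral_cov t s =
  \int[mu]_(xi in pos) (ou_cov kappa (freq xi) t' s' - ou_cov kappa (freq xi) t' s - ou_cov kappa (freq xi) t s' + ou_cov kappa (freq xi) t s).
Proof.
by rewrite (Rintegral_increments measurable_pos_freq (integrable_ou_cov t' s') (integrable_ou_cov t' s)
  (integrable_ou_cov t s') (integrable_ou_cov t s)).
Qed.

Lemma integrable_increment t s : mu.-integrable pos (EFin \o (fun xi : n.-tuple R =>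
  ou_cov kappa (freq xi) t t + ou_cov kappa (freq xi) s s - 2 * ou_cov kappa (freq xi) t s)).
Proof.
have mp := measurable_pos_freq.
have i1 := integrable_ou_cov t t; have i2 := integrable_ou_cov s s; have i3 := integrable_ou_cov t s.
exact: (integrableB mp (integrableD mp i1 i2) (integrableZl mp 2 i3)).
Qed.

Lemma integrable_increments t t' s s' : mu.-integrable pos (EFin \o (fun xi : n.-tuple R =>
  ou_cov kappa (freq xi) t' s' - ou_cov kappa (freq xi) t' s - ou_cov kappa (freq xi) t s' + ou_cov kappa (freq xi) t s)).
Proof.
have mp := measurable_pos_freq.
have i1 := integrable_ou_cov t' s'; have i2 := integrable_ou_cov t' s.
have i3 := integrable_ou_cov t s'; have i4 := integrable_ou_cov t s.
exact: (integrableD mp (integrableB mp (integrableB mp i1 i2) i3) i4).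
Qed.

Lemma measurable_resolvent h q : measurable_fun setT (fun xi : n.-tuple R => (freq xi + h^-1) `^ (- q)).
Proof.
apply: (measurableT_comp (@measurable_powR _ _)); apply: measurable_funD => //.
exact: measurable_freq.
Qed.

Lemma integral_scaled_resolvent_le q : beta < q -> 0 < q -> exists2 C, 0 < C & forall h c, 0 < h -> 0 <= c ->
  (\int[mu]_xi (c * (2 `^ q * (freq xi + h^-1) `^ (- q)))%:E <= (c * (C * h `^ (q - beta)))%:E)%E.
Proof.
move=> bq q0; have [C C0 hC] := spectral_resolvent_le n1 alpha0 alphan amu bq.
have p2 : 0 < 2 `^ q :> R by exact: powR_gt0.
exists (2 `^ q * C) => [|h c h0 c0]; first exact: mulr_gt0.
have c2 : 0 <= c * 2 `^ q by rewrite mulr_ge0// ltW.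
under eq_integral do rewrite mulrA.
rewrite ge0_integralZl_real//; [|exact: measurable_resolvent|by move=> xi; exact: powR_ge0].
apply: (@le_trans _ _ ((c * 2 `^ q)%:E * (C * h `^ (q - beta))%:E)%E).
  by apply: lee_wpmul2l; [rewrite lee_fin|exact: hC].
by rewrite -EFinM lee_fin !mulrA.
Qed.

Lemma spectral_increment_le : exists2 C, 0 < C & forall t h, 0 <= t -> 0 < h ->
  spectral_cov (t + h) (t + h) + spectral_cov t t - 2 * spectral_cov (t + h) t <= C * h `^ (2 * H - beta).
Proof.
have k0 := hurst_kappa_gt0; have k1 := hurst_kappa_lt1; have b2 := spectral_exponent_lt.
have H20 : 0 < 2 * H by move: H12; lra.
have [C C0 hC] := integral_scaled_resolvent_le b2 H20.
have kc := kconst_gt0 k1.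
exists (2 * kconst kappa * C) => [|t h t0 h0]; first by rewrite !mulr_gt0.
rewrite spectral_cov_increment_eq -[leRHS]mulrA.
have c0 : 0 <= 2 * kconst kappa by rewrite mulr_ge0// ltW.
apply: Rintegral_pos_le (hC h _ h0 c0).
- exact: integrable_increment.
- by apply: measurable_funM => //; apply: measurable_funM => //; exact: measurable_resolvent.
- by move=> xi; rewrite mulr_ge0// mulr_ge0 ?powR_ge0.
move=> xi x0; apply: le_trans (ou_cov_increment_le k0 k1 x0 t0 h0) _.
rewrite ler_wpM2l// (_ : 2 - kappa = 2 * H); last by ring.
exact: min_le_resolvent.
Qed.

Lemma spectral_increments_far_le : exists2 C, 0 < C & forall t s h T, 0 <= s -> 0 < h -> 2 * h <= T -> s + T <= t ->
  spectral_cov (t + h) (s + h) - spectral_cov (t + h) s - spectral_cov t (s + h) + spectral_cov t s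
    <= C * T `^ (- kappa) * h `^ (2 - beta).
Proof.
have k0 := hurst_kappa_gt0; have k1 := hurst_kappa_lt1; have b2 := spectral_exponent_lt.
have b22 : beta < 2 by apply: lt_trans b2 _; move: H1; lra.
have [C C0 hC] := integral_scaled_resolvent_le b22 (ltr0Sn R 1).
have kc := kconst_gt0 k1.
exists ((4 + 2 * kconst kappa) * C) => [|t s h T s0 h0 hT sT]; first by rewrite mulr_gt0// addr_gt0// mulr_gt0.
have T0 : 0 < T by apply: lt_le_trans hT; rewrite mulr_gt0.
have c0 : 0 <= (4 + 2 * kconst kappa) * T `^ (- kappa).
  by rewrite mulr_ge0 ?powR_ge0// addr_ge0// mulr_ge0// ltW.
rewrite spectral_cov_increments_eq.
have -> : (4 + 2 * kconst kappa) * C * T `^ (- kappa) * h `^ (2 - beta) =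
  (4 + 2 * kconst kappa) * T `^ (- kappa) * (C * h `^ (2 - beta)) by ring.
apply: Rintegral_pos_le (hC h _ h0 c0).
- exact: integrable_increments.
- by apply: measurable_funM => //; apply: measurable_funM => //; exact: measurable_resolvent.
- by move=> xi; rewrite mulr_ge0// mulr_ge0 ?powR_ge0.
move=> xi x0; apply: le_trans (ou_cov_increments_far_le k0 k1 x0 s0 h0 hT sT) _.
rewrite ler_wpM2l// -powR_mulrn; last by rewrite ltW// lt_min h0 invr_gt0.
exact: min_le_resolvent.
Qed.

Lemma integrable_expR_freq w : 0 < w -> mu.-integrable pos (EFin \o (fun xi : n.-tuple R => expR (- (w * freq xi)))).
Proof.
move=> w0; have [c [C [_ _ h]]] := spectral_expR_bounds n1 alpha0 alphan amu.
have mp := measurable_pos_freq; have [_ hC] := h w w0.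
have me : measurable_fun setT (fun xi : n.-tuple R => expR (- (w * freq xi))).
  apply: (measurableT_comp (@measurable_expR _)); apply: measurable_funN.
  by apply: measurable_funM => //; exact: measurable_freq.
apply/integrableP; split; first by apply/measurable_EFinP; exact: measurable_funTS.
under eq_integral do rewrite /= ger0_norm ?expR_ge0//.
rewrite -integral_pos_freq; last 2 first.
- exact/measurable_EFinP.
- by move=> xi; rewrite lee_fin expR_ge0.
exact: le_lt_trans hC (ltry _).
Qed.

Lemma Rintegral_expR_freq_bounds : exists c C : R, [/\ 0 < c, 0 < C & forall w : R, 0 < w ->
  c * w `^ (- beta) <= \int[mu]_(xi in pos) expR (- (w * freq xi)) <= C * w `^ (- beta)].
Proof.
have [c [C [c0 C0 h]]] := spectral_expR_bounds n1 alpha0 alphan amu.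
exists c, C; split => // w w0; have [h1 h2] := h w w0.
have me : measurable_fun setT (fun xi : n.-tuple R => expR (- (w * freq xi))).
  apply: (measurableT_comp (@measurable_expR _)); apply: measurable_funN.
  by apply: measurable_funM => //; exact: measurable_freq.
have fi := integrable_fin_num measurable_pos_freq (integrable_expR_freq w0).
have E : (\int[mu]_(xi in pos) (expR (- (w * freq xi)))%:E = \int[mu]_xi (expR (- (w * freq xi)))%:E)%E.
  apply/esym/integral_pos_freq; first exact/measurable_EFinP.
  by move=> xi; rewrite lee_fin expR_ge0.
by rewrite -!lee_fin /Rintegral fineK// E h1.
Qed.

(** Integrating the difference of exponentials gives at least [c (2 h)^(-beta) - C (2 h + t /
    2)^(-beta)]. Since [t >= a], the second term stays bounded, and for small [h] it is at most half
    of the first. *)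
Lemma spectral_increment_ge a : 0 < a -> exists c h1 : R, [/\ 0 < c, 0 < h1 & forall t h, a <= t -> 0 < h -> h <= h1 ->
  c * h `^ (2 * H - beta) <= spectral_cov (t + h) (t + h) + spectral_cov t t - 2 * spectral_cov (t + h) t].
Proof.
move=> a0; have k0 := hurst_kappa_gt0; have k1 := hurst_kappa_lt1.
have b0 : 0 < beta by rewrite divr_gt0// subr_gt0.
have [c [C [c0 C0 h]]] := Rintegral_expR_freq_bounds.
pose e := (4 `^ kappa - 1) * expR (- 2) / 4 : R.
have e0 : 0 < e.
  have : 1 `^ kappa < (4 : R) `^ kappa by apply: gt0_ltr_powR; rewrite ?nnegrE// ltr1n.
  by rewrite powR1 => h4; rewrite divr_gt0// mulr_gt0 ?expR_gt0// subr_gt0.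
(* Solution of [C (a / 2)^(-beta) = (c / 2) h2^(-beta)]; it is compared with twice the increment
   length. *)
pose h2 := (c / (2 * C)) `^ beta^-1 * (a / 2).
have h20 : 0 < h2 by rewrite mulr_gt0 ?divr_gt0// powR_gt0// divr_gt0// mulr_gt0.
have h2b : h2 `^ beta = c / (2 * C) * (a / 2) `^ beta.
  rewrite /h2 powRM ?powR_ge0 ?divr_ge0 ?(ltW a0)// -powRrM mulVf ?lt0r_neq0// powRr1//.
  by rewrite divr_ge0 ?mulr_ge0 ?ltW.
exists (e * (c / 2 * 2 `^ (- beta))), (Num.min a (h2 / 2)); split.
- by apply: mulr_gt0 => //; rewrite mulr_gt0 ?divr_gt0// powR_gt0.
- by rewrite lt_min a0 divr_gt0.
move=> t r at_ r0; rewrite le_min => /andP[ra rh2].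
have t0 : 0 < t by apply: lt_le_trans at_.
have r20 : 0 < 2 * r by rewrite mulr_gt0.
have rt0 : 0 < 2 * r + t / 2 by rewrite addr_gt0// divr_gt0.
rewrite spectral_cov_increment_eq.
have mp := measurable_pos_freq.
have i1 := integrable_expR_freq r20; have i2 := integrable_expR_freq rt0.
pose E : R := e * r `^ (2 - kappa).
apply: (@le_trans _ _ (\int[mu]_(xi in pos) (E * (expR (- (2 * r * freq xi)) - expR (- ((2 * r + t / 2) * freq xi)))))); last first.
  apply: le_Rintegral => //; first exact: (integrableZl mp E (integrableB mp i1 i2)).
    exact: integrable_increment.
  by move=> xi xp; exact: (ou_cov_increment_ge k0 k1 xp r0 (le_trans ra at_)).
rewrite RintegralZl//; last exact: (integrableB mp i1 i2).
rewrite RintegralB//.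
have /andP[l1 _] := h _ r20; have /andP[_ l2] := h _ rt0.
have q1 : (2 * r) `^ (- beta) = 2 `^ (- beta) * r `^ (- beta) by rewrite powRM// ltW.
have q2 : C * (2 * r + t / 2) `^ (- beta) <= c / 2 * (2 * r) `^ (- beta).
  apply: (@le_trans _ _ (C * (a / 2) `^ (- beta))).
    rewrite ler_wpM2l ?(ltW C0)// !powRN lef_pV2 ?posrE ?powR_gt0 ?divr_gt0//.
    apply: ge0_ler_powR; rewrite ?nnegrE ?(ltW b0) ?(ltW rt0) ?divr_ge0 ?(ltW a0)//.
    by move: at_ r0 a0; lra.
  have : (2 * r) `^ beta <= h2 `^ beta.
    apply: ge0_ler_powR; rewrite ?nnegrE ?(ltW b0) ?(ltW h20) ?(ltW r20)//.
    by move: rh2; lra.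
  rewrite h2b !powRN => q3; have A0 : 0 < (a / 2) `^ beta by rewrite powR_gt0// divr_gt0.
  rewrite ler_pdivrMr// mulrAC ler_pdivlMr ?powR_gt0//.
  apply: le_trans (ler_wpM2l (ltW C0) q3) _.
  by rewrite le_eqVlt; apply/orP; left; apply/eqP; field; rewrite !lt0r_neq0.
have q4 : r `^ (2 * H - beta) = r `^ (2 - kappa) * r `^ (- beta).
  by rewrite -powRD ?lt0r_neq0 ?implybT//; congr powR; ring.
rewrite q4 (_ : _ * _ = E * (c / 2 * (2 * r) `^ (- beta))); last by rewrite q1 /E; ring.
apply: ler_wpM2l; first by rewrite mulr_ge0 ?powR_ge0 ?ltW.
have := lerB l1 l2; apply: le_trans; move: q2; lra.
Qed.

Lemma integral_fine d (T : measurableType d) (m : {measure set T -> \bar R}) (G : T -> \bar R) :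
  measurable_fun setT G -> (forall x, (0 <= G x)%E) -> (\int[m]_x G x < +oo)%E ->
  (\int[m]_x (fine (G x))%:E = \int[m]_x G x)%E.
Proof.
move=> mG G0 fG.
have iG : m.-integrable setT G.
  apply/integrableP; split => //; by under eq_integral do rewrite gee0_abs//.
apply: ae_eq_integral => //.
  by apply/measurable_EFinP; exact: (measurableT_comp (@fine_measurable R setT measurableT) mG).
by apply: filterS (integrable_ae measurableT iG) => x h _; rewrite fineK// h.
Qed.

Lemma cintegral_real d (T : measurableType d) (m : {measure set T -> \bar R}) (f : T -> R) :
  cintegral m (fun x => (f x)%:C%C) = (\int[m]_x f x)%:C%C.
Proof.
rewrite /cintegral /=; congr (_ +i* _)%C.
by rewrite /Rintegral integral0.
Qed.

(** The modulus of the Fourier transform is the nonnegative kernel itself, so the absolute variance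
    integral is the covariance at [(t, t)]. *)
Lemma wiener_integrable_mild t x : wiener_integrable H mu (mild_integrand t x).
Proof.
split; first exact: measurable_mild_integrand.
  apply: aeW => u; exact: (integrableZl measurableT (\1_`[0, t] u) (integrable_heat_kernel (t - u) x)).
rewrite (_ : (\int[_]_u _)%E = spectral_cov_ereal t t).
  by rewrite ltey_eq spectral_cov_fin.
rewrite /spectral_cov_ereal -(kform_mixture kappa t t (tempered_sigma_finite tmu)).
apply: eq_integral => u _; apply: eq_integral => v _; congr (_ * _)%E.
apply: eq_integral => xi _; congr (_ * _)%:E; exact: normc_fourier_mild.
Qed.

Local Notation mix t s := (fun u v => (\int[mu]_xi (ou xi t u * ou xi s v)%:E)%E).

(** Unless a kernel vanishes, [u < t] and [v < s], and the integrand is at most an exponential of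
    positive rate in [freq]. Finiteness at every pair of times is needed because [cintegral] takes
    real parts of the inner integral. *)
Lemma mixture_fin t s u v : mix t s u v \is a fin_num.
Proof.
have mf := @measurable_freq R n.
rewrite ge0_fin_numE; last by apply: integral_ge0 => xi _; rewrite lee_fin mulr_ge0 ?ou_kernel_ge0.
have [tu|ut] := leP t u.
  by rewrite integral0_eq// => xi _; rewrite ou_kernel_gt// mul0r.
have [sv|vs] := leP s v.
  by rewrite integral0_eq// => xi _; rewrite [X in _ * X]ou_kernel_gt// mulr0.
have w0 : 0 < (t - u) + (s - v) by rewrite addr_gt0// subr_gt0.
have [c [C [_ _ h]]] := spectral_expR_bounds n1 alpha0 alphan amu.
have [_ hC] := h _ w0; apply: le_lt_trans (le_lt_trans hC (ltry _)).
apply: ge0_le_integral => //.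
- by move=> xi _; rewrite lee_fin mulr_ge0 ?ou_kernel_ge0.
- by apply/measurable_EFinP; apply: measurable_funM; apply: measurable_ou_comp.
- apply/measurable_EFinP; apply: (measurableT_comp (@measurable_expR _)); apply: measurable_funN.
  exact: measurable_funM.
move=> xi _; rewrite lee_fin /ou_kernel.
rewrite (_ : - ((t - u + (s - v)) * freq xi) = - (freq xi * (t - u)) + - (freq xi * (s - v))); last by ring.
rewrite expRD; apply: ler_pM; rewrite ?mulr_ge0 ?expR_ge0// -[leRHS]mul1r ler_wpM2r ?expR_ge0// indicE.
all: by case: (_ \in _); rewrite ?lexx ?ler01.
Qed.

Lemma measurable_mixture t s : measurable_fun setT (fun p : R * R => mix t s p.1 p.2).
Proof.
have mf := @measurable_freq R n.
apply: (measurable_int2 (sf_measure (tempered_sigma_finite tmu))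
  (f := fun (p : R * R) xi => ou xi t p.1 * ou xi s p.2)).
  apply: measurable_funM; apply: measurable_ou_comp.
  - exact: (measurableT_comp mf measurable_snd).
  - exact: (measurableT_comp measurable_fst measurable_fst).
  - exact: (measurableT_comp mf measurable_snd).
  - exact: (measurableT_comp measurable_snd measurable_fst).
by move=> p xi; rewrite mulr_ge0 ?ou_kernel_ge0.
Qed.

(** The nested complex integrals are real by [fourier_mild_conj]; each layer is matched with its
    extended-real version, the innermost being finite everywhere and the middle one almost
    everywhere. *)
Lemma noise_covariance_mild t s x :
  noise_covariance H mu (mild_integrand t x) (mild_integrand s x) =
  (alphaH H * (2 * pi) `^ (- n%:R) * spectral_cov t s)%:C%C.
Proof.
pose G u := (\int[leb]_v ((hker kappa (u - v))%:E * mix t s u v))%E.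
have f0 (p : R * R) : (0 <= (hker kappa (p.1 - p.2))%:E * mix t s p.1 p.2)%E.
  by rewrite mule_ge0 ?lee_fin ?hker_ge0// integral_ge0// => xi _; rewrite lee_fin mulr_ge0 ?ou_kernel_ge0.
have mG : measurable_fun setT G.
  apply: (measurable_fun_fubini_tonelli_F (m2 := leb) (fun p : R * R => ((hker kappa (p.1 - p.2))%:E * mix t s p.1 p.2)%E) _ f0).
  apply: emeasurable_funM; last exact: measurable_mixture.
  by apply/measurable_EFinP; apply: measurable_hker; exact: measurable_funB.
have G0 u : (0 <= G u)%E by apply: integral_ge0 => v _; exact: (f0 (u, v)).
have iG : (\int[leb]_u G u = spectral_cov_ereal t s)%E.
  exact: (kform_mixture kappa t s (tempered_sigma_finite tmu)).
rewrite /noise_covariance [RHS]rmorphM; congr (_ * _).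
transitivity (cintegral leb (fun u => (fine (G u))%:C%C)).
  congr cintegral; apply/funext => u.
  transitivity (cintegral leb (fun v => (hker kappa (u - v) * fine (mix t s u v))%:C%C)).
    congr cintegral; apply/funext => v.
    rewrite [RHS]rmorphM; congr (_ * _).
    apply: etrans (cintegral_real mu (fun xi => ou xi t u * ou xi s v)).
    by congr cintegral; apply/funext => xi; rewrite fourier_mild_conj.
  rewrite cintegral_real; congr (_ %:C)%C; rewrite /Rintegral /G; congr fine.
  by apply: eq_integral => v _; rewrite EFinM fineK// mixture_fin.
rewrite cintegral_real; congr (_ %:C)%C; rewrite /Rintegral integral_fine//.
  by rewrite iG -spectral_covE.
by rewrite iG ltey_eq spectral_cov_fin.
Qed.

End spectral_covariance.

(** * Concentration of Gaussian maxima *)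

Lemma layer_cake {R : realType} (y : R) : 0 <= y ->
  (\int[@lebesgue_measure R]_r (\1_`[0, y[ r)%:E)%E = y%:E.
Proof.
move=> y0; rewrite integral_indic; [|by []|exact: measurable_itv]; rewrite setIT.
transitivity (@lebesgue_measure R `[0, y[%classic) => //.
rewrite lebesgue_measure_itv/= lte_fin; move: y0; rewrite le_eqVlt => /predU1P[<-|y0].
  by rewrite ltxx.
by rewrite y0 sube0.
Qed.

Lemma measurable_layer {R : realType} d (T : measurableType d) (f : T -> R) (a : T -> R) :
  measurable_fun setT f -> measurable_fun setT a ->
  measurable_fun setT (fun q => \1_`[0, f q[ (a q) : R).
Proof.
move=> mf ma.
have -> : (fun q => \1_`[0, f q[ (a q) : R) = (fun q => if (0 <= a q) && (a q < f q) then 1 else 0).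
  apply/funext => q; rewrite indicE; case: ifPn => h.
    by rewrite mem_set//= in_itv.
  by rewrite memNset//= in_itv/=; exact/negP.
apply: measurable_fun_ifT => //; apply: measurable_and.
  by apply: measurable_fun_ler.
by apply: measurable_fun_ltr.
Qed.

(** The law is known on sets only. The layer cake formula writes [f (X x)] as an integral of
    indicators of superlevel sets, and Tonelli reduces the claim to these sets. *)
Lemma integral_law_density {R : realType} d1 d2 (T1 : measurableType d1) (T2 : measurableType d2)
  (m1 : {sigma_finite_measure set T1 -> \bar R}) (m2 : {sigma_finite_measure set T2 -> \bar R})
  (X : T1 -> T2) (g f : T2 -> R) :
  measurable_fun setT X -> measurable_fun setT g -> (forall y, 0 <= g y) ->
  (forall A, measurable A -> m1 (X @^-1` A) = (\int[m2]_(y in A) (g y)%:E)%E) ->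
  measurable_fun setT f -> (forall y, 0 <= f y) ->
  (\int[m1]_x (f (X x))%:E = \int[m2]_y (f y * g y)%:E)%E.
Proof.
move=> mX mg g0 m12 mf f0.
have ml d (T : measurableType d) (h : T -> R) : measurable_fun setT h ->
    measurable_fun setT (fun p : T * R => \1_`[0, h p.1[ p.2 : R).
  by move=> mh; apply: measurable_layer; [exact: (measurableT_comp mh)|exact: measurable_snd].
have mfX : measurable_fun setT (fun x => f (X x)) by exact: (measurableT_comp mf).
have l0 (y r : R) : 0 <= \1_`[0, y[ r :> R by [].
transitivity (\int[m1]_x \int[@lebesgue_measure R]_r (\1_`[0, f (X x)[ r)%:E)%E.
  by apply: eq_integral => x _; rewrite layer_cake.
rewrite (tonelli m1 (@lebesgue_measure R) (f := fun x r => \1_`[0, f (X x)[ r) (ml _ _ _ mfX) (fun x => l0 _)).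
transitivity (\int[@lebesgue_measure R]_r \int[m2]_y (\1_`[0, f y[ r * g y)%:E)%E.
  apply: eq_integral => r _.
  pose A := [set y | r \in `[0, f y[].
  have E y : \1_`[0, f y[ r = \1_A y :> R.
    by rewrite !indicE; congr (_%:R); apply/idP/idP; rewrite !inE.
  have mA : measurable A.
    have -> : A = setT `&` (fun y => \1_`[0, f y[ r : R) @^-1` [set 1].
      apply/seteqP; split => y; rewrite /= E indicE.
        by move=> h; split => //; rewrite mem_set.
      move=> [_]; case: (boolP (y \in A)) => [/[!inE]//|_ /eqP].
      by rewrite eq_sym oner_eq0.
    have mlr : measurable_fun setT (fun y => \1_`[0, f y[ r : R) by apply: measurable_layer.
    exact: mlr.
  have EX x : \1_`[0, f (X x)[ r = \1_(X @^-1` A) x :> R.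
    by rewrite E !indicE; congr (_%:R); apply/idP/idP; rewrite !inE.
  have mXA : measurable (X @^-1` A) by rewrite -[X in measurable X]setTI; exact: mX.
  under eq_integral do rewrite EX.
  rewrite integral_indic// setIT; apply: etrans (m12 A mA) _.
  rewrite integral_mkcond; apply: eq_integral => y _.
  by rewrite E patchE indicE; case: (y \in A); rewrite ?mul1r ?mul0r.
rewrite -(tonelli m2 (@lebesgue_measure R) (f := fun y r => \1_`[0, f y[ r * g y)); last 2 first.
- by apply: measurable_funM; [exact: ml|exact: (measurableT_comp mg)].
- by move=> y r; rewrite mulr_ge0.
apply: eq_integral => y _; under eq_integral do rewrite mulrC.
have mi : measurable_fun setT (fun r : R => \1_`[0, f y[ r : R).
  by apply: measurable_indic; exact: measurable_itv.
rewrite (ge0_integralZl_real (@lebesgue_measure R) (g0 y) mi (l0 _)).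
by rewrite layer_cake// -EFinM mulrC.
Qed.

Lemma tangent_algebra_lt {R : realFieldType} (S M a : R) : 0 < a ->
  S <= a * S + (1 - a) * (1 + a) / (2 * a ^+ 2) * M ->
  (1 - a) * (S * (2 * a ^+ 2)) <= (1 - a) * (M * (1 + a)).
Proof.
move=> a0; rewrite -subr_ge0 => h.
have a2 : 0 <= 2 * a ^+ 2 by rewrite mulr_ge0// exprn_ge0// ltW.
have := mulr_ge0 h a2; rewrite -[in X in _ -> X]subr_ge0; congr (0 <= _).
by field; exact: lt0r_neq0.
Qed.

Lemma tangent_algebra_gt {R : realFieldType} (S M a : R) : 0 < a ->
  S + (a - 1) * (1 + a) / (2 * a ^+ 2) * M <= a * S ->
  (a - 1) * (M * (1 + a)) <= (a - 1) * (S * (2 * a ^+ 2)).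
Proof.
move=> a0; rewrite -subr_ge0 => h.
have a2 : 0 <= 2 * a ^+ 2 by rewrite mulr_ge0// exprn_ge0// ltW.
have := mulr_ge0 h a2; rewrite -[in X in _ -> X]subr_ge0; congr (0 <= _).
by field; exact: lt0r_neq0.
Qed.

Lemma integral_addZ {R : realType} d (T : measurableType d) (m : {measure set T -> \bar R})
  (c : R) (f g : T -> R) : 0 <= c -> measurable_fun setT f -> measurable_fun setT g ->
  (forall x, 0 <= f x) -> (forall x, 0 <= g x) ->
  (\int[m]_x (f x + c * g x)%:E = \int[m]_x (f x)%:E + c%:E * \int[m]_x (g x)%:E)%E.
Proof.
move=> c0 mf mg f0 g0; rewrite -(ge0_integralZl_real m c0 mg g0).
rewrite -ge0_integralD//; last 4 first.
- by move=> x _; rewrite lee_fin.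
- exact/measurable_EFinP.
- by move=> x _; rewrite lee_fin mulr_ge0.
- by apply/measurable_EFinP; exact: measurable_funM.
Qed.

(** * Moments and characteristic functions of centered Gaussian variables *)

Section gaussian.
Context {R : realType}.
Local Notation leb := (@lebesgue_measure R).
Local Notation S2pi := (Num.sqrt (2 * pi) : R).
Local Notation g := (fun y : R => expR (- (y ^+ 2 / 2))).

Lemma sqrt2pi_gt0 : 0 < S2pi. Proof. by rewrite sqrtr_gt0 mulr_gt0// pi_gt0. Qed.

Lemma measurable_gauss_exp (c : R) : measurable_fun setT (fun y : R => expR (- (c * y ^+ 2))).
Proof.
apply: (measurableT_comp (@measurable_expR _)); apply: measurable_funN.
by apply: measurable_funM => //; exact: measurable_funX.
Qed.

Lemma integral_gauss_scaled (a : R) : 0 < a ->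
  (\int[leb]_y (expR (- ((2 * a ^+ 2)^-1 * y ^+ 2)))%:E = (a * S2pi)%:E)%E.
Proof.
move=> a0; have c0 : 0 < (2 * a ^+ 2)^-1 by rewrite invr_gt0 mulr_gt0// exprn_gt0.
have := integral_gauss 0 c0; under eq_integral do rewrite subr0; move=> ->; congr EFin.
rewrite invrK (_ : pi * _ = a ^+ 2 * (2 * pi)); last by ring.
by rewrite sqrtrM ?sqr_ge0// sqrtr_sqr gtr0_norm.
Qed.

Lemma integral_gauss1 : (\int[leb]_y (g y)%:E = S2pi%:E)%E.
Proof.
have := integral_gauss_scaled (ltr01 : 0 < 1 :> R); rewrite mul1r => <-.
by apply: eq_integral => y _; rewrite expr1n mulr1 mulrC.
Qed.

Lemma measurable_square_gauss : measurable_fun setT (fun y : R => y ^+ 2 * g y).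
Proof.
apply: measurable_funM; first exact: measurable_funX.
have := measurable_gauss_exp 2^-1; congr measurable_fun.
by apply/funext => y; rewrite mulrC.
Qed.

Lemma measurable_gauss_weight1 : measurable_fun setT g.
Proof.
have := measurable_gauss_exp 2^-1; congr measurable_fun.
by apply/funext => y; rewrite mulrC.
Qed.

Lemma gauss_square_fin : (\int[leb]_y (y ^+ 2 * g y)%:E < +oo)%E.
Proof.
have c0 : 0 < 4^-1 :> R by rewrite invr_gt0.
apply: (@le_lt_trans _ _ (\int[leb]_y (4 * expR (- (4^-1 * (y - 0) ^+ 2)))%:E)%E).
  apply: ge0_le_integral => //.
  - by move=> y _; rewrite lee_fin mulr_ge0 ?sqr_ge0 ?expR_ge0.
  - by apply/measurable_EFinP; exact: measurable_square_gauss.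
  - apply/measurable_EFinP; apply: measurable_funM => //.
    by under eq_fun do rewrite subr0; exact: measurable_gauss_exp.
  move=> y _; rewrite lee_fin subr0.
  have -> : g y = expR (- (4^-1 * y ^+ 2)) * expR (- (4^-1 * y ^+ 2)).
    by rewrite -expRD; congr expR; field.
  rewrite mulrA ler_wpM2r ?expR_ge0// expRN ler_pdivrMr ?expR_gt0//.
  have := expR_ge1Dx (4^-1 * y ^+ 2); lra.
under eq_integral do rewrite subr0.
rewrite (ge0_integralZl_real leb (ler0n R 4) (measurable_gauss_exp 4^-1) (fun y => expR_ge0 _)).
rewrite (_ : (\int[leb]_x _)%E = (Num.sqrt (pi / 4^-1))%:E).
  by rewrite -EFinM ltry.
by rewrite -(integral_gauss 0 c0); apply: eq_integral => y _; rewrite subr0.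
Qed.

(** The inequality [exp z >= 1 + z], multiplied by the standard Gaussian weight; the sign of [k]
    changes at [a = 1]. *)
Lemma gauss_tangent (a y : R) : 0 < a ->
  g y - (a ^- 2 - 1) / 2 * (y ^+ 2 * g y) <= expR (- ((2 * a ^+ 2)^-1 * y ^+ 2)).
Proof.
move=> a0; set k := (a ^- 2 - 1) / 2.
have -> : expR (- ((2 * a ^+ 2)^-1 * y ^+ 2)) = g y * expR (- (k * y ^+ 2)).
  by rewrite -expRD /k; congr expR; field; exact: lt0r_neq0.
rewrite (_ : g y - k * (y ^+ 2 * g y) = g y * (1 + - (k * y ^+ 2))); last by ring.
by rewrite ler_wpM2l ?expR_ge0// expR_ge1Dx.
Qed.

(** Integrating [gauss_tangent] gives [a S >= S - (a^(-2) - 1) / 2 * M] for all [a > 0], with [S]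
    the Gaussian mass and [M] the second moment. After cancelling [1 - a], values of [a] just below
    1 force [M >= S] and values just above 1 force [M <= S]. *)
Lemma gauss_second_moment : (\int[leb]_y (y ^+ 2 * g y)%:E = S2pi%:E)%E.
Proof.
have mq := measurable_square_gauss; have mg := measurable_gauss_weight1.
have q0 y : 0 <= y ^+ 2 * g y by rewrite mulr_ge0 ?sqr_ge0 ?expR_ge0.
have S0 := sqrt2pi_gt0.
have Mf : (\int[leb]_y (y ^+ 2 * g y)%:E)%E \is a fin_num.
  by rewrite ge0_fin_numE ?gauss_square_fin// integral_ge0// => y _; rewrite lee_fin.
rewrite -(fineK Mf); set M := fine _; congr EFin.
have ME : (\int[leb]_y (y ^+ 2 * g y)%:E = M%:E)%E by rewrite fineK.
have M0 : 0 <= M by rewrite /M fine_ge0// integral_ge0// => y _; rewrite lee_fin.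
have hA a : 0 < a -> a < 1 -> S2pi * (2 * a ^+ 2) <= M * (1 + a).
  move=> a0 a1.
  have k0 : 0 <= (a ^- 2 - 1) / 2.
    by rewrite divr_ge0// subr_ge0 -exprVn exprn_ege1// invf_ge1// ltW.
  have : S2pi <= a * S2pi + (a ^- 2 - 1) / 2 * M.
    rewrite -lee_fin -integral_gauss1 EFinD [X in (_ + X)%E]EFinM -integral_gauss_scaled// -ME.
    rewrite -(integral_addZ leb k0 (measurable_gauss_exp _) mq (fun y => expR_ge0 _) q0).
    apply: ge0_le_integral => //.
    - exact/measurable_EFinP.
    - apply/measurable_EFinP; apply: measurable_funD; first exact: measurable_gauss_exp.
      exact: measurable_funM.
    - by move=> y _; rewrite lee_fin; have := gauss_tangent y a0; rewrite lerBlDr.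
  have e : (a ^- 2 - 1) / 2 = (1 - a) * (1 + a) / (2 * a ^+ 2) by field; exact: lt0r_neq0.
  by rewrite e => /(tangent_algebra_lt a0); rewrite ler_pM2l// subr_gt0.
have hB a : 1 < a -> M * (1 + a) <= S2pi * (2 * a ^+ 2).
  move=> a1; have a0 : 0 < a by apply: lt_trans a1.
  have k0 : 0 <= - ((a ^- 2 - 1) / 2).
    by rewrite -mulNr opprB divr_ge0// subr_ge0 -exprVn exprn_ile1 ?invr_ge0 ?invf_le1 ?ltW.
  have : S2pi + - ((a ^- 2 - 1) / 2) * M <= a * S2pi.
    rewrite -lee_fin -(integral_gauss_scaled a0) EFinD [X in (_ + X <= _)%E]EFinM -ME -integral_gauss1.
    rewrite -(integral_addZ leb k0 mg mq (fun y => expR_ge0 _) q0).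
    apply: ge0_le_integral => //.
    - by move=> y _; rewrite lee_fin addr_ge0 ?expR_ge0// mulr_ge0.
    - apply/measurable_EFinP; apply: measurable_funD => //; exact: measurable_funM.
    - by apply/measurable_EFinP; exact: measurable_gauss_exp.
    - by move=> y _; rewrite lee_fin mulNr; exact: gauss_tangent.
  have e : (a ^- 2 - 1) / 2 = - ((a - 1) * (1 + a) / (2 * a ^+ 2)) by field; exact: lt0r_neq0.
  by rewrite e opprK => /(tangent_algebra_gt a0); rewrite ler_pM2l// subr_gt0.
apply/eqP; rewrite eq_le; apply/andP; split.
- rewrite leNgt; apply/negP => SM.
  have [r r1 rM] : exists2 r, 1 < r & S2pi * r ^+ 2 < M.
    pose q := M / S2pi; have q1 : 1 < q by rewrite ltr_pdivlMr// mul1r.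
    exists (Num.sqrt ((1 + q) / 2)).
      by rewrite -[ltLHS]sqrtr1 ltr_sqrt; move: q1; lra.
    rewrite sqr_sqrtr; last by move: q1; lra.
    have -> : S2pi * ((1 + q) / 2) = (S2pi + M) / 2 by rewrite /q; field; exact: lt0r_neq0.
    by move: SM; lra.
  have h2 : M * 2 <= M * (1 + r) by apply: ler_wpM2l => //; lra.
  have := le_trans h2 (hB r r1); rewrite [X in _ <= X]mulrCA mulrC ler_pM2l// leNgt.
  by rewrite rM.
- rewrite leNgt; apply/negP => MS.
  have [r /andP[r0 r1] rM] : exists2 r, 0 < r < 1 & M < S2pi * r ^+ 2.
    pose q := M / S2pi; have q1 : q < 1 by rewrite ltr_pdivrMr// mul1r.
    have q0' : 0 <= q by rewrite divr_ge0// ltW.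
    exists (Num.sqrt ((1 + q) / 2)).
      by rewrite sqrtr_gt0 -[X in _ && (_ < X)]sqrtr1 ltr_sqrt//; apply/andP; split; move: q1 q0'; lra.
    rewrite sqr_sqrtr; last by move: q0'; lra.
    have -> : S2pi * ((1 + q) / 2) = (S2pi + M) / 2 by rewrite /q; field; exact: lt0r_neq0.
    by move: MS; lra.
  have h2 : M * (1 + r) <= M * 2 by apply: ler_wpM2l => //; lra.
  have := le_trans (hA r r0 r1) h2; rewrite [X in X <= _]mulrCA [X in _ <= X]mulrC ler_pM2l// leNgt.
  by rewrite rM.
Qed.

Section law.
Context d (T : measurableType d) (P : probability T R).

Lemma gaussian_expectation_ge0 (X : T -> R) (s : R) (f : R -> R) : 0 < s ->
  measurable_fun setT X ->
  (forall A : set R, measurable A -> P (X @^-1` A) = normal_prob 0 s A) ->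
  measurable_fun setT f -> (forall y, 0 <= f y) ->
  (\int[P]_w (f (X w))%:E = (S2pi^-1)%:E * \int[leb]_y (f (s * y) * g y)%:E)%E.
Proof.
move=> s0 mX law mf f0.
pose p y := normal_pdf 0 s y.
have p0 y : 0 <= p y by exact: normal_pdf_ge0.
have mp : measurable_fun setT p by exact: measurable_normal_pdf.
rewrite (integral_law_density (m2 := leb) mX mp p0 law mf f0).
pose h y := (f y * p y)%:E.
have mh : measurable_fun setT h by apply/measurable_EFinP; exact: measurable_funM.
have h0 y : (0 <= h y)%E by rewrite lee_fin mulr_ge0.
have := ge0_integral_affine 0 s0 mh h0.
move=> /(congr1 (fun z => s%:E * z))%E; rewrite muleA -EFinM divff ?lt0r_neq0// mul1e => <-.
have mfs : measurable_fun setT (fun y : R => f (s * y)).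
  by apply: (measurableT_comp mf); exact: measurable_funM.
have hs0 y : (0 <= h (s * y + 0)%R)%E by exact: h0.
have mh' : measurable_fun setT (fun y : R => h (s * y + 0)).
  by apply: (measurableT_comp mh); apply: measurable_funD => //; exact: measurable_funM.
rewrite -(ge0_integralZl leb measurableT mh' (fun y _ => hs0 y))//; last by rewrite lee_fin ltW.
have mfg : measurable_fun setT (fun y : R => f (s * y) * g y).
  by apply: measurable_funM => //; exact: measurable_gauss_weight1.
have fg0 y : 0 <= f (s * y) * g y by rewrite mulr_ge0 ?expR_ge0.
have S0 : 0 <= S2pi^-1 by rewrite invr_ge0 ltW// sqrt2pi_gt0.
rewrite -(ge0_integralZl_real leb S0 mfg fg0).
apply: eq_integral => y _; rewrite /h /p addr0 -!EFinM; congr EFin.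
rewrite /normal_pdf (negbTE (lt0r_neq0 s0)) /normal_peak /normal_fun.
have -> : Num.sqrt (s ^+ 2 * pi *+ 2) = s * S2pi.
  rewrite (_ : s ^+ 2 * pi *+ 2 = s ^+ 2 * (2 * pi)); last by rewrite -mulr_natr; ring.
  by rewrite sqrtrM ?sqr_ge0// sqrtr_sqr gtr0_norm.
have -> : - (s * y - 0) ^+ 2 / (s ^+ 2 *+ 2) = - (y ^+ 2 / 2).
  by rewrite subr0 -[s ^+ 2 *+ 2]mulr_natr; field; exact: lt0r_neq0.
have := lt0r_neq0 sqrt2pi_gt0; set q := S2pi => q0.
by field; rewrite q0 lt0r_neq0.
Qed.

Lemma gaussian_square (X : T -> R) (s : R) : 0 < s -> measurable_fun setT X ->
  (forall A : set R, measurable A -> P (X @^-1` A) = normal_prob 0 s A) ->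
  (\int[P]_w (X w ^+ 2)%:E = (s ^+ 2)%:E)%E.
Proof.
move=> s0 mX law.
rewrite (gaussian_expectation_ge0 s0 mX law (f := fun y => y ^+ 2)); last 2 first.
- exact: measurable_funX.
- by move=> y; exact: sqr_ge0.
have -> : (\int[leb]_y ((s * y) ^+ 2 * g y)%:E = (s ^+ 2)%:E * \int[leb]_y (y ^+ 2 * g y)%:E)%E.
  rewrite -(ge0_integralZl_real leb (sqr_ge0 s) measurable_square_gauss); last first.
    by move=> y; rewrite mulr_ge0 ?sqr_ge0 ?expR_ge0.
  by apply: eq_integral => y _; rewrite exprMn mulrA.
by rewrite gauss_second_moment -!EFinM mulrC mulfK// lt0r_neq0// sqrt2pi_gt0.
Qed.

Lemma gaussian_expR (X : T -> R) (s : R) : 0 < s -> measurable_fun setT X ->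
  (forall A : set R, measurable A -> P (X @^-1` A) = normal_prob 0 s A) ->
  (\int[P]_w (expR (X w))%:E = (expR (s ^+ 2 / 2))%:E)%E.
Proof.
move=> s0 mX law.
rewrite (gaussian_expectation_ge0 s0 mX law (f := expR))//.
have -> : (\int[leb]_y (expR (s * y) * g y)%:E = (expR (s ^+ 2 / 2) * S2pi)%:E)%E.
  have c0 : 0 < 2^-1 :> R by rewrite invr_gt0.
  have -> : S2pi = Num.sqrt (pi / 2^-1) by rewrite invrK mulrC.
  have mgs : measurable_fun setT (fun y : R => expR (- (2^-1 * (y - s) ^+ 2))).
    apply: (measurableT_comp (@measurable_expR _)); apply: measurable_funN.
    by apply: measurable_funM => //; apply: measurable_funX; exact: measurable_funB.
  rewrite EFinM -(integral_gauss s c0) -(ge0_integralZl_real leb (expR_ge0 _) mgs (fun y => expR_ge0 _)).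
  by apply: eq_integral => y _; rewrite -!expRD; congr (expR _)%:E; field.
by rewrite -EFinM mulrC mulfK// lt0r_neq0// sqrt2pi_gt0.
Qed.

Lemma bounded_integrable (f : T -> R) (K : R) : measurable_fun setT f -> (forall x, `|f x| <= K) ->
  P.-integrable setT (EFin \o f).
Proof.
move=> mf fK; apply: (@le_integrable _ _ _ P setT measurableT _ (cst K%:E)).
- exact/measurable_EFinP.
- by move=> x _; rewrite /= lee_fin (le_trans (fK x))// ler_norm.
- exact: finite_measure_integrable_cst.
Qed.

(** Adding 1 makes the function nonnegative and reduces the claim to [gaussian_expectation_ge0]. *)
Lemma gaussian_bounded (X : T -> R) (s : R) (f : R -> R) : 0 < s -> measurable_fun setT X ->
  (forall A : set R, measurable A -> P (X @^-1` A) = normal_prob 0 s A) ->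
  measurable_fun setT f -> (forall y, `|f y| <= 1) ->
  leb.-integrable setT (EFin \o (fun y => f (s * y) * g y)) ->
  \int[P]_w f (X w) = S2pi^-1 * \int[leb]_y (f (s * y) * g y).
Proof.
move=> s0 mX law mf f1 ifg.
have mg1 : measurable_fun setT (fun y => 1 + f y) by exact: measurable_funD.
have fp y : 0 <= 1 + f y by have := f1 y; rewrite ler_norml => /andP[]; lra.
have := gaussian_expectation_ge0 s0 mX law mg1 fp.
have ig : leb.-integrable setT (EFin \o g).
  apply/integrableP; split; first by apply/measurable_EFinP; exact: measurable_gauss_weight1.
  under eq_integral do rewrite /= ger0_norm ?expR_ge0//.
  by rewrite integral_gauss1 ltry.
have iS := integrableD measurableT ig ifg.
move=> /(congr1 fine).
rewrite [in X in _ = X -> _](_ : (\int[leb]_y _)%E = (\int[leb]_y (g y + f (s * y) * g y)%:E)%E); last first.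
  by apply: eq_integral => y _; rewrite mulrDl mul1r.
rewrite fineM//; last exact: (integrable_fin_num measurableT iS).
move=> E; have E1 : \int[P]_w (1 + f (X w)) = S2pi^-1 * \int[leb]_y (g y + f (s * y) * g y) by exact: E.
move: E1; rewrite RintegralD// mulrDr (_ : \int[leb]_y g y = S2pi); last by rewrite /Rintegral integral_gauss1.
rewrite mulVf ?lt0r_neq0 ?sqrt2pi_gt0// RintegralD//.
- by rewrite [X in X + _ = _](_ : _ = 1) => [/addrI//|]; rewrite /Rintegral integral_cst//= probability_setT mule1.
- exact: finite_measure_integrable_cst.
- by apply: (@bounded_integrable _ 1) => //; exact: (measurableT_comp mf mX).
Qed.

Lemma gaussian_cos (X : T -> R) (s : R) : 0 < s -> measurable_fun setT X ->
  (forall A : set R, measurable A -> P (X @^-1` A) = normal_prob 0 s A) ->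
  \int[P]_w cos (X w) = expR (- (s ^+ 2 / 2)).
Proof.
move=> s0 mX law; rewrite (gaussian_bounded s0 mX law (f := cos)).
- by rewrite cos_gauss mulKf// lt0r_neq0// sqrt2pi_gt0.
- by apply: continuous_measurable_fun; exact: continuous_cos.
- by move=> y; exact: cos_max.
- exact: integrable_cos_gauss.
Qed.

Lemma gaussian_sin (X : T -> R) (s : R) : 0 < s -> measurable_fun setT X ->
  (forall A : set R, measurable A -> P (X @^-1` A) = normal_prob 0 s A) ->
  \int[P]_w sin (X w) = 0.
Proof.
move=> s0 mX law; rewrite (gaussian_bounded s0 mX law (f := sin)).
- by rewrite sin_gauss mulr0.
- by apply: continuous_measurable_fun; exact: continuous_sin.
- by move=> y; exact: sin_max.
- exact: integrable_sin_gauss.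
Qed.

(** The degenerate law is included as variance 0, so that later arguments need no case
    distinction. *)
Lemma centered_gaussian_moments (X : T -> R) : measurable_fun setT X -> centered_gaussian P X ->
  exists v : R, [/\ 0 <= v, (\int[P]_w (X w ^+ 2)%:E = v%:E)%E,
    (\int[P]_w (expR (X w))%:E = (expR (v / 2))%:E)%E,
    \int[P]_w cos (X w) = expR (- (v / 2)) & \int[P]_w sin (X w) = 0].
Proof.
move=> mX [X0|[s s0 law]]; last first.
  exists (s ^+ 2); split; [exact: sqr_ge0|exact: gaussian_square|exact: gaussian_expR|
    exact: gaussian_cos|exact: (gaussian_sin s0 mX law)].
have ae0 (f : R -> R) : measurable_fun setT f -> (\int[P]_w (f (X w))%:E = (f 0)%:E)%E.
  move=> mf; transitivity (\int[P]_w (cst (f 0)%:E) w)%E.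
    apply: ae_eq_integral => //.
    - by apply/measurable_EFinP; exact: (measurableT_comp mf mX).
    - by apply: filterS X0 => w -> _.
  by rewrite integral_cst//= probability_setT mule1.
exists 0; split => //.
- by rewrite (ae0 (fun y => y ^+ 2)) ?expr0n//; exact: measurable_funX.
- by rewrite (ae0 expR)// mul0r.
- rewrite /Rintegral (ae0 cos) ?cos0 ?mul0r ?oppr0 ?expR0//.
  by apply: continuous_measurable_fun; exact: continuous_cos.
- rewrite /Rintegral (ae0 sin) ?sin0//.
  by apply: continuous_measurable_fun; exact: continuous_sin.
Qed.

End law.
End gaussian.

Section bounded_convergence.
Context {R : realType} d (T : measurableType d) (P : probability T R).

Definition bounded_measurable (G : T -> R) :=
  measurable_fun setT G /\ exists K : R, forall w, `|G w| <= K.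

Lemma bounded_measurable_integrable G : bounded_measurable G -> P.-integrable setT (EFin \o G).
Proof. by move=> [mG [K GK]]; exact: (bounded_integrable P mG GK). Qed.

Lemma bounded_measurableD G H : bounded_measurable G -> bounded_measurable H ->
  bounded_measurable (fun w => G w + H w).
Proof.
move=> [mG [K GK]] [mH [L HL]]; split; first exact: measurable_funD.
exists (K + L) => w; exact: le_trans (ler_normD _ _) (lerD (GK w) (HL w)).
Qed.

Lemma bounded_measurableM G H : bounded_measurable G -> bounded_measurable H ->
  bounded_measurable (fun w => G w * H w).
Proof.
move=> [mG [K GK]] [mH [L HL]]; split; first exact: measurable_funM.
by exists (K * L) => w; rewrite normrM ler_pM.
Qed.

Lemma bounded_measurable_cst c : bounded_measurable (fun=> c).
Proof. by split; [exact: measurable_cst|exists `|c|]. Qed.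

Lemma bounded_cvg_Rintegral (f : nat -> T -> R) (g : T -> R) (K : R) :
  (forall n, measurable_fun setT (f n)) -> (forall n w, `|f n w| <= K) ->
  (forall w, f ^~ w @ \oo --> g w) -> measurable_fun setT g ->
  \int[P]_w f n w @[n --> \oo] --> \int[P]_w g w.
Proof.
move=> mf fK fg mg.
have := @dominated_convergence _ T R P setT measurableT (fun n => EFin \o f n) (EFin \o g) (cst K%:E).
case.
- by move=> n; exact/measurable_EFinP.
- exact/measurable_EFinP.
- by apply: aeW => w _; apply: cvg_EFin (fg w); apply: nearW.
- exact: finite_measure_integrable_cst.
- by apply: aeW => w n _; rewrite /= lee_fin.
move=> ig _ h; apply: fine_cvg; rewrite /Rintegral fineK//.
exact: (integrable_fin_num measurableT ig).
Qed.

Lemma bounded_limit (f : nat -> T -> R) (g : T -> R) (K : R) :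
  (forall n, measurable_fun setT (f n)) -> (forall n w, `|f n w| <= K) ->
  (forall w, f ^~ w @ \oo --> g w) -> bounded_measurable g.
Proof.
move=> mf fK fg; split.
  by apply: (@measurable_fun_cvg _ _ _ setT f g) => // w _; exact: fg.
exists K => w; have h : `|f n w| @[n --> \oo] --> `|g w| by apply: cvg_norm; exact: fg.
by rewrite -(cvg_lim (@Rhausdorff R) h); apply: limr_le; [apply/cvg_ex; eexists; exact: h|exact: nearW].
Qed.

End bounded_convergence.

Lemma exp_series_bound {R : realType} (x K : R) (n : nat) : `|x| <= K ->
  `|series (exp_coeff x) n| <= expR K.
Proof.
move=> xK; have K0 : 0 <= K by apply: le_trans xK.
rewrite /series/=; apply: le_trans (ler_norm_sum _ _ _) _.
apply: (@le_trans _ _ (series (exp_coeff K) n)).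
  rewrite /series/=; apply: ler_sum => k _; rewrite /exp_coeff/= normrM normfV normrX.
  rewrite (ger0_norm (ler0n R _)) ler_wpM2r ?invr_ge0//.
  by apply: lerXn2r; rewrite ?nnegrE.
have nd : nondecreasing_seq (series (exp_coeff K)).
  apply: nondecreasing_series => k _ _; rewrite /exp_coeff/= divr_ge0// exprn_ge0//.
have := nondecreasing_cvgn_le nd (is_cvg_series_exp_coeff K) n.
by rewrite /expR.
Qed.

(** * Law of a Gaussian maximum from its linear combinations *)

Section cramer_wold.
Context {R : realType} d d' (T : measurableType d) (T' : measurableType d')
  (P : probability T R) (P' : probability T' R) (I : finType)
  (Z : I -> T -> R) (Z' : I -> T' -> R).
Hypotheses (mZ : forall i, measurable_fun setT (Z i)) (mZ' : forall i, measurable_fun setT (Z' i)).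

Definition lincomb (S : Type) (c : I -> R) (Y : I -> S -> R) (w : S) : R := \sum_i c i * Y i w.

Hypotheses (cosE : forall c, \int[P]_w cos (lincomb c Z w) = \int[P']_w cos (lincomb c Z' w))
  (sinE : forall c, \int[P]_w sin (lincomb c Z w) = \int[P']_w sin (lincomb c Z' w)).

(* [G] and [G'] stand for the same bounded function of [Z] and [Z'] *)
Definition agree (G : T -> R) (G' : T' -> R) :=
  [/\ bounded_measurable G, bounded_measurable G' &
    forall c, \int[P]_w (G w * cos (lincomb c Z w)) = \int[P']_w (G' w * cos (lincomb c Z' w)) /\
              \int[P]_w (G w * sin (lincomb c Z w)) = \int[P']_w (G' w * sin (lincomb c Z' w))].

(** [agree] is stable under linear combinations and bounded limits but not visibly under products.
    The functions that preserve it by multiplication form an algebra, also closed under bounded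
    limits, and applying them to the constant 1 recovers equality of means. *)
Definition multiplier (G : T -> R) (G' : T' -> R) :=
  [/\ bounded_measurable G, bounded_measurable G' &
    forall H H', agree H H' -> agree (fun w => G w * H w) (fun w => G' w * H' w)].

Lemma measurable_lincomb d0 (S : measurableType d0) c (Y : I -> S -> R) :
  (forall i, measurable_fun setT (Y i)) -> measurable_fun setT (lincomb c Y).
Proof. by move=> mY; apply: measurable_sum => i; exact: measurable_funM. Qed.

Lemma bounded_cos d0 (S : measurableType d0) (f : S -> R) : measurable_fun setT f ->
  bounded_measurable (fun w => cos (f w)).
Proof.
move=> mf; split; last by exists 1 => w; exact: cos_max.
by apply: (measurableT_comp (continuous_measurable_fun (@continuous_cos R))).
Qed.

Lemma bounded_sin d0 (S : measurableType d0) (f : S -> R) : measurable_fun setT f ->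
  bounded_measurable (fun w => sin (f w)).
Proof.
move=> mf; split; last by exists 1 => w; exact: sin_max.
by apply: (measurableT_comp (continuous_measurable_fun (@continuous_sin R))).
Qed.

Lemma lincombD (S : Type) c e (Y : I -> S -> R) w :
  lincomb (fun i => c i + e i) Y w = lincomb c Y w + lincomb e Y w.
Proof. by rewrite /lincomb -big_split; apply: eq_bigr => i _; rewrite mulrDl. Qed.

Lemma lincombN (S : Type) c (Y : I -> S -> R) w :
  lincomb (fun i => - c i) Y w = - lincomb c Y w.
Proof. by rewrite /lincomb -sumrN; apply: eq_bigr => i _; rewrite mulNr. Qed.

Lemma agree1 : agree (fun=> 1) (fun=> 1).
Proof.
split; [exact: bounded_measurable_cst..|move=> c].
by split; under eq_Rintegral do rewrite mul1r; under [RHS]eq_Rintegral do rewrite mul1r.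
Qed.

Lemma Rintegral_lin d0 (S : measurableType d0) (Q : probability S R) (a b : R) (f g : S -> R) :
  bounded_measurable f -> bounded_measurable g ->
  \int[Q]_w (a * f w + b * g w) = a * \int[Q]_w f w + b * \int[Q]_w g w.
Proof.
move=> bf bg.
have i1 := bounded_measurable_integrable Q bf.
have i2 := bounded_measurable_integrable Q bg.
have j1 := bounded_measurable_integrable Q (bounded_measurableM (bounded_measurable_cst _ a) bf).
have j2 := bounded_measurable_integrable Q (bounded_measurableM (bounded_measurable_cst _ b) bg).
by rewrite RintegralD// !RintegralZl.
Qed.

Lemma Rintegral_complement d0 (S : measurableType d0) (Q : probability S R) (f : S -> R) :
  bounded_measurable f -> ((1 - \int[Q]_w f w)%R%:E = \int[Q]_w (1 - f w)%:E)%E.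
Proof.
move=> bf; have b1 : bounded_measurable (fun=> 1 : R) := bounded_measurable_cst S 1.
have bg : bounded_measurable (fun w => 1 * 1 + (- 1) * f w).
  apply: bounded_measurableD; apply: bounded_measurableM => //; exact: bounded_measurable_cst.
have E := Rintegral_lin Q 1 (- 1) b1 bf.
have F : \int[Q]_w 1 = 1 by rewrite /Rintegral integral_cst//= probability_setT mule1.
rewrite F mulr1 mulN1r in E; rewrite mulr1 in bg; rewrite -E /Rintegral fineK; last first.
  exact: (integrable_fin_num measurableT (bounded_measurable_integrable Q bg)).
by apply: eq_integral => w _; rewrite ?mulr1 ?mul1r ?mulN1r.
Qed.

Lemma agree_lin a b G G' H H' : agree G G' -> agree H H' ->
  agree (fun w => a * G w + b * H w) (fun w => a * G' w + b * H' w).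
Proof.
move=> [bG bG' eG] [bH bH' eH].
have bc c : bounded_measurable (fun w => cos (lincomb c Z w)) by apply: bounded_cos; exact: measurable_lincomb.
have bs c : bounded_measurable (fun w => sin (lincomb c Z w)) by apply: bounded_sin; exact: measurable_lincomb.
have bc' c : bounded_measurable (fun w => cos (lincomb c Z' w)) by apply: bounded_cos; exact: measurable_lincomb.
have bs' c : bounded_measurable (fun w => sin (lincomb c Z' w)) by apply: bounded_sin; exact: measurable_lincomb.
have D x y z : (a * x + b * y) * z = a * (x * z) + b * (y * z) by ring.
split.
- by apply: bounded_measurableD; apply: bounded_measurableM => //; exact: bounded_measurable_cst.
- by apply: bounded_measurableD; apply: bounded_measurableM => //; exact: bounded_measurable_cst.
move=> c; have [e1 e2] := eG c; have [e3 e4] := eH c.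
split; under eq_Rintegral do rewrite D; under [RHS]eq_Rintegral do rewrite D.
- by rewrite !Rintegral_lin ?e1 ?e3//; exact: bounded_measurableM.
- by rewrite !Rintegral_lin ?e2 ?e4//; exact: bounded_measurableM.
Qed.

Lemma multiplier1 : multiplier (fun=> 1) (fun=> 1).
Proof.
split; [exact: bounded_measurable_cst..|move=> H H' a].
by under eq_fun do rewrite mul1r; under [X in agree _ X]eq_fun do rewrite mul1r.
Qed.

Lemma multiplier_lin a b G G' H H' : multiplier G G' -> multiplier H H' ->
  multiplier (fun w => a * G w + b * H w) (fun w => a * G' w + b * H' w).
Proof.
move=> [bG bG' eG] [bH bH' eH]; split.
- by apply: bounded_measurableD; apply: bounded_measurableM => //; exact: bounded_measurable_cst.
- by apply: bounded_measurableD; apply: bounded_measurableM => //; exact: bounded_measurable_cst.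
move=> F F' aF.
have D x y z : (a * x + b * y) * z = a * (x * z) + b * (y * z) by ring.
under eq_fun do rewrite D; under [X in agree _ X]eq_fun do rewrite D.
by apply: agree_lin; [exact: eG|exact: eH].
Qed.

Lemma multiplierM G G' H H' : multiplier G G' -> multiplier H H' ->
  multiplier (fun w => G w * H w) (fun w => G' w * H' w).
Proof.
move=> [bG bG' eG] [bH bH' eH]; split; [exact: bounded_measurableM..|move=> F F' aF].
under eq_fun do rewrite -mulrA; under [X in agree _ X]eq_fun do rewrite -mulrA.
by apply: eG; exact: eH.
Qed.

Lemma multiplierZ a G G' : multiplier G G' -> multiplier (fun w => a * G w) (fun w => a * G' w).
Proof.
move=> mG; have := multiplier_lin a 0 mG mG.
by under eq_fun do rewrite mul0r addr0; under [X in multiplier _ X]eq_fun do rewrite mul0r addr0.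
Qed.

Lemma multiplier_cst a : multiplier (fun=> a) (fun=> a).
Proof.
have := multiplierZ a multiplier1.
by under eq_fun do rewrite mulr1; under [X in multiplier _ X]eq_fun do rewrite mulr1.
Qed.

Lemma multiplierD G G' H H' : multiplier G G' -> multiplier H H' ->
  multiplier (fun w => G w + H w) (fun w => G' w + H' w).
Proof.
move=> mG mH; have := multiplier_lin 1 1 mG mH.
by under eq_fun do rewrite !mul1r; under [X in multiplier _ X]eq_fun do rewrite !mul1r.
Qed.

(** The product formulas turn [cos (c . Z)] times a test function of frequency [e] into test
    functions of frequencies [c + e] and [e - c]. *)
Lemma multiplier_cos c : multiplier (fun w => cos (lincomb c Z w)) (fun w => cos (lincomb c Z' w)).
Proof.
have bc e : bounded_measurable (fun w => cos (lincomb e Z w)) by apply: bounded_cos; exact: measurable_lincomb.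
have bs e : bounded_measurable (fun w => sin (lincomb e Z w)) by apply: bounded_sin; exact: measurable_lincomb.
have bc' e : bounded_measurable (fun w => cos (lincomb e Z' w)) by apply: bounded_cos; exact: measurable_lincomb.
have bs' e : bounded_measurable (fun w => sin (lincomb e Z' w)) by apply: bounded_sin; exact: measurable_lincomb.
split => // H H' [bH bH' eH]; split; [exact: bounded_measurableM..|move=> e].
pose p i := c i + e i; pose q i := e i + - c i.
have [p1 p2] := eH p; have [q1 q2] := eH q.
have C (S : Type) (Y : I -> S -> R) (h : S -> R) w : cos (lincomb c Y w) * h w * cos (lincomb e Y w) =
    2^-1 * (h w * cos (lincomb p Y w)) + 2^-1 * (h w * cos (lincomb q Y w)).
  by rewrite /p /q !lincombD lincombN !cosD cosN sinN; field.
have D (S : Type) (Y : I -> S -> R) (h : S -> R) w : cos (lincomb c Y w) * h w * sin (lincomb e Y w) =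
    2^-1 * (h w * sin (lincomb p Y w)) + 2^-1 * (h w * sin (lincomb q Y w)).
  by rewrite /p /q !lincombD lincombN !sinD cosN sinN; field.
split.
- under eq_Rintegral do rewrite (C T); under [RHS]eq_Rintegral do rewrite (C T').
  by rewrite !Rintegral_lin ?p1 ?q1//; exact: bounded_measurableM.
- under eq_Rintegral do rewrite (D T); under [RHS]eq_Rintegral do rewrite (D T').
  by rewrite !Rintegral_lin ?p2 ?q2//; exact: bounded_measurableM.
Qed.

Lemma agree_lim (G : nat -> T -> R) (G' : nat -> T' -> R) F F' K :
  (forall n, agree (G n) (G' n)) -> (forall n w, `|G n w| <= K) -> (forall n w, `|G' n w| <= K) ->
  (forall w, G ^~ w @ \oo --> F w) -> (forall w, G' ^~ w @ \oo --> F' w) -> agree F F'.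
Proof.
move=> aG GK GK' GF GF'.
have mG n : measurable_fun setT (G n) by have [[]] := aG n.
have mG' n : measurable_fun setT (G' n) by have [_ []] := aG n.
have bF := bounded_limit mG GK GF; have bF' := bounded_limit mG' GK' GF'.
have K0 : 0 <= K by have := GK 0%N point; apply: le_trans.
have key d0 (S : measurableType d0) (Q : probability S R) (f : nat -> S -> R) (g h : S -> R) :
    (forall n, measurable_fun setT (f n)) -> (forall n w, `|f n w| <= K) ->
    (forall w, f ^~ w @ \oo --> g w) -> measurable_fun setT h -> (forall w, `|h w| <= 1) ->
    \int[Q]_w (f n w * h w) @[n --> \oo] --> \int[Q]_w (g w * h w).
  move=> mf fK fg mh h1.
  apply: (@bounded_cvg_Rintegral _ _ _ Q _ _ K).
  - by move=> n; exact: measurable_funM.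
  - by move=> n w; rewrite normrM -[leRHS]mulr1 ler_pM.
  - by move=> w; apply: cvgMl; exact: fg.
  - by apply: measurable_funM => //; have [] := bounded_limit mf fK fg.
split => // c.
have mc d0 (S : measurableType d0) (Y : I -> S -> R) : (forall i, measurable_fun setT (Y i)) ->
    measurable_fun setT (fun w => cos (lincomb c Y w)).
  by move=> mY; have [] := bounded_cos (measurable_lincomb c mY).
have ms d0 (S : measurableType d0) (Y : I -> S -> R) : (forall i, measurable_fun setT (Y i)) ->
    measurable_fun setT (fun w => sin (lincomb c Y w)).
  by move=> mY; have [] := bounded_sin (measurable_lincomb c mY).
split.
- have h1 := key _ _ P G F _ mG GK GF (mc _ _ _ mZ) (fun w => cos_max _).
  have h2 := key _ _ P' G' F' _ mG' GK' GF' (mc _ _ _ mZ') (fun w => cos_max _).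
  have E : (fun n => \int[P]_w (G n w * cos (lincomb c Z w))) = (fun n => \int[P']_w (G' n w * cos (lincomb c Z' w))).
    by apply/funext => n; have [_ _ /(_ c)[]] := aG n.
  by rewrite E in h1; exact: (cvg_unique _ h1 h2).
- have h1 := key _ _ P G F _ mG GK GF (ms _ _ _ mZ) (fun w => sin_max _).
  have h2 := key _ _ P' G' F' _ mG' GK' GF' (ms _ _ _ mZ') (fun w => sin_max _).
  have E : (fun n => \int[P]_w (G n w * sin (lincomb c Z w))) = (fun n => \int[P']_w (G' n w * sin (lincomb c Z' w))).
    by apply/funext => n; have [_ _ /(_ c)[]] := aG n.
  by rewrite E in h1; exact: (cvg_unique _ h1 h2).
Qed.

Lemma multiplier_lim (G : nat -> T -> R) (G' : nat -> T' -> R) F F' K :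
  (forall n, multiplier (G n) (G' n)) -> (forall n w, `|G n w| <= K) -> (forall n w, `|G' n w| <= K) ->
  (forall w, G ^~ w @ \oo --> F w) -> (forall w, G' ^~ w @ \oo --> F' w) -> multiplier F F'.
Proof.
move=> aG GK GK' GF GF'.
have mG n : measurable_fun setT (G n) by have [[]] := aG n.
have mG' n : measurable_fun setT (G' n) by have [_ []] := aG n.
split; [exact: bounded_limit GF|exact: bounded_limit GF'|move=> H H' aH].
have [[_ [L HL]] [_ [L' HL']] _] := aH.
have K0 : 0 <= K by have := GK 0%N point; apply: le_trans.
apply: (@agree_lim (fun n w => G n w * H w) (fun n w => G' n w * H' w) _ _ (K * Num.max L L')).
- by move=> n; have [_ _] := aG n; exact.
- by move=> n w; rewrite normrM ler_pM// le_max HL.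
- by move=> n w; rewrite normrM ler_pM// le_max HL' orbT.
- by move=> w; apply: cvgMl; exact: GF.
- by move=> w; apply: cvgMl; exact: GF'.
Qed.

(** The partial sums of the exponential series are multipliers, uniformly bounded because [G] and
    [G'] are. *)
Lemma multiplier_expR G G' : multiplier G G' ->
  multiplier (fun w => expR (G w)) (fun w => expR (G' w)).
Proof.
move=> mG; have [[_ [K GK]] [_ [K' GK']] _] := mG.
have KK w : `|G w| <= Num.max K K' by rewrite le_max GK.
have KK' w : `|G' w| <= Num.max K K' by rewrite le_max GK' orbT.
have mpow n : multiplier (fun w => G w ^+ n) (fun w => G' w ^+ n).
  elim: n => [|n ih]; first exact: multiplier1.
  under eq_fun do rewrite exprS; under [X in multiplier _ X]eq_fun do rewrite exprS.
  exact: multiplierM.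
have mser n : multiplier (fun w => series (exp_coeff (G w)) n) (fun w => series (exp_coeff (G' w)) n).
  elim: n => [|n ih].
    rewrite /series/=; under eq_fun do rewrite big_geq//.
    by under [X in multiplier _ X]eq_fun do rewrite big_geq//; exact: multiplier_cst.
  rewrite /series/=; under eq_fun do rewrite big_nat_recr//=.
  under [X in multiplier _ X]eq_fun do rewrite big_nat_recr//=.
  apply: multiplierD; first exact: ih.
  rewrite /exp_coeff/=; under eq_fun do rewrite mulrC; under [X in multiplier _ X]eq_fun do rewrite mulrC.
  exact: multiplierZ.
apply: (multiplier_lim mser (K := expR (Num.max K K'))).
- by move=> n w; exact: exp_series_bound.
- by move=> n w; exact: exp_series_bound.
- by move=> w; exact: is_cvg_series_exp_coeff.
- by move=> w; exact: is_cvg_series_exp_coeff.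
Qed.

Lemma lincomb_single (S : Type) (Y : I -> S -> R) i c w :
  lincomb (fun j => if j == i then c else 0) Y w = c * Y i w.
Proof.
rewrite /lincomb (bigD1 i)//= eqxx big1 ?addr0// => j /negbTE ->.
by rewrite mul0r.
Qed.

(** Built from exponentials only, so that it maps multipliers to multipliers. As [c] grows it tends
    to a step, with the constant value [exp (-1)] at 0. *)
Definition soft_step (c y : R) : R := expR (- expR (c * y)).

Definition step_limit (y : R) : R := if y < 0 then 1 else if y == 0 then expR (- 1) else 0.

Lemma soft_step_bound c y : `|soft_step c y| <= 1.
Proof. by rewrite ger0_norm ?expR_ge0// -expR0 ler_expR oppr_le0 expR_ge0. Qed.

Lemma step_limit_bound y : `|step_limit y| <= 1.
Proof.
rewrite /step_limit; case: ifPn => _; first by rewrite normr1.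
case: ifPn => _; last by rewrite normr0 ler01.
by rewrite ger0_norm ?expR_ge0// -expR0 ler_expR oppr_le0.
Qed.

Lemma soft_step_cvg y : soft_step n%:R y @[n --> \oo] --> step_limit y.
Proof.
have geo (x : R) : x < 0 -> expR (n%:R * x) @[n --> \oo] --> 0.
  move=> x0; have -> : (fun n => expR (n%:R * x)) = (fun n => expR x ^+ n).
    by apply/funext => n; rewrite expRM_natl.
  by apply: cvg_expr; rewrite ger0_norm ?expR_ge0// -expR0 ltr_expR.
rewrite /soft_step /step_limit; have [y0|y0|->] := ltgtP y 0.
- rewrite -[X in _ --> X]expR0 -oppr0.
  have h : - expR (n%:R * y) @[n --> \oo] --> - 0 by apply: cvgN; exact: geo.
  exact: (cvg_comp _ _ h (@continuous_expR R (- 0))).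
- have ny : - y < 0 by rewrite oppr_lt0.
  apply: (squeeze_cvgr (f := fun=> 0) (h := fun n => expR (n%:R * - y))).
  + apply: nearW => n; rewrite expR_ge0 ler_expR mulrN lerN2 /=.
    by apply: le_trans (expR_ge1Dx _); rewrite lerDr.
  + exact: cvg_cst.
  + exact: geo.
- by under eq_fun do rewrite mulr0 expR0; exact: cvg_cst.
Qed.

Lemma multiplier_step i a L : multiplier (fun w => step_limit (a - cos (L^-1 * Z i w)))
  (fun w => step_limit (a - cos (L^-1 * Z' i w))).
Proof.
have mc : multiplier (fun w => cos (L^-1 * Z i w)) (fun w => cos (L^-1 * Z' i w)).
  have := multiplier_cos (fun j => if j == i then L^-1 else 0).
  by under eq_fun do rewrite lincomb_single; under [X in multiplier _ X]eq_fun do rewrite lincomb_single.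
have ms c : multiplier (fun w => soft_step c (a - cos (L^-1 * Z i w))) (fun w => soft_step c (a - cos (L^-1 * Z' i w))).
  apply: multiplier_expR.
  have E x : - expR (c * x) = - 1 * expR (c * x) by rewrite mulN1r.
  under eq_fun do rewrite E; under [X in multiplier _ X]eq_fun do rewrite E.
  apply/multiplierZ/multiplier_expR/multiplierZ.
  have := multiplier_lin 1 (- 1) (multiplier_cst a) mc.
  by under eq_fun do rewrite mul1r mulN1r; under [X in multiplier _ X]eq_fun do rewrite mul1r mulN1r.
apply: (multiplier_lim (fun n => ms n%:R) (K := 1)).
- by move=> n w; exact: soft_step_bound.
- by move=> n w; exact: soft_step_bound.
- by move=> w; exact: soft_step_cvg.
- by move=> w; exact: soft_step_cvg.
Qed.

(* the period 2 pi (n + 1) grows, so the cosine eventually separates [|z| <= a] from [|z| > a] *)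
Lemma cos_threshold_cvg (a z : R) : 0 <= a ->
  step_limit (cos (n.+1%:R^-1 * (a + n.+1%:R^-1)) - cos (n.+1%:R^-1 * z)) @[n --> \oo] --> ((`|z| <= a)%R%:R : R).
Proof.
move=> a0; have cz (x : R) : cos x = cos `|x| by case: (ger0P x) => // _; rewrite cosN.
apply: cvg_near_cst.
have big (M : R) : \forall n \near \oo, M <= n.+1%:R :> R.
  near=> n; apply: (@le_trans _ _ n%:R); last by rewrite ler_nat.
  by near: n; exact: nbhs_infty_ger.
have pi1 : 1 <= pi :> R by apply: le_trans (pi_ge2 _); rewrite ler1n.
near=> n.
have n0 : 0 < n.+1%:R :> R by [].
have nV : 0 < n.+1%:R^-1 :> R by rewrite invr_gt0.
have V1 : n.+1%:R^-1 <= 1 :> R by rewrite invf_le1// ler1n.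
have na : a + 1 <= n.+1%:R by near: n; exact: big.
have nz : `|z| <= n.+1%:R by near: n; exact: big.
have i1 : n.+1%:R^-1 * (a + n.+1%:R^-1) \in `[0, pi].
  rewrite in_itv/= mulr_ge0 ?addr_ge0 ?(ltW nV)//=; apply: le_trans pi1.
  rewrite mulrC ler_pdivrMr// mul1r; apply: le_trans na; exact: lerD.
have i2 : n.+1%:R^-1 * `|z| \in `[0, pi].
  rewrite in_itv/= mulr_ge0 ?(ltW nV)//=; apply: le_trans pi1.
  by rewrite mulrC ler_pdivrMr// mul1r.
rewrite [X in _ - X]cz normrM (ger0_norm (ltW nV)) /step_limit.
have [za|az] := leP `|z| a.
  rewrite subr_lt0 ltr_cos// ltr_pM2l// ifT//.
  by rewrite (le_lt_trans za)// ltrDl.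
have h : a + n.+1%:R^-1 < `|z|.
  rewrite -ltrBrDl invf_plt ?posrE ?subr_gt0//.
  near: n; have := big ((`|z| - a)^-1 + 1); apply: filterS => m; apply: lt_le_trans.
  by rewrite ltrDl.
have : 0 < cos (n.+1%:R^-1 * (a + n.+1%:R^-1)) - cos (n.+1%:R^-1 * `|z|).
  by rewrite subr_gt0 ltr_cos// ltr_pM2l.
by move=> h0; rewrite ltNge (ltW h0)/= gt_eqF.
Unshelve. all: by end_near. Qed.

Lemma multiplier_indicator i a : 0 <= a ->
  multiplier (fun w => (`|Z i w| <= a)%R%:R) (fun w => (`|Z' i w| <= a)%R%:R).
Proof.
move=> a0.
apply: (multiplier_lim (fun n => multiplier_step i (cos (n.+1%:R^-1 * (a + n.+1%:R^-1))) n.+1%:R) (K := 1)).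
- by move=> n w; exact: step_limit_bound.
- by move=> n w; exact: step_limit_bound.
- by move=> w; exact: cos_threshold_cvg.
- by move=> w; exact: cos_threshold_cvg.
Qed.

Lemma multiplier_prod a (r : seq I) : 0 <= a ->
  multiplier (fun w => \prod_(i <- r) (`|Z i w| <= a)%R%:R) (fun w => \prod_(i <- r) (`|Z' i w| <= a)%R%:R).
Proof.
move=> a0; elim: r => [|i r ih].
  by under eq_fun do rewrite big_nil; under [X in multiplier _ X]eq_fun do rewrite big_nil; exact: multiplier1.
under eq_fun do rewrite big_cons; under [X in multiplier _ X]eq_fun do rewrite big_cons.
by apply: multiplierM => //; exact: multiplier_indicator.
Qed.

Lemma multiplier_Rintegral G G' : multiplier G G' -> \int[P]_w G w = \int[P']_w G' w.
Proof.
move=> [_ _ /(_ _ _ agree1)[_ _ /(_ (fun=> 0))[h _]]].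
have l0 (S : Type) (Y : I -> S -> R) w : lincomb (fun=> 0) Y w = 0.
  by rewrite /lincomb big1// => i _; rewrite mul0r.
move: h; under eq_Rintegral do rewrite mulr1 l0 cos0 mulr1.
by under [RHS]eq_Rintegral do rewrite mulr1 l0 cos0 mulr1.
Qed.

Definition max_norm (S : Type) (Y : I -> S -> R) (w : S) : R := \big[Num.max/0]_i `|Y i w|.

Lemma max_norm_le (S : Type) (Y : I -> S -> R) w a : 0 <= a ->
  (max_norm Y w <= a)%R%:R = \prod_i (`|Y i w| <= a)%R%:R :> R.
Proof.
move=> a0; have -> : (max_norm Y w <= a) = [forall i, `|Y i w| <= a].
  apply/idP/forallP => [h i|h].
    apply: le_trans h; rewrite /max_norm; exact: le_bigmax.
  by apply/bigmax_leP.
case: (boolP [forall i, _]) => [/forallP h|].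
  by rewrite big1// => i _; rewrite h.
by rewrite negb_forall => /existsP[i /negbTE h]; rewrite (bigD1 i)//= h mul0r.
Qed.

Lemma measurable_max_norm d0 (S : measurableType d0) (Y : I -> S -> R) :
  (forall i, measurable_fun setT (Y i)) -> measurable_fun setT (max_norm Y).
Proof.
move=> mY; rewrite /max_norm; elim: (index_enum I) => [|i r ih].
  by under eq_fun do rewrite big_nil; exact: measurable_cst.
under eq_fun do rewrite big_cons; apply: measurable_maxr => //.
exact: (measurableT_comp _ (mY i)).
Qed.

(* Cramer-Wold: multipliers form an algebra closed under bounded limits, so they contain the indicators of boxes. *)
Lemma max_norm_expectation (K : R) : 0 <= K ->
  (\int[P]_w (Num.min (max_norm Z w) K)%:E = \int[P']_w (Num.min (max_norm Z' w) K)%:E)%E.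
Proof.
move=> K0.
(* By the layer cake formula the mean is the integral over [r < K] of the probability that the
   maximum exceeds [r], and the complementary event is a product of indicators. *)
have lc d0 (S : measurableType d0) (Q : probability S R) (Y : I -> S -> R) :
    (forall i, measurable_fun setT (Y i)) ->
    (\int[Q]_w (Num.min (max_norm Y w) K)%:E =
     \int[@lebesgue_measure R]_r ((((0 <= r)%R && (r < K)%R)%:R)%:E * (1 - \int[Q]_w (\prod_i (`|Y i w| <= r)%R%:R)%R)%:E))%E.
  move=> mY; have mm := measurable_max_norm mY.
  have m0 w : 0 <= max_norm Y w by rewrite /max_norm; exact: bigmax_ge_id.
  transitivity (\int[Q]_w \int[@lebesgue_measure R]_r (\1_`[0, (Num.min (max_norm Y w) K)[ r)%:E)%E.
    by apply: eq_integral => w _; rewrite layer_cake// le_min m0.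
  rewrite (tonelli Q (@lebesgue_measure R) (f := fun w r => \1_`[0, (Num.min (max_norm Y w) K)[ r)); last 2 first.
  - apply: measurable_layer; last exact: measurable_snd.
    by apply: measurable_minr => //; exact: (measurableT_comp mm).
  - by move=> w r; rewrite indicE.
  apply: eq_integral => r _.
  have [r0|r0] := boolP ((0 <= r) && (r < K)); last first.
    rewrite mul0e; apply: integral0_eq => w _; rewrite indicE memNset//= in_itv/= lt_min.
    by move: r0; rewrite !negb_and => /orP[/negbTE ->//|/negbTE ->]; rewrite !andbF.
  rewrite mul1e; have [r1 r2] := andP r0.
  have bm : bounded_measurable (fun w => (max_norm Y w <= r)%R%:R : R).
    split; last by exists 1 => w; case: (max_norm Y w <= r); rewrite ?normr1 ?normr0.
    have -> : (fun w => (max_norm Y w <= r)%R%:R : R) = (fun w => if max_norm Y w <= r then 1 else 0).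
      by apply/funext => w; case: ifP.
    by apply: measurable_fun_ifT => //; exact: measurable_fun_ler.
  under [X in (1 - X)%:E]eq_Rintegral do rewrite -(max_norm_le _ _ r1).
  rewrite (Rintegral_complement Q bm).
  apply: eq_integral => w _; congr EFin; rewrite indicE.
  have [h|h] := leP (max_norm Y w) r.
    rewrite memNset ?subrr//= in_itv/= lt_min r1 r2 andbT/=; apply/negP.
    by rewrite -leNgt.
  by rewrite mem_set ?subr0//= in_itv/= lt_min r1 r2 h.
rewrite !lc//; apply: eq_integral => r _; have [r0|_] := boolP (0 <= r); last by rewrite !mul0e.
by rewrite (multiplier_Rintegral (multiplier_prod _ r0)).
Qed.

End cramer_wold.

Lemma sin_le_id {R : realType} (x : R) : 0 <= x -> sin x <= x.
Proof.
rewrite le_eqVlt => /predU1P[<-|x0]; first by rewrite sin0.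
have [c _] := @MVT R sin cos 0 x x0 (fun y _ => is_derive_sin y) (continuous_subspaceT (@continuous_sin R)).
by rewrite sin0 !subr0 => ->; rewrite ler_piMl ?cos_le1// ltW.
Qed.

Lemma cos_ge_parabola {R : realType} (x : R) : 0 <= x -> x <= pi -> 1 - cos x <= x ^+ 2 / 2.
Proof.
move=> x0 xpi; have h0 : 0 <= x / 2 by rewrite divr_ge0.
have hp : x / 2 <= pi by rewrite (le_trans _ xpi)// ler_pdivrMr// ler_peMr// ler1n.
have -> : cos x = 1 - 2 * sin (x / 2) ^+ 2.
  have := cos_mulr2n (x / 2); rewrite cos2sin2 (_ : x / 2 *+ 2 = x); last by rewrite -mulr_natr; field.
  by move=> ->; rewrite -mulr_natr; ring.
have s0 : 0 <= sin (x / 2) by apply: sin_ge0_pi; rewrite h0 hp.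
have : sin (x / 2) ^+ 2 <= (x / 2) ^+ 2 by apply: lerXn2r; rewrite ?nnegrE// sin_le_id.
by rewrite exprMn; lra.
Qed.

Lemma mulr_le_sumsq {R : realFieldType} (x y : R) : 0 <= x -> 0 <= y -> x * y <= x ^+ 2 + y ^+ 2.
Proof. by move=> x0 y0; nra. Qed.

Section max_norm_facts.
Context {R : realType} {I : finType}.

Lemma max_norm_ge0 (S : Type) (Y : I -> S -> R) w : 0 <= max_norm Y w.
Proof. by rewrite /max_norm; exact: bigmax_ge_id. Qed.

Lemma max_norm_leP (S : Type) (Y : I -> S -> R) w a : 0 <= a ->
  reflect (forall i, `|Y i w| <= a) (max_norm Y w <= a).
Proof.
move=> a0; apply: (iffP idP) => [h i|h].
  by apply: le_trans h; rewrite /max_norm; exact: le_bigmax.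
by apply/bigmax_leP.
Qed.

Lemma max_norm_ge (S : Type) (Y : I -> S -> R) w i : `|Y i w| <= max_norm Y w.
Proof. by rewrite /max_norm; exact: le_bigmax. Qed.

Lemma max_norm_attained (S : Type) (Y : I -> S -> R) w :
  max_norm Y w = 0 \/ exists i, max_norm Y w = `|Y i w|.
Proof.
have [j _|I0] := pickP (@predT I); last first.
  by left; rewrite /max_norm big_pred0.
by right; eexists; rewrite /max_norm (bigmax_eq_arg _ j).
Qed.

End max_norm_facts.

Lemma max_norm_sum {R : realType} {I : finType} (S : Type) (Y Y' : I -> S -> R) w :
  max_norm (fun s : I + I => match s with inl i => Y i | inr i => Y' i end) w =
  Num.max (max_norm Y w) (max_norm Y' w).
Proof.
set Z := fun s => _.
have a0 : 0 <= Num.max (max_norm Y w) (max_norm Y' w) by rewrite le_max max_norm_ge0.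
apply/eqP; rewrite eq_le; apply/andP; split.
  apply/(max_norm_leP Z w a0); case=> i; rewrite /Z le_max max_norm_ge ?orbT//.
have z0 := max_norm_ge0 Z w.
rewrite ge_max; apply/andP; split; apply/(max_norm_leP _ w z0) => i.
- exact: (max_norm_ge Z w (inl i)).
- exact: (max_norm_ge Z w (inr i)).
Qed.

Lemma probability_integral_addZ {R : realType} d (T : measurableType d) (P : probability T R)
  (a c : R) (g : T -> R) : 0 <= a -> 0 <= c -> measurable_fun setT g -> (forall x, 0 <= g x) ->
  (\int[P]_x (a + c * g x)%:E = a%:E + c%:E * \int[P]_x (g x)%:E)%E.
Proof.
move=> a0 c0 mg g0; rewrite (integral_addZ P (f := fun=> a) c0 _ mg)//.
congr (_ + _)%E; transitivity (\int[P]_x (cst a%:E) x)%E => //.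
by rewrite integral_cst//= probability_setT mule1.
Qed.

(** * Concentration by rotating two independent copies *)

Section concentration.
Context {R : realType} d (T : measurableType d) (P : probability T R) (I : finType)
  (X : I -> T -> R) (s M : R).
Hypotheses (mX : forall i, measurable_fun setT (X i))
  (gX : forall c : I -> R, centered_gaussian P (lincomb c X))
  (s0 : 0 < s) (sX : forall i, (\int[P]_w (X i w ^+ 2)%:E <= (s ^+ 2)%:E)%E) (M0 : 0 <= M).
Local Notation P2 := (P \x P)%E.

Lemma measurable_lincomb_fam (c : I -> R) : measurable_fun setT (lincomb c X).
Proof. exact: measurable_lincomb. Qed.

Definition lvar (c : I -> R) : R := \int[P]_w (lincomb c X w ^+ 2).

Lemma lincomb_moments c : [/\ P.-integrable setT (EFin \o (fun w => lincomb c X w ^+ 2)),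
  \int[P]_w cos (lincomb c X w) = expR (- (lvar c / 2)) & \int[P]_w sin (lincomb c X w) = 0].
Proof.
have mc := measurable_lincomb_fam c.
have [v [v0 v2 _ vc vs]] := centered_gaussian_moments mc (gX c).
have -> : lvar c = v by rewrite /lvar /Rintegral v2.
split => //; apply/integrableP; split; first by apply/measurable_EFinP; exact: measurable_funX.
by under eq_integral do rewrite /= ger0_norm ?sqr_ge0//; rewrite v2 ltry.
Qed.

Lemma lincomb_lin (a b : R) (c e : I -> R) w :
  lincomb (fun i => a * c i + b * e i) X w = a * lincomb c X w + b * lincomb e X w.
Proof.
rewrite /lincomb !mulr_sumr -big_split; apply: eq_bigr => i _ /=.
by rewrite mulrDl !mulrA.
Qed.

Definition lcov (c e : I -> R) : R := \int[P]_w (lincomb c X w * lincomb e X w).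

Lemma integrable_lcov c e : P.-integrable setT (EFin \o (fun w => lincomb c X w * lincomb e X w)).
Proof.
have [i1 _ _] := lincomb_moments c; have [i2 _ _] := lincomb_moments e.
apply: (le_integrable measurableT _ _ (integrableD measurableT i1 i2)).
  by apply/measurable_EFinP; apply: measurable_funM; exact: measurable_lincomb_fam.
move=> w _; rewrite [X in (_ <= `|X|)%E](_ : _ = (lincomb c X w ^+ 2 + lincomb e X w ^+ 2)%:E)//=.
rewrite lee_fin [leRHS]ger0_norm ?addr_ge0 ?sqr_ge0//.
rewrite normrM -(real_normK (num_real (lincomb c X w))) -(real_normK (num_real (lincomb e X w))).
exact: mulr_le_sumsq.
Qed.

Lemma lvar_lin (a b : R) (c e : I -> R) :
  lvar (fun i => a * c i + b * e i) = a ^+ 2 * lvar c + b ^+ 2 * lvar e + 2 * a * b * lcov c e.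
Proof.
have [i1 _ _] := lincomb_moments c; have [i2 _ _] := lincomb_moments e.
have i3 := integrable_lcov c e.
rewrite /lvar /lcov -!RintegralZl//.
have j1 := integrableZl measurableT (a ^+ 2) i1.
have j2 := integrableZl measurableT (b ^+ 2) i2.
have j3 := integrableZl measurableT (2 * a * b) i3.
rewrite -RintegralD// -RintegralD//; last exact: (integrableD measurableT j1 j2).
by apply: eq_Rintegral => w _; rewrite lincomb_lin; ring.
Qed.

(* [rotation 0] and [rotation (pi / 2)] are independent copies of [X], and the joint law of [rotation th] and
   [rotation th'] depends on [th - th'] only. *)
Definition rotation (th : R) (i : I) (p : T * T) : R := cos th * X i p.1 + sin th * X i p.2.

Lemma measurable_rotation th i : measurable_fun setT (rotation th i).
Proof.
by apply: measurable_funD; apply: measurable_funM => //; exact: (measurableT_comp (mX i)).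
Qed.

Definition rotation_pair th th' (j : I + I) : T * T -> R :=
  match j with inl i => rotation th i | inr i => rotation th' i end.

Lemma measurable_rotation_pair th th' j : measurable_fun setT (rotation_pair th th' j).
Proof. by case: j => i; exact: measurable_rotation. Qed.

Local Notation lf c := (fun i : I => c (@inl I I i)).
Local Notation rf c := (fun i : I => c (@inr I I i)).

Lemma lincomb_rotation_pair th th' (c : I + I -> R) p :
  lincomb c (rotation_pair th th') p =
  lincomb (fun i => cos th * lf c i + cos th' * rf c i) X p.1 +
  lincomb (fun i => sin th * lf c i + sin th' * rf c i) X p.2.
Proof.
rewrite /lincomb big_sumType /= /rotation -!big_split /=; apply: eq_bigr => i _.
by ring.
Qed.

(** Independence factorizes the characteristic function. The squares of cosine and sine add up to 1,
    so the angles survive only through [cos (th - th')]. *)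
Lemma rotation_pair_char th th' (c : I + I -> R) :
  \int[P2]_p cos (lincomb c (rotation_pair th th') p) =
    expR (- ((lvar (lf c) + lvar (rf c) + 2 * cos (th - th') * lcov (lf c) (rf c)) / 2)) /\
  \int[P2]_p sin (lincomb c (rotation_pair th th') p) = 0.
Proof.
set A := fun i => cos th * lf c i + cos th' * rf c i.
set B := fun i => sin th * lf c i + sin th' * rf c i.
have [_ cA sA] := lincomb_moments A; have [_ cB sB] := lincomb_moments B.
have ic e : P.-integrable setT (EFin \o (fun w => cos (lincomb e X w))).
  by apply: bounded_measurable_integrable; apply: bounded_cos; exact: measurable_lincomb_fam.
have is_ e : P.-integrable setT (EFin \o (fun w => sin (lincomb e X w))).
  by apply: bounded_measurable_integrable; apply: bounded_sin; exact: measurable_lincomb_fam.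
have E p := lincomb_rotation_pair th th' c p.
split.
- under eq_Rintegral do rewrite E cosD.
  rewrite (RintegralB measurableT (integrable_prodM (ic A) (ic B)) (integrable_prodM (is_ A) (is_ B))).
  rewrite (Rintegral_prodM (ic A) (ic B)) (Rintegral_prodM (is_ A) (is_ B)) cA cB sA mul0r subr0 -expRD; congr expR.
  rewrite /A /B !lvar_lin cosB.
  have h1 := cos2Dsin2 th; have h2 := cos2Dsin2 th'.
  transitivity (- (((cos th ^+ 2 + sin th ^+ 2) * lvar (lf c) + (cos th' ^+ 2 + sin th' ^+ 2) * lvar (rf c)
    + 2 * (cos th * cos th' + sin th * sin th') * lcov (lf c) (rf c)) / 2)); first by field.
  by rewrite h1 h2 !mul1r.
- under eq_Rintegral do rewrite E sinD.
  rewrite (RintegralD measurableT (integrable_prodM (is_ A) (ic B)) (integrable_prodM (ic A) (is_ B))).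
  by rewrite (Rintegral_prodM (is_ A) (ic B)) (Rintegral_prodM (ic A) (is_ B)) sA sB mul0r mulr0 addr0.
Qed.

Local Notation f th := (fun p : T * T => Num.min (max_norm (rotation th) p) M).

Lemma bounded_trunc d0 (S : measurableType d0) (J : finType) (Y : J -> S -> R) :
  (forall i, measurable_fun setT (Y i)) -> bounded_measurable (fun p => Num.min (max_norm Y p) M).
Proof.
move=> mY; split; first by apply: measurable_minr => //; exact: measurable_max_norm.
exists M => p; rewrite ger0_norm ?le_min ?max_norm_ge0//.
by rewrite ge_min lexx orbT.
Qed.

Lemma max_rotation th th' p : Num.max (f th p) (f th' p) = Num.min (max_norm (rotation_pair th th') p) M.
Proof.
have -> : max_norm (rotation_pair th th') p = Num.max (max_norm (rotation th) p) (max_norm (rotation th') p).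
  by rewrite -max_norm_sum /max_norm; apply: eq_bigr => -[].
by rewrite min_maxl.
Qed.

(** The larger of the two truncated norms is itself a truncated max norm, over the doubled index set
    [I + I], hence within reach of [max_norm_expectation]. *)
Lemma rotation_invariance th1 th1' th2 th2' : cos (th1 - th1') = cos (th2 - th2') ->
  \int[P2]_p Num.max (f th1 p) (f th1' p) = \int[P2]_p Num.max (f th2 p) (f th2' p).
Proof.
move=> E; under eq_Rintegral do rewrite max_rotation; under [RHS]eq_Rintegral do rewrite max_rotation.
rewrite /Rintegral; congr fine; apply: max_norm_expectation => //.
- by move=> j; exact: measurable_rotation_pair.
- by move=> j; exact: measurable_rotation_pair.
- by move=> c; rewrite (rotation_pair_char th1 th1' c).1 (rotation_pair_char th2 th2' c).1 E.
- by move=> c; rewrite (rotation_pair_char th1 th1' c).2 (rotation_pair_char th2 th2' c).2.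
Qed.

Lemma bounded_rotation th : bounded_measurable (f th).
Proof. by apply: bounded_trunc => i; exact: measurable_rotation. Qed.

Lemma rotation_marginal th th' : \int[P2]_p f th p = \int[P2]_p f th' p.
Proof.
have D t : \int[P2]_p f t p = \int[P2]_p Num.max (f t p) (f t p).
  by apply: eq_Rintegral => p _; rewrite maxxx.
by rewrite (D th) (D th'); apply: rotation_invariance; rewrite !subrr.
Qed.

Lemma bounded_max d0 (S : measurableType d0) (g h : S -> R) : bounded_measurable g -> bounded_measurable h ->
  bounded_measurable (fun p => Num.max (g p) (h p)).
Proof.
move=> [mg [K gK]] [mh [L hL]]; split; first exact: measurable_maxr.
exists (Num.max K L) => p; rewrite /Num.max; case: ifPn => _; case: ifPn => KL.
- exact: hL.
- by apply: le_trans (hL p) _; rewrite leNgt.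
- by apply: le_trans (gK p) (ltW KL).
- exact: gK.
Qed.

(** From [|x - y| = 2 max x y - x - y]: the distance is expressed by maxima of pairs and by
    marginals, which do not depend on the angle. *)
Lemma rotation_dist th th' :
  \int[P2]_p `|f th p - f th' p| = 2 * \int[P2]_p Num.max (f th p) (f th' p) - 2 * \int[P2]_p f 0 p.
Proof.
have bm := bounded_max (bounded_rotation th) (bounded_rotation th').
transitivity (\int[P2]_p (2 * Num.max (f th p) (f th' p) + (- 1) * (1 * f th p + 1 * f th' p))).
  apply: eq_Rintegral => p _; rewrite /Num.max; set x := Num.min _ _; set y := Num.min _ _.
  by case: (ltP x y) => xy; [rewrite ltr0_norm ?subr_lt0//|rewrite ger0_norm ?subr_ge0//]; ring.
have b2 : bounded_measurable (fun p => 1 * f th p + 1 * f th' p).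
  by apply: bounded_measurableD; apply: bounded_measurableM; [exact: bounded_measurable_cst|exact: bounded_rotation|exact: bounded_measurable_cst|exact: bounded_rotation].
rewrite (Rintegral_lin P2 2 (- 1) bm b2) (Rintegral_lin P2 1 1 (bounded_rotation th) (bounded_rotation th')).
by rewrite (rotation_marginal th 0) (rotation_marginal th' 0); ring.
Qed.

Lemma rotation_dist_invariant th1 th1' th2 th2' : cos (th1 - th1') = cos (th2 - th2') ->
  \int[P2]_p `|f th1 p - f th1' p| = \int[P2]_p `|f th2 p - f th2' p|.
Proof. by move=> E; rewrite !rotation_dist (rotation_invariance E). Qed.

Lemma bounded_dist th th' : bounded_measurable (fun p => `|f th p - f th' p|).
Proof.
have [mt [K tK]] := bounded_rotation th; have [mt' [K' tK']] := bounded_rotation th'.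
split; first by apply: (measurableT_comp (@normr_measurable R setT)); exact: measurable_funB.
exists (K + K') => p; rewrite normr_id; apply: le_trans (ler_normB _ _) _; exact: lerD.
Qed.

(** All steps of angle [dl] have the same mean distance, so the triangle inequality just counts
    them. *)
Lemma rotation_dist_steps (N : nat) (dl : R) :
  \int[P2]_p `|f 0 p - f (N%:R * dl) p| <= N%:R * \int[P2]_p `|f 0 p - f dl p|.
Proof.
elim: N => [|N ih].
  rewrite !mul0r; under eq_Rintegral do rewrite subrr normr0.
  by rewrite /Rintegral integral0.
have E : \int[P2]_p `|f (N%:R * dl) p - f (N.+1%:R * dl) p| = \int[P2]_p `|f 0 p - f dl p|.
  apply: rotation_dist_invariant; rewrite sub0r -natr1 mulrDl mul1r; congr cos; ring.
apply: (@le_trans _ _ (\int[P2]_p (1 * `|f 0 p - f (N%:R * dl) p| + 1 * `|f (N%:R * dl) p - f (N.+1%:R * dl) p|))).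
  apply: le_Rintegral => //.
  - by apply: bounded_measurable_integrable; exact: bounded_dist.
  - apply: bounded_measurable_integrable; apply: bounded_measurableD; apply: bounded_measurableM; do ?[exact: bounded_measurable_cst|exact: bounded_dist].
  - by move=> p _; rewrite !mul1r; exact: ler_distD.
rewrite (Rintegral_lin P2 1 1 (bounded_dist _ _) (bounded_dist _ _)) !mul1r E.
by rewrite -[in leRHS]natr1 [leRHS]mulrDl mul1r lerD2r.
Qed.

Lemma rotation0 i p : rotation 0 i p = X i p.1.
Proof. by rewrite /rotation cos0 sin0 mul1r mul0r addr0. Qed.

Lemma rotation_pihalf i p : rotation (pi / 2) i p = X i p.2.
Proof. by rewrite /rotation cos_pihalf sin_pihalf mul0r mul1r add0r. Qed.

(** From [|x| <= s / 2 + x^2 / (2 s)]. *)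
Lemma expectation_norm_le i : (\int[P]_w (`|X i w|)%:E <= s%:E)%E.
Proof.
have mn : measurable_fun setT (fun w => X i w ^+ 2) by exact: measurable_funX.
have h : (\int[P]_w (`|X i w|)%:E <= \int[P]_w (s / 2 + (2 * s)^-1 * X i w ^+ 2)%:E)%E.
  apply: ge0_le_integral => //.
  - by apply/measurable_EFinP; apply: (measurableT_comp (@normr_measurable R setT)).
  - by apply/measurable_EFinP; apply: measurable_funD => //; exact: measurable_funM.
  - move=> w _; rewrite lee_fin; set x := X i w.
    have : 0 <= (`|x| - s) ^+ 2 * (2 * s)^-1 by rewrite mulr_ge0 ?sqr_ge0// invr_ge0 mulr_ge0// ltW.
    rewrite sqrrB real_normK ?num_real// -mulr_natr.
    rewrite (_ : _ * (2 * s)^-1 = (2 * s)^-1 * x ^+ 2 - `|x| + s / 2); last by field; exact: lt0r_neq0.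
    lra.
apply: le_trans h _.
have k0 : 0 <= (2 * s)^-1 by rewrite invr_ge0 mulr_ge0// ltW.
have s2 : 0 <= s / 2 by rewrite divr_ge0// ltW.
rewrite (probability_integral_addZ P s2 k0 mn (fun w => sqr_ge0 _)).
apply: (@le_trans _ _ ((s / 2)%:E + ((2 * s)^-1)%:E * (s ^+ 2)%:E)%E).
  by rewrite leeD2l// lee_wpmul2l.
by rewrite -EFinM -EFinD lee_fin le_eqVlt; apply/orP; left; apply/eqP; field; exact: lt0r_neq0.
Qed.

(** The index is one where the maximum of the first copy is attained ([None] if that maximum is 0).
    It depends on [w] only, so the second copy enters through a single variable and not through a
    maximum; the maximum itself carries only [1 - cos dl], of order [dl^2]. *)
Lemma trunc_increment_le w dl : 0 <= dl -> dl <= pi / 2 -> exists j : option I, forall w',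
  Num.max (f 0 (w, w') - f dl (w, w')) 0 <=
  dl ^+ 2 / 2 * max_norm X w + dl * (if j is Some i then `|X i w'| else 0).
Proof.
move=> d0 dpi.
have dp : dl <= pi by apply: le_trans dpi _; rewrite ler_pdivrMr// ler_peMr ?pi_ge0// ler1n.
have mX0 w' : max_norm (rotation 0) (w, w') = max_norm X w.
  by rewrite /max_norm; apply: eq_bigr => i _; rewrite rotation0.
have c2 : 0 <= dl ^+ 2 / 2 by rewrite divr_ge0// sqr_ge0.
have g0 := max_norm_ge0 X w.
have [E|[i E]] := max_norm_attained X w.
  exists None => w'; rewrite mulr0 addr0 mX0 E mulr0 ge_max lexx andbT subr_le0.
  by rewrite (min_l M0) le_min max_norm_ge0 M0.
exists (Some i) => w'; rewrite ge_max mX0; apply/andP; split; last first.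
  by rewrite addr_ge0// mulr_ge0.
have h1 : max_norm X w - max_norm (rotation dl) (w, w') <= dl ^+ 2 / 2 * max_norm X w + dl * `|X i w'|.
  have k1 : `|rotation dl i (w, w')| <= max_norm (rotation dl) (w, w') by exact: max_norm_ge.
  have cs0 : 0 <= cos dl by apply: cos_ge0_pihalf; rewrite dpi andbT (le_trans _ d0)// oppr_le0 divr_ge0// pi_ge0.
  have sn0 : 0 <= sin dl by apply: sin_ge0_pi; rewrite d0 dp.
  have k2 : cos dl * `|X i w| - sin dl * `|X i w'| <= `|rotation dl i (w, w')|.
    rewrite /rotation /= -{1}(ger0_norm cs0) -{1}(ger0_norm sn0) -!normrM.
    by rewrite lerBlDr; have := ler_normB (cos dl * X i w + sin dl * X i w') (sin dl * X i w'); rewrite addrK.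
  have k3 := cos_ge_parabola d0 dp; have k4 := sin_le_id d0.
  have k5 : (1 - cos dl) * `|X i w| <= dl ^+ 2 / 2 * `|X i w| by rewrite ler_wpM2r.
  have k6 : sin dl * `|X i w'| <= dl * `|X i w'| by rewrite ler_wpM2r.
  by rewrite E; move: k1 k2 k5 k6; rewrite mulrBl mul1r; lra.
have pos : 0 <= dl ^+ 2 / 2 * max_norm X w + dl * `|X i w'| by rewrite addr_ge0// mulr_ge0.
move: h1; set x := max_norm X w; set y := max_norm _ _; set z := _ + _ * `|_|.
by rewrite -/z in pos *; rewrite /Num.min; case: ifPn; case: ifPn; rewrite -?leNgt; lra.
Qed.

(** Bounding the maximum by the sum is crude but harmless: this term is multiplied by [dl^2] and
    disappears as the steps shrink. *)
Lemma integral_max_norm_le : (\int[P]_w (max_norm X w)%:E <= (#|I|%:R * s)%:E)%E.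
Proof.
have mn i : measurable_fun setT (fun w => `|X i w|) by apply: (measurableT_comp (@normr_measurable R setT)).
apply: (@le_trans _ _ (\int[P]_w (\sum_i `|X i w|)%:E)%E).
  apply: ge0_le_integral => //.
  - by move=> w _; rewrite lee_fin max_norm_ge0.
  - by apply/measurable_EFinP; exact: measurable_max_norm.
  - by apply/measurable_EFinP; apply: measurable_sum.
  - move=> w _; rewrite lee_fin; apply/max_norm_leP => [|i]; first exact: sumr_ge0.
    by rewrite (bigD1 i)//= lerDl sumr_ge0.
under eq_integral do rewrite -sumEFin.
rewrite ge0_integral_sum//; last by move=> i; exact/measurable_EFinP.
rewrite mulr_natl -sumr_const -sumEFin; apply: lee_sum => i _; exact: expectation_norm_le.
Qed.

(** The two marginals have the same mean, so the positive and negative parts of the difference do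
    too, and bounding the positive part is enough. *)
Lemma rotation_step_le dl : 0 <= dl -> dl <= pi / 2 ->
  \int[P2]_p `|f 0 p - f dl p| <= 2 * (dl ^+ 2 / 2 * (#|I|%:R * s) + dl * s).
Proof.
move=> d0 dpi.
have bd : bounded_measurable (fun p => 1 * f 0 p + (- 1) * f dl p).
  apply: bounded_measurableD; apply: bounded_measurableM; do ?[exact: bounded_measurable_cst|exact: bounded_rotation].
have bp : bounded_measurable (fun p => Num.max (f 0 p - f dl p) 0).
  under eq_fun do rewrite -[f 0 _]mul1r -mulN1r.
  by apply: bounded_max => //; exact: bounded_measurable_cst.
have -> : \int[P2]_p `|f 0 p - f dl p| = 2 * \int[P2]_p Num.max (f 0 p - f dl p) 0.
  transitivity (\int[P2]_p (2 * Num.max (f 0 p - f dl p) 0 + (- 1) * (1 * f 0 p + (- 1) * f dl p))).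
    apply: eq_Rintegral => p _; rewrite /Num.max; set x := Num.min _ _; set y := Num.min _ _.
    case: ifPn => [xy|]; first by rewrite ltr0_norm//; ring.
    by rewrite -leNgt => xy; rewrite ger0_norm//; ring.
  rewrite (Rintegral_lin P2 2 (- 1) bp bd) (Rintegral_lin P2 1 (- 1) (bounded_rotation 0) (bounded_rotation dl)).
  by rewrite (rotation_marginal dl 0); ring.
rewrite ler_pM2l// -lee_fin /Rintegral fineK; last first.
  exact: (integrable_fin_num measurableT (bounded_measurable_integrable P2 bp)).
rewrite fubini_tonelli1; last 2 first.
- by apply/measurable_EFinP; case: bp.
- by move=> p; rewrite lee_fin le_max lexx orbT.
have mn i : measurable_fun setT (fun w => `|X i w|) by apply: (measurableT_comp (@normr_measurable R setT)).
have c2 : 0 <= dl ^+ 2 / 2 by rewrite divr_ge0// sqr_ge0.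
apply: (@le_trans _ _ (\int[P]_w (dl * s + dl ^+ 2 / 2 * max_norm X w)%:E)%E).
  apply: ge0_le_integral => //.
  - by move=> w _; apply: integral_ge0 => w' _; rewrite lee_fin le_max lexx orbT.
  - apply: measurable_fun_fubini_tonelli_F; last by move=> p; rewrite lee_fin le_max lexx orbT.
    by apply/measurable_EFinP; case: bp.
  - apply/measurable_EFinP; apply: measurable_funD => //; apply: measurable_funM => //.
    exact: measurable_max_norm.
  move=> w _; have [j hj] := trunc_increment_le w d0 dpi.
  pose g w' := if j is Some i then `|X i w'| else 0.
  have mg : measurable_fun setT g by rewrite /g; case: j {hj g}.
  have gs : (\int[P]_w' (g w')%:E <= s%:E)%E.
    rewrite /g; case: j {hj g mg} => [i|]; first exact: expectation_norm_le.
    by rewrite integral0 lee_fin ltW.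
  have g0 w' : 0 <= g w' by rewrite /g; case: j {hj g mg gs}.
  apply: (@le_trans _ _ (\int[P]_w' (dl ^+ 2 / 2 * max_norm X w + dl * g w')%:E)%E).
    apply: ge0_le_integral => //.
    - by move=> w' _; rewrite lee_fin le_max lexx orbT.
    - apply/measurable_EFinP; case: bp => mbp _; exact: (measurableT_comp mbp (measurable_pair1 w)).
    - by apply/measurable_EFinP; apply: measurable_funD => //; exact: measurable_funM.
    - by move=> w' _; rewrite lee_fin; exact: hj.
  have a0 : 0 <= dl ^+ 2 / 2 * max_norm X w by rewrite mulr_ge0// max_norm_ge0.
  rewrite (probability_integral_addZ P a0 d0 mg g0).
  rewrite [X in (_ <= X%:E)%E]addrC EFinD leeD2l// EFinM; exact: lee_wpmul2l.
have ds0 : 0 <= dl * s by rewrite mulr_ge0// ltW.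
rewrite (probability_integral_addZ P ds0 c2 (measurable_max_norm mX) (max_norm_ge0 X)).
rewrite [X in (_ <= X%:E)%E]addrC EFinD leeD2l// [in leRHS]EFinM.
by apply: lee_wpmul2l => //; exact: integral_max_norm_le.
Qed.

(** A quarter turn in [N] steps: the terms linear in the angle add up to [2 (pi / 2) s = pi s], and
    the quadratic ones, the only place where the number of variables enters, are [A / N]. *)
Lemma max_norm_concentration :
  \int[P2]_p `|Num.min (max_norm X p.1) M - Num.min (max_norm X p.2) M| <= pi * s.
Proof.
have E : \int[P2]_p `|Num.min (max_norm X p.1) M - Num.min (max_norm X p.2) M| =
    \int[P2]_p `|f 0 p - f (pi / 2) p|.
  apply: eq_Rintegral => p _; congr `|Num.min _ _ - Num.min _ _|.
    by apply: eq_bigr => i _; rewrite rotation0.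
  by apply: eq_bigr => i _; rewrite rotation_pihalf.
rewrite E; apply/ler_addgt0Pr => e e0.
pose A : R := pi ^+ 2 / 4 * (#|I|%:R * s).
have A0 : 0 <= A by rewrite /A mulr_ge0 ?divr_ge0 ?sqr_ge0// mulr_ge0// ltW.
pose N := (Num.trunc (A / e)).+1.
have NA : A / e < N%:R by rewrite /N; exact: truncnS_gt.
have N0 : 0 < N%:R :> R by rewrite ltr0n.
pose dl : R := pi / (2 * N%:R).
have d0 : 0 <= dl by rewrite divr_ge0 ?pi_ge0// mulr_ge0.
have dN : N%:R * dl = pi / 2 by rewrite /dl; field; exact: lt0r_neq0.
have dpi : dl <= pi / 2.
  by rewrite -dN ler_peMl// ler1n.
rewrite -dN; apply: le_trans (rotation_dist_steps N dl) _.
apply: (@le_trans _ _ (N%:R * (2 * (dl ^+ 2 / 2 * (#|I|%:R * s) + dl * s)))).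
  by rewrite ler_wpM2l// rotation_step_le.
have -> : N%:R * (2 * (dl ^+ 2 / 2 * (#|I|%:R * s) + dl * s)) = A / N%:R + pi * s.
  by rewrite /A /dl; field; exact: lt0r_neq0.
rewrite addrC lerD2l ler_pdivrMr// mulrC -ler_pdivrMr//; exact: ltW.
Qed.

End concentration.

(** * Modulus of continuity over dyadic points *)

Section chaining.
Context {R : realType}.
Variables (F : nat -> nat -> R) (e : nat -> R).
Hypothesis nested : forall n k, F n.+1 k.*2 = F n k.

(** The parent of [k] is [k./2]: for even [k] it is the same point, for odd [k] one adjacent
    increment away. The ancestor at level [m] is the quotient by [2^(n - m)]. *)
Lemma chain_down m n k : (m <= n)%N -> (k <= 2 ^ n)%N ->
  (forall j i, (m < j)%N -> (j <= n)%N -> (i < 2 ^ j)%N -> `|F j i.+1 - F j i| <= e j) ->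
  `|F n k - F m (k %/ 2 ^ (n - m))| <= \sum_(m.+1 <= j < n.+1) e j.
Proof.
move=> mn; elim: n k mn => [|n ih] k.
  rewrite leqn0 => /eqP -> _ _; rewrite expn0 divn1 subrr normr0 big_geq//.
rewrite leq_eqVlt => /predU1P[->|mn] kn st.
  by rewrite subnn expn0 divn1 subrr normr0 big_geq.
rewrite big_nat_recr//= addrC.
have k2 : (k./2 <= 2 ^ n)%N by rewrite -(doubleK (2 ^ n)%N) half_leq// -mul2n -expnS.
have h1 : `|F n.+1 k - F n k./2| <= e n.+1.
  rewrite -(nested n k./2); have := odd_double_half k; case: (odd k) => /= kE.
    rewrite -{1}kE add1n; apply: st => //.
    by move: kn; rewrite -{1}kE add1n.
  rewrite -{1}kE add0n subrr normr0.
  by apply: le_trans (st n.+1 0%N _ _ _) => //; rewrite expn_gt0.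
have -> : (k %/ 2 ^ (n.+1 - m) = k./2 %/ 2 ^ (n - m))%N.
  by rewrite subSn// expnS divnMA divn2.
apply: le_trans (ler_distD (F n k./2) _ _) (lerD h1 _).
by apply: ih => // j i mj jn; apply: st => //; exact: leqW.
Qed.

(** Descend from both points to level [m], where the ancestors are equal or adjacent because
    [l - k <= 2^(n - m)]. *)
Lemma chain_pair m n k l : (m <= n)%N -> (k <= l)%N -> (l <= 2 ^ n)%N -> (l - k <= 2 ^ (n - m))%N ->
  (forall j, 0 <= e j) ->
  (forall j i, (m <= j)%N -> (j <= n)%N -> (i < 2 ^ j)%N -> `|F j i.+1 - F j i| <= e j) ->
  `|F n l - F n k| <= 2 * \sum_(m <= j < n.+1) e j.
Proof.
move=> mn kl ln lk e0 st.
have kn : (k <= 2 ^ n)%N by exact: leq_trans ln.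
have st' j i : (m < j)%N -> (j <= n)%N -> (i < 2 ^ j)%N -> `|F j i.+1 - F j i| <= e j.
  by move=> mj; apply: st; exact: ltnW.
have h1 := chain_down mn ln st'; have h2 := chain_down mn kn st'.
set D := (2 ^ (n - m))%N in lk h1 h2; have D0 : (0 < D)%N by rewrite expn_gt0.
have h3 : `|F m (l %/ D) - F m (k %/ D)| <= e m.
  have AB : (k %/ D <= l %/ D)%N by exact: leq_div2r.
  have BA : (l %/ D <= (k %/ D).+1)%N.
    have /(leq_div2r D) : (l <= k + D)%N by rewrite -leq_subLR.
    by rewrite divnDr// divnn D0 addn1.
  move: AB; rewrite leq_eqVlt => /predU1P[->|AB]; first by rewrite subrr normr0.
  have -> : (l %/ D = (k %/ D).+1)%N by apply/eqP; rewrite eqn_leq BA AB.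
  apply: st => //; apply: leq_trans AB _.
  have -> : (2 ^ m)%N = (2 ^ n %/ D)%N by rewrite -{1}(subnKC mn) expnD mulnK.
  exact: leq_div2r.
have -> : 2 * \sum_(m <= j < n.+1) e j = \sum_(m.+1 <= j < n.+1) e j + (e m + \sum_(m.+1 <= j < n.+1) e j) + e m.
  by rewrite big_ltn//; ring.
set A := F n l - _ in h1; set B := F m _ - _ in h3; set C := F n k - _ in h2.
have -> : F n l - F n k = A + (B - C) by rewrite /A /B /C; ring.
apply: le_trans (ler_normD A (B - C)) _.
have := ler_normB B C; have := e0 m; move: h1 h2 h3.
by move: `|A| `|B| `|C| `|B - C| (\sum_(_ <= _ < _) _) (e m) => *; lra.
Qed.

Lemma sum_weighted_geometric (r : R) (N : nat) : 0 <= r -> r < 1 ->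
  \sum_(i < N) i.+1%:R * r ^+ i <= (1 - r) ^- 2.
Proof.
move=> r0 r1; have q0 : 0 < 1 - r by rewrite subr_gt0.
(* The right-hand side is the closed form of the partial sum, so equality is proved by induction. *)
suff : \sum_(i < N) i.+1%:R * r ^+ i <= (1 - r) ^- 2 * (1 - N.+1%:R * r ^+ N + N%:R * r ^+ N.+1).
  move/le_trans; apply; rewrite ler_piMr ?invr_ge0 ?exprn_ge0 ?(ltW q0)//.
  rewrite -addrA gerDl exprS -natr1 mulrDl mul1r opprD.
  have h : 0 <= N%:R * r ^+ N by rewrite mulr_ge0// exprn_ge0.
  have h2 : N%:R * (r * r ^+ N) <= N%:R * r ^+ N.
    by rewrite ler_wpM2l// ler_piMl ?exprn_ge0// ltW.
  have h3 : 0 <= r ^+ N by rewrite exprn_ge0.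
  by lra.
rewrite le_eqVlt; apply/orP; left; apply/eqP.
elim: N => [|N ih]; first by rewrite big_ord0 mul0r addr0 expr0 mulr1 subrr mulr0.
rewrite big_ord_recr/= ih -!natr1 !exprS; field; exact: lt0r_neq0.
Qed.

Lemma sqrt_addn_le (m i : nat) : (1 <= m)%N ->
  Num.sqrt (m + i)%:R <= Num.sqrt m%:R * i.+1%:R :> R.
Proof.
move=> m1; rewrite -[X in _ <= _ * X]ger0_norm// -sqrtr_sqr -sqrtrM//.
apply: ler_wsqrtr; rewrite -natrX -natrM ler_nat.
by rewrite (leq_trans (_ : _ <= m * i.+1)%N)// ?leq_mul// ?leq_exp2l ?mulnS ?leq_add2l ?leq_pmull// -mulnn leq_pmull.
Qed.

(** The tail of the series is comparable with its first term, since [sqrt (m + i)] is at most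
    [(i + 1) sqrt m]. *)
Lemma sum_sqrt_geometric (r : R) (m n : nat) : 0 <= r -> r < 1 -> (1 <= m)%N -> (m <= n)%N ->
  \sum_(m <= j < n.+1) (r ^+ j * Num.sqrt j%:R) <= (1 - r) ^- 2 * (r ^+ m * Num.sqrt m%:R).
Proof.
move=> r0 r1 m1 mn.
rewrite -{1}(add0n m) big_addn big_mkord.
apply: (@le_trans _ _ (\sum_(i < n.+1 - m) (i.+1%:R * r ^+ i) * (r ^+ m * Num.sqrt m%:R))).
  apply: ler_sum => i _; rewrite exprD addnC.
  rewrite (_ : i.+1%:R * r ^+ i * (r ^+ m * Num.sqrt m%:R) = r ^+ i * r ^+ m * (Num.sqrt m%:R * i.+1%:R)); last by ring.
  by rewrite ler_wpM2l ?sqrt_addn_le// mulr_ge0 ?exprn_ge0.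
rewrite -mulr_suml ler_wpM2r ?mulr_ge0 ?exprn_ge0 ?sqrtr_ge0//.
exact: sum_weighted_geometric.
Qed.

End chaining.

Section modulus.
Context {R : realType}.
Variables (gamma a b : R).
Hypotheses (g0 : 0 < gamma) (ab : a < b).

Definition modulus (r : R) : R := r `^ gamma * Num.sqrt (ln (1 / r)).

Definition dyadic_pt (n k : nat) : R := a + (b - a) * (k%:R / 2 ^+ n).

Lemma dyadic_pt_nested n k : dyadic_pt n.+1 k.*2 = dyadic_pt n k.
Proof.
rewrite /dyadic_pt exprS -muln2 natrM; congr (_ + _ * _); field.
by rewrite lt0r_neq0// exprn_gt0.
Qed.

Lemma dyadic_pt_nestedD m i k : dyadic_pt (m + i) (k * 2 ^ i) = dyadic_pt m k.
Proof.
elim: i => [|i ih]; first by rewrite addn0 muln1.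
by rewrite addnS expnS mulnCA mul2n dyadic_pt_nested.
Qed.

Lemma dyadic_dist n k l : (k <= l)%N ->
  `|dyadic_pt n l - dyadic_pt n k| = (b - a) * ((l - k)%:R / 2 ^+ n).
Proof.
move=> kl; rewrite /dyadic_pt ger0_norm.
  by rewrite natrB//; ring.
rewrite opprD addrACA subrr add0r -mulrBr -mulrBl mulr_ge0 ?subr_ge0 ?(ltW ab)//.
by rewrite mulr_ge0 ?invr_ge0 ?exprn_ge0// subr_ge0 ler_nat.
Qed.

Lemma dyadic_pt_itv n k : (k <= 2 ^ n)%N -> a <= dyadic_pt n k <= b.
Proof.
move=> kn; have l0 : 0 <= b - a by rewrite subr_ge0 ltW.
rewrite lerDl mulr_ge0 ?divr_ge0 ?exprn_ge0//= -lerBrDl ler_piMr//.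
by rewrite ler_pdivrMr ?exprn_gt0// mul1r -natrX ler_nat.
Qed.

Lemma modulus_ge0 r : 0 <= modulus r.
Proof. by rewrite mulr_ge0 ?powR_ge0 ?sqrtr_ge0. Qed.

Lemma modulus_gt0 r : 0 < r -> r < 1 -> 0 < modulus r.
Proof.
move=> r0 r1; rewrite mulr_gt0 ?powR_gt0// sqrtr_gt0 ln_gt0// div1r invf_gt1//.
Qed.

(** Three thresholds: [1 / 2] keeps distances below 1, where the modulus is positive; [(b - a) / 2]
    forces the level found in [chain_level] to be at least 1; [1 / (b - a)] gives
    [(b - a) / dl <= dl^(-2)], hence the logarithmic bound on that level. *)
Definition chain_scale : R := Num.min (Num.min 2^-1 ((b - a) / 2)) (b - a)^-1.

Lemma chain_scale_gt0 : 0 < chain_scale.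
Proof. by rewrite !lt_min invr_gt0 ltr0n divr_gt0 ?invr_gt0 ?subr_gt0. Qed.

(** In this order: the two descents, the geometric sum, the cells of the starting level being at
    most twice the distance, and the passage from the level to the logarithm of the distance. *)
Definition chain_const : R :=
  2 * (1 - 2 `^ (- gamma)) ^- 2 * 2 `^ gamma * Num.sqrt (2 / ln 2).

Lemma level_powR j : ((b - a) / 2 ^+ j) `^ gamma = (b - a) `^ gamma * (2 `^ (- gamma)) ^+ j.
Proof.
have ba0 : 0 <= b - a by rewrite subr_ge0 ltW.
rewrite powRM ?invr_ge0 ?exprn_ge0//; congr (_ * _).
rewrite -powR_mulrn ?powR_ge0// -powRrM mulNr powRN mulrC powRrM powR_mulrn//.
by rewrite -powR_inv1 ?exprn_ge0// -powRrM mulN1r powRN.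
Qed.

(** Take [m = n - e], with [e] the binary logarithm of [l - k] rounded up: the cells of level [m]
    are at least as long as the distance and at most twice as long. *)
Lemma chain_level (n k l : nat) (dl := (b - a) * ((l - k)%:R / 2 ^+ n)) :
  (k < l)%N -> (l <= 2 ^ n)%N -> dl < chain_scale ->
  exists m, [/\ (1 <= m <= n)%N, (l - k <= 2 ^ (n - m))%N, (b - a) / 2 ^+ m <= 2 * dl &
    m%:R <= 2 / ln 2 * ln (1 / dl)].
Proof.
move=> kl ln2 dls.
have ba0 : 0 < b - a by rewrite subr_gt0.
have lk0 : (0 < l - k)%N by rewrite subn_gt0.
have dl0 : 0 < dl by rewrite mulr_gt0// divr_gt0 ?exprn_gt0// ltr0n.
pose e := up_log 2 (l - k).
have lke : (l - k <= 2 ^ e)%N by exact: up_logP.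
have en : (e <= n)%N.
  by rewrite /e -[X in (_ <= X)%N](@up_expnK 2 n)//; apply: leq_up_log; rewrite (leq_trans (leq_subr _ _)).
have elk : (2 ^ e <= 2 * (l - k))%N.
  move: lk0; rewrite leq_eqVlt => /predU1P[lk1|lk1]; first by rewrite /e -lk1 up_log1.
  have := @up_log_gtn 2 (l - k) isT lk1; have := @up_log_gt0 2 (l - k); rewrite -/e lk1/=.
  by case: e {lke en} => // e' _; rewrite expnS leq_mul2l/= => /ltnW.
pose m := (n - e)%N.
have mn : (m <= n)%N by exact: leq_subr.
have nm : (n - m)%N = e by rewrite /m subKn.
have E : (b - a) / 2 ^+ m = (b - a) * ((2 ^ e)%:R / 2 ^+ n).
  have -> : 2 ^+ n = 2 ^+ e * 2 ^+ m :> R by rewrite -exprD -nm subnK.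
  by rewrite natrX; field; rewrite !expf_neq0.
have sc : (b - a) / 2 ^+ m <= 2 * dl.
  rewrite E /dl [2 * _]mulrCA ler_pM2l// [2 * _]mulrA ler_pM2r ?invr_gt0 ?exprn_gt0//.
  by rewrite -natrM ler_nat.
have sc2 : dl <= (b - a) / 2 ^+ m.
  by rewrite E /dl ler_pM2l// ler_pM2r ?invr_gt0 ?exprn_gt0// ler_nat.
move: dls; rewrite /chain_scale !lt_min => /andP[/andP[_ dl2] dlV].
exists m; split => //; last 1 first.
- have l2 : 0 < ln (2 : R) by rewrite ln_gt0// ltr1n.
  rewrite mulrAC ler_pdivlMr//.
  rewrite !mulr_natl -lnXn// -lnXn ?divr_gt0// ler_ln ?posrE ?exprn_gt0 ?divr_gt0//.
  have h1 : 2 ^+ m <= (b - a) / dl.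
    by rewrite ler_pdivlMr// mulrC -ler_pdivlMr// exprn_gt0.
  apply: le_trans h1 _; rewrite expr2 div1r ler_pM2r ?invr_gt0//.
  by rewrite -[leLHS]invrK ler_pV2 ?inE ?unitfE ?lt0r_neq0 ?invr_gt0//= ltW.
- rewrite mn andbT lt0n; apply/eqP => m0; move: sc; rewrite m0 expr0 divr1.
  by move: dl2; rewrite ltr_pdivlMr// mulrC => h /(lt_le_trans h); rewrite ltxx.
- by rewrite nm.
Qed.

(* Chaining: adjacent increments of order h^gamma sqrt(level) at every scale bound all dyadic
   increments by the modulus. *)
Lemma chaining_modulus (f : R -> R) (kap : R) (n : nat) : 0 <= kap ->
  (forall j i, (1 <= j)%N -> (j <= n)%N -> (i < 2 ^ j)%N ->
    `|f (dyadic_pt j i.+1) - f (dyadic_pt j i)| <= kap * ((b - a) / 2 ^+ j) `^ gamma * Num.sqrt j%:R) ->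
  forall k l, (k < l)%N -> (l <= 2 ^ n)%N -> `|dyadic_pt n l - dyadic_pt n k| < chain_scale ->
  `|f (dyadic_pt n l) - f (dyadic_pt n k)| <= chain_const * kap * modulus `|dyadic_pt n l - dyadic_pt n k|.
Proof.
move=> kap0 st k l kl l2; rewrite dyadic_dist ?(ltnW kl)//.
set dl := (b - a) * _ => dls.
have [m [/andP[m1 mn] lk sc ml]] := chain_level kl l2 dls; rewrite -/dl in sc ml.
pose rho : R := 2 `^ (- gamma).
have rho0 : 0 <= rho by exact: powR_ge0.
have rho1 : rho < 1.
  rewrite /rho powRN invf_lt1 ?powR_gt0//.
  by have := @gt0_ltr_powR _ _ g0 1 2; rewrite !nnegrE powR1 ltr1n; apply.
pose e j := kap * (b - a) `^ gamma * (rho ^+ j * Num.sqrt j%:R).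
have e0 j : 0 <= e j by rewrite !mulr_ge0 ?powR_ge0 ?exprn_ge0 ?sqrtr_ge0.
have st' j i : (m <= j)%N -> (j <= n)%N -> (i < 2 ^ j)%N ->
    `|f (dyadic_pt j i.+1) - f (dyadic_pt j i)| <= e j.
  move=> mj jn ij; apply: le_trans (st j i (leq_trans m1 mj) jn ij) _.
  by rewrite level_powR /e !mulrA.
have := @chain_pair _ (fun n k => f (dyadic_pt n k)) e _ m n k l mn (ltnW kl) l2 lk e0 st'.
move=> /(_ (fun n k => congr1 f (dyadic_pt_nested n k))) /le_trans; apply.
rewrite -mulr_sumr.
have := @sum_sqrt_geometric _ rho m n rho0 rho1 m1 mn => h.
have h2 : rho ^+ m * (b - a) `^ gamma <= 2 `^ gamma * dl `^ gamma.
  rewrite mulrC -level_powR -powRM//; last first.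
    by rewrite /dl mulr_ge0 ?divr_ge0 ?exprn_ge0// subr_ge0 ltW.
  by rewrite ge0_ler_powR ?nnegrE ?(ltW g0)//; rewrite ?divr_ge0 ?exprn_ge0 ?subr_ge0 ?(ltW ab)//;
    rewrite !mulr_ge0 ?invr_ge0 ?exprn_ge0 ?subr_ge0 ?(ltW ab).
have h3 : Num.sqrt (m%:R : R) <= Num.sqrt (2 / ln 2) * Num.sqrt (ln (1 / dl)).
  rewrite -sqrtrM; first exact: ler_wsqrtr.
  by rewrite divr_ge0// ln_ge0// ler1n.
rewrite /chain_const /modulus -/rho.
have q0 : 0 <= (1 - rho) ^- 2 by rewrite invr_ge0 sqr_ge0.
have := ler_pM (mulr_ge0 (exprn_ge0 m rho0) (powR_ge0 (b - a) gamma)) (sqrtr_ge0 _) h2 h3.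
set hp := (X in X <= _ -> _); rewrite -/rho in h *.
move=> hq; apply: (@le_trans _ _ (2 * (kap * (1 - rho) ^- 2 * hp))).
  rewrite (_ : _ * hp = kap * (b - a) `^ gamma * ((1 - rho) ^- 2 * (rho ^+ m * Num.sqrt m%:R))).
    by rewrite ler_pM2l// ler_wpM2l// mulr_ge0// powR_ge0.
  by rewrite /hp; ring.
apply: le_trans (ler_wpM2l (ler0n _ 2) (ler_wpM2l (mulr_ge0 kap0 q0) hq)) _.
by rewrite le_eqVlt; apply/orP; left; apply/eqP; ring.
Qed.

End modulus.

(** * Gaussian tails and the upper bound on dyadic maxima *)

Section gaussian_tail.
Context {R : realType} d (T : measurableType d) (P : probability T R).

Lemma gaussian_laplace (X : T -> R) (c v : R) : measurable_fun setT X ->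
  (forall c, centered_gaussian P (fun w => c * X w)) -> \int[P]_w (X w ^+ 2) <= v ->
  (\int[P]_w (expR (c * X w))%:E <= (expR (c ^+ 2 * v / 2))%:E)%E.
Proof.
move=> mX gX Xv.
have mc : measurable_fun setT (fun w => c * X w) by exact: measurable_funM.
have [u [u0 u2 -> _ _]] := centered_gaussian_moments mc (gX c).
have m1 : measurable_fun setT (fun w => 1 * X w) by exact: measurable_funM.
have [u' [u'0 u'2 _ _ _]] := centered_gaussian_moments m1 (gX 1).
have u'v : u' <= v.
  apply: le_trans Xv; rewrite /Rintegral; under eq_integral do rewrite -[X _]mul1r.
  by rewrite u'2.
rewrite lee_fin ler_expR ler_pM2r//.
have -> : u = c ^+ 2 * u'.
  apply: EFin_inj; rewrite -u2 EFinM -u'2 -ge0_integralZl_EFin ?sqr_ge0//.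
  - by apply: eq_integral => w _; rewrite -EFinM mul1r exprMn.
  - by move=> w _; rewrite lee_fin sqr_ge0.
  - by apply/measurable_EFinP; exact: measurable_funX.
by rewrite ler_wpM2l// sqr_ge0.
Qed.

(** Exponential Markov inequality for both signs, with the optimal parameter [l = r / v]. *)
Lemma gaussian_tail (X : T -> R) (v r : R) : measurable_fun setT X ->
  (forall c, centered_gaussian P (fun w => c * X w)) -> 0 < v -> \int[P]_w (X w ^+ 2) <= v -> 0 < r ->
  (P [set w | (r < `|X w|)%R] <= (2 * expR (- (r ^+ 2 / (2 * v))))%:E)%E.
Proof.
move=> mX gX v0 Xv r0; set A := [set w | _].
have mA : measurable A.
  rewrite (_ : A = (fun w => `|X w|) @^-1` `]r, +oo[).
    by rewrite -[X in measurable X]setTI; apply: (measurableT_comp (@normr_measurable R setT)).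
  by apply/seteqP; split => w; rewrite /A /= in_itv/= andbT.
pose l := r / v; have l0 : 0 < l by rewrite divr_gt0.
have me (c : R) : measurable_fun setT (fun w => expR (c * X w)).
  by apply: measurableT_comp => //; exact: measurable_funM.
have := gaussian_laplace l mX gX Xv; have := gaussian_laplace (- l) mX gX Xv; rewrite sqrrN => h2 h1.
rewrite -(setIT A) -integral_indic//.
apply: (@le_trans _ _ (\int[P]_w ((expR (- (l * r)))%:E * ((expR (l * X w))%:E + (expR (- l * X w))%:E)))%E).
  apply: ge0_le_integral => //.
  - by apply/measurable_EFinP; exact: measurable_indic.
  - by apply/measurable_EFinP; apply: measurable_funM => //; apply: measurable_funD.
  move=> w _; rewrite -EFinD -EFinM lee_fin indicE; have [|] := boolP (w \in A); last first.
    by rewrite mulr_ge0 ?addr_ge0 ?expR_ge0.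
  rewrite inE /A/= mulrDr -!expRD ltr_normr => /orP[h|h].
    have h' : 1 <= expR (- (l * r) + l * X w) by rewrite -[leLHS]expR0 ler_expR addrC subr_ge0 ler_pM2l// ltW.
    by rewrite (le_trans h')// lerDl expR_ge0.
  have h' : 1 <= expR (- (l * r) + - l * X w).
    by rewrite -[leLHS]expR0 ler_expR addrC subr_ge0 mulNr -mulrN ler_pM2l// ltW.
  by rewrite (le_trans h')// lerDr expR_ge0.
rewrite ge0_integralZl_EFin ?expR_ge0//; last 2 first.
- by move=> w _; rewrite adde_ge0// lee_fin expR_ge0.
- by apply/measurable_EFinP; exact: measurable_funD.
rewrite ge0_integralD//; do ?[by apply/measurable_EFinP; exact: me].
apply: le_trans (lee_wpmul2l _ (leeD h1 h2)) _; first by rewrite lee_fin expR_ge0.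
have dbl (x y : R) : x * (y + y) = 2 * (x * y) by ring.
rewrite -EFinD -EFinM lee_fin dbl -expRD.
rewrite le_eqVlt; apply/orP; left; apply/eqP; congr (2 * expR _).
by rewrite /l; field; exact: lt0r_neq0.
Qed.

End gaussian_tail.

Section normalized_increments.
Context {R : realType} d (T : measurableType d) (P : probability T R).
Variables (V : R -> T -> R) (gamma a b : R).

(* At [r = 0] the value is the junk [0^-1], multiplied by a null increment. *)
Definition weight (eps r : R) : R := if r < eps then (modulus gamma r)^-1 else 0.

(** Pairs too far apart get weight 0 instead of being removed: the index set then depends on [n]
    only, and the maxima for different [eps] are comparable. *)
Definition normalized_increment (eps : R) (n : nat) (jk : 'I_(2 ^ n).+1 * 'I_(2 ^ n).+1) (w : T) : R :=
  weight eps `|dyadic_pt a b n jk.2 - dyadic_pt a b n jk.1| *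
  (V (dyadic_pt a b n jk.2) w - V (dyadic_pt a b n jk.1) w).

Hypothesis mV : forall t, measurable_fun setT (V t).
Hypothesis gV : forall (I : finType) (c t : I -> R), (forall i, 0 <= t i) ->
  centered_gaussian P (lincomb c (fun i => V (t i))).

Lemma weight_ge0 eps r : 0 <= weight eps r.
Proof. by rewrite /weight; case: ifP => // _; rewrite invr_ge0 modulus_ge0. Qed.

Lemma measurable_normalized_increment eps n jk : measurable_fun setT (@normalized_increment eps n jk).
Proof. by apply: measurable_funM => //; exact: measurable_funB. Qed.

(** Each increment is a combination of two values, so the index set is doubled. *)
Lemma increments_gaussian (I : finType) (c g p q : I -> R) : (forall i, 0 <= p i) -> (forall i, 0 <= q i) ->
  centered_gaussian P (lincomb c (fun i w => g i * (V (q i) w - V (p i) w))).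
Proof.
move=> p0 q0.
have := @gV (I + I)%type (fun s => match s with inl i => c i * g i | inr i => - (c i * g i) end)
  (fun s => match s with inl i => q i | inr i => p i end).
have -> : lincomb (fun s => match s with inl i => c i * g i | inr i => - (c i * g i) end)
    (fun s : I + I => V (match s with inl i => q i | inr i => p i end)) =
  lincomb c (fun i w => g i * (V (q i) w - V (p i) w)).
  apply/funext => w; rewrite /lincomb big_sumType/= -big_split/=; apply: eq_bigr => i _.
  by rewrite mulNr -mulrBr mulrA.
by apply; case.
Qed.

Lemma increment_gaussian c p q : 0 <= p -> 0 <= q -> centered_gaussian P (fun w => c * (V q w - V p w)).
Proof.
move=> p0 q0; have := @increments_gaussian unit (fun=> c) (fun=> 1) (fun=> p) (fun=> q) (fun=> p0) (fun=> q0).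
congr (centered_gaussian P _); apply/funext => w; rewrite /lincomb (bigD1 tt)//= big1; last by case.
by rewrite addr0 mul1r.
Qed.

End normalized_increments.

Section upper_modulus.
Context {R : realType} d (T : measurableType d) (P : probability T R).
Variables (V : R -> T -> R) (gamma a b C : R).
Hypotheses (g0 : 0 < gamma) (a0 : 0 < a) (ab : a < b) (C0 : 0 < C).
Hypothesis mV : forall t, measurable_fun setT (V t).
Hypothesis gV : forall (I : finType) (c t : I -> R), (forall i, 0 <= t i) ->
  centered_gaussian P (lincomb c (fun i => V (t i))).
Hypothesis V_le : forall t h, 0 <= t -> 0 < h -> \int[P]_w ((V (t + h) w - V t w) ^+ 2) <= C * h `^ (2 * gamma).

(* Level [m] has [2^m] increments; this choice makes each exceed its bound with probability at most [2 * 8^-m]. *)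
Definition adjacent_bound : R := Num.sqrt (2 * C * ln 8).

Definition adjacent_exceeds (m k : nat) : set T :=
  [set w | (adjacent_bound * ((b - a) / 2 ^+ m) `^ gamma * Num.sqrt m%:R <
    `|V (dyadic_pt a b m k.+1) w - V (dyadic_pt a b m k) w|)%R].

Lemma dyadic_ptS m k : dyadic_pt a b m k.+1 = dyadic_pt a b m k + (b - a) / 2 ^+ m.
Proof. by rewrite /dyadic_pt -natr1; ring. Qed.

Lemma dyadic_pt_ge0 m k : 0 <= dyadic_pt a b m k.
Proof.
by rewrite /dyadic_pt addr_ge0 ?(ltW a0)// mulr_ge0 ?subr_ge0 ?(ltW ab)// divr_ge0 ?exprn_ge0.
Qed.

Lemma measurable_adjacent_exceeds m k : measurable (adjacent_exceeds m k).
Proof.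
rewrite /adjacent_exceeds; set r := _ * _ * _.
pose f w := V (dyadic_pt a b m k.+1) w - V (dyadic_pt a b m k) w.
have mf : measurable_fun setT (fun w => `|f w|).
  by apply: (measurableT_comp (@normr_measurable R setT)); exact: measurable_funB.
rewrite (_ : mkset _ = (fun w => `|f w|) @^-1` `]r, +oo[).
  by rewrite -[X in measurable X]setTI; exact: mf.
by apply/seteqP; split => w; rewrite /= in_itv/= andbT.
Qed.

Lemma adjacent_exceeds_le m k : (1 <= m)%N -> (P (adjacent_exceeds m k) <= (2 * 8 ^- m)%:E)%E.
Proof.
move=> m1; set h := (b - a) / 2 ^+ m.
have h0 : 0 < h by rewrite divr_gt0 ?exprn_gt0// subr_gt0.
have ln8 : 0 < ln (8 : R) by rewrite ln_gt0// ltr1n.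
have v0 : 0 < C * h `^ (2 * gamma) by rewrite mulr_gt0// powR_gt0.
have r0 : 0 < adjacent_bound * h `^ gamma * Num.sqrt m%:R.
  by apply: mulr_gt0; [apply: mulr_gt0; [rewrite sqrtr_gt0 !mulr_gt0|exact: powR_gt0]|rewrite sqrtr_gt0 ltr0n].
have m0 : 0 < m%:R :> R by rewrite ltr0n.
have p0 := dyadic_pt_ge0 m k; have p1 := dyadic_pt_ge0 m k.+1.
have := @gaussian_tail _ _ _ P (fun w => V (dyadic_pt a b m k.+1) w - V (dyadic_pt a b m k) w)
  (C * h `^ (2 * gamma)) (adjacent_bound * h `^ gamma * Num.sqrt m%:R)
  (measurable_funB (mV _) (mV _)) (fun c => increment_gaussian gV c p0 p1) v0.
rewrite {1 2}dyadic_ptS => /(_ (V_le p0 h0) r0); rewrite -dyadic_ptS => /le_trans; apply.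
(* The powers of [h] and the constant [C] cancel by the choice of [adjacent_bound]. *)
rewrite lee_fin ler_pM2l// (_ : _ / _ = m%:R * ln 8); last first.
  rewrite !exprMn !sqr_sqrtr ?mulr_ge0 ?ltW//.
  rewrite -powR_mulrn ?powR_ge0// -powRrM [gamma * _]mulrC; field.
  by apply/andP; split; apply: lt0r_neq0 => //; exact: powR_gt0.
by rewrite expRN expRM_natl lnK ?posrE.
Qed.

(** Level 0 is left out: chaining starts at level 1, and the threshold at level 0 would be 0. *)
Definition exceed_count n w : R := \sum_(m < n) \sum_(k < 2 ^ m.+1) \1_(adjacent_exceeds m.+1 k) w.

Lemma measurable_exceed_count n : measurable_fun setT (exceed_count n).
Proof.
apply: measurable_sum => m; apply: measurable_sum => k.
by apply: measurable_indic; exact: measurable_adjacent_exceeds.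
Qed.

Lemma exceed_count_expectation n : (\int[P]_w (exceed_count n w)%:E <= (2 / 3)%:E)%E.
Proof.
under eq_integral do rewrite -sumEFin.
rewrite ge0_integral_sum//; last 2 first.
- move=> m; apply/measurable_EFinP; apply: measurable_sum => k.
  by apply: measurable_indic; exact: measurable_adjacent_exceeds.
- by move=> m w _; rewrite lee_fin sumr_ge0.
apply: (@le_trans _ _ (\sum_(m < n) (2 * 4 ^- m.+1)%:E)%E).
  apply: lee_sum => m _; under eq_integral do rewrite -sumEFin.
  rewrite ge0_integral_sum//; last first.
    by move=> k; apply/measurable_EFinP; apply: measurable_indic; exact: measurable_adjacent_exceeds.
  apply: (@le_trans _ _ (\sum_(k < 2 ^ m.+1) (2 * 8 ^- m.+1)%:E)%E).
    apply: lee_sum => k _; rewrite integral_indic//; last exact: measurable_adjacent_exceeds.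
    by rewrite setIT; exact: adjacent_exceeds_le.
  rewrite sumEFin lee_fin sumr_const card_ord -[X in X <= _]mulr_natl natrX.
  rewrite (_ : 8 = 2 * 4 :> R); last by rewrite -natrM.
  rewrite exprMn invfM mulrCA mulVKf// ?lt0r_neq0// exprn_gt0//.
rewrite sumEFin lee_fin -mulr_sumr ler_pM2l//.
suff : \sum_(m < n) 4 ^- m.+1 <= (1 - 4 ^- n) / 3 :> R.
  move/le_trans; apply; rewrite ler_piMl// gerBl invr_ge0 exprn_ge0//.
elim: n => [|n ih]; first by rewrite big_ord0 expr0 invr1 subrr mul0r.
rewrite big_ord_recr/=; apply: le_trans (lerD ih (lexx _)) _.
rewrite le_eqVlt; apply/orP; left; apply/eqP; rewrite exprS; field.
by rewrite lt0r_neq0// exprn_gt0.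
Qed.

(** If no adjacent increment exceeds its threshold, chaining bounds the maximum by [C']; otherwise
    [exceed_count] is at least 1 and pays for the truncation level [C' + 1]. The result lies
    strictly below the truncation, which is what makes the truncation harmless later. *)
Lemma upper_modulus_expectation eps n (C' := chain_const gamma * adjacent_bound) : eps <= chain_scale a b ->
  \int[P]_w Num.min (max_norm (@normalized_increment _ _ _ V gamma a b eps n) w) (C' + 1) <= C' + 2 / 3.
Proof.
move=> epsl.
have C'0 : 0 <= C'.
  by rewrite /C' /chain_const !mulr_ge0 ?invr_ge0 ?sqr_ge0 ?powR_ge0 ?sqrtr_ge0.
have pt w : Num.min (max_norm (@normalized_increment _ _ _ V gamma a b eps n) w) (C' + 1) <= C' + exceed_count n w.
  have B0 : 0 <= exceed_count n w by rewrite sumr_ge0// => m _; rewrite sumr_ge0.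
  have [[m [k [mn km w1]]]|h] := pselect (exists m k, [/\ (m < n)%N, (k < 2 ^ m.+1)%N & adjacent_exceeds m.+1 k w]).
    rewrite ge_min lerD2l (_ : 1 <= _) ?orbT//.
    rewrite /exceed_count (bigD1 (Ordinal mn))//= (bigD1 (Ordinal km))//= indicE mem_set//.
    by rewrite -addrA lerDl addr_ge0// sumr_ge0// => ? _; rewrite sumr_ge0.
  rewrite ge_min; apply/orP; left; apply: (@le_trans _ _ C'); last by rewrite lerDl.
  have st j i : (1 <= j)%N -> (j <= n)%N -> (i < 2 ^ j)%N ->
    `|V (dyadic_pt a b j i.+1) w - V (dyadic_pt a b j i) w| <= adjacent_bound * ((b - a) / 2 ^+ j) `^ gamma * Num.sqrt j%:R.
    move=> j1 jn ij; rewrite leNgt; apply/negP => hw; apply: h.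
    by exists j.-1, i; rewrite prednK//; split.
  have ch := @chaining_modulus _ gamma a b g0 ab (fun t => V t w) adjacent_bound n (sqrtr_ge0 _) st.
  have key (k l : 'I_(2 ^ n).+1) : (k < l)%N ->
      weight gamma eps `|dyadic_pt a b n l - dyadic_pt a b n k| * `|V (dyadic_pt a b n l) w - V (dyadic_pt a b n k) w| <= C'.
    move=> kl; rewrite /weight; case: ifP => [le|]; last by rewrite mul0r.
    have ln : (l <= 2 ^ n)%N by rewrite -ltnS ltn_ord.
    have lc := lt_le_trans le epsl.
    have d0 : 0 < `|dyadic_pt a b n l - dyadic_pt a b n k|.
      by rewrite dyadic_dist ?(ltnW kl)// mulr_gt0 ?subr_gt0// divr_gt0 ?exprn_gt0// ltr0n subn_gt0.
    have d1 : `|dyadic_pt a b n l - dyadic_pt a b n k| < 1.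
      by apply: lt_trans lc _; rewrite /chain_scale !gt_min invf_lt1 ?ltr1n.
    by rewrite mulrC ler_pdivrMr ?modulus_gt0//; exact: ch.
  apply/max_norm_leP => // -[k l]; rewrite /normalized_increment normrM ger0_norm ?weight_ge0//=.
  case: (ltngtP k l) => [kl|lk|/val_inj ->]; first exact: key.
    by rewrite distrC [X in _ * X]distrC; exact: key.
  by rewrite !subrr normr0 mulr0.
have K0 : 0 <= C' + 1 by rewrite addr_ge0.
have Bm := bounded_trunc K0 (@measurable_normalized_increment _ _ _ V gamma a b mV eps n).
have fi := integrable_fin_num measurableT (bounded_measurable_integrable P Bm).
rewrite /Rintegral -lee_fin fineK//.
have B0 w : 0 <= exceed_count n w by rewrite sumr_ge0// => m _; rewrite sumr_ge0.
have mB := measurable_exceed_count n.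
apply: (@le_trans _ _ (\int[P]_w (C' + 1 * exceed_count n w)%:E)%E).
  apply: ge0_le_integral => //.
  - by move=> w _; rewrite lee_fin le_min max_norm_ge0.
  - by apply/measurable_EFinP; case: Bm.
  - by apply/measurable_EFinP; apply: measurable_funD => //; apply: measurable_funM.
  - by move=> w _; rewrite lee_fin mul1r.
rewrite probability_integral_addZ// mul1e EFinD leeD2l//.
exact: exceed_count_expectation.
Qed.

End upper_modulus.

(** * Second moment method and the lower bound on dyadic maxima *)

Section second_moment.
Context {R : realType} d (T : measurableType d) (P : probability T R).

Lemma Rintegral_bigsum (I : Type) (s : seq I) (f : I -> T -> R) :
  (forall i, P.-integrable setT (EFin \o f i)) ->
  P.-integrable setT (EFin \o (fun w => \sum_(i <- s) f i w)) /\
  \int[P]_w (\sum_(i <- s) f i w) = \sum_(i <- s) \int[P]_w f i w.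
Proof.
move=> fi; elim: s => [|i s [ih1 ih2]].
  rewrite (_ : (fun w => _) = cst 0); last by apply/funext => w; rewrite big_nil.
  rewrite big_nil Rintegral_cst//= mul0r; split => //.
  exact: (finite_measure_integrable_cst P 0).
rewrite (_ : (fun w => _) = fun w => f i w + \sum_(j <- s) f j w); last first.
  by apply/funext => w; rewrite big_cons.
rewrite big_cons RintegralD// ih2; split => //.
exact: (integrableD measurableT (fi i) ih1).
Qed.

Context {I : finType} (Y : I -> T -> R).
Hypothesis mY : forall i, measurable_fun setT (Y i).
Hypothesis gY : forall c, centered_gaussian P (lincomb c Y).

Lemma expR_lincomb c : P.-integrable setT (EFin \o (fun w => expR (lincomb c Y w))) /\
  \int[P]_w expR (lincomb c Y w) = expR (lvar P Y c / 2).
Proof.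
have mc := measurable_lincomb c mY.
have [v [v0 v2 ve _ _]] := centered_gaussian_moments mc (gY c).
rewrite /lvar [X in expR (X / 2)](_ : _ = v); last by rewrite /Rintegral v2.
rewrite [X in X = _](_ : _ = expR (v / 2)); last by rewrite /Rintegral ve.
split => //; apply/integrableP; split.
  by apply/measurable_EFinP; exact: measurableT_comp.
by under eq_integral do rewrite /= ger0_norm ?expR_ge0//; rewrite ve ltry.
Qed.

Local Notation delta i := (fun k : I => (k == i)%:R : R).

Lemma lincomb_delta i w : lincomb (delta i) Y w = Y i w.
Proof.
rewrite /lincomb (bigD1 i)//= eqxx mul1r big1 ?addr0// => k ki.
by rewrite (negbTE ki) mul0r.
Qed.

Variables (beta C rho : R).
Hypothesis YC : forall i, \int[P]_w (Y i w ^+ 2) <= C.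
Hypothesis Yrho : forall i j, i != j -> \int[P]_w (Y i w * Y j w) <= rho.

(** The exponential of [beta Y_i] divided by its mean, so that the products have mean
    [exp (beta^2 cov)]. *)
Definition exp_tilt i w : R := expR (beta * Y i w - beta ^+ 2 * \int[P]_w (Y i w ^+ 2) / 2).

Lemma exp_tilt_mul i j :
  P.-integrable setT (EFin \o (fun w => exp_tilt i w * exp_tilt j w)) /\
  \int[P]_w (exp_tilt i w * exp_tilt j w) = expR (beta ^+ 2 * \int[P]_w (Y i w * Y j w)).
Proof.
have vE k : lvar P Y (delta k) = \int[P]_w (Y k w ^+ 2).
  by apply: eq_Rintegral => w _; rewrite lincomb_delta.
have cE : lcov P Y (delta i) (delta j) = \int[P]_w (Y i w * Y j w).
  by apply: eq_Rintegral => w _; rewrite !lincomb_delta.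
have := expR_lincomb (fun k => beta * (k == i)%:R + beta * (k == j)%:R).
rewrite lvar_lin// !vE cE => -[h1 h2].
pose q := expR (- (beta ^+ 2 * (\int[P]_w (Y i w ^+ 2) + \int[P]_w (Y j w ^+ 2)) / 2)).
have E w : exp_tilt i w * exp_tilt j w = q * expR (lincomb (fun k => beta * (k == i)%:R + beta * (k == j)%:R) Y w).
  by rewrite /exp_tilt /q lincomb_lin !lincomb_delta -!expRD; congr expR; field.
split; first by under eq_fun do rewrite E; exact: (integrableZl measurableT q h1).
under eq_Rintegral do rewrite E.
rewrite RintegralZl// h2 /q -expRD; congr expR.
by field.
Qed.

Lemma exp_tilt_one i :
  P.-integrable setT (EFin \o exp_tilt i) /\ \int[P]_w exp_tilt i w = 1.
Proof.
have vE k : lvar P Y (delta k) = \int[P]_w (Y k w ^+ 2).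
  by apply: eq_Rintegral => w _; rewrite lincomb_delta.
have := expR_lincomb (fun k => beta * (k == i)%:R + 0 * (k == i)%:R).
rewrite lvar_lin// !vE => -[h1 h2].
pose q := expR (- (beta ^+ 2 * \int[P]_w (Y i w ^+ 2) / 2)).
have E w : exp_tilt i w = q * expR (lincomb (fun k => beta * (k == i)%:R + 0 * (k == i)%:R) Y w).
  by rewrite /exp_tilt /q lincomb_lin !lincomb_delta -!expRD; congr expR; ring.
split; first by rewrite (funext E); exact: (integrableZl measurableT q h1).
under eq_Rintegral do rewrite E.
rewrite RintegralZl// h2 /q -expRD -[RHS]expR0; congr expR.
by field.
Qed.

Definition tilt_mean w : R := #|I|%:R^-1 * \sum_i exp_tilt i w.

(** Expanding the square leaves one diagonal term per index, weighted by the inverse square of their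
    number, and off-diagonal terms close to 1 when the covariances are small. *)
Lemma tilt_mean_variance : (0 < #|I|)%N ->
  P.-integrable setT (EFin \o (fun w => (tilt_mean w - 1) ^+ 2)) /\
  \int[P]_w ((tilt_mean w - 1) ^+ 2) <=
    #|I|%:R^-1 * expR (beta ^+ 2 * C) + expR (beta ^+ 2 * rho) - 1.
Proof.
move=> I0; set N := #|I|%:R : R; have N0 : 0 < N by rewrite ltr0n.
have [i1 e1] := Rintegral_bigsum (index_enum I) (fun i => (exp_tilt_one i).1).
have h2 i := Rintegral_bigsum (index_enum I) (fun j => (exp_tilt_mul i j).1).
have [i2 e2] := Rintegral_bigsum (index_enum I) (fun i => (h2 i).1).
have E w : (tilt_mean w - 1) ^+ 2 =
  N ^- 2 * (\sum_i \sum_j exp_tilt i w * exp_tilt j w) + (- (2 / N) * \sum_i exp_tilt i w + 1).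
  rewrite /tilt_mean -/N; under [\sum_i \sum_j _]eq_bigr do rewrite -mulr_sumr.
  by rewrite -mulr_suml; field; exact: lt0r_neq0.
have j2 := integrableZl measurableT (N ^- 2) i2.
have j1 := integrableZl measurableT (- (2 / N)) i1.
have jc := finite_measure_integrable_cst P (1 : R) measurableT.
have j3 := integrableD measurableT j1 jc.
split.
  by under eq_fun do rewrite E; exact: (integrableD measurableT j2 j3).
under eq_Rintegral do rewrite E.
rewrite RintegralD// RintegralD// !RintegralZl// e1 e2 Rintegral_cst//.
rewrite (_ : fine (P setT) = 1); last by rewrite probability_setT.
rewrite mulr1.
rewrite [X in - (2 / N) * X](eq_bigr (fun=> 1)); last by move=> i _; rewrite (exp_tilt_one i).2.
rewrite [X in - (2 / N) * X]sumr_const -/N.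
have -> : - (2 / N) * N + 1 = - 1 by field; exact: lt0r_neq0.
rewrite lerD2r.
apply: (@le_trans _ _ (N ^- 2 * (N * (expR (beta ^+ 2 * C) + N * expR (beta ^+ 2 * rho))))); last first.
  by rewrite le_eqVlt; apply/orP; left; apply/eqP; field; exact: lt0r_neq0.
rewrite ler_wpM2l ?invr_ge0 ?sqr_ge0//.
apply: (@le_trans _ _ (\sum_(i : I) (expR (beta ^+ 2 * C) + N * expR (beta ^+ 2 * rho)))); last first.
  by rewrite sumr_const -[X in X <= _]mulr_natl.
apply: ler_sum => i _; rewrite (h2 i).2 (bigD1 i)//= (exp_tilt_mul i i).2.
apply: lerD.
  by rewrite ler_expR ler_wpM2l ?sqr_ge0//; under eq_Rintegral do rewrite -expr2; exact: YC.
apply: (@le_trans _ _ (\sum_(j : I) expR (beta ^+ 2 * rho))); last first.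
  by rewrite sumr_const -[X in X <= _]mulr_natl.
rewrite [leRHS](bigD1 i)//= -[leLHS]add0r lerD ?expR_ge0//; apply: ler_sum => j ji.
by rewrite (exp_tilt_mul i j).2 ler_expR ler_wpM2l ?sqr_ge0// Yrho// eq_sym.
Qed.

End second_moment.

Section lower_asymptotics.
Context {R : realType}.

(** With [q = r^2], the factor [m r^m] is bounded by a term of the weighted geometric sum and the
    other [r^m] tends to 0. *)
Lemma natr_geometric_cvg0 (q : R) : 0 < q -> q < 1 -> (fun m => m%:R * q ^+ m) @ \oo --> (0 : R).
Proof.
move=> q0 q1; pose r := Num.sqrt q.
have r0 : 0 < r by rewrite sqrtr_gt0.
have r1 : r < 1 by rewrite /r -[ltRHS]sqrtr1 ltr_sqrt.
have h : geometric ((1 - r) ^- 2) r @ \oo --> (0 : R) by apply: cvg_geometric; rewrite ger0_norm// ltW.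
apply: (squeeze_cvgr (f := cst 0) (h := geometric ((1 - r) ^- 2) r)) => //; last exact: cvg_cst.
apply: nearW => m; rewrite mulr_ge0 ?exprn_ge0 ?(ltW q0)//=.
have -> : q ^+ m = r ^+ m * r ^+ m by rewrite -exprMn -expr2 sqr_sqrtr// ltW.
rewrite mulrA ler_wpM2r ?exprn_ge0 ?(ltW r0)//.
have := @sum_weighted_geometric _ r m.+1 (ltW r0) r1; rewrite big_ord_recr/=; apply: le_trans.
rewrite -[leLHS]add0r lerD//.
  by rewrite sumr_ge0// => i _; rewrite mulr_ge0 ?exprn_ge0// ltW.
by rewrite ler_wpM2r ?exprn_ge0 ?(ltW r0)// ler_nat.
Qed.

End lower_asymptotics.

Section lower_scale.
Context {R : realType}.
Variables (C c th kappa ell delta : R).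
Hypotheses (c0 : 0 < c) (th0 : 0 < th) (thC : th ^+ 2 * C = ln 2 / 2) (k0 : 0 < kappa)
  (ell0 : 0 < ell) (delta0 : 0 < delta).

Lemma geometric_eventually_lt (A q e : R) : 0 <= q -> q < 1 -> 0 < e -> \forall m \near \oo, A * q ^+ m < e.
Proof.
move=> q0 q1 e0; have h : geometric A q @ \oo --> (0 : R) by apply: cvg_geometric; rewrite ger0_norm.
exact: (cvgr_lt _ h _ e0).
Qed.

(** The choice of [th] gives [exp (th^2 m C) = 2^(m / 2)], which averaging over [2^m] terms beats.
    The covariances decay geometrically in [m], which beats the factor [m] in the exponent. The
    final [1 / 8] is split evenly between the two effects. *)
Lemma lower_scale : exists m : nat, [/\ (1 <= m)%N, ell / 2 ^+ (m + m) < delta,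
  ln (1 / (ell / 2 ^+ (m + m))) <= 2 * m%:R * ln 4,
  expR (- (th ^+ 2 * c * m%:R / 4)) <= 1 / 2 &
  (2 ^ m)%:R^-1 * expR ((th ^+ 2 * m%:R) * C) + expR ((th ^+ 2 * m%:R) * (C * (2 `^ (- kappa)) ^+ m)) - 1 <= 1 / 8].
Proof.
have q4 : 0 <= 4^-1 :> R by rewrite invr_ge0.
have q4' : 4^-1 < 1 :> R by rewrite invf_lt1// ltr1n.
have ln2 : 0 < ln (2 : R) by rewrite ln_gt0// ltr1n.
have E4 m : 2 ^+ (m + m) = 4 ^+ m :> R by rewrite exprD -exprMn -natrM.
(* This is [2^(-1 / 2)], the ratio of the diagonal contribution. *)
pose q5 : R := 2^-1 * expR (ln 2 / 2).
have q50 : 0 <= q5 by rewrite mulr_ge0 ?expR_ge0.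
have q51 : q5 < 1.
  rewrite /q5 mulrC ltr_pdivrMr// mul1r -[ltRHS]lnK ?posrE// ltr_expR ltr_pdivrMr//.
  by rewrite mulrC ltr_pMl// ltr1n.
have q60 : 0 < 2 `^ (- kappa) :> R by rewrite powR_gt0.
have q61 : 2 `^ (- kappa) < 1 :> R.
  rewrite powRN invf_lt1 ?powR_gt0//.
  by have := @gt0_ltr_powR _ _ k0 1 2; rewrite !nnegrE powR1 ltr1n; apply.
have N6 : \forall m \near \oo, expR ((th ^+ 2 * m%:R) * (C * (2 `^ (- kappa)) ^+ m)) < 1 + 1 / 16.
  have h : (fun m => expR (th ^+ 2 * C * (m%:R * (2 `^ (- kappa)) ^+ m))) @ \oo --> expR (0 : R).
    have h : (fun m => th ^+ 2 * C * (m%:R * (2 `^ (- kappa)) ^+ m)) @ \oo --> (0 : R).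
      rewrite -[X in _ --> X](mulr0 (th ^+ 2 * C)).
      by apply: cvgM; [exact: cvg_cst|exact: natr_geometric_cvg0].
    exact: (cvg_comp _ _ h (@continuous_expR R 0)).
  have h16 : expR 0 < 1 + 1 / 16 :> R by rewrite expR0 ltrDl divr_gt0.
  apply: filterS (cvgr_lt _ h _ h16) => m; rewrite (_ : th ^+ 2 * C * _ = th ^+ 2 * m%:R * (C * (2 `^ (- kappa)) ^+ m))//.
  by ring.
have N1 := nbhs_infty_gt 0%N.
have N2 := geometric_eventually_lt ell q4 q4' delta0.
have N3 := geometric_eventually_lt ell^-1 q4 q4' ltr01.
have half0 : 0 < 1 / 2 :> R by rewrite divr_gt0.
have e16 : 0 < 1 / 16 :> R by rewrite divr_gt0.
have x41 : expR (- (th ^+ 2 * c / 4)) < 1.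
  by rewrite -[ltRHS]expR0 ltr_expR oppr_lt0 divr_gt0// mulr_gt0// exprn_gt0.
have N4 := geometric_eventually_lt 1 (expR_ge0 _) x41 half0.
have N5 := geometric_eventually_lt 1 q50 q51 e16.
have [m] := @filter_ex _ \oo _ _ (filterI N1 (filterI N2 (filterI N3 (filterI N4 (filterI N5 N6))))).
move=> [m1 [n2 [n3 [n4 [n5 n6]]]]]; exists m; rewrite E4; split => //.
- by rewrite -exprVn.
- rewrite (_ : 2 * m%:R * ln 4 = ln ((4 ^+ m) ^+ 2)); last first.
    by rewrite lnXn ?exprn_gt0// lnXn// -[RHS]mulr_natl -[ln 4 *+ m]mulr_natl mulrA.
  rewrite ler_ln ?posrE ?exprn_gt0 ?divr_gt0 ?exprn_gt0//.
  rewrite div1r invf_div expr2 ler_pM2l ?exprn_gt0//.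
  by move: n3; rewrite exprVn ltr_pdivrMr ?exprn_gt0// mul1r => /ltW.
- apply: ltW; move: n4; rewrite mul1r -expRM_natl.
  by rewrite (_ : m%:R * _ = - (th ^+ 2 * c * m%:R / 4))//; field.
- move: n5 n6; rewrite mul1r.
  have -> : q5 ^+ m = (2 ^ m)%:R^-1 * expR (th ^+ 2 * m%:R * C).
    rewrite /q5 exprMn exprVn natrX -expRM_natl; congr (_ * expR _).
    by rewrite -thC; ring.
  by move=> /ltW n5 /ltW n6; move: n5 n6; move: (_ * expR _) => x; move: (expR _) => y; lra.
Qed.

End lower_scale.

Section lower_modulus.
Context {R : realType} d (T : measurableType d) (P : probability T R).
Variables (V : R -> T -> R) (gamma kappa a b C c h1 : R).
Hypotheses (g0 : 0 < gamma) (k0 : 0 < kappa) (a0 : 0 < a) (ab : a < b) (C0 : 0 < C) (c0 : 0 < c) (h10 : 0 < h1).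
Hypothesis mV : forall t, measurable_fun setT (V t).
Hypothesis gV : forall (I : finType) (c t : I -> R), (forall i, 0 <= t i) ->
  centered_gaussian P (lincomb c (fun i => V (t i))).
Hypothesis V_le : forall t h : R, 0 <= t -> 0 < h -> \int[P]_w ((V (t + h) w - V t w) ^+ 2) <= C * h `^ (2 * gamma).
Hypothesis V_ge : forall t h : R, a <= t -> 0 < h -> h <= h1 ->
  c * h `^ (2 * gamma) <= \int[P]_w ((V (t + h) w - V t w) ^+ 2).
Hypothesis V_far : forall t s h D : R, 0 <= s -> 0 < h -> 2 * h <= D -> s + D <= t ->
  \int[P]_w ((V (t + h) w - V t w) * (V (s + h) w - V s w)) <= C * D `^ (- kappa) * h `^ (2 * gamma + kappa).

Lemma increments_mul_integrable p q p' q' : 0 <= p -> 0 <= q -> 0 <= p' -> 0 <= q' ->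
  P.-integrable setT (EFin \o (fun w => (V q w - V p w) * (V q' w - V p' w))).
Proof.
move=> hp hq hp' hq'.
have h0 (x y : R) : 0 <= x -> 0 <= y -> forall e : bool, 0 <= if e then x else y by move=> ? ? [].
(* The two increments form a family indexed by [bool], to which the integrability of products of
   linear combinations applies. *)
pose X (e : bool) w := 1 * (V (if e then q else q') w - V (if e then p else p') w).
have mX e : measurable_fun setT (X e) by apply: measurable_funM => //; exact: measurable_funB.
have := integrable_lcov mX (fun c => increments_gaussian gV c (fun=> 1) (h0 _ _ hp hp') (h0 _ _ hq hq'))
  (fun k => (k == true)%:R) (fun k => (k == false)%:R).
by under eq_fun do rewrite !lincomb_delta /X !mul1r.
Qed.

(* [2^m] increments of length [(b - a) * 4^-m], spaced by [(b - a) * 2^-m] so that they decorrelate. *)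
Section at_scale.
Variable m : nat.
Let h := (b - a) / 2 ^+ (m + m).
Let pt (j : 'I_(2 ^ m)) := dyadic_pt a b m j.
Definition fine_increment (j : 'I_(2 ^ m)) (w : T) : R := (h `^ gamma)^-1 * (V (pt j + h) w - V (pt j) w).

Lemma fine_step_gt0 : 0 < h.
Proof. by rewrite divr_gt0 ?exprn_gt0// subr_gt0. Qed.

Lemma fine_increment_mul i j : \int[P]_w (fine_increment i w * fine_increment j w) =
  h `^ (- (2 * gamma)) * \int[P]_w ((V (pt i + h) w - V (pt i) w) * (V (pt j + h) w - V (pt j) w)).
Proof.
have hh := fine_step_gt0.
have pi0 := dyadic_pt_ge0 a0 ab m i; have pj0 := dyadic_pt_ge0 a0 ab m j.
rewrite -RintegralZl//; last by apply: increments_mul_integrable => //; rewrite addr_ge0// ltW.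
apply: eq_Rintegral => w _; rewrite /fine_increment.
rewrite mulr_natl mulr2n opprD powRD; last by rewrite lt0r_neq0 ?implybT.
by rewrite powRN; ring.
Qed.

(** The lower variance bound is available only for steps up to [h1]; the second alternative is
    excluded once [m] is chosen. *)
Lemma fine_increment_sq i : c <= \int[P]_w (fine_increment i w ^+ 2) <= C \/ h1 < h.
Proof.
have hh := fine_step_gt0; have pi0 := dyadic_pt_ge0 a0 ab m i.
have [hl|] := leP h h1; last by right.
left; under eq_Rintegral do rewrite expr2.
rewrite fine_increment_mul; under eq_Rintegral do rewrite -expr2.
have ai : a <= pt i by have /andP[] := dyadic_pt_itv ab (ltnW (ltn_ord i)).
have e : h `^ (- (2 * gamma)) * h `^ (2 * gamma) = 1 by rewrite powRN mulVf// lt0r_neq0// powR_gt0.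
have hp : 0 < h `^ (- (2 * gamma)) by exact: powR_gt0.
have u1 := ler_wpM2l (ltW hp) (V_le pi0 hh); have u2 := ler_wpM2l (ltW hp) (V_ge ai hh hl).
by move: u1 u2; rewrite !(mulrCA (h `^ (- _))) e !mulr1 => -> ->.
Qed.

(** The base points are at least [D = (b - a) / 2^m] apart and the step is [h = D / 2^m], so the
    normalized far bound is [C (h / D)^kappa]. *)
Lemma fine_increment_cov i j : (1 <= m)%N -> i != j ->
  \int[P]_w (fine_increment i w * fine_increment j w) <= C * (2 `^ (- kappa)) ^+ m.
Proof.
move=> m1; wlog ji : i j / (j < i)%N => [wl ij|_].
  case: (ltngtP i j) => [lt|lt|/val_inj eq].
  - under eq_Rintegral do rewrite mulrC; apply: wl => //; rewrite eq_sym//.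
  - exact: wl.
  - by move: ij; rewrite eq eqxx.
rewrite fine_increment_mul; have hh := fine_step_gt0; have pj0 := dyadic_pt_ge0 a0 ab m j.
pose D := (b - a) / 2 ^+ m.
have D0 : 0 < D by rewrite divr_gt0 ?exprn_gt0// subr_gt0.
have hD : h = D / 2 ^+ m by rewrite /h /D exprD invfM mulrA.
have hD2 : 2 * h <= D.
  rewrite hD mulrCA ler_piMr// ?(ltW D0)// ler_pdivrMr ?exprn_gt0// mul1r.
  by rewrite -(expr1 2) ler_weXn2l// ler1n.
have far : pt j + D <= pt i.
  rewrite /pt -dyadic_ptS /dyadic_pt lerD2l ler_pM2l ?subr_gt0//.
  by rewrite ler_pM2r ?invr_gt0 ?exprn_gt0// ler_nat.
have hp : 0 < h `^ (- (2 * gamma)) by exact: powR_gt0.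
apply: le_trans (ler_wpM2l (ltW hp) (V_far pj0 hh hD2 far)) _.
rewrite le_eqVlt; apply/orP; left; apply/eqP.
have e : h `^ (- (2 * gamma)) * h `^ (2 * gamma) = 1 by rewrite powRN mulVf// lt0r_neq0// powR_gt0.
rewrite powRD; last by rewrite lt0r_neq0 ?implybT.
rewrite mulrCA -!mulrA; congr (C * _).
rewrite [X in _ * X = _]mulrA e mul1r hD powRM ?(ltW D0) ?invr_ge0 ?exprn_ge0//.
rewrite mulrA powRN mulVf ?mul1r; last by rewrite lt0r_neq0// powR_gt0.
rewrite -[RHS]powR_mulrn ?powR_ge0// -powRrM mulNr powRN mulrC powRrM powR_mulrn//.
by rewrite -powR_inv1 ?exprn_ge0// -powRrM mulN1r powRN.
Qed.

Lemma measurable_fine_increment j : measurable_fun setT (fine_increment j).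
Proof. by apply: measurable_funM => //; exact: measurable_funB. Qed.

Lemma fine_increment_gaussian e : centered_gaussian P (lincomb e fine_increment).
Proof.
have hh := fine_step_gt0.
apply: (increments_gaussian gV e (fun=> (h `^ gamma)^-1) (p := pt) (q := fun j => pt j + h)) => j.
  exact: dyadic_pt_ge0.
by rewrite addr_ge0 ?(ltW hh)//; exact: dyadic_pt_ge0.
Qed.

(** On level [2 m] the base point has index [j * 2^m], and the increment joins it to its successor.
    The hypothesis on [ln (1 / h)] replaces the logarithm in the modulus by [2 m ln 4]. *)
Lemma fine_increment_normalized eps j w (r : R) : h < eps -> h < 1 -> 0 <= r ->
  ln (1 / h) <= 2 * m%:R * ln 4 -> (1 <= m)%N ->
  r * Num.sqrt m%:R <= `|fine_increment j w| ->
  r / Num.sqrt (2 * ln 4) <= max_norm (@normalized_increment _ _ _ V gamma a b eps (m + m)) w.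
Proof.
move=> he hl1 r0 lnh m1 hY; have hh := fine_step_gt0.
have jb : (j * 2 ^ m < 2 ^ (m + m))%N by rewrite expnD ltn_pmul2r ?expn_gt0.
pose p := Ordinal (leqW jb : (j * 2 ^ m < (2 ^ (m + m)).+1)%N).
pose q := Ordinal (jb : ((j * 2 ^ m).+1 < (2 ^ (m + m)).+1)%N).
apply: le_trans (max_norm_ge _ w (p, q)).
have pE : dyadic_pt a b (m + m) (j * 2 ^ m) = pt j by exact: dyadic_pt_nestedD.
rewrite /normalized_increment /= dyadic_ptS pE -/h.
have -> : pt j + h - pt j = h by ring.
rewrite (gtr0_norm hh) /weight he.
have g0' : 0 < modulus gamma h by exact: modulus_gt0.
rewrite normrM gtr0_norm ?invr_gt0// [leRHS]mulrC ler_pdivlMr//.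
have hg : 0 < h `^ gamma by exact: powR_gt0.
move: hY; rewrite /fine_increment normrM gtr0_norm ?invr_gt0// [X in _ <= X -> _]mulrC ler_pdivlMr// => /(le_trans _); apply.
rewrite /modulus mulrA [leRHS]mulrC mulrAC [leRHS]mulrC ler_wpM2r ?(ltW hg)//.
have l4 : 0 < ln (4 : R) by rewrite ln_gt0// ltr1n.
have s0 : 0 < Num.sqrt (2 * ln 4) :> R by rewrite sqrtr_gt0 mulr_gt0.
rewrite mulrAC ler_pdivrMr// -mulrA ler_wpM2l// -sqrtrM//.
by apply: ler_wsqrtr; rewrite mulrCA mulrA.
Qed.

End at_scale.

(** Either some fine increment reaches [th c / 4 * sqrt m], and the truncated maximum is at least
    [c1], or all tilts are at most [1 / 2], so that [(A - 1)^2 >= 1 / 4]. In both cases it is at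
    least [c1 - 4 c1 (A - 1)^2], whose mean is at least [c1 / 2]; and [c1] does not depend on
    [eps]. *)
Lemma lower_modulus_expectation K : 0 < K -> exists2 c2 : R, 0 < c2 & forall eps, 0 < eps -> exists n,
  c2 <= \int[P]_w Num.min (max_norm (@normalized_increment _ _ _ V gamma a b eps n) w) K.
Proof.
move=> K0.
have l2 : 0 < ln (2 : R) by rewrite ln_gt0// ltr1n.
have l4 : 0 < ln (4 : R) by rewrite ln_gt0// ltr1n.
have s0 : 0 < Num.sqrt (2 * ln 4) :> R by rewrite sqrtr_gt0 mulr_gt0.
have [th th0 thC] : exists2 th : R, 0 < th & th ^+ 2 * C = ln 2 / 2.
  exists (Num.sqrt (ln 2 / (2 * C))); first by rewrite sqrtr_gt0 divr_gt0// mulr_gt0.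
  by rewrite sqr_sqrtr ?divr_ge0 ?(ltW l2) ?mulr_ge0 ?(ltW C0)//; field; exact: lt0r_neq0.
pose c1 : R := Num.min (th * c / 4 / Num.sqrt (2 * ln 4)) K.
have c10 : 0 < c1 by rewrite lt_min K0 !divr_gt0// mulr_gt0.
exists (c1 / 2) => [|eps eps0]; first exact: divr_gt0.
have ell0 : 0 < b - a by rewrite subr_gt0.
have delta0 : 0 < Num.min h1 (Num.min eps 1) by rewrite !lt_min h10 eps0 ltr01.
have [m [m1 hd hln h4 h5]] := lower_scale c0 th0 thC k0 ell0 delta0.
exists (m + m)%N; set h := (b - a) / 2 ^+ (m + m) in hd hln.
move: hd; rewrite !lt_min => /and3P[hh1 heps hone].
(* The tilt has the order [sqrt m] of the maximum of [2^m] weakly dependent Gaussian variables. *)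
pose beta := th * Num.sqrt m%:R.
have beta2 : beta ^+ 2 = th ^+ 2 * m%:R by rewrite exprMn; congr (_ * _); rewrite sqr_sqrtr.
have Yv i : c <= \int[P]_w (@fine_increment m i w ^+ 2) <= C.
  by have [//|] := fine_increment_sq i; rewrite ltNge (ltW hh1).
have YC i : \int[P]_w (@fine_increment m i w ^+ 2) <= C by have /andP[] := Yv i.
have I0 : (0 < #|'I_(2 ^ m)|)%N by rewrite card_ord expn_gt0.
have [iA vA] := @tilt_mean_variance _ _ _ P _ (@fine_increment m) (@measurable_fine_increment m)
  (@fine_increment_gaussian m) beta C (C * (2 `^ (- kappa)) ^+ m) YC (fun i j => @fine_increment_cov m i j m1) I0.
rewrite beta2 card_ord in vA; have {vA} vA := le_trans vA h5.
set A := tilt_mean _ _ _ in iA vA.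
have pt w : c1 + - (4 * c1) * (A w - 1) ^+ 2 <=
    Num.min (max_norm (@normalized_increment _ _ _ V gamma a b eps (m + m)) w) K.
  have sm : 0 <= Num.sqrt (m%:R : R) by exact: sqrtr_ge0.
  have [[i hi]|hn] := pselect (exists i, th * c / 4 * Num.sqrt m%:R <= `|@fine_increment m i w|).
    apply: (@le_trans _ _ c1); first by rewrite gerDl mulNr oppr_le0 mulr_ge0 ?sqr_ge0// mulr_ge0// ltW.
    have r0 : 0 <= th * c / 4 by rewrite divr_ge0// mulr_ge0// ltW.
    have := @fine_increment_normalized m eps i w _ heps hone r0 hln m1 hi.
    by rewrite /c1 !le_min !ge_min lexx orbT andbT => ->.
  have A2 : A w <= 1 / 2.
    rewrite /A /tilt_mean card_ord mulrC ler_pdivrMr ?ltr0n ?expn_gt0//.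
    apply: (@le_trans _ _ (\sum_(i : 'I_(2 ^ m)) (1 / 2))); last first.
      by rewrite sumr_const card_ord -[X in X <= _]mulr_natr.
    apply: ler_sum => i _; apply: le_trans h4; rewrite /exp_tilt ler_expR beta2.
    have Yi : @fine_increment m i w <= th * c / 4 * Num.sqrt m%:R.
      by rewrite leNgt; apply/negP => h'; apply: hn; exists i; apply: le_trans (ltW h') (ler_norm _).
    have /andP[cv _] := Yv i.
    have x1 := ler_wpM2l (mulr_ge0 (ltW th0) sm) Yi.
    have q0 : 0 <= th ^+ 2 * m%:R by rewrite mulr_ge0// sqr_ge0.
    have x2 := ler_wpM2l q0 cv.
    have x3 : th * Num.sqrt m%:R * (th * c / 4 * Num.sqrt m%:R) = th ^+ 2 * m%:R * c / 4.
      by rewrite -[in RHS](@sqr_sqrtr R m%:R)//; field.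
    rewrite x3 in x1; move: x1 x2; rewrite /beta.
    rewrite (_ : th ^+ 2 * c * m%:R = th ^+ 2 * m%:R * c); last by ring.
    by move: (_ * fine_increment _ _) (_ * m%:R * c) (_ * Rintegral _ _ _) => x y z; lra.
  apply: (@le_trans _ _ 0); last by rewrite le_min max_norm_ge0 ltW.
  have : 1 / 4 <= (A w - 1) ^+ 2 by move: (A w) A2 => x; nra.
  by move=> /(ler_wpM2l (ltW c10)); move: (_ ^+ 2) => x; lra.
have bm := bounded_trunc (ltW K0) (@measurable_normalized_increment _ _ _ V gamma a b mV eps (m + m)).
have i1 := finite_measure_integrable_cst P c1 measurableT.
have i2 := integrableZl measurableT (- (4 * c1)) iA.
have := le_Rintegral measurableT (integrableD measurableT i1 i2) (bounded_measurable_integrable P bm) (fun w _ => pt w).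
rewrite RintegralD// RintegralZl// Rintegral_cst//.
rewrite (_ : fine (P setT) = 1); last by rewrite probability_setT.
rewrite mulr1 => /(le_trans _); apply.
have := ler_wpM2l (ltW c10) vA.
by move: (Rintegral _ _ _) => x; lra.
Qed.

End lower_modulus.

(** * Constancy of the limit *)

Lemma cvgn_le_bound {R : realType} (u : nat -> R) (l s : R) : u @ \oo --> l -> (forall n, u n <= s) -> l <= s.
Proof.
move=> h us; rewrite -(cvg_lim (@Rhausdorff R) h); apply: limr_le; last exact: nearW.
by apply/cvg_ex; exists l.
Qed.

Lemma cvgn_ge_bound {R : realType} (u : nat -> R) (l s : R) : u @ \oo --> l -> (forall n, s <= u n) -> s <= l.
Proof.
move=> h us; rewrite -lerN2; apply: (@cvgn_le_bound _ (fun n => - u n)); first exact: cvgN.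
by move=> n; rewrite lerN2.
Qed.

Section constant_limit.
Context {R : realType} d (T : measurableType d) (P : probability T R).

Local Notation P2 := (P \x P)%E.

(** The two coordinates give independent copies of [L]. Boundedness yields
    [(L - L')^2 <= |K| |L - L'|], so the variance, half the mean of the left-hand side, is 0. *)
Lemma constant_of_coincidence (L : T -> R) (K : R) : measurable_fun setT L -> (forall w, 0 <= L w <= K) ->
  \int[P2]_p `|L p.1 - L p.2| <= 0 -> {ae P, forall w, L w = \int[P]_w L w}.
Proof.
have aux1 (x y : R) : x + (x + - 2 * y) <= 0 -> x <= y by lra.
have aux2 (x y : R) : x <= y * y -> x + (- (2 * y) * y + y ^+ 2 * 1) <= 0 by nra.
move=> mL LK L0; set k := \int[P]_w L w.
have aL w : `|L w| <= `|K|.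
  by have /andP[l0 lK] := LK w; rewrite ger0_norm// (le_trans lK)// ler_norm.
have bL : bounded_measurable L by split => //; exists `|K|.
have bLL : bounded_measurable (fun w => L w * L w) by exact: bounded_measurableM.
have b1 : bounded_measurable (fun _ : T => 1 : R) by exact: bounded_measurable_cst.
have iL := bounded_measurable_integrable P bL; have iLL := bounded_measurable_integrable P bLL.
have i1 := bounded_measurable_integrable P b1.
have E1 : \int[P]_w (1 : R) = 1.
  by rewrite Rintegral_cst// (_ : fine (P setT) = 1) ?mulr1// probability_setT.
have bD : bounded_measurable (fun p : T * T => `|L p.1 - L p.2|).
  split; last by exists (`|K| + `|K|) => p; rewrite normr_id (le_trans (ler_normB _ _))// lerD.
  apply: (measurableT_comp (@normr_measurable R setT)).
  by apply: measurable_funB; exact: (measurableT_comp mL).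
have iD := bounded_measurable_integrable P2 bD.
have ia := integrable_prodM iLL i1; have ib := integrable_prodM i1 iLL.
have ic := integrable_prodM iL iL.
have ic' := integrableZl measurableT (- 2) ic.
have ibc := integrableD measurableT ib ic'.
have iD' := integrableZl measurableT `|K| iD.
have va := Rintegral_prodM iLL i1; have vb := Rintegral_prodM i1 iLL; have vc := Rintegral_prodM iL iL.
rewrite E1 -/k in va vb vc; rewrite mulr1 in va; rewrite mul1r in vb.
have V : \int[P2]_p (L p.1 * L p.1 * 1 + (1 * (L p.2 * L p.2) + - 2 * (L p.1 * L p.2))) =
    \int[P]_w (L w * L w) + (\int[P]_w (L w * L w) + - 2 * (k * k)).
  apply: (etrans (RintegralD measurableT ia ibc)); congr (_ + _); first exact: va.
  apply: (etrans (RintegralD measurableT ib ic')); congr (_ + _); first exact: vb.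
  by apply: (etrans (RintegralZl (- 2) measurableT ic)); congr (_ * _); exact: vc.
have h : \int[P2]_p (L p.1 * L p.1 * 1 + (1 * (L p.2 * L p.2) + - 2 * (L p.1 * L p.2))) <=
    \int[P2]_p (`|K| * `|L p.1 - L p.2|).
  apply: le_Rintegral => //; first exact: (integrableD measurableT ia ibc).
  move=> p _; rewrite mulr1 mul1r.
  have -> : L p.1 * L p.1 + (L p.2 * L p.2 + - 2 * (L p.1 * L p.2)) = `|L p.1 - L p.2| ^+ 2.
    by rewrite real_normK ?num_real//; ring.
  rewrite expr2 ler_wpM2r// ler_norml; have /andP[a1 a2] := LK p.1; have /andP[b1' b2] := LK p.2.
  by have := ler_norm K; move: `|K| => x ?; apply/andP; split; lra.
have var0 : \int[P]_w (L w * L w) <= k * k.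
  suff : \int[P]_w (L w * L w) + (\int[P]_w (L w * L w) + - 2 * (k * k)) <= 0.
    exact: aux1.
  by rewrite -V; apply: le_trans h _; rewrite -(mulr0 `|K|); apply: le_trans (ler_wpM2l (normr_ge0 K) L0); rewrite le_eqVlt; apply/orP; left; apply/eqP; exact: (RintegralZl `|K| measurableT iD).
have E w : (L w - k) ^+ 2 = L w * L w + (- (2 * k) * L w + k ^+ 2 * 1) by ring.
have j1 := integrableZl measurableT (- (2 * k)) iL; have j2 := integrableZl measurableT (k ^+ 2) i1.
have j3 := integrableD measurableT iLL (integrableD measurableT j1 j2).
have i3 : P.-integrable setT (EFin \o (fun w => (L w - k) ^+ 2)).
  by rewrite (_ : (fun w => _) = fun w => L w * L w + (- (2 * k) * L w + k ^+ 2 * 1)) //; apply/funext.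
have v0 : \int[P]_w ((L w - k) ^+ 2) <= 0.
  under eq_Rintegral do rewrite E.
  rewrite RintegralD//; last exact: (integrableD measurableT j1 j2).
  rewrite RintegralD// !RintegralZl// E1 -/k.
  exact: aux2.
have m3 : measurable_fun setT (EFin \o (fun w => (L w - k) ^+ 2)) by exact: measurable_int i3.
have [h0 _] := ae_eq_integral_abs P measurableT m3.
have /h0 : (\int[P]_w `|(EFin \o (fun w => ((L w - k) ^+ 2)%R)) w|)%E = 0%E.
  under eq_integral do rewrite /= ger0_norm ?sqr_ge0//.
  apply/eqP; rewrite eq_le; apply/andP; split; last by apply: integral_ge0 => w _; rewrite lee_fin sqr_ge0.
  by rewrite -(fineK (integrable_fin_num measurableT i3)) lee_fin.
apply: filterS => w /(_ I) /= [] /eqP; rewrite sqrf_eq0 subr_eq0 => /eqP ->//.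
Qed.

End constant_limit.

Section double_limit.
Context {R : realType} d (T : measurableType d) (P : probability T R).
Variables (m : nat -> nat -> T -> R) (K c U : R) (s : nat -> R).
Hypothesis mm : forall i n, measurable_fun setT (m i n).
Hypothesis mK : forall i n w, 0 <= m i n w <= K.
Hypothesis m_nd : forall i w, {homo (fun n => m i n w) : n n' / (n <= n')%N >-> n <= n'}.
Hypothesis m_ni : forall n w, {homo (fun i => m i n w) : i i' / (i <= i')%N >-> i' <= i}.
Hypothesis m_conc : forall i n, \int[(P \x P)%E]_p `|m i n p.1 - m i n p.2| <= s i.
Hypothesis s0 : s @ \oo --> (0 : R).
Hypothesis m_lower : forall i, exists n, c <= \int[P]_w m i n w.
Hypothesis m_upper : exists i, forall n, \int[P]_w m i n w <= U.

(** The truncated maxima increase with the level [n] and decrease with the scale index [i], so both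
    iterated limits exist at every point. *)
Definition level_limit i w : R := limn (fun n => m i n w).
Definition scale_limit w : R := limn (level_limit ^~ w).

Lemma level_limit_cvg i w : (fun n => m i n w) @ \oo --> level_limit i w.
Proof.
apply: nondecreasing_is_cvgn => //; exists K => _ [n _ <-].
by have /andP[] := mK i n w.
Qed.

Lemma level_limit_bounds i w : 0 <= level_limit i w <= K.
Proof.
apply/andP; split; [apply: (cvgn_ge_bound (@level_limit_cvg i w))|apply: (cvgn_le_bound (@level_limit_cvg i w))] => n;
  by have /andP[] := mK i n w.
Qed.

Lemma level_limit_ge i n w : m i n w <= level_limit i w.
Proof.
apply: (nondecreasing_cvgn_le (m_nd i w)).
by apply/cvg_ex; exists (level_limit i w); exact: level_limit_cvg.
Qed.

Lemma level_limit_ni w : {homo (level_limit ^~ w) : i i' / (i <= i')%N >-> i' <= i}.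
Proof.
move=> i i' ii; apply: (cvgn_le_bound (@level_limit_cvg i' w)) => n.
exact: le_trans (m_ni n w ii) (level_limit_ge i n w).
Qed.

Lemma scale_limit_cvg w : level_limit ^~ w @ \oo --> scale_limit w.
Proof.
apply: nonincreasing_is_cvgn; first exact: level_limit_ni.
by exists 0 => _ [n _ <-]; have /andP[] := level_limit_bounds n w.
Qed.

Lemma scale_limit_le i w : scale_limit w <= level_limit i w.
Proof.
apply: (nonincreasing_cvgn_ge (@level_limit_ni w)).
by apply/cvg_ex; exists (scale_limit w); exact: scale_limit_cvg.
Qed.

Lemma scale_limit_bounds w : 0 <= scale_limit w <= K.
Proof.
apply/andP; split; [apply: (cvgn_ge_bound (@scale_limit_cvg w))|apply: (cvgn_le_bound (@scale_limit_cvg w))] => n;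
  by have /andP[] := level_limit_bounds n w.
Qed.

Lemma bounded_normr (f : T -> R) w : 0 <= f w <= K -> `|f w| <= K.
Proof. by move=> /andP[f0 fK]; rewrite ger0_norm. Qed.

Lemma measurable_level_limit i : measurable_fun setT (level_limit i).
Proof.
have [] // := @bounded_limit _ _ _ (m i) (level_limit i) K (mm i).
by move=> n w; exact: bounded_normr.
by move=> w; exact: level_limit_cvg.
Qed.

Lemma measurable_scale_limit : measurable_fun setT scale_limit.
Proof.
have [] // := @bounded_limit _ _ _ level_limit scale_limit K measurable_level_limit.
by move=> n w; apply: bounded_normr; exact: level_limit_bounds.
by move=> w; exact: scale_limit_cvg.
Qed.

Lemma diff_bound (f : T -> R) (p : T * T) : (forall w, 0 <= f w <= K) -> `|(`|f p.1 - f p.2|)| <= K.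
Proof.
move=> fK; have /andP[a1 a2] := fK p.1; have /andP[b1 b2] := fK p.2.
by rewrite normr_id ler_norml; apply/andP; split; lra.
Qed.

Lemma measurable_diff (f : T -> R) : measurable_fun setT f -> measurable_fun setT (fun p : T * T => `|f p.1 - f p.2|).
Proof.
move=> mf; apply: (measurableT_comp (@normr_measurable R setT)).
by apply: measurable_funB; exact: (measurableT_comp mf).
Qed.

Lemma level_limit_conc i : \int[(P \x P)%E]_p `|level_limit i p.1 - level_limit i p.2| <= s i.
Proof.
apply: cvgn_le_bound (m_conc i).
apply: (bounded_cvg_Rintegral (K := K)).
- by move=> n; exact: measurable_diff.
- by move=> n p; apply: diff_bound.
- by move=> p; apply: cvg_norm; apply: cvgB; exact: level_limit_cvg.
- by apply: measurable_diff; exact: measurable_level_limit.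
Qed.

(** The bound [s i] is uniform in the level, hence inherited by [level_limit i]; then [s i] tends to
    0. *)
Lemma scale_limit_conc : \int[(P \x P)%E]_p `|scale_limit p.1 - scale_limit p.2| <= 0.
Proof.
have h : (fun i => \int[(P \x P)%E]_p `|level_limit i p.1 - level_limit i p.2| - s i) @ \oo -->
    \int[(P \x P)%E]_p `|scale_limit p.1 - scale_limit p.2| - 0.
  apply: cvgB => //; apply: (bounded_cvg_Rintegral (K := K)).
  - by move=> n; apply: measurable_diff; exact: measurable_level_limit.
  - by move=> n p; apply: diff_bound; exact: level_limit_bounds.
  - by move=> p; apply: cvg_norm; apply: cvgB; exact: scale_limit_cvg.
  - by apply: measurable_diff; exact: measurable_scale_limit.
by rewrite -[leLHS]subr0; apply: (cvgn_le_bound h) => i; rewrite subr_le0; exact: level_limit_conc.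
Qed.

(** The constant is the mean of the double limit, so the bounds [c] and [U] on means carry over to
    it. The two almost sure clauses spell out an infimum over scales of suprema over levels. *)
Lemma constant_double_limit : exists kap : R, [/\ c <= kap, kap <= U &
  {ae P, forall w, (forall e, 0 < e -> exists i, forall n, m i n w <= kap + e) /\
                   (forall e i, 0 < e -> exists n, kap - e < m i n w)}].
Proof.
have bS : P.-integrable setT (EFin \o scale_limit).
  apply: (bounded_integrable P (K := K)); first exact: measurable_scale_limit.
  by move=> w; apply: bounded_normr; exact: scale_limit_bounds.
have bL i : P.-integrable setT (EFin \o level_limit i).
  apply: (bounded_integrable P (K := K)); first exact: measurable_level_limit.
  by move=> w; apply: bounded_normr; exact: level_limit_bounds.
have bm i n : P.-integrable setT (EFin \o m i n).
  by apply: (bounded_integrable P (K := K)) => // w; exact: bounded_normr.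
exists (\int[P]_w scale_limit w); split.
- have h : (fun i => \int[P]_w level_limit i w) @ \oo --> \int[P]_w scale_limit w.
    apply: (bounded_cvg_Rintegral (K := K)).
    + exact: measurable_level_limit.
    + by move=> n w; apply: bounded_normr; exact: level_limit_bounds.
    + exact: scale_limit_cvg.
    + exact: measurable_scale_limit.
  apply: (cvgn_ge_bound h) => i; have [n] := m_lower i; move/le_trans; apply.
  by apply: le_Rintegral => // w _; exact: level_limit_ge.
- have [i hi] := m_upper.
  have h : (fun n => \int[P]_w m i n w) @ \oo --> \int[P]_w level_limit i w.
    apply: (bounded_cvg_Rintegral (K := K)) => //.
    + by move=> n w; exact: bounded_normr.
    + exact: level_limit_cvg.
    + exact: measurable_level_limit.
  apply: le_trans (cvgn_le_bound h hi).
  by apply: le_Rintegral => // w _; exact: scale_limit_le.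
have := constant_of_coincidence measurable_scale_limit scale_limit_bounds scale_limit_conc.
apply: filterS => w <-; split.
  move=> e e0; have h1 : scale_limit w < scale_limit w + e by rewrite ltrDl.
  have [i hi] := @filter_ex _ \oo _ _ (cvgr_le _ (@scale_limit_cvg w) _ h1).
  by exists i => n; exact: le_trans (level_limit_ge i n w) hi.
move=> e i e0; have h1 : scale_limit w - e < level_limit i w.
  by apply: lt_le_trans (scale_limit_le i w); rewrite gtrBl.
by have [n hn] := @filter_ex _ \oo _ _ (cvgr_gt _ (@level_limit_cvg i w) _ h1); exists n.
Qed.

End double_limit.

Section dyadic_modulus.
Context {R : realType} d (T : measurableType d) (P : probability T R).
Variables (V : R -> T -> R) (gamma kappa a b C c h1 : R).
Hypotheses (g0 : 0 < gamma) (k0 : 0 < kappa) (a0 : 0 < a) (ab : a < b) (C0 : 0 < C) (c0 : 0 < c) (h10 : 0 < h1).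
Hypothesis mV : forall t, measurable_fun setT (V t).
Hypothesis gV : forall (I : finType) (c t : I -> R), (forall i, 0 <= t i) ->
  centered_gaussian P (lincomb c (fun i => V (t i))).
Hypothesis V_le : forall t h : R, 0 <= t -> 0 < h -> \int[P]_w ((V (t + h) w - V t w) ^+ 2) <= C * h `^ (2 * gamma).
Hypothesis V_ge : forall t h : R, a <= t -> 0 < h -> h <= h1 ->
  c * h `^ (2 * gamma) <= \int[P]_w ((V (t + h) w - V t w) ^+ 2).
Hypothesis V_far : forall t s h D : R, 0 <= s -> 0 < h -> 2 * h <= D -> s + D <= t ->
  \int[P]_w ((V (t + h) w - V t w) * (V (s + h) w - V s w)) <= C * D `^ (- kappa) * h `^ (2 * gamma + kappa).

Local Notation pt := (dyadic_pt a b).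
Local Notation NI eps n := (@normalized_increment _ _ _ V gamma a b eps n).
Local Notation scale i := (expR (- i.+1%:R) : R).

Lemma increment_variance p q : 0 <= p -> 0 <= q -> p != q ->
  \int[P]_w ((V q w - V p w) ^+ 2) <= C * `|q - p| `^ (2 * gamma).
Proof.
move=> p0 q0; case: (ltgtP p q) => // pq _.
  rewrite gtr0_norm ?subr_gt0//; have := V_le p0 (_ : 0 < q - p); rewrite subr_gt0 => /(_ pq).
  by rewrite (_ : p + (q - p) = q)//; ring.
under eq_Rintegral do rewrite -sqrrN opprB.
rewrite distrC gtr0_norm ?subr_gt0//; have := V_le q0 (_ : 0 < p - q); rewrite subr_gt0 => /(_ pq).
by rewrite (_ : q + (p - q) = p)//; ring.
Qed.

Lemma increment_sq_integrable p q : 0 <= p -> 0 <= q ->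
  P.-integrable setT (EFin \o (fun w => (V q w - V p w) ^+ 2)).
Proof. by move=> p0 q0; under eq_fun do rewrite expr2; exact: (increments_mul_integrable mV gV). Qed.

Lemma scale_lt1 i : scale i < 1.
Proof. by rewrite -[ltRHS]expR0 ltr_expR oppr_lt0 ltr0n. Qed.

(** A pair of nonzero weight is closer than [exp (- (i + 1))], so [ln (1 / r) > i + 1]; dividing
    [C r^(2 gamma)] by the squared modulus leaves [C / ln (1 / r)]. *)
Lemma normalized_increment_variance i n jk :
  (\int[P]_w (NI (scale i) n jk w ^+ 2)%:E <= (Num.sqrt (C / i.+1%:R) ^+ 2)%:E)%E.
Proof.
case: jk => j k; rewrite /normalized_increment /=; set p := pt n j; set q := pt n k.
have p0 : 0 <= p by exact: dyadic_pt_ge0.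
have q0 : 0 <= q by exact: dyadic_pt_ge0.
have Ci : 0 <= C / i.+1%:R by rewrite divr_ge0// ltW.
rewrite sqr_sqrtr//.
have zero : (forall w, weight gamma (scale i) `|q - p| * (V q w - V p w) = 0) ->
    (\int[P]_w ((weight gamma (scale i) `|q - p| * (V q w - V p w)) ^+ 2)%:E <= (C / i.+1%:R)%:E)%E.
  by move=> z; under eq_integral do rewrite z expr0n/=; rewrite integral0 lee_fin.
have [eq|pq] := eqVneq p q; first by apply: zero => w; rewrite eq (subrr (V q w)) mulr0.
have [le|ge] := ltP `|q - p| (scale i); last by apply: zero => w; rewrite /weight ltNge ge mul0r.
clear zero; rewrite /weight le; set r := `|q - p| in le *.
have r0 : 0 < r by rewrite normr_gt0 subr_eq0 eq_sym.
have r1 : r < 1 by exact: lt_trans le (scale_lt1 i).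
have lnr : i.+1%:R < ln (1 / r).
  by rewrite div1r lnV ?posrE// ltrNr -[ltRHS]expRK ltr_ln ?posrE ?expR_gt0.
have lnr0 : 0 < ln (1 / r) by exact: lt_trans lnr.
have rg : 0 < r `^ gamma by exact: powR_gt0.
have i2 := increment_sq_integrable p0 q0.
under eq_integral do rewrite exprMn EFinM.
rewrite ge0_integralZl_EFin ?sqr_ge0//; last 2 first.
- by move=> w _; rewrite lee_fin sqr_ge0.
- exact: measurable_int i2.
rewrite -(fineK (integrable_fin_num measurableT i2)) -EFinM lee_fin.
apply: le_trans (ler_wpM2l (sqr_ge0 _) (increment_variance p0 q0 pq)) _.
rewrite -/r exprVn exprMn sqr_sqrtr ?(ltW lnr0)// mulrCA ler_pM2l//.
rewrite [2 * _]mulrC powRrM powR_mulrn ?powR_ge0// invfM mulrAC mulVf ?mul1r ?lt0r_neq0 ?exprn_gt0//.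
by rewrite -(div1r r) lef_pV2 ?posrE ?ltr0n//; exact: ltW.
Qed.

Lemma normalized_increment_gaussian eps n e : centered_gaussian P (lincomb e (NI eps n)).
Proof.
apply: (increments_gaussian gV e (fun jk => weight gamma eps `|pt n jk.2 - pt n jk.1|)
  (p := fun jk : 'I_(2 ^ n).+1 * 'I_(2 ^ n).+1 => pt n jk.1) (q := fun jk => pt n jk.2)) => jk; exact: dyadic_pt_ge0.
Qed.

Lemma max_normalized_nested eps n w : max_norm (NI eps n) w <= max_norm (NI eps n.+1) w.
Proof.
apply/max_norm_leP; first exact: max_norm_ge0.
case=> j k; have dbl (l : 'I_(2 ^ n).+1) : (l.*2 < (2 ^ n.+1).+1)%N.
  by rewrite ltnS expnS mul2n leq_double -ltnS.
by have := max_norm_ge (NI eps n.+1) w (Ordinal (dbl j), Ordinal (dbl k));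
  rewrite /normalized_increment/= !dyadic_pt_nested.
Qed.

Lemma max_normalized_scale i i' n w : (i <= i')%N -> max_norm (NI (scale i') n) w <= max_norm (NI (scale i) n) w.
Proof.
move=> ii; apply/max_norm_leP; first exact: max_norm_ge0.
move=> jk; apply: le_trans (max_norm_ge _ w jk).
rewrite /normalized_increment !normrM ler_wpM2r// !(ger0_norm (weight_ge0 _ _ _)) /weight.
case: ifP => h; last by case: ifP => // _; rewrite invr_ge0 modulus_ge0.
by rewrite (lt_le_trans h)// ler_expR lerN2 ler_nat.
Qed.

Lemma scale_small eps : 0 < eps -> exists i, scale i < eps.
Proof.
move=> e0; have h : geometric (expR (-1)) (expR (-1) : R) @ \oo --> (0 : R).
  by apply: cvg_geometric; rewrite ger0_norm ?expR_ge0// -[ltRHS]expR0 ltr_expR ltrN10.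
have [i hi] := @filter_ex _ \oo _ _ (cvgr_lt _ h _ e0); exists i.
by move: hi; rewrite /= -exprS -expRM_natl mulrN1.
Qed.

Lemma scale_variance_cvg : (fun i => pi * Num.sqrt (C / i.+1%:R)) @ \oo --> (0 : R).
Proof.
have h : (fun i => C * harmonic i) @ \oo --> C * (0 : R) by apply: cvgMr; exact: cvg_harmonic.
rewrite mulr0 in h; have := cvg_comp _ _ h (@sqrt_continuous R 0).
rewrite sqrtr0 => h2; rewrite -[X in _ --> X](mulr0 pi); apply: cvgMr; exact: h2.
Qed.

Theorem dyadic_modulus : exists2 kap : R, 0 < kap & {ae P, forall w,
  (forall e, 0 < e -> exists2 eps, 0 < eps & forall n j k, (j <= 2 ^ n)%N -> (k <= 2 ^ n)%N ->
     `|pt n k - pt n j| < eps ->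
     `|V (pt n k) w - V (pt n j) w| <= (kap + e) * modulus gamma `|pt n k - pt n j|) /\
  (forall e eps, 0 < e -> 0 < eps -> exists n j k, [/\ (j <= 2 ^ n)%N, (k <= 2 ^ n)%N,
     0 < `|pt n k - pt n j| < eps &
     (kap - e) * modulus gamma `|pt n k - pt n j| <= `|V (pt n k) w - V (pt n j) w|])}.
Proof.
have aux1 (x k K : R) : k < K -> x <= (K - k) / 2 -> K <= k + x -> False by lra.
have aux2 (x k : R) : 0 < k -> x <= k / 2 -> 0 < k - x by lra.
(* The constant will be at most the chaining bound plus [2 / 3], hence strictly below this
   truncation level. *)
pose K : R := chain_const gamma * adjacent_bound C + 1.
have K0 : 0 < K.
  by rewrite ltr_wpDl// /chain_const !mulr_ge0 ?invr_ge0 ?sqr_ge0 ?powR_ge0 ?sqrtr_ge0.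
pose m i n w := Num.min (max_norm (NI (scale i) n) w) K.
have [c2 c20 lower] := lower_modulus_expectation k0 a0 ab C0 c0 h10 mV gV V_le V_ge V_far K0.
have [i0 hi0] := scale_small (chain_scale_gt0 ab).
have bm i n := bounded_trunc (ltW K0) (@measurable_normalized_increment _ _ _ V gamma a b mV (scale i) n).
have [||||||||kap [kc kU ae]] := @constant_double_limit _ _ _ P m K c2 (chain_const gamma * adjacent_bound C + 2 / 3)
  (fun i => pi * Num.sqrt (C / i.+1%:R)).
- by move=> i n; case: (bm i n).
- by move=> i n w; rewrite le_min max_norm_ge0 ge_min lexx orbT (ltW K0).
- move=> i w; apply/nondecreasing_seqP => n; rewrite le_min2//; exact: max_normalized_nested.
- by move=> n w i i' ii; rewrite le_min2//; exact: max_normalized_scale.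
- move=> i n; apply: (max_norm_concentration (X := NI (scale i) n)).
  + by move=> jk; exact: measurable_normalized_increment.
  + exact: normalized_increment_gaussian.
  + by rewrite sqrtr_gt0 divr_gt0.
  + exact: normalized_increment_variance.
  + exact: ltW.
- exact: scale_variance_cvg.
- by move=> i; apply: lower; exact: expR_gt0.
- by exists i0 => n; apply: (upper_modulus_expectation g0 a0 ab C0 mV gV V_le n); exact: ltW.
have kap0 : 0 < kap by exact: lt_le_trans kc.
exists kap => //; apply: filterS ae => w [S1 S2]; split.
  (* The second bound ensures [kap + e' < K], so a truncated maximum below [kap + e'] is the maximum
     itself. *)
  move=> e e0; pose e' := Num.min e ((K - kap) / 2).
  have kK : kap < K by apply: le_lt_trans kU _; rewrite ltrD2l ltr_pdivrMr// mul1r ltr_nat.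
  have e'0 : 0 < e' by rewrite lt_min e0 divr_gt0// subr_gt0.
  have [i hi] := S1 e' e'0; exists (scale i); first exact: expR_gt0.
  move=> n j k jn kn; set p := pt n j; set q := pt n k; set r := `|q - p| => rs.
  have [eq|pq] := eqVneq p q; first by rewrite eq subrr normr0 mulr_ge0 ?modulus_ge0// addr_ge0// ltW.
  have r0 : 0 < r by rewrite normr_gt0 subr_eq0 eq_sym.
  have g0' := modulus_gt0 gamma r0 (lt_trans rs (scale_lt1 i)).
  have := hi n; rewrite /m ge_min => /orP[h|]; last first.
    have : e' <= (K - kap) / 2 by rewrite ge_min lexx orbT.
    by move=> h1' h2'; case: (aux1 _ _ _ kK h1' h2').
  have := max_norm_ge (NI (scale i) n) w (Ordinal (jn : (j < (2 ^ n).+1)%N), Ordinal (kn : (k < (2 ^ n).+1)%N)).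
  rewrite /normalized_increment/= -/p -/q -/r /weight rs normrM gtr0_norm ?invr_gt0// => /le_trans /(_ h).
  rewrite mulrC ler_pdivrMr// => /le_trans; apply; rewrite ler_wpM2r ?(ltW g0')// lerD2l.
  by rewrite ge_min lexx.
(* Keeping [kap - e'] positive forces the maximum to be attained at two distinct points closer than
   the scale. *)
move=> e eps e0 eps0; pose e' := Num.min e (kap / 2).
have e'0 : 0 < e' by rewrite lt_min e0 divr_gt0.
have [i hi] := scale_small eps0.
have [n] := S2 e' i e'0; rewrite /m lt_min => /andP[hn _].
have ke : 0 < kap - e'.
  have : e' <= kap / 2 by rewrite ge_min lexx orbT.
  exact: aux2 kap0.
have [E|[[j k] E]] := max_norm_attained (NI (scale i) n) w.
  by move: hn; rewrite E ltNge (ltW ke).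
rewrite E /normalized_increment/= in hn.
have jn : (j <= 2 ^ n)%N by rewrite -ltnS. 
have kn : (k <= 2 ^ n)%N by rewrite -ltnS.
exists n, j, k; set p := pt n j in hn *; set q := pt n k in hn *; set r := `|q - p| in hn *.
have [le|ge] := ltP r (scale i); last first.
  by move: hn; rewrite /weight (ltNge r) ge/= mul0r normr0 ltNge (ltW ke).
have [eq|pq] := eqVneq p q; first by move: hn; rewrite eq subrr mulr0 normr0 ltNge (ltW ke).
have r0 : 0 < r by rewrite normr_gt0 subr_eq0 eq_sym.
have g0' := modulus_gt0 gamma r0 (lt_trans le (scale_lt1 i)).
split => //; first by rewrite r0 (lt_trans le).
move: hn; rewrite /weight le normrM gtr0_norm ?invr_gt0// mulrC ltr_pdivlMr// => /ltW; apply: le_trans.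
rewrite ler_wpM2r ?(ltW g0')// lerD2l lerN2.
by rewrite ge_min lexx.
Qed.

End dyadic_modulus.

(** * From dyadic points to continuous paths *)

Section modulus_analysis.
Context {R : realType}.
Variable gamma : R.
Hypothesis g0 : 0 < gamma.

Lemma modulusE (r : R) : 0 < r -> modulus gamma r = expR (gamma * ln r) * Num.sqrt (- ln r).
Proof. by move=> r0; rewrite /modulus /powR gt_eqF// div1r lnV// posrE. Qed.

Lemma modulus_cvg (u : nat -> R) (r : R) : 0 < r -> u @ \oo --> r ->
  (fun n => modulus gamma (u n)) @ \oo --> modulus gamma r.
Proof.
move=> r0 ur; rewrite (modulusE r0).
have lnu : (fun n => ln (u n)) @ \oo --> ln r by exact: (cvg_comp _ _ ur (continuous_ln r0)).
have h1 : (fun n => gamma * ln (u n)) @ \oo --> gamma * ln r by exact: cvgMr.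
have h2 : (fun n => expR (gamma * ln (u n))) @ \oo --> expR (gamma * ln r).
  exact: (cvg_comp _ _ h1 (@continuous_expR R _)).
have h3 : (fun n => - ln (u n)) @ \oo --> - ln r by exact: cvgN.
have h4 : (fun n => Num.sqrt (- ln (u n))) @ \oo --> Num.sqrt (- ln r).
  exact: (cvg_comp _ _ h3 (@sqrt_continuous R _)).
apply: cvg_trans (cvgM h2 h4); apply: near_eq_cvg.
by apply: filterS (cvgr_gt _ ur _ r0) => n un; rewrite (modulusE un).
Qed.

(** In the variable [z = ln t] the squared modulus is [- z exp (2 gamma z)], which increases up to
    [z = - 1 / (2 gamma)]; the proof compares two values through [exp y >= 1 + y]. *)
Lemma modulus_nondecreasing (s t : R) : 0 < s -> s <= t -> t <= expR (- (2 * gamma)^-1) ->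
  modulus gamma s <= modulus gamma t.
Proof.
move=> s0 st tr; have t0 := lt_le_trans s0 st.
rewrite !modulusE//; have xz : ln s <= ln t by rewrite ler_ln ?posrE.
have zr : ln t <= - (2 * gamma)^-1 by rewrite -[leRHS]expRK ler_ln ?posrE ?expR_gt0.
set x := ln s in xz *; set z := ln t in xz zr *.
have -> : expR (gamma * z) = expR (gamma * x) * expR (gamma * (z - x)).
  by rewrite -expRD; congr expR; ring.
rewrite -mulrA ler_wpM2l ?expR_ge0// -[X in _ <= X * _](@ger0_norm R) ?expR_ge0// -sqrtr_sqr -sqrtrM ?sqr_ge0//.
apply: ler_wsqrtr; rewrite -expRM_natl.
have h := expR_ge1Dx (2 * (gamma * (z - x))).
have z1 : (2 * gamma)^-1 <= - z by rewrite lerNr.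
have z0 : 0 <= - z by apply: le_trans z1; rewrite invr_ge0 mulr_ge0// ltW.
apply: le_trans (ler_wpM2r z0 h).
have h2 : 1 <= 2 * gamma * (- z) by rewrite mulrC -ler_pdivrMr ?mulr_gt0// mul1r.
have h3 : 0 <= z - x by rewrite subr_ge0.
have := ler_wpM2r h3 h2; rewrite mul1r => h4.
rewrite (_ : (1 + 2 * (gamma * (z - x))) * - z = - z + 2 * gamma * - z * (z - x)); last by ring.
by move: h4; move: (_ * (z - x)) => y; lra.
Qed.

End modulus_analysis.

Section pathwise.
Context {R : realType}.
Variables (f : R -> R) (gamma a b kap : R).
Hypotheses (g0 : 0 < gamma) (a0 : 0 < a) (ab : a < b) (kap0 : 0 < kap).
Hypothesis cf : {within `[0, +oo[, continuous f}.

Local Notation pt := (dyadic_pt a b).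

Hypothesis upper : forall e, 0 < e -> exists2 eps, 0 < eps & forall n j k, (j <= 2 ^ n)%N -> (k <= 2 ^ n)%N ->
  `|pt n k - pt n j| < eps -> `|f (pt n k) - f (pt n j)| <= (kap + e) * modulus gamma `|pt n k - pt n j|.
Hypothesis lower : forall e eps, 0 < e -> 0 < eps -> exists n j k, [/\ (j <= 2 ^ n)%N, (k <= 2 ^ n)%N,
  0 < `|pt n k - pt n j| < eps & (kap - e) * modulus gamma `|pt n k - pt n j| <= `|f (pt n k) - f (pt n j)|].

Lemma path_continuous t : 0 < t -> {for t, continuous f}.
Proof.
move=> t0; have h : {within `]0, +oo[, continuous f}.
  by apply: continuous_subspaceW cf; apply: subset_itvr; rewrite bnd_simp.
rewrite continuous_open_subspace in h; last exact: interval_open.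
by apply: h; rewrite inE /= in_itv/= t0.
Qed.

(** Rounding down at each level, with an error of at most [(b - a) / 2^n]. *)
Lemma dyadic_approx s : a <= s <= b -> exists k : nat -> nat,
  (forall n, (k n <= 2 ^ n)%N) /\ (fun n => pt n (k n)) @ \oo --> s.
Proof.
move=> /andP[as_ sb]; have ba : 0 < b - a by rewrite subr_gt0.
pose y n := (s - a) / (b - a) * 2 ^+ n.
have y0 n : 0 <= y n by rewrite mulr_ge0 ?exprn_ge0// divr_ge0 ?subr_ge0// ltW.
exists (fun n => Num.truncn (y n)); split.
  move=> n; rewrite -(ler_nat R); have /andP[+ _] := truncn_itv (y0 n); move/le_trans; apply.
  by rewrite natrX ler_piMl ?exprn_ge0// ler_pdivrMr// mul1r lerD2r.
have h : geometric (b - a) 2^-1 @ \oo --> (0 : R).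
  by apply: cvg_geometric; rewrite ger0_norm ?invr_ge0// invf_lt1// ltr1n.
have h' : (fun n => s - geometric (b - a) 2^-1 n) @ \oo --> s.
  by rewrite -[X in _ --> X]subr0; apply: cvgB => //; exact: cvg_cst.
apply: (squeeze_cvgr (f := fun n => s - geometric (b - a) 2^-1 n) (h := cst s)) => //; last exact: cvg_cst.
apply: nearW => n; have /andP[h1 h2] := truncn_itv (y0 n).
have e0 : 0 < (2 ^+ n : R) by exact: exprn_gt0.
have sE : s = a + (b - a) * (y n / 2 ^+ n).
  by rewrite /y; field; rewrite !lt0r_neq0.
rewrite /dyadic_pt /= sE; apply/andP; split; last first.
  by rewrite lerD2l ler_pM2l// ler_pM2r ?invr_gt0.
rewrite -addrA lerD2l exprVn -mulrBr ler_pM2l// -[X in _ - X]mul1r -mulrBl ler_pM2r ?invr_gt0//.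
by rewrite lerBlDr natr1 ltW.
Qed.

Lemma path_upper e : 0 < e -> exists2 eps, 0 < eps < 1 & forall s t, a <= s <= b -> a <= t <= b ->
  0 < `|t - s| -> `|t - s| < eps -> `|f t - f s| <= (kap + e) * modulus gamma `|t - s|.
Proof.
move=> e0; have [eps eps0 h] := upper e0.
exists (Num.min eps 2^-1) => [|s t sI tI r0].
  by rewrite lt_min eps0 invr_gt0 ltr0n gt_min invf_lt1 ?ltr1n ?orbT.
rewrite lt_min => /andP[re _].
(* Both points are approximated at the same level, since [upper] compares points of one level;
   continuity of the path and of the modulus passes the bound to the limit. *)
have [k [kn ks]] := dyadic_approx sI; have [l [ln_ lt_]] := dyadic_approx tI.
have s0 : 0 < s by case/andP: sI => /(lt_le_trans a0).
have t0 : 0 < t by case/andP: tI => /(lt_le_trans a0).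
have fs : (fun n => f (pt n (k n))) @ \oo --> f s by exact: (cvg_comp _ _ ks (path_continuous s0)).
have ft : (fun n => f (pt n (l n))) @ \oo --> f t by exact: (cvg_comp _ _ lt_ (path_continuous t0)).
have d : (fun n => `|pt n (l n) - pt n (k n)|) @ \oo --> `|t - s| by apply: cvg_norm; exact: cvgB.
have c1 : (fun n => `|f (pt n (l n)) - f (pt n (k n))|) @ \oo --> `|f t - f s|.
  by apply: cvg_norm; exact: cvgB.
have c2 : (fun n => (kap + e) * modulus gamma `|pt n (l n) - pt n (k n)|) @ \oo --> (kap + e) * modulus gamma `|t - s|.
  by apply: cvgMr; exact: modulus_cvg.
apply: (ler_cvg_to c1 c2).
by apply: filterS (cvgr_lt _ d _ re) => n dn; exact: h.
Qed.

Lemma path_lower e eps : 0 < e -> 0 < eps -> exists s t, [/\ a <= s <= b, a <= t <= b,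
  0 < `|s - t| < eps & (kap - e) * modulus gamma `|s - t| <= `|f t - f s|].
Proof.
move=> e0 eps0; have [n [j [k [jn kn h1 h2]]]] := lower e0 eps0.
by exists (pt n j), (pt n k); rewrite !(dyadic_pt_itv ab)// [`|_ - pt n k|]distrC.
Qed.

Lemma path_modulus_cvg : ereal_sup
         [set r : \bar R | exists s t : R,
            [/\ a <= s <= b, a <= t <= b, 0 < `|s - t| <= eps &
              r = (`|f t - f s| /
                   (`|s - t| `^ gamma *
                    Num.sqrt (ln (1 / `|t - s|))))%:E]]
         @[eps --> 0^'+] --> kap%:E.
Proof.
(* The limit is nonzero, so convergence of the real parts suffices: an infinite supremum would have
   real part 0. *)
apply/neq0_fine_cvgP; first exact: lt0r_neq0.
apply/cvgrPdist_le => e e0.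
have [eps /andP[eps0 eps1] h] := path_upper e0.
near=> r; have r0 : 0 < r by near: r; exact: nbhs_right_gt.
have re : r < eps by near: r; exact: nbhs_right_lt.
rewrite /=; set S := [set _ | _].
have Su : (ereal_sup S <= (kap + e)%:E)%E.
  apply: ge_ereal_sup => _ [s [t [sI tI /andP[d0 dr] ->]]]; rewrite lee_fin.
  rewrite (distrC s t) in d0 dr *; have d1 := le_lt_trans dr re.
  by rewrite ler_pdivrMr; [exact: h|exact: modulus_gt0 d0 (lt_trans d1 eps1)].
have Sl : ((kap - e)%:E <= ereal_sup S)%E.
  have [s [t [sI tI /andP[d0 dr] hst]]] := path_lower e0 r0.
  apply: (@le_trans _ _ (`|f t - f s| / modulus gamma `|s - t|)%:E).
    by rewrite lee_fin ler_pdivlMr//; apply: modulus_gt0 => //; exact: lt_trans dr (lt_trans re eps1).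
  apply: ereal_sup_ubound; exists s, t; split => //; first by rewrite d0 ltW.
  by rewrite /modulus (distrC t s).
case: (ereal_sup S) Su Sl => //= x; rewrite !lee_fin => x1 x2.
by rewrite distrC ler_distl; apply/andP; split; lra.
Unshelve. all: by end_near.
Qed.

(** The denominator now uses the radius instead of the distance. Monotonicity of the modulus near 0
    gives the upper bound; for the lower bound the radius is taken equal to the distance of a nearly
    extremal pair, where the two quotients coincide. *)
Lemma path_modulus_limsup : limf_esup
         (fun eps : R => ereal_sup
           [set r : \bar R | exists s t : R,
              [/\ a <= s <= b, a <= t <= b, `|s - t| <= eps &
                r = (`|f t - f s| /
                     (eps `^ gamma *
                      Num.sqrt (ln (1 / eps))))%:E]])
         0^'+ = kap%:E.
Proof.
rewrite /limf_esup; set G := fun eps : R => ereal_sup _.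
apply/eqP; rewrite eq_le; apply/andP; split.
  apply/lee_addgt0Pr => e e0; have [eps /andP[eps0 eps1] h] := path_upper e0.
  pose d := Num.min eps (expR (- (2 * gamma)^-1)).
  have d0 : 0 < d by rewrite lt_min eps0 expR_gt0.
  apply: (@le_trans _ _ (ereal_sup [set G x | x in [set x | 0 < x < d]])).
    apply: ereal_inf_lbound; exists [set x | 0 < x < d] => //.
    by apply: filterS2 (nbhs_right_gt 0) (nbhs_right_lt d0) => x /= -> ->.
  apply: ge_ereal_sup => _ [r /= /andP[r0 rd] <-]; move: rd; rewrite lt_min => /andP[re rr].
  apply: ge_ereal_sup => _ [s [t [sI tI dr ->]]]; rewrite -EFinD lee_fin.
  have m0 : 0 < modulus gamma r by exact: modulus_gt0 r0 (lt_trans re eps1).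
  rewrite ler_pdivrMr//.
  have ke : 0 <= kap + e by rewrite addr_ge0// ltW.
  have [->|st] := eqVneq s t; first by rewrite subrr normr0 mulr_ge0// ltW.
  rewrite (distrC s t) in dr; have ts0 : 0 < `|t - s| by rewrite normr_gt0 subr_eq0 eq_sym.
  apply: le_trans (h s t sI tI ts0 (le_lt_trans dr re)) _.
  by rewrite ler_wpM2l//; exact: (modulus_nondecreasing g0 ts0 dr (ltW rr)).
apply: le_ereal_inf_tmp => _ [U U0 <-].
apply/lee_addgt0Pr => e e0.
have [d /= d0 Ud] := U0.
have d1 : 0 < Num.min d 1 by rewrite lt_min d0 ltr01.
have [s [t [sI tI /andP[r0 rd] hst]]] := path_lower e0 d1.
move: rd; rewrite lt_min => /andP[rd r1]; set r := `|s - t| in r0 rd r1 hst.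
have m0 : 0 < modulus gamma r by exact: modulus_gt0.
have Ur : U r by apply: Ud => //=; rewrite sub0r normrN gtr0_norm.
have h1 : (G r <= ereal_sup [set G x | x in U])%E by apply: ereal_sup_ubound; exists r.
have h2 : ((kap - e)%:E <= G r)%E.
  apply: (@le_trans _ _ (`|f t - f s| / modulus gamma r)%:E).
    by rewrite lee_fin ler_pdivlMr.
  by apply: ereal_sup_ubound; exists s, t; split.
rewrite -leeBlDr//; apply: le_trans h1; exact: h2.
Qed.

End pathwise.

(** * The mild solution as a Gaussian process in time *)

Section gaussian_modification.
Context {R : realType} d (T : measurableType d) (P : probability T R).

Lemma centered_gaussian_ae (X Y : T -> R) : measurable_fun setT X -> measurable_fun setT Y ->
  {ae P, forall w, X w = Y w} -> centered_gaussian P Y -> centered_gaussian P X.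
Proof.
move=> mX mY XY [Y0|[s s0 hY]]; first by left; apply: filterS2 XY Y0 => w ->.
right; exists s => // A mA; rewrite -hY//.
have mXA : measurable (X @^-1` A) by rewrite -[X in measurable X]setTI; exact: mX.
have mYA : measurable (Y @^-1` A) by rewrite -[X in measurable X]setTI; exact: mY.
rewrite -(setIT (X @^-1` A)) -(setIT (Y @^-1` A)) -!integral_indic//.
apply: ae_eq_integral => //; do ?[by apply/measurable_EFinP; exact: measurable_indic].
apply: filterS XY => w XYw _; rewrite !indicE.
suff -> : (w \in X @^-1` A) = (w \in Y @^-1` A) by [].
by apply/idP/idP; rewrite !inE /preimage /= XYw.
Qed.

End gaussian_modification.

Lemma mul_expand {R : comPzRingType} (p q r s : R) : (p - q) * (r - s) = p * r - p * s - q * r + q * s.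
Proof. by ring. Qed.

Lemma sq_expand {R : comPzRingType} (p q : R) : (p - q) ^+ 2 = p * p - p * q - p * q + q * q.
Proof. by ring. Qed.

Lemma scale_expand {R : comPzRingType} (c p q r s : R) : c * p - c * q - c * r + c * s = c * (p - q - r + s).
Proof. by ring. Qed.

Lemma cov_expand {R : comPzRingType} (c p q r : R) : c * p - c * q - c * q + c * r = c * (p + r - 2 * q).
Proof. by ring. Qed.

Section mild_bridge.
Context {R : realType} {n : nat} {dT : measure_display} {T : measurableType dT} (P : probability T R).
Variables (H alpha : R) (mu : {measure set (n.-tuple R) -> \bar R})
  (W : (R -> n.-tuple R -> R) -> {RV P >-> R}) (u : R -> n.-tuple R -> {RV P >-> R}) (x : n.-tuple R).
Hypotheses (n1 : (1 <= n)%N) (H12 : 1 / 2 < H) (H1 : H < 1) (alpha0 : 0 < alpha) (alphan : alpha < n%:R)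
  (nH : n%:R < 4 * H + alpha) (tmu : tempered_measure mu) (amu : asymp_power mu alpha)
  (noise : fractional_colored_noise H mu W) (mild : mild_solution W u).

Local Notation V := (fun t => u t x : T -> R).
Local Notation c0 := (alphaH H * (2 * pi) `^ (- n%:R)).
Local Notation S := (spectral_cov H mu).

Lemma noise_constant_gt0 : 0 < c0.
Proof.
rewrite mulr_gt0 ?powR_gt0 ?mulr_gt0 ?pi_gt0//; move: H12 H1 => ? ?; lra.
Qed.

(** The solution agrees with the Wiener integral only almost surely at each time; for finitely many
    times the exceptional sets are still negligible together. [enum_val] passes from the finite type
    to the ordinals of [noise_gaussian]. *)
Lemma mild_gaussian (I : finType) (c t : I -> R) : (forall i, 0 <= t i) ->
  centered_gaussian P (lincomb c (fun i => V (t i))).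
Proof.
move=> t0; pose X w := \sum_(k < #|I|) c (enum_val k) * W (mild_integrand (t (enum_val k)) x) w.
apply: (@centered_gaussian_ae _ _ _ P _ X).
- by apply: measurable_lincomb.
- by apply: measurable_sum => k; exact: measurable_funM.
- have h : {ae P, forall w, forall i : I, u (t i) x w = W (mild_integrand (t i) x) w}.
    by apply: filter_forall => i; exact: mild.
  apply: filterS h => w hw; rewrite /lincomb /X.
  rewrite -(big_enum_val (A := I) (fun i => c i * W (mild_integrand (t i) x) w)).
  by apply: eq_big => // i _; rewrite hw.
apply: (noise_gaussian noise (fun k => c (enum_val k)) (phi := fun k => mild_integrand (t (enum_val k)) x)) => k.
exact: (wiener_integrable_mild n1 H12 H1 alpha0 alphan nH tmu amu).
Qed.

Lemma mild_mul_integrable p q : 0 <= p -> 0 <= q ->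
  P.-integrable setT (EFin \o (fun w => V p w * V q w)).
Proof.
move=> p0 q0; pose X (e : bool) := V (if e then p else q).
have mX e : measurable_fun setT (X e) by [].
have gX c : centered_gaussian P (lincomb c X) by apply: mild_gaussian => -[].
have := integrable_lcov mX gX (fun k => (k == true)%:R) (fun k => (k == false)%:R).
by under eq_fun do rewrite !lincomb_delta.
Qed.

Lemma mild_covariance p q : 0 <= p -> 0 <= q -> \int[P]_w (V p w * V q w) = c0 * S p q.
Proof.
move=> p0 q0; have ip := wiener_integrable_mild n1 H12 H1 alpha0 alphan nH tmu amu p x.
have iq := wiener_integrable_mild n1 H12 H1 alpha0 alphan nH tmu amu q x.
have := noise_covarianceE noise ip iq.
rewrite (noise_covariance_mild n1 H12 H1 alpha0 alphan nH tmu amu) => -[<-].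
rewrite expectation.unlock /Rintegral; congr fine; apply: ae_eq_integral => //.
- by apply/measurable_EFinP; exact: measurable_funM.
- by apply/measurable_EFinP; exact: measurable_funM.
by apply: filterS2 (mild x p0) (mild x q0) => w h1 h2 _; rewrite h1 h2.
Qed.

Lemma mild_increments p q p' q' : 0 <= p -> 0 <= q -> 0 <= p' -> 0 <= q' ->
  \int[P]_w ((V q w - V p w) * (V q' w - V p' w)) = c0 * (S q q' - S q p' - S p q' + S p p').
Proof.
move=> p0 q0 p'0 q'0.
have := @Rintegral_increments _ _ _ P setT measurableT _ _ _ _ (mild_mul_integrable q0 q'0)
  (mild_mul_integrable q0 p'0) (mild_mul_integrable p0 q'0) (mild_mul_integrable p0 p'0).
rewrite (mild_covariance q0 q'0) (mild_covariance q0 p'0) (mild_covariance p0 q'0) (mild_covariance p0 p'0).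
move=> h; apply: etrans (scale_expand _ _ _ _ _); rewrite -h; apply: eq_Rintegral => w _.
exact: mul_expand.
Qed.

Lemma mild_increment_sq p q : 0 <= p -> 0 <= q ->
  \int[P]_w ((V q w - V p w) ^+ 2) = c0 * (S q q + S p p - 2 * S q p).
Proof.
move=> p0 q0.
have := @Rintegral_increments _ _ _ P setT measurableT _ _ _ _ (mild_mul_integrable q0 q0)
  (mild_mul_integrable q0 p0) (mild_mul_integrable q0 p0) (mild_mul_integrable p0 p0).
rewrite (mild_covariance q0 q0) (mild_covariance q0 p0) (mild_covariance p0 p0).
move=> h; apply: etrans (cov_expand _ _ _ _); rewrite -h.
by apply: eq_Rintegral => w _; exact: sq_expand.
Qed.

End mild_bridge.

Theorem proposition1 (R : realType) (n : nat) (H alpha : R)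
    (mu : {measure set (n.-tuple R) -> \bar R})
    (dT : measure_display) (T : measurableType dT) (P : probability T R)
    (W : (R -> n.-tuple R -> R) -> {RV P >-> R})
    (u : R -> n.-tuple R -> {RV P >-> R}) (x : n.-tuple R) (a b : R) :
  (1 <= n)%N -> 1 / 2 < H -> H < 1 -> 0 < alpha -> alpha < n%:R ->
  n%:R < 4 * H + alpha ->
  symmetric_measure mu -> tempered_measure mu -> asymp_power mu alpha ->
  fractional_colored_noise H mu W ->
  mild_solution W u ->
  {ae P, forall w, {within `[0, +oo[, continuous (fun t => u t x w)}} ->
  0 < a -> a < b ->
  let gamma := H - (n%:R - alpha) / 4 in
  exists c3 : R, [/\ 0 < c3,
    {ae P, forall w,
       ereal_sup
         [set r : \bar R | exists s t : R,
            [/\ a <= s <= b, a <= t <= b, 0 < `|s - t| <= eps &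
              r = (`|u t x w - u s x w| /
                   (`|s - t| `^ gamma *
                    Num.sqrt (ln (1 / `|t - s|))))%:E]]
         @[eps --> 0^'+] --> c3%:E} &
    {ae P, forall w,
       limf_esup
         (fun eps : R => ereal_sup
           [set r : \bar R | exists s t : R,
              [/\ a <= s <= b, a <= t <= b, `|s - t| <= eps &
                r = (`|u t x w - u s x w| /
                     (eps `^ gamma *
                      Num.sqrt (ln (1 / eps))))%:E]])
         0^'+ = c3%:E}].
Proof.
move=> n1 H12 H1 alpha0 alphan nH _ tmu amu noise mild cont a0 ab gamma.
have g0 : 0 < gamma by rewrite /gamma; lra.
have k0 : 0 < 2 - 2 * H by exact: hurst_kappa_gt0.
have c0 := noise_constant_gt0 (n := n) H12 H1.
set c := alphaH H * _ in c0.
(* The exponents of the spectral bounds in the form expected by [dyadic_modulus], with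
   [kappa = 2 - 2 H]. *)
have E2 : 2 * H - (n%:R - alpha) / 2 = 2 * gamma by rewrite /gamma; lra.
have E3 : 2 - (n%:R - alpha) / 2 = 2 * gamma + (2 - 2 * H) by rewrite /gamma; lra.
have [C1 C10 le1] := spectral_increment_le n1 H12 H1 alpha0 alphan nH amu.
have [C2 C20 le2] := spectral_increments_far_le n1 H12 H1 alpha0 alphan nH amu.
have [c1 [h1 [c10 h10 ge1]]] := spectral_increment_ge n1 H12 H1 alpha0 alphan nH amu a0.
have sq := mild_increment_sq x n1 H12 H1 alpha0 alphan nH tmu amu noise mild.
have inc := mild_increments x n1 H12 H1 alpha0 alphan nH tmu amu noise mild.
have gV := mild_gaussian x n1 H12 H1 alpha0 alphan nH tmu amu noise mild.
(* The sum [C1 + C2] serves both the increment bound and the decorrelation bound. *)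
have [||||||||kap kap0 ae] := @dyadic_modulus _ _ _ P (fun t => u t x) gamma (2 - 2 * H) a b
  (c * (C1 + C2)) (c * c1) h1 g0 k0 a0 ab.
- by rewrite mulr_gt0// addr_gt0.
- exact: mulr_gt0.
- exact: h10.
- by [].
- exact: gV.
- move=> t h t0 hh; rewrite sq ?addr_ge0 ?(ltW hh)// -/c -mulrA ler_pM2l//.
  by apply: le_trans (le1 t h t0 hh) _; rewrite E2 ler_wpM2r ?powR_ge0// lerDl ltW.
- move=> t h at_ hh hl; have t0 : 0 <= t by exact: le_trans (ltW a0) at_.
  rewrite sq ?addr_ge0 ?(ltW hh)// -/c -mulrA ler_pM2l// -E2.
  exact: ge1.
- move=> t s h D s0 hh hD sD.
  have D0 : 0 < D by apply: lt_le_trans hD; rewrite mulr_gt0.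
  have t0 : 0 <= t by apply: le_trans sD; rewrite addr_ge0// ltW.
  rewrite inc ?addr_ge0 ?(ltW hh)// -/c -E3 -2!(mulrA c) ler_pM2l//.
  apply: le_trans (le2 t s h D s0 hh hD sD) _; rewrite -!mulrA.
  by rewrite ler_wpM2r ?mulr_ge0 ?powR_ge0// lerDr ltW.
exists kap; split => //.
- apply: filterS2 ae cont => w [S1 S2] cw.
  exact: (path_modulus_cvg a0 ab kap0 cw S1 S2).
- apply: filterS2 ae cont => w [S1 S2] cw.
  exact: (path_modulus_limsup g0 a0 ab kap0 cw S1 S2).
Qed.
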